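(* Let $\{f_n\}_{n\ge1}\subset\mathcal{LPI}$ be an admissible sequence with limit data $(c,\Sigma)$ (as defined in the context), and for $\beta>-1$ let $\mathscr L_{\beta}=z\partial_z^2+(1+\beta)\partial_z$. If $\beta\equiv\beta_n$ and $\frac{n}{n+\beta}\to\lambda\in(0,1]$, then, as $n\to\infty$, $$\left[\!\left[f_n\!\left(\frac\lambda n\mathscr L_{\beta}\right)z^n\right]\!\right]\Rightarrow\mathsf{MP}_{1,\lambda}\boxtimes\mu_{c,\Sigma},$$ where $\mu_{c,\Sigma}$ is the $\boxplus$-infinitely divisible weak limit of the root distributions of the Appell polynomials $A_{n,f_n}(z)=f_n(\partial_z)z^n$, that is, the $\boxplus$-infinitely divisible distribution with Lévy pair $(c,\Sigma)$, and $\mathsf{MP}_{1,\lambda}$ is the standard Marchenko–Pastur distribution with density $$\frac1{2\pi\lambda x}\sqrt{\big((1+\sqrt\lambda)^2-x\big)\big(x-(1-\sqrt\lambda)^2\big)}\quad\text{on }x\in[(1-\sqrt\lambda)^2,(1+\sqrt\lambda)^2].$$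
   Context: $\mathcal{LPI}$ (Laguerre–Pólya class of type I) is the set of real entire functions $f(z)=Cz^me^{-cz}\prod_{j\ge1}(1-\alpha_jz)e^{\alpha_jz}$ with $\alpha_j\in[0,\infty)$, $\sum_j\alpha_j<\infty$ and $c\ge\sum_j\alpha_j$ (the product may have finitely many or no factors). Admissible sequence in $\mathcal{LPI}$ with limit data $(c,\Sigma)$: $f_n\in\mathcal{LPI}$ has the form $f_n(z)=e^{-c_nz}\prod_{j}(1-\alpha_{j,n}z)e^{\alpha_{j,n}z}$, the finite measures $\Sigma_n=\frac1n\sum_j\frac{n^2\alpha_{j,n}^2}{n^2\alpha_{j,n}^2+1}\,\delta_{n\alpha_{j,n}}$ converge vaguely, as $n\to\infty$, to a positive finite Borel measure $\Sigma$ on $\mathbb R$, and $\lim_{n\to\infty}\big(c_n-\int x\,d\Sigma_n(x)\big)=c$. For $f(z)=\sum_k\frac{\gamma_k}{k!}z^k$ and a degree-lowering operator $L$ on polynomials (such as $\partial_z$ or a multiple of $\mathscr L_\beta$), $f(L)=\sum_k\frac{\gamma_k}{k!}L^k$. For a polynomial $p$ of (formal) degree $n$, $[\![p]\!]=\frac1n\sum_{w:p(w)=0}\delta_w$ (roots counted with multiplicity); $\Rightarrow$ is weak convergence. For a probability measure $\mu$ on $\mathbb R$, $G_\mu(z)=\int\frac{d\mu(s)}{z-s}$ on the upper half-plane. With $\Gamma_{\alpha,\beta}=\{z:\alpha\,\mathrm{Im}\,z>|\mathrm{Re}\,z|,\ \mathrm{Im}\,z>\beta\}$ and $\Delta_{\alpha,\beta}=\{u:1/u\in\Gamma_{\alpha,\beta}\}$,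 for every $\alpha>0$ there is $\beta>0$ such that the $R$-transform $R_\mu:\Delta_{\alpha,\beta}\to\mathbb C$ satisfies $G_\mu(R_\mu(u)+1/u)=u$ on $\Delta_{\alpha,\beta}$ and $R_\mu(G_\mu(z))+1/G_\mu(z)=z$ on $\Gamma_{\alpha,\beta}$. $\mu\boxplus\nu$ is the probability measure with $R_{\mu\boxplus\nu}=R_\mu+R_\nu$. $\mu_{c,\Sigma}$ is the ($\boxplus$-infinitely divisible) probability measure whose $R$-transform extends analytically to the lower half-plane as $c+\int_{\mathbb R}\frac{u+x}{1-xu}\,d\Sigma(x)$; here it is supported on $[0,\infty)$. For a probability measure $\mu\ne\delta_0$ on $[0,\infty)$, $\psi_\mu(z)=\int_0^\infty\frac{uz}{1-uz}\,d\mu(u)$, which has an inverse on a neighborhood of $(-1+\mu(\{0\}),0)$, and $S_\mu(z)=\frac{1+z}{z}\psi_\mu^{-1}(z)$ for $z\in(-1+\mu(\{0\}),0)$. For $\mu_1,\mu_2\neq\delta_0$ on $[0,\infty)$, $\mu_1\boxtimes\mu_2$ is the probability measure with $S_{\mu_1\boxtimes\mu_2}=S_{\mu_1}S_{\mu_2}$ on some common interval $(-\varepsilon,0)$ (as usual, $\mu\boxtimes\delta_0=\delta_0$).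
   Formalization: The vague convergence of Σ_n to Σ is strengthened to weak convergence (bounded continuous test functions), since with escaping mass the claim fails: f_n(z)=(1-(M_n/n)z)^n with M_n→∞ has limit data (0,0), but its roots do not tend to δ_0. *)

(* Defs.v *)
From HB Require Import structures.
From mathcomp Require Import all_boot all_order all_algebra.
From mathcomp Require Import all_classical all_reals all_analysis.
From mathcomp Require Import measurable_realfun.
From mathcomp Require Export complex.

Set Implicit Arguments.
Unset Strict Implicit.
Unset Printing Implicit Defensive.

Import Order.TTheory GRing.Theory Num.Theory.
Import numFieldNormedType.Exports.

Local Open Scope classical_set_scope.
Local Open Scope ring_scope.
Local Open Scope complex_scope.

(* the usual topology of C, induced by the modulus *)
HB.instance Definition _ (R : realType) :=
  NormedModule.copy R[i] (R[i]^o).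

Definition cexp {R : realType} (z : R[i]) : R[i] :=
  (expR (complex.Re z) * cos (complex.Im z)) +i*
  (expR (complex.Re z) * sin (complex.Im z)).

(* f(z) = sum_k (taylor f k) / k! * z^k, convergent on the whole of C *)
Record real_entire (R : realType) := RealEntire {
  taylor :> nat -> R ;
  entire_cvg : forall z : R[i],
    cvgn (series (fun k => (taylor k / k`!%:R)%:C * z ^+ k)) }.

Definition eval_entire {R : realType} (f : real_entire R) (z : R[i]) : R[i] :=
  limn (series (fun k => (f k / k`!%:R)%:C * z ^+ k)).

(* Factors with [alpha j = 0] equal 1, which accounts for products having
   finitely many factors, or none. *)
Definition LPI_form {R : realType} (f : real_entire R)
    (C : R) (m : nat) (c : R) (alpha : nat -> R) : Prop :=
  [/\ forall j, 0 <= alpha j,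
      cvgn (series alpha),
      limn (series alpha) <= c &
      forall z : R[i],
        (fun N => C%:C * z ^+ m * cexp (- c%:C * z) *
           \prod_(j < N) ((1 - (alpha j)%:C * z) * cexp ((alpha j)%:C * z)))
        @ \oo --> eval_entire f z].

Definition LPI {R : realType} (f : real_entire R) : Prop :=
  exists C m c alpha, LPI_form f C m c alpha.

Definition bounded_continuous {R : realType} {T : topologicalType}
    (phi : T -> R) : Prop :=
  continuous phi /\ exists M : R, forall x, `|phi x| <= M.

Definition weak_cvg {R : realType}
    (mu_ : nat -> {measure set (measurableTypeR R) -> \bar R})
    (mu : {measure set (measurableTypeR R) -> \bar R}) : Prop :=
  forall phi : R -> R, bounded_continuous phi ->
    (fun n => \int[mu_ n]_x phi x) @ \oo --> \int[mu]_x phi x.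

Section sigma_measure.
Context {R : realType}.

Lemma sigma_weight_ge0 (x : R) : 0 <= x ^+ 2 / (x ^+ 2 + 1).
Proof. by rewrite divr_ge0 ?addr_ge0 ?sqr_ge0. Qed.

Definition sigma_weight (x : R) : {nonneg R} := NngNum (sigma_weight_ge0 x).

Definition Sigma_ (alpha : nat -> R) (n : nat) :
    {measure set (measurableTypeR R) -> \bar R} :=
  mscale (n%:R^-1)%:nng
    (mseries (fun j => mscale (sigma_weight (n%:R * alpha j))
                         (dirac (n%:R * alpha j : measurableTypeR R))) 0).

End sigma_measure.

(* "Vague convergence" of the finite measures [Sigma_n] is tested against
   bounded continuous functions, that is, mass may not escape to infinity.
   Compactly supported test functions would not be enough to determine the
   limit: for f_n(z) = (1 - (M_n/n) z)^n with M_n -> +oo, Sigma_n is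
   M_n^2/(M_n^2+1) times the Dirac mass at M_n and c_n - int x dSigma_n =
   M_n/(M_n^2+1) -> 0, yet the roots of f_n(d/dz) z^n have mean M_n. *)
Definition admissible {R : realType} (f : nat -> real_entire R)
    (c : R) (Sigma : {finite_measure set (measurableTypeR R) -> \bar R})
    : Prop :=
  exists (c_ : nat -> R) (alpha : nat -> nat -> R),
    [/\ forall n, (0 < n)%N ->
          LPI (f n) /\ LPI_form (f n) 1 0 (c_ n) (alpha n),
        weak_cvg (fun n => Sigma_ (alpha n) n) Sigma &
        (fun n => c_ n - \int[Sigma_ (alpha n) n]_x x) @ \oo --> c].

Definition Lbeta {R : realType} (beta : R) (p : {poly R}) : {poly R} :=
  'X * p^`(2) + (1 + beta) *: p^`().

(* f(L) p, for L lowering the degree: the terms with k >= size p vanish. *)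
Definition apply_entire {R : realType} (f : real_entire R)
    (L : {poly R} -> {poly R}) (p : {poly R}) : {poly R} :=
  \sum_(k < size p) (f k / k`!%:R) *: iter k L p.

Definition borelC (R : realType) := g_sigma_algebraType (@open R[i]).

Definition croots {R : realType} (p : {poly R}) : seq R[i] :=
  sval (closed_field_poly_normal (map_poly (real_complex R) p)).

Definition root_distr {R : realType} (n : nat) (p : {poly R}) :
    {measure set (borelC R) -> \bar R} :=
  mscale (n%:R^-1)%:nng
    (msum (fun k => dirac (nth 0 (croots p) k : borelC R)) (size (croots p))).

(* weak convergence in C to a measure carried by the real line *)
Definition weak_cvgC {R : realType}
    (mu_ : nat -> {measure set (borelC R) -> \bar R})
    (mu : {measure set (measurableTypeR R) -> \bar R}) : Prop :=
  forall phi : R[i] -> R, bounded_continuous phi ->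
    (fun n => \int[mu_ n]_z phi z) @ \oo --> \int[mu]_x phi x%:C.

Section free_additive.
Context {R : realType}.
Implicit Types mu : {measure set (measurableTypeR R) -> \bar R}.

Definition cintegral mu (g : R -> R[i]) : R[i] :=
  (\int[mu]_x complex.Re (g x)) +i* (\int[mu]_x complex.Im (g x)).

Definition cauchy_transform mu (z : R[i]) : R[i] :=
  cintegral mu (fun s => (z - s%:C)^-1).

Definition Gamma_ (a b : R) : set R[i] :=
  [set z | `|complex.Re z| < a * complex.Im z /\ b < complex.Im z].

Definition Delta_ (a b : R) : set R[i] := [set u | Gamma_ a b u^-1].

Definition is_R_transform mu (r : R[i] -> R[i]) : Prop :=
  forall a : R, 0 < a -> exists2 b : R, 0 < b &
    (forall u, Delta_ a b u ->
       0 < complex.Im (r u + u^-1) /\ cauchy_transform mu (r u + u^-1) = u) /\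
    (forall z, Gamma_ a b z ->
       r (cauchy_transform mu z) + (cauchy_transform mu z)^-1 = z).

(* mu is, for every k >= 1, a k-fold free additive convolution rho [+] ... [+]
   rho, whose R-transform is k times the one of rho *)
Definition free_inf_divisible mu : Prop :=
  forall k : nat, (0 < k)%N ->
    exists (rho : probability (measurableTypeR R) R) (r : R[i] -> R[i]),
      is_R_transform rho r /\ is_R_transform mu (fun u => k%:R * r u).

Definition levy_R (c : R)
    (Sigma : {finite_measure set (measurableTypeR R) -> \bar R})
    (u : R[i]) : R[i] :=
  c%:C + cintegral Sigma (fun x => (u + x%:C) / (1 - x%:C * u)).

Definition free_levy_pair mu (c : R)
    (Sigma : {finite_measure set (measurableTypeR R) -> \bar R}) : Prop :=
  free_inf_divisible mu /\ is_R_transform mu (levy_R c Sigma).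

End free_additive.

Section free_multiplicative.
Context {R : realType}.
Implicit Types mu : {measure set (measurableTypeR R) -> \bar R}.

Definition nneg_supported mu : Prop := mu [set x : R | x < 0] = 0%E.

Definition is_dirac0 mu : Prop :=
  forall A, measurable A -> mu A = dirac (0 : measurableTypeR R) A.

Definition psi_transform mu (z : R) : R :=
  \int[mu]_(u in `[0, +oo[) (u * z / (1 - u * z)).

(* On the real interval (-1 + mu {0}, 0) the inverse of psi_mu is the inverse of
   its restriction to the negative half-line, where psi_mu is increasing. *)
Definition psi_inv mu (z : R) : R :=
  xget 0 [set w | w < 0 /\ psi_transform mu w = z].

Definition S_transform mu (z : R) : R := (1 + z) / z * psi_inv mu z.

Definition is_free_mult_conv mu1 mu2 mu : Prop :=
  [/\ nneg_supported mu1, nneg_supported mu2, nneg_supported mu &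
      (is_dirac0 mu1 \/ is_dirac0 mu2 -> is_dirac0 mu) /\
      (~ is_dirac0 mu1 -> ~ is_dirac0 mu2 ->
        ~ is_dirac0 mu /\
        exists2 e : R, 0 < e &
          [/\ e <= 1 - fine (mu1 [set 0]),
              e <= 1 - fine (mu2 [set 0]),
              e <= 1 - fine (mu [set 0]) &
              forall z, - e < z < 0 ->
                S_transform mu z = S_transform mu1 z * S_transform mu2 z])].

End free_multiplicative.

Section marchenko_pastur.
Context {R : realType}.
Variable lambda : R.

Definition MP_pdf (x : R) : R :=
  if (1 - Num.sqrt lambda) ^+ 2 <= x <= (1 + Num.sqrt lambda) ^+ 2 then
    (2 * pi * lambda * x)^-1 *
    Num.sqrt (((1 + Num.sqrt lambda) ^+ 2 - x) *
              (x - (1 - Num.sqrt lambda) ^+ 2))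
  else 0.

Definition MP : set (measurableTypeR R) -> \bar R :=
  fun A => (\int[lebesgue_measure]_(x in A) (MP_pdf x)%:E)%E.

Lemma MP_pdf_ge0 x : 0 <= MP_pdf x.
Proof.
rewrite /MP_pdf; case: ifPn => // /andP[ax xb].
have [l0|l0] := leP 0 lambda.
  rewrite mulr_ge0 ?sqrtr_ge0// invr_ge0 !mulr_ge0 ?pi_ge0//.
  exact: le_trans (sqr_ge0 _) ax.
move: ax xb; rewrite (ler0_sqrtr (ltW l0)) subr0 addr0 expr1n => ax xb.
have -> : x = 1 by apply/le_anti/andP.
by rewrite subrr mulr0 sqrtr0 mulr0.
Qed.

Lemma measurable_MP_pdf : measurable_fun [set: R] MP_pdf.
Proof.
have mV : measurable_fun [set: R] (fun x : R => x^-1).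
  rewrite (_ : (fun x => _) = (fun x => if x == 0 then 0 else x^-1)); last first.
    by apply/funext => x; case: eqVneq => // ->; rewrite invr0.
  apply: measurable_fun_if => //.
  - exact: measurable_fun_eqr.
  - rewrite setTI; apply: open_continuous_measurable_fun.
      rewrite (_ : _ @^-1` _ = ~` [set 0]).
        by apply: closed_openC; exact: accessible_closed_set1 (hausdorff_accessible (@Rhausdorff R)) 0.
      by apply/seteqP; split => x /=; [move/eqP | move=> ?; apply/eqP].
    by move=> x /=; rewrite inE /= => /negbT x0; exact: inv_continuous.
apply: measurable_fun_ifT => //.
- apply: measurable_and; exact: measurable_fun_ler.
- apply: measurable_funM.
    by apply: measurableT_comp => //; exact: measurable_funM.
  apply: measurableT_comp.
    by apply: continuous_measurable_fun; exact: sqrt_continuous.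
  by apply: measurable_funM; exact: measurable_funB.
Qed.

Let MP0 : MP set0 = 0%E.
Proof. by rewrite /MP integral_set0. Qed.

Let MP_ge0 A : (0 <= MP A)%E.
Proof. by apply: integral_ge0 => x _; rewrite lee_fin MP_pdf_ge0. Qed.

Let MP_sigma_additive : semi_sigma_additive MP.
Proof.
move=> /= A mA tA mUA; rewrite /MP/= ge0_integral_bigcup//=.
- by apply: is_cvg_ereal_nneg_natsum_cond => n _ _; exact: MP_ge0.
- by apply/measurable_funTS/measurable_EFinP; exact: measurable_MP_pdf.
- by move=> x _; rewrite lee_fin MP_pdf_ge0.
Qed.

HB.instance Definition _ := isMeasure.Build _ _ _
  MP MP0 MP_ge0 MP_sigma_additive.

End marchenko_pastur.

(* Main.v *)
Require Import Defs.
From HB Require Import structures.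
From mathcomp Require Import all_boot all_order all_algebra.
From mathcomp Require Import all_classical all_reals all_analysis.
From mathcomp Require Import measurable_realfun ring lra zify.

Set Implicit Arguments.
Unset Strict Implicit.
Unset Printing Implicit Defensive.

Import Order.TTheory GRing.Theory Num.Theory.
Import numFieldNormedType.Exports.

Local Open Scope classical_set_scope.
Local Open Scope ring_scope.

(** Write [x_j = n alpha_j]. Up to a limit, [f_n] is a polynomial
[\prod_j (1 - alpha_j z)], so that both polynomials of the statement have
coefficients [(-1)^k e_k(x) \prod_(i < k) g(i / n)] with
[g(t) = (1 - t)(rho_n - lam t)], where [lam = 0] for the Appell polynomials
and [rho_n -> 1]; their roots are nonnegative by Gauss-Lucas arguments.

Root distributions. For a polynomial [\prod_a (1 + a x)], [a >= 0], the ratios of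
consecutive coefficients locate the mean [\sum_a a x / (1 + a x)] (Darroch).
Applied to the list [x_j] and to the list [u_j] of roots, this turns the
convergence of [n^-1 \sum_j x_j y / (1 + x_j y)] to [M(y) = y R(-y)] into
[n^-1 \sum_j (1 + u_j w)^-1 -> 1 - M] at [w = y / ((1 - M)(1 - lam M))], hence
into weak convergence of the root distributions. Since
[psi_nu (- w) = - \int u w / (1 + u w) dnu(u)], the limits [mu] ([lam = 0]) and
[nu] have [S_mu (- M) = y / M] and [S_nu (- M) = y / (M (1 - lam M))], and
[S_MP (- t) = 1 / (1 - lam t)] by an explicit integral.

R-transform. For [A = \prod_j (1 - a_j d/dz) z^n] one has the exact identity
[z A' = n A + \sum_j a_j A_j'] with [A_j] the product without the factor [j].
Divided by [n A] it becomes [z = 1/G + R(G)] in the limit, for all [Im z > 0]. *)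

(** * Elementary symmetric functions and Darroch's bounds *)

(** Passing from the [x_j] to the roots multiplies the ratio of the coefficients [k + 1] and [k] by
    [g(k / n)]. The index where the ratio for the [x_j] drops below [1 / y] is thus the one where
    the ratio for the roots drops below [g(k / n) / y]. Darroch's bounds apply to both lists at this
    common [k]; they force [k / n -> M] on one side and produce the point [w = y / g(M)] on the
    other. Only real [w > 0] near 0 are needed: there [\int (1 + w x)^-1] already determines a
    measure on the half-line. The measures of the second claim are known only through an R-transform
    on cones and an S-transform near 0. Hence a limit measure of explicit root lists is built as
    well, which also gives existence; the given [mu] is identified with it by uniqueness, and [nu]
    through the values of its S-transform. Each [f_n] is replaced by finite products whose
    coefficients converge for fixed [n], and a diagonal choice follows. The construction carries a
    factor [kap] because infinite divisibility requires measures whose R-transform is [R / k]. *)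

Lemma cvg_bigsum (R : realType) (T I : Type) (F : set_system T) (FF : Filter F)
    (r : seq I) (f : T -> I -> R) (l : I -> R) :
  (forall i, (fun t => f t i) @ F --> l i) ->
  (fun t => \sum_(i <- r) f t i) @ F --> \sum_(i <- r) l i.
Proof.
move=> fl; elim: r => [|i r IH].
  by under eq_fun do rewrite big_nil; rewrite big_nil; exact: cvg_cst.
by under eq_fun do rewrite big_cons; rewrite big_cons; exact: cvgD.
Qed.

Section esp.
Variable R : realType.
Implicit Types (s : seq R) (a x : R).

Fixpoint esp s (k : nat) : R :=
  if s is a :: s' then esp s' k + a * (if k is k'.+1 then esp s' k' else 0)
  else (k == 0)%:R.

Lemma esp0 s : esp s 0 = 1.
Proof. by elim: s => //= a s ->; rewrite mulr0 addr0. Qed.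

Lemma espS a s k : esp (a :: s) k.+1 = esp s k.+1 + a * esp s k.
Proof. by []. Qed.

Lemma esp_ge0 s k : all (>= 0) s -> 0 <= esp s k.
Proof.
elim: s k => [|a s IH] k /=; first by rewrite ler0n.
by case/andP=> a0 s0; rewrite addr_ge0 ?IH// mulr_ge0//; case: k => // k; exact: IH.
Qed.

Lemma esp_gt_size s k : (size s < k)%N -> esp s k = 0.
Proof.
elim: s k => [|a s IH] [|k]//= sk.
by rewrite !IH ?mulr0 ?addr0// ltnW.
Qed.

(** Log-concavity is the case [k = j + 1]; the two-index form is what an induction over the entries
    can carry. One more entry [a] turns the difference of the two sides into a polynomial in [a]
    whose coefficients are sums of differences already known to be nonnegative. *)
Lemma esp_TP2 s j k : all (>= 0) s -> (j <= k)%N ->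
  esp s j * esp s k.+1 <= esp s j.+1 * esp s k.
Proof.
elim: s j k => [|a s IH] j k; first by rewrite /= mulr0 mul0r.
move=> /andP[a0 s0]; have e0 i := esp_ge0 i s0.
move=> jk.
have [->|] := eqVneq j k; first by rewrite mulrC.
move=> njk; have {jk njk} : (j < k)%N by rewrite ltn_neqAle njk.
case: k => // k; rewrite ltnS => jk.
case: j jk => [|j] jk.
  rewrite esp0 !espS esp0.
  have h1 := IH 0%N k.+1 s0 isT; have h2 := IH 0%N k s0 isT.
  rewrite esp0 in h1 h2.
  have := e0 k.+2; have := e0 k.+1; have := e0 k; have := e0 1%N.
  rewrite mulr1.
  nra.
rewrite !espS.
have h1 := IH j.+1 k.+1 s0 (leqW jk).
have h2 := IH j k.+1 s0 (leqW (ltnW jk)).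
have h3 := IH j.+1 k s0 jk.
have h4 := IH j k s0 (ltnW jk).
rewrite -subr_ge0.
have -> : (esp s j.+2 + a * esp s j.+1) * (esp s k.+1 + a * esp s k) -
  (esp s j.+1 + a * esp s j) * (esp s k.+2 + a * esp s k.+1) =
  (esp s j.+2 * esp s k.+1 - esp s j.+1 * esp s k.+2) +
  a * ((esp s j.+2 * esp s k - esp s j.+1 * esp s k.+1) +
       (esp s j.+1 * esp s k.+1 - esp s j * esp s k.+2)) +
  a ^+ 2 * (esp s j.+1 * esp s k - esp s j * esp s k.+1) by ring.
apply: addr_ge0; last by rewrite mulr_ge0 ?sqr_ge0// subr_ge0.
apply: addr_ge0; first by rewrite subr_ge0.
by apply: mulr_ge0 => //; apply: addr_ge0; rewrite subr_ge0.
Qed.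

(** A vanishing [e_k] means that fewer than [k] entries are nonzero, so the sequence has no internal
    zeros. *)
Lemma esp_eq0S s k : all (>= 0) s -> esp s k = 0 -> esp s k.+1 = 0.
Proof.
elim: s k => [|a s IH] k //= /andP[a0 s0].
case: k => [|k]; first by rewrite esp0 mulr0 addr0 => /eqP; rewrite oner_eq0.
move=> /eqP; rewrite paddr_eq0 ?mulr_ge0 ?esp_ge0// mulf_eq0 => /andP[/eqP e1 /orP[]/eqP e2].
  by rewrite e2 mul0r addr0 IH.
by rewrite e1 mulr0 addr0 IH.
Qed.

Lemma esp_le s k (S : R) : all (>= 0) s -> \sum_(a <- s) a <= S -> esp s k <= S ^+ k.
Proof.
elim: s k S => [|a s IH] k S /=.
  rewrite big_nil => _ S0; case: k => [|k] /=; first by rewrite expr0.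
  by rewrite exprn_ge0.
case/andP=> a0 s0; rewrite big_cons => aS.
have sS : \sum_(b <- s) b <= S - a by rewrite lerBrDl.
have sum0 : 0 <= \sum_(b <- s) b.
  by rewrite big_seq sumr_ge0// => b bs; exact: (allP s0).
have Sa0 : 0 <= S - a by rewrite (le_trans sum0).
have S0 : 0 <= S by rewrite -(subrK a S) addr_ge0.
case: k => [|k]; first by rewrite esp0 mulr0 addr0 expr0.
have h1 := IH k.+1 _ s0 sS; have h2 := IH k _ s0 sS.
have aSk : (S - a) ^+ k <= S ^+ k by rewrite lerXn2r ?nnegrE// gerBl.
apply: (le_trans (lerD h1 (ler_wpM2l a0 h2))).
rewrite !exprS -mulrDl subrK; exact: ler_wpM2l.
Qed.

Lemma prod_esp s x N : (size s <= N)%N ->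
  \prod_(a <- s) (1 + a * x) = \sum_(k < N.+1) esp s k * x ^+ k.
Proof.
elim: s N => [|a s IH] N.
  rewrite big_nil => _; rewrite big_ord_recl big1 ?addr0 ?expr0 ?mulr1//.
  by move=> i _; rewrite /= mul0r.
case: N => // N; rewrite ltnS => sN; rewrite big_cons.
rewrite (IH N.+1 (leqW sN)) mulrDl mul1r.
rewrite [in RHS]big_ord_recl esp0.
under [in RHS]eq_bigr => i _ do rewrite lift0 espS mulrDl.
rewrite big_split/= addrA; congr (_ + _).
  rewrite big_ord_recl esp0; congr (_ + _); apply: eq_bigr.
rewrite -(IH N.+1 (leqW sN)) (IH N sN) mulr_sumr; apply: eq_bigr => i _.
by rewrite exprS; ring.
Qed.

(** One pair per position, so that repeated entries keep their multiplicity. It indexes the sums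
    whose terms depend on an entry and on the list deprived of it. *)
Fixpoint splits s : seq (R * seq R) :=
  if s is a :: s' then (a, s') :: [seq (p.1, a :: p.2) | p <- splits s'] else [::].

Lemma map_fst_splits s : [seq p.1 | p <- splits s] = s.
Proof. by elim: s => //= a s IH; rewrite -map_comp -[in RHS]IH; congr cons; apply: eq_map. Qed.

Lemma sum_splits (f : R -> R) s : \sum_(p <- splits s) f p.1 = \sum_(a <- s) f a.
Proof. by rewrite -[in RHS](map_fst_splits s) big_map. Qed.

Lemma splits_ge0 s p : all (>= 0) s -> p \in splits s -> 0 <= p.1 /\ all (>= 0) p.2.
Proof.
elim: s p => //= a s IH p /andP[a0 s0]; rewrite inE => /predU1P[->//|].
by case/mapP=> q /(IH _ s0)[q1 q2] -> /=; rewrite a0.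
Qed.

Lemma size_splits s p : p \in splits s -> size s = (size p.2).+1.
Proof.
elim: s p => //= a s IH p; rewrite inE => /predU1P[->//|].
by case/mapP=> q /IH -> ->.
Qed.

Lemma esp_splits s p k : p \in splits s ->
  esp s k.+1 = esp p.2 k.+1 + p.1 * esp p.2 k.
Proof.
elim: s p k => //= a s IH p k; rewrite inE => /predU1P[->//|].
case/mapP=> q qs ->/=; rewrite (IH _ _ qs).
case: k => [|k]; first by rewrite !esp0; ring.
by rewrite (IH _ _ qs); ring.
Qed.

Lemma esp_sum_splits s k :
  k.+1%:R * esp s k.+1 = \sum_(p <- splits s) p.1 * esp p.2 k.
Proof.
elim: s k => [|a s IH] k /=; first by rewrite big_nil mulr0.
rewrite big_cons big_map /=.
under eq_bigr do rewrite mulrDr.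
rewrite big_split/= -IH mulrDr addrCA; congr (_ + _).
case: k => [|k]; first by rewrite esp0 mul1r big1 ?addr0// => p _; rewrite !mulr0.
under eq_bigr do rewrite mulrCA.
by rewrite -mulr_sumr -IH [in LHS]mulrSr; ring.
Qed.

(** Mean of the law on the integers with weights proportional to [esp s k * x ^+ k], that of a sum
    of independent Bernoulli variables with odds [a * x]. *)
Definition bmean s x := \sum_(a <- s) a * x / (1 + a * x).

Lemma bmean_ge0 s x : all (>= 0) s -> 0 <= x -> 0 <= bmean s x.
Proof.
move=> s0 x0; rewrite /bmean big_seq sumr_ge0// => a /(allP s0) /= a0.
by rewrite divr_ge0 ?addr_ge0 ?mulr_ge0.
Qed.

(** At most [k] entries are nonzero, and each contributes at most 1. *)
Lemma esp_eq0_bmean s x k : all (>= 0) s -> 0 <= x -> esp s k.+1 = 0 -> bmean s x <= k%:R.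
Proof.
move=> + x0; elim: s k => [|a s IH] k /=.
  by move=> _ _; rewrite /bmean big_nil.
case/andP=> a0 s0 /eqP; rewrite paddr_eq0 ?mulr_ge0 ?esp_ge0// mulf_eq0.
move=> /andP[/eqP e1 /orP[]/eqP e2].
  by rewrite /bmean big_cons e2 !mul0r add0r; exact: IH.
case: k => [|k] in e1 e2 *; first by move: e2 => /eqP; rewrite esp0 oner_eq0.
rewrite /bmean big_cons -nat1r lerD//; last exact: IH.
have ax : 0 <= a * x by rewrite mulr_ge0.
by rewrite ler_pdivrMr ?ltr_pwDl// mul1r lerDr.
Qed.

(** For consecutive terms [p], [q], [t] of a log-concave sequence, [p / q <= q / t <= x]; written
    without dividing by [t]. *)
Lemma logconcave_step (p q t x : R) : 0 < q -> 0 <= p -> 0 < x ->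
  p * t <= q * q -> q <= x * t -> p <= x * q.
Proof.
move=> q0 p0 x0 ptqq qxt; rewrite -(ler_pM2r q0).
apply: (le_trans (ler_wpM2l p0 qxt)).
by rewrite mulrCA -mulrA ler_pM2l.
Qed.

(* Darroch's bounds: conditioning a sum of independent Bernoulli variables on
   its value, the mean is located by the ratios of consecutive weights. *)
Lemma bmean_le s x k : all (>= 0) s -> 0 < x ->
  x * esp s k.+1 <= esp s k -> bmean s x <= k.+1%:R.
Proof.
move=> s0 x0 hk.
have [e0|ne0] := eqVneq (esp s k.+1) 0.
  by apply: (le_trans (esp_eq0_bmean s0 (ltW x0) e0)); rewrite ler_nat.
have e0 : 0 < esp s k.+1 by rewrite lt_neqAle eq_sym ne0 esp_ge0.
(* With [r] the complement of the entry [a], the sum of the [a * esp r k] equals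
   [(k + 1) * esp s k.+1], and the comparison is made entry by entry. *)
rewrite -(ler_pM2r e0) esp_sum_splits /bmean -(sum_splits (fun a => a * x / (1 + a * x))).
rewrite mulr_suml; rewrite big_seq [leRHS]big_seq; apply: ler_sum => -[a r] ars /=.
have [/= a0 r0] := splits_ge0 s0 ars.
have ax : 0 < 1 + a * x by rewrite ltr_pwDl// mulr_ge0// ltW.
rewrite mulrAC ler_pdivrMr// -!mulrA; apply: ler_wpM2l => //.
rewrite (esp_splits k ars)/= in hk *.
(* Removing an entry keeps the hypothesis: a failure for [r] would spread by log-concavity to the
   previous ratio, and the two inequalities would add up to the negation of [hk]. *)
suff : x * esp r k.+1 <= esp r k by move=> h; lra.
rewrite leNgt; apply/negP => hx.
have ek := esp_ge0 k r0; have ek1 := esp_ge0 k.+1 r0.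
case: k => [|k] in hk e0 ne0 hx ek ek1 *.
  by move: hk; rewrite !esp0 in hx *; have := mulr_ge0 (ltW x0) a0; lra.
rewrite (esp_splits k ars)/= in hk.
have ekp : 0 < esp r k.+1.
  rewrite lt_neqAle ek andbT; apply/eqP => /esym e1.
  by move: hx; rewrite (esp_eq0S r0 e1) mulr0 e1 ltxx.
have h2 := ler_wpM2l a0 (logconcave_step ekp (esp_ge0 k r0) x0 (esp_TP2 r0 (leqnSn k)) (ltW hx)).
by move: hk; nra.
Qed.

(** The mirror argument: removing an entry has to keep the reversed inequality, and log-concavity
    now spreads a failure to the next ratio. *)
Lemma le_bmean s x k : all (>= 0) s -> 0 < x ->
  esp s k <= x * esp s k.+1 -> 0 < esp s k -> k%:R <= bmean s x.
Proof.
move=> s0 x0 hk e0.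
case: k => [|k] in hk e0 *; first by rewrite bmean_ge0// ltW.
rewrite -(ler_pM2r e0) esp_sum_splits /bmean -(sum_splits (fun a => a * x / (1 + a * x))).
rewrite mulr_suml; rewrite big_seq [leRHS]big_seq; apply: ler_sum => -[a r] ars /=.
have [/= a0 r0] := splits_ge0 s0 ars.
have [->|an0] := eqVneq a 0; first by rewrite !mul0r.
have ap : 0 < a by rewrite lt_neqAle eq_sym an0.
have ax : 0 < 1 + a * x by rewrite ltr_pwDl// mulr_ge0// ltW.
rewrite -!mulrA; apply: ler_wpM2l => //.
rewrite mulrA mulrAC ler_pdivlMr//.
rewrite (esp_splits k ars) (esp_splits k.+1 ars)/= in hk; rewrite (esp_splits k ars)/=.
suff h : esp r k <= x * esp r k.+1 by nra.
rewrite leNgt; apply/negP => hx.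
have ek0 := esp_ge0 k r0.
have [e1|/eqP e1] := eqVneq (esp r k.+1) 0.
  rewrite e1 (esp_eq0S r0 e1) in hk.
  have : 0 < a * esp r k by rewrite mulr_gt0// (le_lt_trans _ hx)// e1 mulr0.
  lra.
have ep : 0 < esp r k.+1 by rewrite lt_neqAle eq_sym esp_ge0// andbT; apply/eqP.
have h3 : x * esp r k.+2 <= esp r k.+1.
  rewrite leNgt; apply/negP => h3.
  have := logconcave_step ep ek0 x0 (esp_TP2 r0 (leqnSn k)) (ltW h3).
  by move/(lt_le_trans hx); rewrite ltxx.
have : a * (x * esp r k.+1) < a * esp r k by rewrite ltr_pM2l.
move: hk h3; nra.
Qed.
End esp.

(** * Polynomials with nonnegative roots *)

Local Open Scope complex_scope.

Section complex_parts.
Variable R : realType.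
Implicit Types (z w : R[i]) (x : R).
Notation Re := complex.Re.
Notation Im := complex.Im.

Lemma ReD z w : Re (z + w) = Re z + Re w. Proof. by case: z w => [a b] [c d]. Qed.
Lemma ImD z w : Im (z + w) = Im z + Im w. Proof. by case: z w => [a b] [c d]. Qed.
Lemma ReN z : Re (- z) = - Re z. Proof. by case: z. Qed.
Lemma ImN z : Im (- z) = - Im z. Proof. by case: z. Qed.
Lemma ReM z w : Re (z * w) = Re z * Re w - Im z * Im w.
Proof. by case: z w => [a b] [c d]. Qed.
Lemma ImM z w : Im (z * w) = Re z * Im w + Im z * Re w.
Proof. by case: z w => [a b] [c d]. Qed.
Lemma Re_real x : Re x%:C = x. Proof. by []. Qed.
Lemma Im_real x : Im x%:C = 0. Proof. by []. Qed.
Lemma Re_mk (a b : R) : Re (a +i* b) = a. Proof. by []. Qed.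
Lemma Im_mk (a b : R) : Im (a +i* b) = b. Proof. by []. Qed.
Lemma Re1 : Re (1 : R[i]) = 1. Proof. by []. Qed.
Lemma Im1 : Im (1 : R[i]) = 0. Proof. by []. Qed.
Definition ReImE := (ReD, ImD, ReN, ImN, ReM, ImM, Re_real, Im_real, Re_mk, Im_mk, Re1, Im1).
Lemma Re_sum (I : Type) (r : seq I) (F : I -> R[i]) :
  Re (\sum_(i <- r) F i) = \sum_(i <- r) Re (F i).
Proof. by elim/big_rec2: _ => // i _ y _ <-; rewrite ReD. Qed.
Lemma Im_sum (I : Type) (r : seq I) (F : I -> R[i]) :
  Im (\sum_(i <- r) F i) = \sum_(i <- r) Im (F i).
Proof. by elim/big_rec2: _ => // i _ y _ <-; rewrite ImD. Qed.

Lemma complex_eq z w : Re z = Re w -> Im z = Im w -> z = w.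
Proof. by case: z w => [a b] [c d] /= -> ->. Qed.

(** Squared modulus as an element of [R], so that estimates stay in an ordered field. *)
Definition nsq z : R := Re z ^+ 2 + Im z ^+ 2.

Lemma nsq_ge0 z : 0 <= nsq z. Proof. by rewrite addr_ge0 ?sqr_ge0. Qed.
Lemma nsqM z w : nsq (z * w) = nsq z * nsq w.
Proof. by rewrite /nsq ReM ImM; ring. Qed.
Lemma nsq_eq0 z : (nsq z == 0) = (z == 0).
Proof.
apply/idP/idP => [|/eqP ->]; last by rewrite /nsq/= expr0n addr0.
by rewrite paddr_eq0 ?sqr_ge0// !sqrf_eq0 => /andP[/eqP h1 /eqP h2]; apply/eqP/complex_eq.
Qed.

Lemma nsq_gt0 z : (0 < nsq z) = (z != 0).
Proof. by rewrite lt_neqAle eq_sym nsq_eq0 nsq_ge0 andbT. Qed.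
Lemma ReV z : Re z^-1 = Re z / nsq z. Proof. by case: z. Qed.
Lemma ImV z : Im z^-1 = - (Im z / nsq z). Proof. by case: z. Qed.
Lemma nsqV z : nsq z^-1 = (nsq z)^-1.
Proof.
have [->|z0] := eqVneq z 0.
  by have /eqP e : nsq 0 == 0; rewrite ?nsq_eq0// invr0 e invr0.
apply: (mulfI (_ : nsq z != 0)); first by rewrite nsq_eq0.
rewrite -nsqM divff// divff ?nsq_eq0//.
by rewrite /nsq /= expr1n expr0n addr0.
Qed.

Lemma nsqX z n : nsq (z ^+ n) = nsq z ^+ n.
Proof.
by elim: n => [|n IH]; rewrite ?expr0 ?exprS ?nsqM ?IH// /nsq /= expr1n expr0n addr0.
Qed.

End complex_parts.

Section nonneg_rooted.
Variable R : realType.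
Implicit Types (u s : seq R) (z : R[i]) (p q : {poly R}).
Notation Re := complex.Re.
Notation Im := complex.Im.

Definition rooted u : {poly R} := \prod_(x <- u) ('X - x%:P).

(** Coefficients are counted from the leading one and carry alternating signs, so that for a product
    of linear factors [b] is the sequence of elementary symmetric functions of the roots. *)
Definition altpoly n (b : nat -> R) : {poly R} :=
  \poly_(i < n.+1) ((-1) ^+ (n - i) * b (n - i)%N).

Lemma coef_altpoly n b k : (k <= n)%N -> (altpoly n b)`_(n - k) = (-1) ^+ k * b k.
Proof. by move=> kn; rewrite coef_poly ltnS leq_subr subKn. Qed.

Lemma eq_altpoly n b b' : (forall k, (k <= n)%N -> b k = b' k) ->
  altpoly n b = altpoly n b'.
Proof.
by move=> bb; apply/polyP => i; rewrite !coef_poly; case: ifP => // _; rewrite bb// leq_subr.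
Qed.

Lemma altpoly_inj n b b' : altpoly n b = altpoly n b' ->
  forall k, (k <= n)%N -> b k = b' k.
Proof.
move=> bb k kn; have := coef_altpoly b kn; rewrite bb coef_altpoly// => /esym.
by apply: mulfI; rewrite signr_eq0.
Qed.

Lemma rooted_altpoly u : rooted u = altpoly (size u) (esp u).
Proof.
rewrite /rooted; elim: u => [|a u IH].
  rewrite big_nil; apply/polyP => i; rewrite coef_poly coef1.
  by case: i => //=; rewrite subn0 expr0 mulr1.
rewrite big_cons IH mulrBl; apply/polyP => i.
rewrite coefB coefXM coefCM !coef_poly [size (a :: u)]/=.
case: i => [|i] /=.
  rewrite !subn0 (esp_gt_size (leqnn _)) !add0r exprS; ring.
rewrite !ltnS subSS; case: (ltngtP i (size u)) => [iu|iu|->].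
- rewrite -[(size u - i)%N](@prednK _) ?subn_gt0// -subnS.
  by rewrite exprS /=; ring.
- by rewrite mulr0 subr0.
- by rewrite subnn /= esp0; ring.
Qed.

(** The complement of the closed half-line [[0, +oo)] in the complex plane; having no zero there is
    how rootedness in the half-line is proved. *)
Definition slit z := (Im z != 0) || (Re z < 0).

Definition pc p z := (map_poly (real_complex R) p).[z].

Lemma pcD p q z : pc (p + q) z = pc p z + pc q z.
Proof. by rewrite /pc rmorphD hornerD. Qed.

Lemma pcB p q z : pc (p - q) z = pc p z - pc q z.
Proof. by rewrite /pc rmorphB hornerD hornerN. Qed.

Lemma pcM p q z : pc (p * q) z = pc p z * pc q z.
Proof. by rewrite /pc rmorphM hornerM. Qed.

Lemma pcZ c p z : pc (c *: p) z = c%:C * pc p z.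
Proof. by rewrite /pc -mul_polyC rmorphM/= map_polyC hornerM hornerC. Qed.

Lemma pcX z : pc 'X z = z. Proof. by rewrite /pc map_polyX hornerX. Qed.

Lemma pcXsubC x z : pc ('X - x%:P) z = z - x%:C.
Proof. by rewrite /pc rmorphB/= map_polyX map_polyC/= hornerXsubC. Qed.

Lemma pcE p n z : (size p <= n)%N -> pc p z = \sum_(k < n) (p`_k)%:C * z ^+ k.
Proof.
move=> pn; rewrite /pc (@horner_coef_wide _ n) ?size_map_poly//.
by apply: eq_bigr => i _; rewrite coef_map.
Qed.

Lemma pc_rooted u z : pc (rooted u) z = \prod_(x <- u) (z - x%:C).
Proof.
rewrite /pc /rooted rmorph_prod/= horner_prod; apply: eq_bigr => x _.
by rewrite rmorphB/= map_polyX map_polyC/= hornerXsubC.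
Qed.

Definition logder u z : R[i] := \sum_(x <- u) (z - x%:C)^-1.

Lemma slitP z : slit z -> Im z != 0 \/ Im z = 0 /\ Re z < 0.
Proof. by rewrite /slit; case: eqVneq => //= [zi zr|]; [right|left]. Qed.

Lemma slit_sub_neq0 z x : slit z -> 0 <= x -> z - x%:C != 0.
Proof.
move=> sz x0; apply/eqP => /eqP; rewrite subr_eq0 => /eqP zx.
by move: sz; rewrite /slit zx /= eqxx/= ltNge x0.
Qed.

Lemma pc_rooted_neq0 u z : all (>= 0) u -> slit z -> pc (rooted u) z != 0.
Proof.
move=> u0 sz; rewrite pc_rooted prodf_seq_neq0/=; apply/allP => x xu.
by apply: slit_sub_neq0 => //; exact: (allP u0).
Qed.

Lemma pc_deriv_rooted u z : all (>= 0) u -> slit z ->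
  pc (rooted u)^`() z = pc (rooted u) z * logder u z.
Proof.
move=> + sz; rewrite /logder; elim: u => [|a u IH] /=.
  by move=> _; rewrite /rooted !big_nil /pc derivC rmorph0 horner0 mulr0.
case/andP=> a0 u0; have {}IH := IH u0.
rewrite /rooted !big_cons -/(rooted u) derivM derivXsubC mul1r.
rewrite pcD !pcM pcXsubC IH.
by have := slit_sub_neq0 sz a0; move: (z - _) => w w0; field.
Qed.

Lemma Im_inv_slit z x : Im z != 0 -> Im z * Im (z - x%:C)^-1 < 0.
Proof.
move=> z0; have nz : z - x%:C != 0.
  by apply: contra z0; rewrite subr_eq0 => /eqP ->.
rewrite ImV ImD ImN Im_real subr0 mulrN oppr_lt0 mulrA.
by rewrite divr_gt0 ?nsq_gt0// -expr2 exprn_even_gt0.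
Qed.

Lemma Re_inv_slit z x : Im z = 0 -> Re z < 0 -> 0 <= x -> Re (z - x%:C)^-1 < 0.
Proof.
move=> zi zr x0; have sz : slit z by rewrite /slit zr orbT.
rewrite ReV ReD ReN Re_real pmulr_llt0 ?invr_gt0 ?nsq_gt0 ?slit_sub_neq0//.
lra.
Qed.

(* The imaginary part has the sign of [- Im z]; on the negative half-line the
   value is a negative real. *)
Lemma logder_comb_neq0 u z x c : all (>= 0) u -> slit z -> 0 <= x -> 0 < c ->
  logder u z + c%:C * (z - x%:C)^-1 != 0.
Proof.
move=> u0 /slitP[zi|[zi zr]] x0 c0.
  apply/eqP => /(congr1 (fun w => Im z * Im w)); rewrite mulr0 ImD ImM Im_real mul0r addr0.
  rewrite Re_real /logder Im_sum mulrDr mulr_sumr => /eqP; apply/negP.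
  rewrite lt_eqF// mulrCA ltr_wnDl//; last by rewrite pmulr_rlt0// Im_inv_slit.
  by rewrite sumr_le0// => a _; rewrite ltW// Im_inv_slit.
apply/eqP => h; have : Re (logder u z + c%:C * (z - x%:C)^-1) = 0 by rewrite h.
rewrite ReD ReM Im_real mul0r subr0 Re_real /logder Re_sum.
move=> /eqP; apply/negP; rewrite lt_eqF// ltr_wnDl//.
  by rewrite big_seq sumr_le0// => a au; rewrite ltW// Re_inv_slit//; exact: (allP u0).
by rewrite pmulr_rlt0// Re_inv_slit.
Qed.

Definition nnr n p := exists u, [/\ all (>= 0) u, size u = n & p = rooted u].

Lemma rooted_monic u : rooted u \is monic.
Proof. by rewrite /rooted monic_prod_XsubC. Qed.

Lemma size_rooted u : size (rooted u) = (size u).+1.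
Proof. by rewrite /rooted size_prod_XsubC. Qed.

Lemma croots_nonneg n p : p \is monic -> size p = n.+1 ->
  (forall z, slit z -> pc p z != 0) ->
  [/\ all (>= 0) [seq Re z | z <- croots p], size (croots p) = n,
      croots p = [seq (Re z)%:C | z <- croots p] &
      p = rooted [seq Re z | z <- croots p]].
Proof.
move=> pm sp pz.
have e : map_poly (real_complex R) p = \prod_(z <- croots p) ('X - z%:P).
  rewrite /croots; case: closed_field_poly_normal => /= r {1}->.
  by rewrite lead_coef_map (eqP pm) /= scale1r.
have cp z : z \in croots p -> Im z = 0 /\ 0 <= Re z.
  move=> zr; have : pc p z = 0.
    apply/eqP; rewrite /pc e; move: zr; rewrite -root_prod_XsubC.
    exact.
  move=> pz0; have : ~~ slit z by apply/negP => /pz; rewrite pz0 eqxx.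
  by rewrite /slit negb_or negbK -leNgt => /andP[/eqP].
have ec : croots p = [seq (Re z)%:C | z <- croots p].
  rewrite -[LHS]map_id; apply/eq_in_map => z /cp[zi _].
  by apply: complex_eq => //=.
split=> //.
- by apply/allP => _ /mapP[z zr ->]; case: (cp _ zr).
- have := congr1 (fun q : {poly R[i]} => size q) e.
  by rewrite size_map_poly sp size_prod_XsubC => -[].
- apply: (map_inj_poly (@complexI R)) => //.
  rewrite /rooted e rmorph_prod/= big_map {1}ec big_map; apply: eq_bigr => z _.
  by rewrite rmorphB/= map_polyX map_polyC.
Qed.

Lemma nnrP n p : p \is monic -> size p = n.+1 ->
  (forall z, slit z -> pc p z != 0) -> nnr n p.
Proof.
move=> pm sp pz; have [h1 h2 _ h3] := croots_nonneg pm sp pz.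
by exists [seq Re z | z <- croots p]; rewrite size_map.
Qed.

Lemma nnr_slit n p : nnr n p -> [/\ p \is monic, size p = n.+1 & forall z, slit z -> pc p z != 0].
Proof.
case=> u [u0 su ->]; rewrite rooted_monic size_rooted su; split=> // z.
exact: pc_rooted_neq0.
Qed.

(** Off the half-line [p'/p] never takes the value [1 / a]: for [Im z <> 0] it is not real unless it
    is an empty sum, and on the negative axis it is at most 0. *)
Lemma nnr_sub_deriv n p a : 0 <= a -> nnr n p -> nnr n (p - a *: p^`()).
Proof.
move=> a0 np; have [pm sp _] := nnr_slit np.
case: np => u [u0 su pu].
have sd : (size (- (a *: p^`())) < size p)%N.
  rewrite size_polyN (leq_ltn_trans (size_scale_leq _ _))// lt_size_deriv//.
  by rewrite -size_poly_eq0 sp.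
apply: nnrP.
- by rewrite monicE lead_coefDl// -monicE.
- by rewrite size_polyDl.
move=> z sz; rewrite pu pcB pcZ pc_deriv_rooted// mulrCA -{1}[pc _ _]mulr1 -mulrBr mulf_neq0 ?pc_rooted_neq0//.
have [->|an0] := eqVneq a 0; first by rewrite rmorph0 mul0r subr0 oner_neq0.
have ap : 0 < a by rewrite lt_neqAle eq_sym an0.
apply/eqP => h; case: (slitP sz) => [zi|[zi zr]].
  have : Im z * Im (1 - a%:C * logder u z) = 0 by rewrite h mulr0.
  rewrite ImD ImN ImM Im_real mul0r addr0 Re_real /= add0r mulrN mulrCA => /eqP.
  rewrite oppr_eq0 mulf_eq0 (negbTE an0)/= => /eqP e.
  case: u u0 e h {su pu} => [|x u] /=; rewrite /logder.
    by move=> _ _ /eqP; rewrite big_nil mulr0 subr0 oner_eq0.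
  move=> _; rewrite big_cons ImD mulrDr Im_sum mulr_sumr => e _.
  have := Im_inv_slit x zi; have : \sum_(i <- u) Im z * Im (z - i%:C)^-1 <= 0.
    by rewrite sumr_le0// => b _; rewrite ltW// Im_inv_slit.
  by move: e; set S := \sum_(_ <- _) _; lra.
have : Re (1 - a%:C * logder u z) = 0 by rewrite h.
rewrite ReD ReN ReM Im_real mul0r subr0 Re_real /= /logder Re_sum.
have : a * (\sum_(i <- u) Re (z - i%:C)^-1) <= 0.
  rewrite pmulr_rle0// big_seq sumr_le0// => x xu; rewrite ltW// Re_inv_slit//.
  exact: (allP u0).
by move: (a * _) => t; lra.
Qed.

(** The term [c * p] acts as a root of fractional multiplicity [c] at 0:
    [z p' + c p = z p (p'/p + c / z)], and the bracket cannot vanish off the half-line. The scalar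
    makes the result monic. *)
Lemma nnr_theta n p c : 0 < c -> nnr n p ->
  nnr n ((n%:R + c)^-1 *: ('X * p^`() + c *: p)).
Proof.
move=> c0 np; have [pm sp _] := nnr_slit np.
case: np => u [u0 su pu].
have nc0 : n%:R + c != 0 :> R by rewrite gt_eqF// ltr_wpDl.
set q := _ *: _.
have qn : q`_n = 1.
  rewrite /q coefZ coefD coefXM coefZ.
  have pn : p`_n = 1 by have := eqP pm; rewrite lead_coefE sp.
  case: (n) pn nc0 => [|m] pn nc0 /=; rewrite ?coef_deriv pn mulr1 ?add0r ?mulVf//.
  by rewrite add0r in nc0.
have qz i : (n < i)%N -> q`_i = 0.
  move=> ni; rewrite /q coefZ coefD coefXM coefZ coef_deriv.
  rewrite [p`_i]nth_default ?sp// mulr0 addr0.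
  case: i ni => [|i] ni /=; first by rewrite mulr0.
  by rewrite nth_default ?sp// mul0rn mulr0.
have sq : size q = n.+1.
  apply/eqP; rewrite eqn_leq; apply/andP; split.
    by apply/leq_sizeP => i; exact: qz.
  by rewrite ltnNge; apply/negP => /leq_sizeP/(_ n (leqnn _))/eqP; rewrite qn oner_eq0.
apply: nnrP => //; first by rewrite monicE lead_coefE sq qn.
move=> z sz; have z0 : z != 0 by have := slit_sub_neq0 sz (lexx 0); rewrite subr0.
rewrite /q pcZ pcD pcM pcZ pcX pu pc_deriv_rooted//.
rewrite mulf_neq0 ?fmorph_eq0 ?invr_eq0//.
have -> : z * (pc (rooted u) z * logder u z) + c%:C * pc (rooted u) z =
  pc (rooted u) z * (z * (logder u z + c%:C * (z - 0%:C)^-1)).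
  by rewrite rmorph0 subr0; move: (pc _ _) (logder _ _) (c%:C) => P L C; field.
by rewrite !mulf_neq0 ?pc_rooted_neq0// logder_comb_neq0.
Qed.

Lemma altpoly_monic n b : b 0%N = 1 -> altpoly n b \is monic /\ size (altpoly n b) = n.+1.
Proof.
move=> b0; have s : size (altpoly n b) = n.+1.
  by rewrite size_poly_eq// subnn expr0 mul1r b0 oner_neq0.
by rewrite monicE lead_coefE s coef_poly ltnSn subnn expr0 mul1r b0.
Qed.

Lemma slit_dist z : slit z -> exists2 d : R, 0 < d &
  forall x, 0 <= x -> d <= nsq (z - x%:C).
Proof.
move=> /slitP[zi|[zi zr]].
  exists (Im z ^+ 2); first by rewrite exprn_even_gt0.
  by move=> x x0; rewrite /nsq ImD ImN Im_real subr0 lerDr sqr_ge0.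
exists (Re z ^+ 2); first by rewrite exprn_even_gt0//= lt_eqF.
move=> x x0; rewrite /nsq ImD ImN Im_real subr0 zi expr0n addr0 ReD ReN Re_real.
rewrite -subr_ge0; have -> : (Re z - x) ^+ 2 - Re z ^+ 2 = x * (x - 2 * Re z) by ring.
apply: mulr_ge0 => //; lra.
Qed.

Lemma nsq_pc_rooted u z d : all (>= 0) u -> 0 <= d ->
  (forall x, 0 <= x -> d <= nsq (z - x%:C)) -> d ^+ size u <= nsq (pc (rooted u) z).
Proof.
rewrite pc_rooted => + d0 h; elim: u => [|a u IH] /=.
  by rewrite big_nil /nsq /= expr1n expr0n addr0.
case/andP=> a0 /IH{}IH; rewrite big_cons nsqM exprS.
by rewrite ler_pM// ?exprn_ge0// h.
Qed.

(* Rootedness passes to the limit because a monic polynomial with all its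
   [n] roots in the half-line is at least [dist z ^ n] at [z]. *)
Lemma nnr_limit n (b : nat -> nat -> R) (l : nat -> R) :
  (forall N, nnr n (altpoly n (b N))) -> l 0%N = 1 ->
  (forall k, (k <= n)%N -> (fun N => b N k) @ \oo --> l k) ->
  nnr n (altpoly n l).
Proof.
move=> nb l0 bl; have [lm ls] := altpoly_monic n l0.
apply: nnrP => // z sz; have [d d0 hd] := slit_dist sz.
suff : d ^+ n <= nsq (pc (altpoly n l) z).
  move=> h; rewrite -nsq_gt0; apply: lt_le_trans h; exact: exprn_gt0.
have coefc i : (i <= n)%N -> (fun N => (altpoly n (b N))`_i) @ \oo --> (altpoly n l)`_i.
  move=> ni; rewrite -(subKn ni) coef_altpoly ?leq_subr//.
  under eq_fun do rewrite coef_altpoly ?leq_subr//.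
  by apply: cvgM; [exact: cvg_cst|apply: bl; rewrite leq_subr].
have cvgRI (F : R[i] -> R) (FD : forall v w, F (v + w) = F v + F w)
    (FZ : forall c w, F (c%:C * w) = c * F w) :
    (fun N => F (pc (altpoly n (b N)) z)) @ \oo --> F (pc (altpoly n l) z).
  have F0 : F 0 = 0 by have := FZ 0 0; rewrite mulr0 mul0r.
  have Fs p : (size p <= n.+1)%N -> F (pc p z) = \sum_(k < n.+1) p`_k * F (z ^+ k).
    move=> sp; rewrite (pcE _ sp); elim/big_rec2: _ => // i y w _ <-.
    by rewrite FD FZ.
  rewrite Fs ?size_poly//; under eq_fun do rewrite Fs ?size_poly//.
  apply: cvg_bigsum => i; apply: cvgM; last exact: cvg_cst.
  by apply: coefc; rewrite -ltnS.
have cRe : (fun N => Re (pc (altpoly n (b N)) z)) @ \oo --> Re (pc (altpoly n l) z).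
  by apply: (cvgRI (@complex.Re R) (@ReD R)) => c w; rewrite ReM mul0r subr0.
have cIm : (fun N => Im (pc (altpoly n (b N)) z)) @ \oo --> Im (pc (altpoly n l) z).
  by apply: (cvgRI (@complex.Im R) (@ImD R)) => c w; rewrite ImM mul0r addr0.
have cn : (fun N => nsq (pc (altpoly n (b N)) z)) @ \oo --> nsq (pc (altpoly n l) z).
  by rewrite /nsq; apply: cvgD; apply: cvgM.
rewrite -(cvg_lim _ cn)//; apply: limr_ge; first by apply/cvg_ex; eexists; exact: cn.
apply: nearW => N; have [u [u0 su ->]] := nb N.
by rewrite -{1}su nsq_pc_rooted// ltW.
Qed.

Lemma nnr_scale n b t : 0 < t -> nnr n (altpoly n b) ->
  nnr n (altpoly n (fun k => b k * t ^+ k)).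
Proof.
move=> t0 [u [u0 su e]]; exists [seq x * t | x <- u]; rewrite size_map; split=> //.
  by apply/allP => _ /mapP[x xu ->]; apply: mulr_ge0; [exact: (allP u0)|exact: ltW].
rewrite rooted_altpoly size_map su; apply: eq_altpoly => k kn.
rewrite rooted_altpoly su in e; rewrite (altpoly_inj e kn).
elim: u k {e kn u0 su} => [|a u IH] [|k] /=; rewrite ?expr0 ?mulr1 ?mul0r//.
  by rewrite !esp0 !mulr0.
by rewrite -!IH exprS; ring.
Qed.

Lemma nnr_theta_altpoly n b c : 0 < c -> nnr n (altpoly n b) ->
  nnr n (altpoly n (fun k => b k * ((n - k)%:R + c) / (n%:R + c))).
Proof.
move=> c0 /(nnr_theta c0); congr nnr; apply/polyP => i.
rewrite coefZ coefD coefXM coefZ coef_deriv !coef_poly.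
case: i => [|i] /=; first by rewrite subn0 subnn !add0r; ring.
rewrite !ltnS; case: ltnP => ni; last by rewrite mul0rn mulr0 addr0 mulr0.
by rewrite subKn// -mulr_natr; ring.
Qed.

(** The multiplier is a ratio of Gamma values, and Gauss's product for Gamma writes it as a limit of
    products of the multipliers of [z d/dz + (beta + 1 + j)]. Each of these operators preserves
    rootedness because [beta + 1 + j > 0]. *)
Lemma nnr_laguerre n b (beta rho : R) : -1 < beta -> 0 < rho -> nnr n (altpoly n b) ->
  nnr n (altpoly n (fun k => b k * \prod_(i < k) (rho * (n%:R + beta - i%:R)))).
Proof.
move=> hb r0 nb.
suff h : nnr n (altpoly n (fun k => b k * \prod_(i < k) (n%:R + beta - i%:R))).
  have := nnr_scale r0 h; congr nnr; apply: eq_altpoly => k _.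
  by rewrite big_split/= prodr_const card_ord; ring.
have b0 : b 0%N = 1.
  have [pm sp _] := nnr_slit nb; move: (eqP pm).
  by rewrite lead_coefE sp coef_poly ltnSn subnn expr0 mul1r.
pose Q N k : R := \prod_(j < N) (((n - k)%:R + (beta + 1 + j%:R)) / (n%:R + (beta + 1 + j%:R))).
have nnq N : nnr n (altpoly n (fun k => b k * Q N k)).
  elim: N => [|N IH].
    by move: nb; congr nnr; apply: eq_altpoly => k _; rewrite /Q big_ord0 mulr1.
  have cN : 0 < beta + 1 + N%:R by rewrite ltr_wpDr//; lra.
  have := nnr_theta_altpoly cN IH; congr nnr; apply: eq_altpoly => k _.
  by rewrite /Q big_ord_recr/= -!mulrA.
(* Rescaling the roots by [N + 1] compensates the decay of the multipliers; the index is shifted to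
   keep the scale positive. *)
apply: (@nnr_limit n (fun N k => b k * Q N.+1 k * N.+1%:R ^+ k)).
- by move=> N; exact: nnr_scale.
- by rewrite b0 big_ord0 mulr1.
move=> k kn.
suff hQ : (fun N => Q N.+1 k * N.+1%:R ^+ k) @ \oo --> \prod_(i < k) (n%:R + beta - i%:R).
  under eq_fun do rewrite -mulrA.
  by apply: cvgM => //; exact: cvg_cst.
elim: k kn => [|k IH] kn.
  under eq_fun.
    move=> N; rewrite expr0 mulr1 /Q big1; first over.
    move=> j _; rewrite subn0 divff// gt_eqF// ltr_wpDl//.
    by rewrite ltr_wpDr//; lra.
  by rewrite big_ord0; exact: cvg_cst.
rewrite big_ord_recr/=.
have nk : (n - k = (n - k.+1).+1)%N by rewrite subnSK.
pose t : R := (n - k.+1)%:R + (beta + 1).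
have t0 : 0 < t by rewrite /t ltr_wpDl//; lra.
have et : n%:R + beta - k%:R = t.
  by rewrite /t natrB// -natr1; ring.
rewrite et.
(* From [k] to [k + 1] the numerators shift by one, and the quotient of the two products telescopes
   to [t / (t + N + 1)]. *)
have eQ N : Q N.+1 k.+1 * N.+1%:R ^+ k.+1 =
    (Q N.+1 k * N.+1%:R ^+ k) * (t * (N.+1%:R / (t + N.+1%:R))).
  suff -> : Q N.+1 k.+1 = Q N.+1 k * (t / (t + N.+1%:R)) by rewrite exprS; ring.
  rewrite /Q nk; elim: (N.+1) => [|m IHm].
    by rewrite !big_ord0 addr0 divff ?mulr1// gt_eqF.
  rewrite !big_ord_recr/= IHm.
  have h1 : t + m%:R != 0 by rewrite gt_eqF// ltr_wpDr.
  have h2 : t + m.+1%:R != 0 by rewrite gt_eqF// ltr_wpDr.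
  have h3 : n%:R + (beta + 1 + m%:R) != 0.
    by rewrite gt_eqF// ltr_wpDl// ltr_wpDr//; lra.
  have -> : (n - k.+1)%:R + (beta + 1 + m%:R) = t + m%:R by rewrite /t; ring.
  have -> : (n - k.+1).+1%:R + (beta + 1 + m%:R) = t + m.+1%:R.
    by rewrite /t -!natr1; ring.
  move: (\prod_(_ < _) _) => P; move: (t + m%:R) (t + m.+1%:R) h1 h2 => v w h1 h2.
  by move: h3; set v' := n%:R + _ => h3; field; rewrite h1 h2 h3.
rewrite (eq_cvg _ _ eQ); apply: cvgM; first exact: IH (ltnW kn).
rewrite -[X in _ --> X]mulr1; apply: cvgM; first exact: cvg_cst.
have -> : (fun N : nat => N.+1%:R / (t + N.+1%:R)) = (fun N => (1 + t * (N.+1%:R)^-1)^-1 :> R).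
  apply/funext => N; have h1 : N.+1%:R != 0 :> R by rewrite pnatr_eq0.
  have h2 : t + N.+1%:R != 0 by rewrite gt_eqF// ltr_wpDr.
  have h3 : 1 + t * (N.+1%:R)^-1 != 0 by rewrite gt_eqF// ltr_wpDr// mulr_ge0// ltW.
  move: (N.+1%:R) h1 h2 h3 => w h1 h2 h3; field; by rewrite h1 addrC h2.
rewrite -[X in _ --> X]invr1; apply: cvgV; first exact: oner_neq0.
rewrite -[X in _ --> X]addr0; apply: cvgD; first exact: cvg_cst.
rewrite -(mulr0 t); apply: cvgM; [exact: cvg_cst|exact: cvg_harmonic].
Qed.

Fixpoint appell n s : {poly R} :=
  if s is a :: s' then appell n s' - a *: (appell n s')^`() else 'X^n.

Lemma appell_altpoly n s :
  appell n s = altpoly n (fun k => esp s k * (n ^_ k)%:R).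
Proof.
elim: s => [|a s IH] /=; apply/polyP => i.
  rewrite coefXn coef_poly; case: (ltngtP i n) => [ni|ni|->].
  - rewrite leqW// subn_eq0 leqNgt ni /= mul0r mulr0//.
  - by rewrite ltnS leqNgt ni.
  - by rewrite ltnSn subnn expr0 ffactn0 !mul1r.
rewrite coefB coefZ coef_deriv IH !coef_poly !ltnS.
case: (ltngtP i n) => [ni|ni|->]; last first.
- by rewrite subnn mul0rn !mulr0 subr0 addr0.
- by rewrite mul0rn mulr0 subr0.
rewrite -[(n - i)%N](@prednK _) ?subn_gt0// -subnS.
rewrite ffactnSr; have -> : (n - (n - i.+1) = i.+1)%N by rewrite subKn.
by rewrite natrM exprS /= -[_ *+ _]mulr_natr; ring.
Qed.

Lemma nnr_appell n s : all (>= 0) s -> nnr n (appell n s).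
Proof.
elim: s => [|a s IH] /=; last by case/andP=> a0 /IH; exact: nnr_sub_deriv.
move=> _; exists (nseq n 0); rewrite size_nseq; split=> //.
  by rewrite all_nseq lexx orbT.
by rewrite /rooted big_nseq subr0 -Monoid.iteropE.
Qed.

End nonneg_rooted.

(** * Coefficient ratios and root means *)

Section ratio.
Variable R : realType.
Implicit Types (s u : seq R) (x y w : R).

(** [bmean] increases with its argument and [bmean u w / w] decreases. This moves a bound at
    [y / g n k] to the limiting point at the cost of a factor tending to 1. *)
Lemma bmean_scale u w w' : all (>= 0) u -> 0 < w -> 0 < w' ->
  bmean u w' <= Num.max 1 (w' / w) * bmean u w.
Proof.
move=> u0 w0 w'0; rewrite /bmean mulr_sumr big_seq [leRHS]big_seq.
apply: ler_sum => x /(allP u0)/= x0.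
have xw : 0 <= x * w by rewrite mulr_ge0// ltW.
have xw' : 0 <= x * w' by rewrite mulr_ge0// ltW.
have p : 0 < 1 + x * w by rewrite ltr_pwDl.
have p' : 0 < 1 + x * w' by rewrite ltr_pwDl.
have [ww'|ww'] := leP w' w.
  apply: (@le_trans _ _ (x * w / (1 + x * w))).
    have xx : x * w' <= x * w by rewrite ler_wpM2l.
    by rewrite ler_pdivrMr// mulrAC ler_pdivlMr//; nra.
  by apply: ler_peMl; [apply: divr_ge0 => //; exact: ltW|rewrite le_max lexx].
apply: (@le_trans _ _ (w' / w * (x * w / (1 + x * w)))).
  have -> : w' / w * (x * w / (1 + x * w)) = x * w' / (1 + x * w).
    by field; rewrite !gt_eqF.
  by rewrite ler_wpM2l// lef_pV2 ?posrE// lerD2l ler_wpM2l// ltW.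
by apply: ler_wpM2r; [apply: divr_ge0 => //; exact: ltW|rewrite le_max lexx orbT].
Qed.

Definition weighted s (g : nat -> R) k := esp s k * \prod_(i < k) g i.

(** [k] is the first index at which [y * esp s k.+1 < esp s k], or [n] if there is none below [n].
    The ratios before and after it give the lower and the upper bounds, hence [g k.-1] in one and
    [g k] in the other; for [k = 0] the lower bounds are trivial. *)
Lemma mode_index s u n (g : nat -> R) y : 0 < y -> all (>= 0) s -> all (>= 0) u ->
  size u = n -> rooted u = altpoly n (weighted s g) ->
  (forall i, (i < n)%N -> 0 < g i) ->
  exists k, [/\ (k <= n)%N, k%:R <= bmean s y + 1, k%:R <= bmean u (y / g k.-1) + 1 &
    k = n \/ bmean s y <= k.+1%:R /\ bmean u (y / g k) <= k.+1%:R].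
Proof.
move=> y0 s0 u0 su e g0.
have eu k : (k <= n)%N -> esp u k = weighted s g k.
  by move=> kn; rewrite rooted_altpoly su in e; exact: (altpoly_inj e kn).
have gP k : (k <= n)%N -> 0 < \prod_(i < k) g i.
  by move=> kn; apply: prodr_gt0 => i _; rewrite g0// (leq_trans _ kn).
pose P k := y * esp s k.+1 < esp s k.
have ePos k : (forall i, (i < k)%N -> ~~ P i) -> 0 < esp s k.
  elim: k => [|k IH] nP; first by rewrite esp0.
  have ek : 0 < esp s k by apply: IH => i ik; apply: nP; exact: ltnW.
  by have := nP k (leqnn _); rewrite -leNgt => /(lt_le_trans ek); rewrite pmulr_rgt0.
have main k : (k <= n)%N -> (forall i, (i < k)%N -> ~~ P i) ->
    k%:R <= bmean s y + 1 /\ k%:R <= bmean u (y / g k.-1) + 1.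
  case: k => [|k] kn nP.
    split; first by rewrite addr_ge0// bmean_ge0// ltW.
    rewrite addr_ge0//; case: (posnP n) => [n0|n0].
      by rewrite n0 in su; rewrite (size0nil su) /bmean big_nil.
    by rewrite bmean_ge0// divr_ge0// ltW// g0.
  have ek : 0 < esp s k by apply: ePos => i ik; apply: nP; exact: ltnW.
  have := nP k (leqnn _); rewrite -leNgt => ek1.
  rewrite -natr1; split; rewrite lerD2r; first exact: le_bmean.
  have gk := g0 k kn.
  apply: le_bmean => //; rewrite ?divr_gt0// !eu ?(ltnW kn)// /weighted ?mulr_gt0 ?gP ?(ltnW kn)//.
  rewrite big_ord_recr/= [X in _ <= X](_ : _ = (y * esp s k.+1) * \prod_(i < k) g i).
    by rewrite ler_pM2r// gP// ltnW.
  by field; rewrite gt_eqF.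
have main2 k : (k < n)%N -> P k -> bmean s y <= k.+1%:R /\ bmean u (y / g k) <= k.+1%:R.
  move=> kn Pk; have gk := g0 k kn.
  split; apply: bmean_le => //; rewrite ?divr_gt0 ?(ltW Pk)//.
  rewrite !eu ?(ltnW kn)// /weighted.
  rewrite big_ord_recr/= [X in X <= _](_ : _ = (y * esp s k.+1) * \prod_(i < k) g i).
    by rewrite ler_pM2r ?ltW// gP// ltnW.
  by field; rewrite gt_eqF.
have [/existsP[k0 Pk0]|/existsPn nP] := boolP [exists k : 'I_n, P k].
  have exP : exists k, P k by exists k0.
  have kmin := ex_minnP exP; case: kmin => k Pk kmin.
  have kn : (k < n)%N := leq_ltn_trans (kmin _ Pk0) (ltn_ord k0).
  have nP i : (i < k)%N -> ~~ P i.
    by move=> ik; apply/negP => /kmin; rewrite leqNgt ik.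
  have [h1 h2] := main k (ltnW kn) nP; exists k; split=> //; first exact: ltnW.
  by right; exact: main2.
have nP' i : (i < n)%N -> ~~ P i by move=> ni; exact: (nP (Ordinal ni)).
by have [h1 h2] := main n (leqnn _) nP'; exists n; split=> //; left.
Qed.

Definition hmean u w := (\sum_(x <- u) (1 + w * x)^-1) / (size u)%:R.

Lemma hmean_bmean u w : (0 < size u)%N -> all (>= 0) u -> 0 < w ->
  hmean u w = 1 - bmean u w / (size u)%:R.
Proof.
move=> su u0 w0; have sn : (size u)%:R != 0 :> R by rewrite pnatr_eq0 -lt0n.
apply: (mulIf sn); rewrite /hmean mulrBl mul1r !divfK//.
have -> : (size u)%:R = \sum_(x <- u) (1 : R).
  by rewrite big_const_seq count_predT iter_addr_0.
rewrite -sumrB big_seq [RHS]big_seq; apply: eq_bigr => x /(allP u0)/= x0.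
have p : 1 + w * x != 0 by rewrite gt_eqF// ltr_pwDl// mulr_ge0// ltW.
by rewrite [x * w]mulrC -{2}(divff p) -mulrBl addrK div1r.
Qed.

Lemma div_natB_le (a b : R) n : a - 1 <= b -> a / n%:R - n%:R^-1 <= b / n%:R.
Proof. by move=> h; rewrite -[X in _ - X]mul1r -mulrBl ler_wpM2r. Qed.

Lemma div_natD_le (a b : R) n : b <= a + 1 -> b / n%:R <= a / n%:R + n%:R^-1.
Proof. by move=> h; rewrite -[X in _ + X]mul1r -mulrDl ler_wpM2r. Qed.

(** The bounds for [s n] squeeze [k n / n] to [M]. Then [g n (k n)] and [g n (k n).-1] both tend to
    [gam], so the bounds for [u n] can be transported to the single point [y / gam]. *)
Lemma hmean_cvg (s u : nat -> seq R) (rho : nat -> R) (lam y M : R) :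
  0 <= lam <= 1 -> 0 < y -> 0 <= M < 1 -> rho @ \oo --> (1 : R) ->
  (forall n, (0 < n)%N -> [/\ all (>= 0) (s n), all (>= 0) (u n), size (u n) = n,
    (forall i, (i < n)%N -> 0 < rho n - lam * i%:R / n%:R) &
    rooted (u n) = altpoly n
      (weighted (s n) (fun i => (1 - i%:R / n%:R) * (rho n - lam * i%:R / n%:R)))]) ->
  (fun n => bmean (s n) y / n%:R) @ \oo --> M ->
  (fun n => hmean (u n) (y / ((1 - M) * (1 - lam * M)))) @ \oo --> 1 - M.
Proof.
move=> /andP[lam0 lam1] y0 /andP[M0 M1] rho1 H sM.
pose g n i : R := (1 - i%:R / n%:R) * (rho n - lam * i%:R / n%:R).
set gam := (1 - M) * (1 - lam * M).
have gam0 : 0 < gam.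
  rewrite mulr_gt0 ?subr_gt0//; apply: le_lt_trans M1; exact: ler_piMl.
have g0 n i : (0 < n)%N -> (i < n)%N -> 0 < g n i.
  move=> n0 ni; have [_ _ _ + _] := H n n0; move=> /(_ i ni) h.
  by rewrite /g mulr_gt0// subr_gt0 ltr_pdivrMr ?ltr0n// mul1r ltr_nat.
have /choice[k kP] : forall n, exists k, (0 < n)%N ->
    [/\ (k <= n)%N, k%:R <= bmean (s n) y + 1, k%:R <= bmean (u n) (y / g n k.-1) + 1 &
    k = n \/ bmean (s n) y <= k.+1%:R /\ bmean (u n) (y / g n k) <= k.+1%:R].
  case=> [|n]; first by exists 0%N.
  have [s0 u0 su gp e] := H n.+1 isT.
  have [k hk] := mode_index y0 s0 u0 su e (fun i => @g0 n.+1 i isT).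
  by exists k.
have invn : (fun n => n%:R^-1 : R) @ \oo --> (0 : R).
  by rewrite -cvg_shiftS; exact: cvg_harmonic.
(* The value [k = n] would give [n <= bmean (s n) y + 1] infinitely often, against [M < 1]. *)
have kn1 : \forall n \near \oo, k n <> n.
  have : (fun n => bmean (s n) y / n%:R + n%:R^-1) @ \oo --> M + 0 by exact: cvgD.
  rewrite addr0 => /cvgr_lt/(_ _ M1) hlt.
  near=> n => kn.
  have n0 : (0 < n)%N by near: n; exact: nbhs_infty_gt.
  have : bmean (s n) y / n%:R + n%:R^-1 < 1 by near: n.
  rewrite -[X in _ + X]mul1r -mulrDl ltr_pdivrMr ?ltr0n// mul1r ltNge.
  by have [_ + _ _] := kP n n0; rewrite kn => ->.
have kM : (fun n => (k n)%:R / n%:R) @ \oo --> M.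
  apply: (@squeeze_cvgr _ _ _ _ (fun n => bmean (s n) y / n%:R - n%:R^-1)
    (fun n => bmean (s n) y / n%:R + n%:R^-1)).
  - near=> n.
    have n0 : (0 < n)%N by near: n; exact: nbhs_infty_gt.
    have nk : k n <> n by near: n.
    have [_ h1 _ [//|[h2 _]]] := kP n n0.
    have ni : 0 < n%:R^-1 :> R by rewrite invr_gt0 ltr0n.
    by rewrite div_natB_le ?div_natD_le// lerBlDr natr1.
  - by rewrite -[X in _ --> X]subr0; apply: cvgB.
  - by rewrite -[X in _ --> X]addr0; apply: cvgD.
have k1M : (fun n => (k n).-1%:R / n%:R) @ \oo --> M.
  apply: (@squeeze_cvgr _ _ _ _ (fun n => (k n)%:R / n%:R - n%:R^-1)
    (fun n => (k n)%:R / n%:R)) => //.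
  - near=> n.
    have n0 : (0 < n)%N by near: n; exact: nbhs_infty_gt.
    have ni : 0 < n%:R^-1 :> R by rewrite invr_gt0 ltr0n.
    rewrite div_natB_le ?ler_pM2r ?ler_nat ?leq_pred// lerBlDr natr1 ler_nat.
    exact: leqSpred.
  - by rewrite -[X in _ --> X]subr0; apply: cvgB.
have gM (j : nat -> nat) : (fun n => (j n)%:R / n%:R : R) @ \oo --> M ->
    (fun n => g n (j n)) @ \oo --> gam.
  move=> jM; apply: cvgM; first by apply: cvgB => //; exact: cvg_cst.
  apply: cvgB => //; under eq_fun do rewrite -mulrA.
  by apply: cvgM => //; exact: cvg_cst.
have max1 (F : nat -> R) : F @ \oo --> (1 : R) -> (fun n => Num.max 1 (F n)) @ \oo --> (1 : R).
  move=> F1; apply: (@squeeze_cvgr _ _ _ _ (fun=> 1) (fun n => 1 + `|F n - 1|)).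
  - apply: nearW => n; rewrite le_max lexx ge_max lerDl normr_ge0/= -lerBlDl.
    exact: ler_norm.
  - exact: cvg_cst.
  - rewrite -[X in _ --> X]addr0 -(normr0 R) -(subrr 1).
    apply: cvgD; first exact: cvg_cst.
    by apply: cvg_norm; apply: cvgB => //; exact: cvg_cst.
have c1 : (fun n => Num.max 1 (gam / g n (k n).-1)) @ \oo --> (1 : R).
  apply: max1; rewrite -(divff (lt0r_neq0 gam0)); apply: cvgM; first exact: cvg_cst.
  by apply: cvgV (gM _ k1M); rewrite gt_eqF.
have c2 : (fun n => Num.max 1 (g n (k n) / gam)) @ \oo --> (1 : R).
  apply: max1; rewrite -(divff (lt0r_neq0 gam0)); apply: cvgM; last exact: cvg_cst.
  exact: gM.
have key : (fun n => bmean (u n) (y / gam) / n%:R) @ \oo --> M.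
  apply: (@squeeze_cvgr _ _ _ _
      (fun n => ((k n)%:R / n%:R - n%:R^-1) / Num.max 1 (gam / g n (k n).-1))
      (fun n => Num.max 1 (g n (k n) / gam) * ((k n)%:R / n%:R + n%:R^-1))).
  - near=> n.
    have n0 : (0 < n)%N by near: n; exact: nbhs_infty_gt.
    have nk : k n <> n by near: n.
    have ni : 0 < n%:R^-1 :> R by rewrite invr_gt0 ltr0n.
    have [kn h1 h2 [//|[h3 h4]]] := kP n n0.
    have [s0 u0 su _ _] := H n n0.
    have gk : 0 < g n (k n) by apply: g0 => //; rewrite ltn_neqAle kn andbT; apply/eqP.
    have gk1 : 0 < g n (k n).-1.
      by apply: g0 => //; move: nk kn; case: (k n) => //= j _; exact.
    have max0 (t : R) : 0 < Num.max 1 t by rewrite lt_max ltr01.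
    apply/andP; split.
      rewrite ler_pdivrMr// -[X in _ - X]mul1r -mulrBl mulrAC ler_pM2r// lerBlDr.
      apply: (le_trans h2); rewrite lerD2r [leRHS]mulrC.
      have -> : gam / g n (k n).-1 = (y / g n (k n).-1) / (y / gam).
        by field; rewrite !gt_eqF.
      by apply: bmean_scale; rewrite ?divr_gt0.
    rewrite -[X in _ + X]mul1r -mulrDl natr1 mulrA ler_pM2r//.
    have -> : g n (k n) / gam = (y / gam) / (y / g n (k n)).
      by field; rewrite !gt_eqF.
    apply: le_trans (ler_wpM2l (ltW (max0 _)) h4).
    by apply: bmean_scale; rewrite ?divr_gt0.
  - rewrite -[X in _ --> X]divr1; apply: cvgM; last by apply: cvgV => //; exact: oner_neq0.
    by rewrite -[X in _ --> X]subr0; apply: cvgB.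
  - rewrite -[X in _ --> X]mul1r; apply: cvgM => //.
    by rewrite -[X in _ --> X]addr0; apply: cvgD.
have : (fun n => 1 - bmean (u n) (y / gam) / n%:R) @ \oo --> 1 - M.
  by apply: cvgB => //; exact: cvg_cst.
apply: cvg_trans; apply: near_eq_cvg; near=> n.
have n0 : (0 < n)%N by near: n; exact: nbhs_infty_gt.
have [s0 u0 su _ _] := H n n0.
by rewrite hmean_bmean ?su// divr_gt0.
Unshelve. all: by end_near. Qed.

End ratio.

(** * Convergence of means on the unit interval *)

Section weierstrass.
Variable R : realType.

Lemma continuous_itv01_bounded (f : R -> R) : continuous f ->
  exists2 B, 0 <= B & forall x, 0 <= x <= 1 -> `|f x| <= B.
Proof.
move=> cf; have cn : {within `[0, 1], continuous (fun x => `|f x|)}.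
  by apply: continuous_subspaceT => x; apply: cvg_norm; exact: cf.
have [c _ hc] := EVT_max ler01 cn.
by exists `|f c| => // x x01; apply: hc; rewrite in_itv.
Qed.

(** The modulus is quadratic because the second moment of the binomial law is explicit. If no [K]
    works, the violating pairs come together and cluster at a point where continuity fails. *)
Lemma modulus_itv01 (f : R -> R) (e : R) : continuous f -> 0 < e ->
  exists2 K, 0 <= K & forall x y, 0 <= x <= 1 -> 0 <= y <= 1 ->
    `|f x - f y| <= e + K * (x - y) ^+ 2.
Proof.
move=> cf e0; have [B B0 fB] := continuous_itv01_bounded cf.
apply: contrapT => nK.
have /choice[z zP] : forall n : nat, exists z : R * R, [/\ 0 <= z.1 <= 1, 0 <= z.2 <= 1 &
    e + n%:R * (z.1 - z.2) ^+ 2 < `|f z.1 - f z.2| ].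
  move=> n; apply: contrapT => nz; apply: nK; exists n%:R => // x y x01 y01.
  by rewrite leNgt; apply/negP => h; apply: nz; exists (x, y).
have [p [p01 clp]] : `[0, 1]%classic `&` cluster ((fun n => (z n).1) @ \oo) !=set0.
  have FP : ProperFilter ((fun n => (z n).1) @ \oo) by exact: fmap_proper_filter.
  apply: (@segment_compact R 0 1 _ FP); exists 0%N => // n _ /=.
  by rewrite in_itv/=; have [] := zP n.
have e4 : 0 < e / 2 by rewrite divr_gt0.
have /cvgrPdist_lt/(_ _ e4)/nbhs_ballP[r /= r0 hr] := cf p.
have r2 : 0 < r / 2 by rewrite divr_gt0.
(* The excess [n * (z.1 - z.2) ^+ 2] is at most twice the bound [B] of [f], so the two members of a
   pair approach each other. *)
have far : \forall n \near \oo, `|(z n).1 - (z n).2| < r / 2.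
  have : \forall n \near \oo, 2 * B / (r / 2) ^+ 2 < n%:R by exact: nbhs_infty_gtr.
  apply: filterS => n; rewrite ltr_pdivrMr ?exprn_gt0// => hn.
  have [z1 z2 h] := zP n; rewrite ltNge; apply/negP => hz.
  have : (r / 2) ^+ 2 <= ((z n).1 - (z n).2) ^+ 2.
    by rewrite -[leRHS]real_normK ?num_real// lerXn2r ?nnegrE// ltW.
  move=> /(ler_wpM2l (ler0n R n)).
  have : `|f (z n).1 - f (z n).2| <= 2 * B.
    by apply: (le_trans (ler_normB _ _)); have := fB _ z1; have := fB _ z2; lra.
  by lra.
have : exists n, `|(z n).1 - (z n).2| < r / 2 /\ `|p - (z n).1| < r / 2.
  have nb : nbhs p (ball p (r / 2)) by apply: nbhsx_ballx.
  have im : ((fun n => (z n).1) @ \oo) [set x | exists n, x = (z n).1 /\ `|(z n).1 - (z n).2| < r / 2].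
    by apply: filterS far => n hn; exists n.
  by have [_ [[n [-> h]] hb]] := clp _ _ im nb; exists n.
case=> n [h1 h2]; have [z1 z2 h] := zP n.
have g1 : `|f p - f (z n).1| < e / 2.
  by apply: hr; rewrite /ball/=; apply: lt_trans h2 _; rewrite ltr_pdivrMr//; lra.
have g2 : `|f p - f (z n).2| < e / 2.
  apply: hr; rewrite /ball/=.
  rewrite -(subrKA (z n).1); apply: (le_lt_trans (ler_normD _ _)).
  by rewrite [ltRHS](splitr r) ltrD.
have : `|f (z n).1 - f (z n).2| < e.
  rewrite -(subrKA (f p)) (le_lt_trans (ler_normD _ _))// [ltRHS](splitr e) ltrD//.
  by rewrite distrC.
have := mulr_ge0 (ler0n R n) (sqr_ge0 ((z n).1 - (z n).2)).
by lra.
Qed.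

(** The Bernstein polynomial as an expectation over [n] tosses with bias [x], conditioned on one
    toss at a time; positivity and moments then follow by induction without binomial
    coefficients. *)
Fixpoint bernstein n (f : nat -> R) : {poly R} :=
  if n is m.+1 then
    (1 - 'X) * bernstein m f + 'X * bernstein m (fun k => f k.+1)
  else (f 0%N)%:P.

Lemma bernsteinS n f x : (bernstein n.+1 f).[x] =
  (1 - x) * (bernstein n f).[x] + x * (bernstein n (fun k => f k.+1)).[x].
Proof. by rewrite /= hornerD !hornerM hornerD hornerN hornerX hornerC. Qed.

Lemma bernstein_le n f g x : 0 <= x <= 1 -> (forall k, (k <= n)%N -> f k <= g k) ->
  (bernstein n f).[x] <= (bernstein n g).[x].
Proof.
move=> /andP[x0 x1]; elim: n f g => [|n IH] f g fg; first by rewrite !hornerC fg.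
by rewrite !bernsteinS lerD// ler_wpM2l ?subr_ge0// IH// => k kn; rewrite fg// ltnW.
Qed.

Lemma bernsteinD n f g a x : (bernstein n (fun k => a * f k + g k)).[x] =
  a * (bernstein n f).[x] + (bernstein n g).[x].
Proof.
elim: n f g => [|n IH] f g; first by rewrite /= !hornerC.
by rewrite !bernsteinS !IH; ring.
Qed.

Lemma bernstein_cst n c x : (bernstein n (fun=> c)).[x] = c.
Proof. by elim: n => [|n IH]; rewrite ?hornerC// bernsteinS IH; ring. Qed.

(** Second moment of the binomial law about [c]: its variance plus the squared bias. *)
Lemma bernstein_var n c x : (bernstein n (fun k => (k%:R - c) ^+ 2)).[x] =
  n%:R * x * (1 - x) + (n%:R * x - c) ^+ 2.
Proof.
elim: n c => [|n IH] c; first by rewrite /= hornerC; ring.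
rewrite bernsteinS IH.
have -> : (fun k => (k.+1%:R - c) ^+ 2) = (fun k => (k%:R - (c - 1)) ^+ 2 :> R).
  by apply/funext => k; rewrite -natr1; ring.
by rewrite IH -natr1; ring.
Qed.

(** Bernstein's proof: the quadratic modulus of [f] is integrated against the binomial law, whose
    variance contributes [K * x * (1 - x) / n], at most [e / 2]. *)
Lemma weierstrass_itv01 (f : R -> R) (e : R) : continuous f -> 0 < e ->
  exists p : {poly R}, forall x, 0 <= x <= 1 -> `|f x - p.[x]| <= e.
Proof.
move=> cf e0; have e2 : 0 < e / 2 by rewrite divr_gt0.
have [K K0 hK] := modulus_itv01 cf e2.
have [n0 hn0] := filter_ex (nbhs_infty_gtr (K / (e / 2))).
pose n := n0.+1; have nn0 : 0 < n%:R :> R by rewrite ltr0n.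
have hn : K / n%:R <= e / 2.
  rewrite ler_pdivrMr// mulrC -ler_pdivrMr//; apply: (le_trans (ltW hn0)).
  by rewrite ler_nat.
exists (bernstein n (fun k => f (k%:R / n%:R))) => x /[dup] x01 /andP[x0 x1].
have kn01 k : (k <= n)%N -> 0 <= (k%:R / n%:R : R) <= 1.
  by move=> kn; rewrite divr_ge0//= ler_pdivrMr// mul1r ler_nat.
have e1 k : K * (x - k%:R / n%:R) ^+ 2 = K / n%:R ^+ 2 * (k%:R - n%:R * x) ^+ 2.
  by field; rewrite gt_eqF.
have v : K / n%:R ^+ 2 * (n%:R * x * (1 - x) + (n%:R * x - n%:R * x) ^+ 2) <= e / 2.
  apply: le_trans hn; rewrite subrr expr0n addr0.
  have -> : K / n%:R ^+ 2 * (n%:R * x * (1 - x)) = K / n%:R * (x * (1 - x)).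
    by field; rewrite gt_eqF.
  by rewrite ler_piMr ?divr_ge0//; nra.
rewrite ler_norml; apply/andP; split.
  have : (bernstein n (fun k => f (k%:R / n%:R))).[x] <=
      (bernstein n (fun k => K / n%:R ^+ 2 * (k%:R - n%:R * x) ^+ 2 + (f x + e / 2))).[x].
    apply: bernstein_le => // k kn; rewrite -e1.
    by have := hK x _ x01 (kn01 k kn); rewrite ler_norml; lra.
  by rewrite bernsteinD bernstein_var bernstein_cst; lra.
have : (bernstein n (fun k => - (K / n%:R ^+ 2) * (k%:R - n%:R * x) ^+ 2 + (f x - e / 2))).[x]
    <= (bernstein n (fun k => f (k%:R / n%:R))).[x].
  apply: bernstein_le => // k kn; rewrite mulNr -e1.
  by have := hK x _ x01 (kn01 k kn); rewrite ler_norml; lra.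
by rewrite bernsteinD bernstein_var bernstein_cst; lra.
Qed.

End weierstrass.

Section moments.
Variable R : realType.

(** Integration against a probability on [[0, 1]], reduced to what the approximation argument uses;
    averages over lists and integrals are thus handled together. *)
Record mean01 (E : (R -> R) -> R) : Prop := Mean01 {
  mean01_lin : forall (a : R) (f g : R -> R), continuous f -> continuous g ->
    E (fun v => a * f v + g v) = a * E f + E g ;
  mean01_norm : forall (f : R -> R) (C : R), continuous f ->
    (forall v, 0 <= v <= 1 -> `|f v| <= C) -> `|E f| <= C ;
  mean01_cst : E (fun=> 1) = 1 }.

Lemma mean01_sum E (I : Type) (r : seq I) (f : I -> R -> R) (a : I -> R) :
  mean01 E -> (forall i, continuous (f i)) ->
  E (fun v => \sum_(i <- r) a i * f i v) = \sum_(i <- r) a i * E (f i).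
Proof.
move=> mE cf; have cs (s : seq I) : continuous (fun v => \sum_(i <- s) a i * f i v).
  move=> v; apply: (@cvg_bigsum R _ _ (nbhs v) _ s (fun v i => a i * f i v)) => i.
  by apply: cvgM; [exact: cvg_cst|exact: cf].
elim: r => [|i r IH].
  rewrite big_nil; under eq_fun do rewrite big_nil.
  apply/eqP; rewrite -normr_le0; apply: (mean01_norm mE) => [v|v _]; first exact: cvg_cst.
  by rewrite normr0.
rewrite big_cons -IH; under eq_fun do rewrite big_cons.
by rewrite (mean01_lin mE)//; exact: cf.
Qed.

(** Retraction onto [[0, 1]], so that the kernels below are continuous on the whole line. *)
Definition clamp (v : R) := Num.min 1 (Num.max 0 v).

Lemma continuous_clamp : continuous clamp.
Proof.
move=> v; have h1 (c : R) : {for v, continuous (fun=> c : R)} by exact: cvg_cst.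
have h : {for v, continuous ((fun=> 0 : R) \max id)}.
  by apply: (@continuous_max R R _ id v) => //; exact: cvg_id.
exact: (@continuous_min R R _ _ v (h1 1) h).
Qed.

Lemma clamp01 v : 0 <= clamp v <= 1.
Proof. by rewrite /clamp le_min ler01 le_max lexx ge_min lexx. Qed.

Lemma clampE v : 0 <= v <= 1 -> clamp v = v.
Proof. by move=> /andP[v0 v1]; rewrite /clamp (max_idPr v0) (min_idPr v1). Qed.

(* With [v = (1 + w x)^-1] this is [(1 + t w x)^-1]. *)
Definition stker (t v : R) := clamp v / (clamp v + t * (1 - clamp v)).

Lemma stker_den t v : 0 < t <= 1 -> 0 < clamp v + t * (1 - clamp v).
Proof.
move=> /andP[t0 t1]; have /andP[c0 c1] := clamp01 v.
have [c|c] := ltP 0 (clamp v).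
  by rewrite ltr_pwDl// mulr_ge0 ?subr_ge0// ltW.
have -> : clamp v = 0 by apply/le_anti; rewrite c c0.
by rewrite add0r subr0 mulr1.
Qed.

Lemma continuous_stker t : 0 < t <= 1 -> continuous (stker t).
Proof.
move=> t01 v; apply: cvgM; first exact: continuous_clamp.
apply: cvgV; first by rewrite gt_eqF// stker_den.
apply: cvgD; first exact: continuous_clamp.
apply: cvgM; first exact: cvg_cst.
by apply: cvgB; [exact: cvg_cst|exact: continuous_clamp].
Qed.

Lemma stker01 t v : 0 < t <= 1 -> 0 <= stker t v <= 1.
Proof.
move=> /[dup] t01 /andP[t0 t1]; have /andP[c0 c1] := clamp01 v.
rewrite divr_ge0//=; last exact: ltW (stker_den v t01).
by rewrite ler_pdivrMr ?stker_den// mul1r lerDl mulr_ge0 ?subr_ge0// ltW.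
Qed.

(** The coefficient of [e ^+ k] in the expansion of [stker (1 - e)]. *)
Definition mono (k : nat) (v : R) := clamp v * (1 - clamp v) ^+ k.

Lemma continuous_clamp_pow k : continuous (fun v => (1 - clamp v) ^+ k).
Proof.
move=> v; apply: (@continuous_comp _ _ _ (fun v => 1 - clamp v) (fun x => x ^+ k)).
  by apply: cvgB; [exact: cvg_cst|exact: continuous_clamp].
exact: exprn_continuous.
Qed.

Lemma continuous_mono k : continuous (mono k).
Proof.
move=> v; apply: cvgM; [exact: continuous_clamp|exact: continuous_clamp_pow].
Qed.

(** On [[0, 1]] the denominator is [1 - e * (1 - v)]: a geometric series, with remainder
    [(e * (1 - v)) ^+ K * stker (1 - e) v]. *)
Lemma stker_expand e K v : 0 <= e < 1 ->
  `|stker (1 - e) v - \sum_(k < K) e ^+ k * mono k v| <= e ^+ K.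
Proof.
move=> /andP[e0 e1].
have t01 : 0 < 1 - e <= 1 by rewrite subr_gt0 e1 gerBl.
have -> : stker (1 - e) v - \sum_(k < K) e ^+ k * mono k v =
    (e * (1 - clamp v)) ^+ K * stker (1 - e) v.
  have h : clamp v + (1 - e) * (1 - clamp v) != 0 by rewrite gt_eqF// stker_den.
  apply/eqP; rewrite subr_eq [X in _ == X]addrC; apply/eqP.
  elim: K => [|K IH]; first by rewrite big_ord0 expr0 mul1r add0r.
  rewrite big_ord_recr/= {1}IH -addrA; congr (_ + _).
  by rewrite exprS /mono exprMn /stker; field; exact: h.
have /andP[s0 s1] := stker01 v t01; have /andP[c0 c1] := clamp01 v.
have ec0 : 0 <= e * (1 - clamp v) by rewrite mulr_ge0 ?subr_ge0.
rewrite ger0_norm; last by apply: mulr_ge0 => //; exact: exprn_ge0.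
apply: (@le_trans _ _ ((e * (1 - clamp v)) ^+ K)); first by rewrite ler_piMr ?exprn_ge0.
by rewrite lerXn2r ?nnegrE// ler_piMr// gerBl.
Qed.

Context {T : Type} {F : set_system T} {FF : Filter F}.
Variables (E E' : T -> (R -> R) -> R).
Hypotheses (mE : forall i, mean01 (E i)) (mE' : forall i, mean01 (E' i)).

(** Coefficient extraction: once the lower coefficients are known to converge, [e ^+ k] times the
    [k]-th one differs from a null sequence by at most [2 * e ^+ k.+1]. The limit is taken at fixed
    [e], and only then is the result divided by [e ^+ k]. *)
Lemma mean01_mono (t0 : R) : t0 < 1 ->
  (forall t, t0 < t <= 1 -> 0 < t -> (fun i => E i (stker t) - E' i (stker t)) @ F --> (0 : R)) ->
  forall k, (fun i => E i (mono k) - E' i (mono k)) @ F --> (0 : R).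
Proof.
move=> t01 H; elim/ltn_ind => k IH.
apply/cvgrPdist_le => eta eta0.
(* The first bound keeps [1 - e] above [t0], the second keeps it positive, the third makes the two
   remainders cost at most [eta / 4]. *)
pose e := Num.min ((1 - t0) / 2) (Num.min (2^-1) (eta / 8)).
have e0 : 0 < e by rewrite /e !lt_min !divr_gt0// ?subr_gt0// invr_gt0 ltr0n.
have et0 : e <= (1 - t0) / 2 by rewrite ge_min lexx.
have e2 : e <= 2^-1 by rewrite /e !ge_min lexx/= orbT.
have e8 : e <= eta / 8 by rewrite /e !ge_min lexx !orbT.
have ek : 0 < e ^+ k by rewrite exprn_gt0.
pose D i f := E i f - E' i f.
have h1 : (fun i => D i (stker (1 - e)) - \sum_(j < k) e ^+ j * D i (mono j)) @ F --> (0 : R).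
  rewrite -[X in _ --> X]subr0; apply: cvgB; first by apply: H; lra.
  have hs : (fun i => \sum_(j < k) e ^+ j * D i (mono j)) @ F --> \sum_(j < k) e ^+ j * (0 : R).
    by apply: cvg_bigsum => j; apply: cvgM; [exact: cvg_cst|exact: IH].
  by move: hs; rewrite big1// => j _; rewrite mulr0.
have eta2 : 0 < e ^+ k * (eta / 2) by rewrite mulr_gt0 ?divr_gt0.
have /cvgrPdist_le/(_ _ eta2) := h1; apply: filterS => i; rewrite !sub0r !normrN => hi.
have key E0 : mean01 E0 ->
    `|E0 (stker (1 - e)) - \sum_(j < k.+1) e ^+ j * E0 (mono j)| <= e ^+ k.+1.
  move=> m0; rewrite -(mean01_sum _ _ m0); last exact: continuous_mono.
  have ct : continuous (stker (1 - e)) by apply: continuous_stker; lra.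
  have cs : continuous (fun v => \sum_(j < k.+1) e ^+ j * mono j v).
    move=> v; apply: (@cvg_bigsum R _ _ (nbhs v) _ _ (fun v (j : 'I_k.+1) => e ^+ j * mono j v)) => j.
    by apply: cvgM; [exact: cvg_cst|exact: continuous_mono].
  rewrite addrC -mulN1r -(mean01_lin m0)//; apply: (mean01_norm m0).
    by move=> v; apply: cvgD; [apply: cvgM; [exact: cvg_cst|exact: cs]|exact: ct].
  by move=> v _; rewrite mulN1r addrC; apply: stker_expand; lra.
have k1 := key _ (mE i); have k2 := key _ (mE' i).
have hk : e ^+ k * `|D i (mono k)| <= e ^+ k * eta.
  rewrite -{1}(gtr0_norm ek) -normrM.
  have -> : e ^+ k * D i (mono k) =
     (D i (stker (1 - e)) - \sum_(j < k) e ^+ j * D i (mono j))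
     - (E i (stker (1 - e)) - \sum_(j < k.+1) e ^+ j * E i (mono j))
     + (E' i (stker (1 - e)) - \sum_(j < k.+1) e ^+ j * E' i (mono j)).
    rewrite !big_ord_recr/= /D.
    under eq_bigr do rewrite mulrBr.
    by rewrite sumrB; ring.
  apply: (le_trans (ler_normD _ _)).
  apply: (le_trans (lerD (ler_normB _ _) (lexx _))).
  apply: (le_trans (lerD (lerD hi k1) k2)).
  rewrite exprS; have -> : e ^+ k * (eta / 2) + e * e ^+ k + e * e ^+ k =
    e ^+ k * (eta / 2 + 2 * e) by ring.
  by rewrite ler_pM2l//; lra.
by rewrite ler_pM2l in hk.
Qed.

(** Since [mono k] is the difference of the powers [k] and [k + 1] of [1 - v], all powers follow
    from the constant 1, and Weierstrass gives every continuous function. Two families and an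
    arbitrary filter are allowed in order to cover Cauchy sequences as well as convergence to a
    given measure. *)
Lemma mean01_cvg (t0 : R) : t0 < 1 ->
  (forall t, t0 < t <= 1 -> 0 < t -> (fun i => E i (stker t) - E' i (stker t)) @ F --> (0 : R)) ->
  forall f : R -> R, continuous f -> (fun i => E i f - E' i f) @ F --> (0 : R).
Proof.
move=> t01 H f cf; have Hm := mean01_mono t01 H.
pose pw k (v : R) := (1 - clamp v) ^+ k.
have cpw k : continuous (pw k).
  exact: continuous_clamp_pow.
have Hp k : (fun i => E i (pw k) - E' i (pw k)) @ F --> (0 : R).
  elim: k => [|k IH].
    have -> : pw 0%N = (fun=> 1) by apply/funext => v; rewrite /pw expr0.
    under eq_fun do rewrite (mean01_cst (mE _)) (mean01_cst (mE' _)) subrr.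
    exact: cvg_cst.
  have -> : pw k.+1 = (fun v => -1 * mono k v + pw k v).
    by apply/funext => v; rewrite /pw /mono exprS; ring.
  under eq_fun do rewrite (mean01_lin (mE _) _ (@continuous_mono k) (cpw k))
     (mean01_lin (mE' _) _ (@continuous_mono k) (cpw k)).
  have -> : (fun i => -1 * E i (mono k) + E i (pw k) - (-1 * E' i (mono k) + E' i (pw k))) =
    (fun i => (E i (pw k) - E' i (pw k)) - (E i (mono k) - E' i (mono k))).
    by apply/funext => i; ring.
  have h := @cvgB _ _ _ F FF _ _ _ _ IH (Hm k); rewrite subr0 in h; exact: h.
apply/cvgrPdist_le => eta eta0.
have eta4 : 0 < eta / 4 by rewrite divr_gt0.
have cf' : continuous (fun r : R => f (1 - r)).
  move=> r; apply: (@continuous_comp R R R (fun r : R => 1 - r) f); last exact: cf.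
  by apply: cvgB; [exact: cvg_cst|exact: cvg_id].
have [p hp] := weierstrass_itv01 cf' eta4.
pose q v := \sum_(k < size p) p`_k * pw k v.
have cq : continuous q.
  move=> v; apply: (@cvg_bigsum R _ _ (nbhs v) _ _ (fun v (j : 'I_(size p)) => p`_j * pw j v)) => j.
  by apply: cvgM; [exact: cvg_cst|exact: cpw].
have fq v : 0 <= v <= 1 -> `|f v - q v| <= eta / 4.
  move=> v01; have -> : q v = p.[1 - v].
    by rewrite horner_coef; apply: eq_bigr => k _; rewrite /pw clampE.
  have := hp (1 - v); rewrite subKr; apply.
  by case/andP: v01 => ? ?; lra.
have Hq : (fun i => E i q - E' i q) @ F --> (0 : R).
  have -> : (fun i => E i q - E' i q) =
      (fun i => \sum_(k < size p) p`_k * (E i (pw k) - E' i (pw k))).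
    apply/funext => i; rewrite !(mean01_sum _ (fun k : 'I_(size p) => p`_k))//.
    by rewrite -sumrB; apply: eq_bigr => k _; rewrite mulrBr.
  have hs : (fun i => \sum_(k < size p) p`_k * (E i (pw k) - E' i (pw k))) @ F -->
      \sum_(k < size p) p`_k * (0 : R).
    by apply: cvg_bigsum => j; apply: cvgM; [exact: cvg_cst|exact: Hp].
  by move: hs; rewrite big1// => j _; rewrite mulr0.
have eta2 : 0 < eta / 2 by rewrite divr_gt0.
have /cvgrPdist_le/(_ _ eta2) := Hq; apply: filterS => i; rewrite !sub0r !normrN => hi.
have key E0 : mean01 E0 -> `|E0 f - E0 q| <= eta / 4.
  move=> m0; rewrite addrC -mulN1r -(mean01_lin m0)//; apply: (mean01_norm m0).
    by move=> v; apply: cvgD; [apply: cvgM; [exact: cvg_cst|exact: cq]|exact: cf].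
  by move=> v /fq; rewrite mulN1r addrC.
have := key _ (mE i); have := key _ (mE' i); move: hi.
by rewrite !ler_norml => /andP[? ?] /andP[? ?] /andP[? ?]; apply/andP; split; lra.
Qed.

End moments.

(** * Weak convergence of root lists *)

Section bounded_integrals.
Context d (T : measurableType d) (R : realType).
Variable P : {finite_measure set T -> \bar R}.
Implicit Types f g : T -> R.

Lemma integrable_bounded f C : measurable_fun setT f -> (forall x, `|f x| <= C) ->
  P.-integrable setT (EFin \o f).
Proof.
move=> mf fC; apply: measurable_bounded_integrable => //.
  exact: fin_num_fun_lty (fin_num_measure P).
exists C; split; first exact: num_real.
by move=> M CM x _; exact: le_trans (fC x) (ltW CM).
Qed.

Lemma cvg_Rintegral_bounded (f_ : nat -> T -> R) f C :
  (forall n, measurable_fun setT (f_ n)) -> measurable_fun setT f ->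
  (forall n x, `|f_ n x| <= C) ->
  {ae P, forall x, (fun n => f_ n x) @ \oo --> f x} ->
  (fun n => \int[P]_x f_ n x) @ \oo --> \int[P]_x f x.
Proof.
move=> mf_ mf fC ff.
have iC : P.-integrable setT (EFin \o (fun=> C)).
  by apply: (@integrable_bounded _ `|C|) => //; exact: measurable_cst.
have [] := @dominated_convergence _ _ _ P setT measurableT
  (fun n => EFin \o f_ n) (EFin \o f) (EFin \o (fun=> C)).
- by move=> n; exact/measurable_EFinP.
- exact/measurable_EFinP.
- by apply: filterS ff => x h _; apply: cvg_EFin => //; exact: nearW.
- exact: iC.
- by apply: aeW => x n _ /=; rewrite lee_fin.
move=> ifin _ h; rewrite /Rintegral.
by apply: fine_cvg; rewrite fineK//; exact: integrable_fin_num.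
Qed.

Lemma Rintegral_bigsum (I : Type) (r : seq I) (f : I -> T -> R) :
  (forall i, P.-integrable setT (EFin \o f i)) ->
  \int[P]_x (\sum_(i <- r) f i x) = \sum_(i <- r) \int[P]_x f i x.
Proof.
move=> fi.
have fs (s : seq I) : P.-integrable setT (EFin \o (fun x => \sum_(i <- s) f i x)).
  rewrite (_ : _ \o _ = (fun x => \sum_(i <- s) (f i x)%:E)%E).
    by apply: integrable_sum => // i _; exact: fi.
  by apply/funext => x /=; rewrite sumEFin.
elim: r => [|i r IH].
  by rewrite big_nil; under eq_Rintegral do rewrite big_nil; rewrite Rintegral_cst// mul0r.
rewrite big_cons -IH -RintegralD//.
by apply: eq_Rintegral => x _; rewrite big_cons.
Qed.

Lemma Rintegral_indic (A : set T) : measurable A -> \int[P]_x \1_A x = fine (P A).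
Proof. by move=> mA; rewrite /Rintegral integral_indic// setIT. Qed.

Lemma normr_Rintegral_le f C : measurable_fun setT f -> (forall x, `|f x| <= C) ->
  `|\int[P]_x f x| <= C * fine (P setT).
Proof.
move=> mf fC; have i := integrable_bounded mf fC.
apply: (le_trans (le_normr_Rintegral measurableT i)).
rewrite -Rintegral_cst//; apply: le_Rintegral => //.
- apply: (@integrable_bounded _ C); last by move=> x; rewrite normr_id.
  exact: measurableT_comp.
- by apply: (@integrable_bounded _ `|C|) => //; exact: measurable_cst.
Qed.

End bounded_integrals.

Section mean01_measure.
Context d (T : measurableType d) (R : realType).
Variable P : probability T R.

Lemma mean01_measure (V : T -> R) : measurable_fun setT V -> (forall x, 0 <= V x <= 1) ->
  mean01 (fun f => \int[P]_x f (V x)).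
Proof.
move=> mV V01.
have mfV (f : R -> R) : continuous f -> measurable_fun setT (fun x => f (V x)).
  by move=> cf; apply: measurableT_comp => //; exact: continuous_measurable_fun.
have ifV (f : R -> R) : continuous f -> P.-integrable setT (EFin \o (fun x => f (V x))).
  move=> cf; have [B _ hB] := continuous_itv01_bounded cf.
  by apply: (@integrable_bounded _ _ _ P _ B) => [|x]; [exact: mfV|exact: hB].
split.
- move=> a f g cf cg.
  rewrite -RintegralZl//; last exact: ifV.
  rewrite -RintegralD//; last exact: ifV.
  by apply: (@ifV (fun v => a * f v)) => v; apply: cvgM; [exact: cvg_cst|exact: cf].
- move=> f C cf fC.
  rewrite -[C]mulr1; have -> : 1 = fine (P [set: T]) :> R by rewrite probability_setT.
  by apply: (@normr_Rintegral_le _ _ _ P) => [|x]; [exact: mfV|exact: fC].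
- by rewrite Rintegral_cst// mul1r; exact: (congr1 fine (probability_setT P)).
Qed.

End mean01_measure.

Section averages.
Variable R : realType.
Implicit Types (u : seq R) (g : R -> R).

Definition avg u g := (\sum_(x <- u) g x) / (size u)%:R.

Lemma mean01_avg u (V : R -> R) : (0 < size u)%N ->
  (forall x, x \in u -> 0 <= V x <= 1) ->
  mean01 (fun f => avg u (fun x => f (V x))).
Proof.
move=> su V01; have s0 : 0 < (size u)%:R :> R by rewrite ltr0n.
split.
- by move=> a f g _ _; rewrite /avg big_split/= -mulr_sumr; ring.
- move=> f C _ fC; rewrite /avg normrM normfV normr_nat ler_pdivrMr//.
  apply: (le_trans (ler_norm_sum _ _ _)).
  have -> : C * (size u)%:R = \sum_(x <- u) C.
    by rewrite big_const_seq count_predT iter_addr_0 mulr_natr.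
  by rewrite big_seq [leRHS]big_seq; apply: ler_sum => x /V01; exact: fC.
- by rewrite /avg big_const_seq count_predT iter_addr_0 divff// gt_eqF.
Qed.

Definition pos (x : R) := Num.max 0 x.

Lemma pos_ge0 x : 0 <= pos x. Proof. by rewrite le_max lexx. Qed.
Lemma posE x : 0 <= x -> pos x = x. Proof. by move=> x0; apply: max_idPr. Qed.
Lemma continuous_pos : continuous pos.
Proof.
move=> v; apply: (@continuous_max R R _ id v) => //; exact: cvg_cst.
Qed.

(* [cpt w] compactifies the half-line: [0 <= x <= +oo] becomes [1 >= v >= 0] *)
Definition cpt (w x : R) := (1 + w * pos x)^-1.

Lemma cpt_den w x : 0 <= w -> 0 < 1 + w * pos x.
Proof. by move=> w0; rewrite ltr_pwDl// mulr_ge0// pos_ge0. Qed.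

Lemma cpt_gt0 w x : 0 <= w -> 0 < cpt w x.
Proof. by move=> w0; rewrite invr_gt0 cpt_den. Qed.

Lemma cpt01 w x : 0 <= w -> 0 <= cpt w x <= 1.
Proof.
move=> w0; rewrite ltW ?cpt_gt0//= invf_le1 ?cpt_den//.
by rewrite lerDl mulr_ge0// pos_ge0.
Qed.

Lemma continuous_cpt w : 0 <= w -> continuous (cpt w).
Proof.
move=> w0 v; apply: cvgV; first by rewrite gt_eqF// cpt_den.
apply: cvgD; first exact: cvg_cst.
by apply: cvgM; [exact: cvg_cst|exact: continuous_pos].
Qed.

Lemma stker_cpt t w x : 0 < t -> 0 <= w -> stker t (cpt w x) = cpt (t * w) x.
Proof.
move=> t0 w0; rewrite /stker clampE ?cpt01// /cpt.
have h1 := cpt_den x w0; have h2 := @cpt_den (t * w) x (mulr_ge0 (ltW t0) w0).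
have e : (1 + w * pos x)^-1 + t * (1 - (1 + w * pos x)^-1) =
   (1 + t * w * pos x) / (1 + w * pos x) by field; rewrite gt_eqF.
by rewrite e invf_div; field; rewrite !gt_eqF.
Qed.

Lemma avg_cpt u w : all (>= 0) u -> avg u (cpt w) = hmean u w.
Proof.
move=> u0; rewrite /avg /hmean; congr (_ / _).
by rewrite big_seq [RHS]big_seq; apply: eq_bigr => x /(allP u0) x0; rewrite /cpt posE.
Qed.

End averages.

Section nneg_supported.
Variable R : realType.
Variable mu : {measure set (measurableTypeR R) -> \bar R}.
Hypothesis mu0 : nneg_supported mu.

Lemma nneg_supported_ae : {ae mu, forall x : R, 0 <= x}.
Proof.
exists [set x : R | x < 0]; split => //.
  rewrite [X in measurable X](_ : _ = `]-oo, 0[%classic); first exact: measurable_itv.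
  by apply/seteqP; split=> x /=; rewrite in_itv.
by move=> x /= /negP; rewrite -ltNge.
Qed.

Lemma Rintegral_pos (g : R -> R) : measurable_fun setT g ->
  \int[mu]_x g x = \int[mu]_x g (pos x).
Proof.
move=> mg; rewrite /Rintegral; congr fine; apply: ae_eq_integral => //.
- exact/measurable_EFinP.
- apply/measurable_EFinP; apply: measurableT_comp => //.
  by apply: continuous_measurable_fun; exact: continuous_pos.
- apply: (@filterS _ (almost_everywhere mu) _ _ _ _ nneg_supported_ae) => x x0 _.
  by rewrite posE.
Qed.

End nneg_supported.

Section convergence_to_measure.
Variable R : realType.
Implicit Types (g : R -> R).
Variables (u : nat -> seq R) (w0 : R).
Hypothesis w00 : 0 < w0.
Hypothesis u0 : forall n, (0 < n)%N -> all (>= 0) (u n) /\ size (u n) = n.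
Variable mu : probability (measurableTypeR R) R.
Hypothesis mu0 : nneg_supported mu.
Hypothesis hmu : forall w : R, 0 < w < w0 ->
  (fun n => hmean (u n) w) @ \oo --> \int[mu]_x cpt w x.

(** In the variable [v = cpt w1 x] only functions with a limit at infinity are reached. A general
    [g] is therefore frozen beyond a large [r], and the mass beyond [r] is controlled, for [mu] and
    for the lists alike, by [1 - cpt w] with small [w]. *)
Lemma avg_cvg_measure g : continuous g -> (exists M : R, forall x, `|g x| <= M) ->
  (fun n => avg (u n) g) @ \oo --> \int[mu]_x g x.
Proof.
move=> cg [C gC]; have C0 : 0 <= C := le_trans (normr_ge0 _) (gC 0).
pose w1 := w0 / 2.
have w10 : 0 < w1 by rewrite divr_gt0.
have w1w0 : w1 < w0 by rewrite ltr_pdivrMr//; have := w00; lra.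
have w1ge := ltW w10.
have key f : continuous f ->
    (fun n => avg (u n.+1) (fun x => f (cpt w1 x))) @ \oo --> \int[mu]_x f (cpt w1 x).
  move=> cf; rewrite -[X in _ --> X]add0r.
  have -> : (fun n => avg (u n.+1) (fun x => f (cpt w1 x))) =
    (fun n => (avg (u n.+1) (fun x => f (cpt w1 x)) - \int[mu]_x f (cpt w1 x)) + \int[mu]_x f (cpt w1 x)).
    by apply/funext => n; rewrite subrK.
  apply: cvgD; last exact: cvg_cst.
  apply: (@mean01_cvg R nat \oo _ (fun n f => avg (u n.+1) (fun x => f (cpt w1 x)))
    (fun n f => \int[mu]_x f (cpt w1 x)) _ _ 0) => //.
  - move=> n; apply: mean01_avg => [|x _]; last exact: cpt01.
    by case: (u0 (ltn0Sn n)) => _ ->.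
  - move=> n; apply: mean01_measure => [|x]; last exact: cpt01.
    by apply: continuous_measurable_fun; exact: continuous_cpt.
  - move=> t /andP[t0 t1] _; rewrite -(subrr (\int[mu]_x cpt (t * w1) x)).
    have eF : (fun x => stker t (cpt w1 x)) = cpt (t * w1).
      by apply/funext => x; rewrite stker_cpt.
    rewrite /= eF.
    apply: cvgB; last exact: cvg_cst.
    have := hmu (w := t * w1); rewrite mulr_gt0//= => /(_ (le_lt_trans (ler_piMl w1ge t1) w1w0)).
    move/(cvg_comp _ _ (cvg_addnr 1)); apply: cvg_trans; apply: near_eq_cvg.
    apply: nearW => n /=; rewrite addn1 avg_cpt//.
    by case: (u0 (ltn0Sn n)).
have tail : (fun k => \int[mu]_x cpt (w0 / k.+2%:R) x) @ \oo --> (1 : R).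
  have e1 : \int[mu]_x (fun=> 1) x = 1 :> R.
    by rewrite Rintegral_cst// mul1r; exact: (congr1 fine (probability_setT mu)).
  rewrite -[X in _ --> X]e1.
  apply: (@cvg_Rintegral_bounded _ _ _ mu _ _ 1).
  - move=> k; apply: continuous_measurable_fun; apply: continuous_cpt.
    by apply: divr_ge0; [exact: ltW w00|].
  - exact: measurable_cst.
  - move=> k x; have /andP[h1 h2] : 0 <= cpt (w0 / k.+2%:R) x <= 1.
      by apply: cpt01; apply: divr_ge0; [exact: ltW w00|].
    by rewrite ger0_norm.
  - apply: aeW => x /=; rewrite -[X in _ --> X]invr1 /cpt; apply: cvgV; first exact: oner_neq0.
    rewrite -[X in _ --> X]addr0; apply: cvgD; first exact: cvg_cst.
    have h : (fun k => w0 * pos x * k.+2%:R^-1) @ \oo --> w0 * pos x * (0 : R).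
      apply: cvgM; first exact: cvg_cst.
      by rewrite (cvg_shiftS (fun k => k.+1%:R^-1 : R)); exact: cvg_harmonic.
    rewrite mulr0 in h; apply: cvg_trans h; apply: near_eq_cvg; apply: nearW => k.
    by rewrite mulrAC.
apply/cvgrPdist_le => eta eta0.
(* Freezing [g] costs [4 * C * eps] for [mu] and [8 * C * eps] for the lists; with the remaining
   [eta / 4] the total stays below [eta] because [16 * C * eps <= eta]. *)
pose eps := eta / (16 * (C + 1)).
have C1 : 0 < 16 * (C + 1) by rewrite mulr_gt0// ltr_wpDl.
have eps0 : 0 < eps by rewrite divr_gt0.
have Ceps : 16 * (C * eps) <= eta.
  have C2 : 0 < C + 1 by rewrite ltr_wpDl.
  have -> : 16 * (C * eps) = eta * (C / (C + 1)) by rewrite /eps; field; rewrite gt_eqF.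
  by rewrite ler_piMr ?(ltW eta0)// ler_pdivrMr// mul1r lerDl.
have [k hk] : exists k, 1 - eps <= \int[mu]_x cpt (w0 / k.+2%:R) x.
  have /cvgrPdist_le/(_ _ eps0) := tail; case=> k _ /(_ k (leqnn _)) /=.
  by rewrite ler_norml => /andP[_ h]; exists k; rewrite lerBlDr -lerBlDl.
pose w := w0 / k.+2%:R.
have ww0 : 0 < w < w0.
  rewrite divr_gt0//= ltr_pdivrMr// ltr_pMr// ltr1n//.
have [w_gt0 _] := andP ww0.
have wge0 := ltW w_gt0.
(* Beyond [1 / w] the value of [cpt w] is at most [1 / 2], so [4 * C * (1 - cpt w x)] exceeds the
   largest possible difference [2 * C]. *)
pose r := w^-1; have r0 : 0 < r by rewrite invr_gt0.
pose gc x := g (Num.min (pos x) r).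
pose vr := (1 + w1 * r)^-1.
have vr0 : 0 < vr by rewrite invr_gt0 ltr_wpDr// mulr_ge0// ltW.
(* [g] composed with the inverse of [cpt w1], frozen below [vr = cpt w1 r] where that inverse blows
   up. *)
pose f v := g (((Num.max v vr)^-1 - 1) / w1).
have cmax : continuous (fun v => Num.max v vr).
  move=> v; apply: (@continuous_max R R id _ v); first exact: cvg_id.
  exact: cvg_cst.
have cf : continuous f.
  move=> v; rewrite /f.
  apply: (@continuous_comp R R R (fun v => ((Num.max v vr)^-1 - 1) / w1) g); last exact: cg.
  apply: cvgM; last exact: cvg_cst.
  apply: cvgB; last exact: cvg_cst.
  apply: cvgV; last exact: cmax.
  by rewrite gt_eqF// lt_max vr0 orbT.
have fE x : f (cpt w1 x) = gc x.
  rewrite /f /gc; congr g; rewrite /cpt /vr.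
  have p1 := cpt_den x w1ge; have p2 : 0 < 1 + w1 * r by rewrite -invr_gt0.
  have -> : Num.max (1 + w1 * pos x)^-1 (1 + w1 * r)^-1 = (1 + w1 * Num.min (pos x) r)^-1.
    have [h|h] := leP (pos x) r.
      by apply: max_idPl; rewrite lef_pV2 ?posrE// lerD2l ler_pM2l.
    by apply: max_idPr; rewrite lef_pV2 ?posrE// lerD2l ler_pM2l// ltW.
  by rewrite invrK; field; rewrite gt_eqF.
have gle x : 0 <= x -> `|g x - gc x| <= 4 * C * (1 - cpt w x).
  move=> x0; rewrite /gc posE//; have /andP[q0 q1] := cpt01 x wge0.
  have [h|h] := leP x r.
    by rewrite subrr normr0 !mulr_ge0// subr_ge0.
  have q2 : cpt w x <= 2^-1.
    rewrite /cpt posE// lef_pV2 ?posrE//; last by rewrite ltr_wpDr// mulr_ge0.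
    have : w * r <= w * x by rewrite ler_pM2l// ltW.
    by rewrite divff ?gt_eqF//; lra.
  apply: (le_trans (ler_normB _ _)); have := gC x; have := gC r.
  have : 4 * C * 2^-1 <= 4 * C * (1 - cpt w x) by rewrite ler_wpM2l ?mulr_ge0//; lra.
  lra.
have mcpt : measurable_fun setT (cpt w : R -> R).
  by apply: continuous_measurable_fun; exact: continuous_cpt.
have cgc : continuous gc.
  have -> : gc = (fun x => f (cpt w1 x)) by apply/funext => x; rewrite fE.
  by move=> x; apply: (@continuous_comp R R R (cpt w1) f); [exact: continuous_cpt|exact: cf].
have mg : measurable_fun setT g by exact: continuous_measurable_fun.
have mgc : measurable_fun setT gc by exact: continuous_measurable_fun.
have mpos : measurable_fun setT (@pos R) by apply: continuous_measurable_fun; exact: continuous_pos.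
have gcC x : `|gc x| <= C by exact: gC.
have b1 : `|\int[mu]_x g x - \int[mu]_x gc x| <= 4 * C * eps.
  rewrite (Rintegral_pos mu0 mg) (Rintegral_pos mu0 mgc).
  have i1 : mu.-integrable setT (EFin \o (fun x => g (pos x))).
    by apply: (@integrable_bounded _ _ _ mu _ C) => //; exact: measurableT_comp.
  have i2 : mu.-integrable setT (EFin \o (fun x => gc (pos x))).
    by apply: (@integrable_bounded _ _ _ mu _ C) => //; exact: measurableT_comp.
  rewrite -RintegralB//.
  have i3 : mu.-integrable setT (EFin \o (fun x => g (pos x) - gc (pos x))).
    apply: (@integrable_bounded _ _ _ mu _ (C + C)).
      by apply: measurable_funB; exact: measurableT_comp.
    by move=> x; rewrite (le_trans (ler_normB _ _))// lerD.
  apply: (le_trans (le_normr_Rintegral measurableT i3)).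
  have icpt : mu.-integrable setT (EFin \o cpt w).
    apply: (@integrable_bounded _ _ _ mu _ 1) => // x.
    by have /andP[h1 h2] := cpt01 x wge0; rewrite ger0_norm.
  have icst (c : R) : mu.-integrable setT (EFin \o (fun=> c)).
    by apply: (@integrable_bounded _ _ _ mu _ `|c|) => //; exact: measurable_cst.
  have iB : mu.-integrable setT (EFin \o (fun x => 1 - cpt w x)).
    apply: (@integrable_bounded _ _ _ mu _ 1).
      by apply: measurable_funB => //; exact: measurable_cst.
    move=> x; have /andP[h1 h2] := cpt01 x wge0.
    by rewrite ger0_norm ?subr_ge0// gerBl.
  apply: (@le_trans _ _ (\int[mu]_x (4 * C * (1 - cpt w x)))).
    apply: le_Rintegral => //.
    - apply: (@integrable_bounded _ _ _ mu _ (C + C)); last first.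
        by move=> x; rewrite normr_id (le_trans (ler_normB _ _))// lerD.
      by apply: measurableT_comp => //; apply: measurable_funB; exact: measurableT_comp.
    - apply: (@integrable_bounded _ _ _ mu _ (4 * C)).
        apply: measurable_funM; first exact: measurable_cst.
        by apply: measurable_funB => //; exact: measurable_cst.
      move=> x; have /andP[h1 h2] := cpt01 x wge0.
      by rewrite ger0_norm ?mulr_ge0 ?subr_ge0// ler_piMr ?mulr_ge0// gerBl.
    - move=> x _; apply: (le_trans (gle _ (pos_ge0 x))).
      by rewrite /cpt (posE (pos_ge0 x)).
  rewrite RintegralZl// ler_wpM2l ?mulr_ge0// RintegralB// Rintegral_cst// mul1r.
  have -> : fine (mu setT) = 1 by exact: (congr1 fine (probability_setT mu)).
  by rewrite lerBlDr -lerBlDl.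
have hw := hmu ww0.
have /cvgrPdist_le/(_ _ eps0) hw1 := hw.
have : (fun n => avg (u n) gc) @ \oo --> \int[mu]_x gc x.
  rewrite -(cvg_shiftS (fun n => avg (u n) gc)).
  have := key f cf; under eq_Rintegral do rewrite fE.
  by under eq_fun do under eq_fun do rewrite fE.
have eta2 : 0 < eta / 4 by rewrite divr_gt0.
move=> /cvgrPdist_le/(_ _ eta2) hgc.
near=> n.
have n0 : (0 < n)%N by near: n; exact: nbhs_infty_gt.
have [un0 sn] := u0 n0.
have b2 : `|avg (u n) g - avg (u n) gc| <= 4 * C * (1 - hmean (u n) w).
  have s0 : 0 < (size (u n))%:R :> R by rewrite sn ltr0n.
  rewrite -avg_cpt// /avg -mulrBl -sumrB normrM normfV normr_nat ler_pdivrMr//.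
  apply: (le_trans (ler_norm_sum _ _ _)).
  have -> : 4 * C * (1 - (\sum_(x <- u n) cpt w x) / (size (u n))%:R) * (size (u n))%:R =
      4 * C * ((size (u n))%:R - \sum_(x <- u n) cpt w x) by field; rewrite gt_eqF.
  have -> : (size (u n))%:R = \sum_(x <- u n) (1 : R).
    by rewrite big_const_seq count_predT iter_addr_0.
  rewrite -sumrB mulr_sumr big_seq [leRHS]big_seq; apply: ler_sum => x xu.
  by apply: gle; exact: (allP un0).
have b3 : `|\int[mu]_x cpt w x - hmean (u n) w| <= eps by near: n.
have b4 : `|\int[mu]_x gc x - avg (u n) gc| <= eta / 4 by near: n.
have b5 : 4 * C * (1 - hmean (u n) w) <= 4 * C * (2 * eps).
  rewrite ler_wpM2l ?mulr_ge0//; move: b3 hk; rewrite -/w ler_norml => /andP[? ?]; lra.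
move: b1 b2 b4; rewrite !ler_norml => /andP[? ?] /andP[? ?] /andP[? ?].
by apply/andP; split; lra.
Unshelve. all: by end_near. Qed.

End convergence_to_measure.

(** * Existence of limit measures *)

Section helly.
Variable R : realType.

Let P : probability (measurableTypeR R) R := uniform_prob (@ltr01 R).

Lemma uniform_prob_itv (a b : R) : 0 <= a -> a <= b -> b <= 1 ->
  P [set` `[a, b[] = (b - a)%:E.
Proof.
move=> a0 ab b1; rewrite /P /= /uniform_prob.
rewrite (eq_integral (cst 1%:E)); last first.
  move=> x; rewrite inE/= in_itv/= => /andP[ax xb].
  by rewrite /uniform_pdf subr0 invr1 (le_trans a0 ax) (le_trans (ltW xb) b1).
rewrite integral_cst//= mul1e.
rewrite lebesgue_measure_itv/= lte_fin; case: ltP => // ba.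
by have -> : a = b; [apply/le_anti/andP|rewrite subrr].
Qed.

Lemma uniform_prob_ae01 : {ae P, forall x : R, 0 <= x < 1}.
Proof.
exists (~` [set` `[0, 1[]); split.
- by apply: measurableC; exact: measurable_itv.
- rewrite probability_setC; last exact: measurable_itv.
  by rewrite uniform_prob_itv// subr0 -EFinB subrr.
- by move=> x /= h; rewrite in_itv/=.
Qed.

Variable Q : nat -> R -> R.
Hypothesis Q_nd : forall n, {homo Q n : s t / s <= t}.
Hypothesis Q01 : forall n t, 0 <= Q n t <= 1.
Hypothesis Qcvg : forall f : R -> R, continuous f -> cvgn (fun n => \int[P]_t f (Q n t)).

(** The infimum [qs] of the eventual upper bounds and the supremum [qi] of the eventual lower bounds
    are the upper and lower limits of [Q n t]. No subsequence is extracted, since the integrals are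
    assumed to converge. *)
Let up t := [set b : R | 0 <= b /\ \forall n \near \oo, Q n t <= b].
Let lo t := [set a : R | a <= 1 /\ \forall n \near \oo, a <= Q n t].

Let up1 t : up t 1.
Proof. by split => //; apply: nearW => n; case/andP: (Q01 n t). Qed.
Let lo0 t : lo t 0.
Proof. by split => //; apply: nearW => n; case/andP: (Q01 n t). Qed.
Let upb t : has_lbound (up t). Proof. by exists 0 => b []. Qed.
Let lob t : has_ubound (lo t). Proof. by exists 1 => b []. Qed.

Let qs t := inf (up t).
Let qi t := sup (lo t).

Let qs01 t : 0 <= qs t <= 1.
Proof.
apply/andP; split; last exact: ge_inf.
by apply: lb_le_inf; [exists 1|move=> b []].
Qed.

Let qs_lt t b : qs t < b -> \forall n \near \oo, Q n t <= b.
Proof.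
move=> h; have hi : has_inf (up t) by split; [exists 1|].
have b0 : 0 < b - qs t by rewrite subr_gt0.
have [c [_ hc] cb] := inf_adherent b0 hi.
apply: filterS hc => n /le_trans; apply; apply: ltW.
by rewrite addrC subrK in cb.
Qed.

Let qi_gt t a : a < qi t -> \forall n \near \oo, a <= Q n t.
Proof.
move=> h; have hi : has_sup (lo t) by split; [exists 0|].
have b0 : 0 < qi t - a by rewrite subr_gt0.
have [c [_ hc] cb] := sup_adherent b0 hi.
apply: filterS hc => n; apply: le_trans; apply: ltW.
by rewrite subKr in cb.
Qed.

Let qs_nd : {homo qs : s t / s <= t}.
Proof.
move=> s t st; apply: lb_le_inf; first by exists 1.
move=> b [b0 hb]; apply: ge_inf => //; split=> //.
by apply: filterS hb => n; apply: le_trans; exact: Q_nd.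
Qed.

Let mQ n : measurable_fun setT (Q n).
Proof. by apply: nondecreasing_measurable => //; exact: Q_nd. Qed.

Let mqs : measurable_fun setT qs.
Proof. by apply: nondecreasing_measurable => //; exact: qs_nd. Qed.

(** Otherwise two levels [a < b] separate them. Infinitely often [Q n t > b], and a ramp [f] from
    [a] to [b] has integral at least [1 - t]; infinitely often [Q n t' < a], and the integral is at
    most [1 - t']. A convergent sequence cannot do both. *)
Let qs_le_qi t t' : 0 <= t -> t < t' -> t' < 1 -> qs t <= qi t'.
Proof.
move=> t0 tt' t'1; rewrite leNgt; apply/negP => h.
pose a := qi t' + (qs t - qi t') / 3; pose b := qi t' + 2 * (qs t - qi t') / 3.
have ab : a < b by rewrite /a /b; lra.
have qia : qi t' < a by rewrite /a; lra.
have bqs : b < qs t by rewrite /b; lra.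
have a1 : a <= 1 by have /andP[_ ?] := qs01 t; lra.
have b0 : 0 <= b by have : 0 <= qi t' by [exact: sup_ubound]; lra.
pose f v : R := clamp ((v - a) / (b - a)).
have cf : continuous f.
  move=> v; apply: (@continuous_comp R R R (fun v => (v - a) / (b - a)) (@clamp R)); last exact: continuous_clamp.
  by apply: cvgM; [apply: cvgB; [exact: cvg_id|exact: cvg_cst]|exact: cvg_cst].
have f01 v : 0 <= f v <= 1 by exact: clamp01.
have ba0 : 0 < b - a by rewrite subr_gt0.
have f0 v : v <= a -> f v = 0.
  move=> va; rewrite /f /clamp (max_idPl _); first by apply: min_idPr.
  by rewrite ler_pdivrMr// mul0r subr_le0.
have f1 v : b <= v -> f v = 1.
  move=> bv; rewrite /f /clamp; apply: min_idPl; rewrite le_max; apply/orP; right.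
  by rewrite ler_pdivlMr// mul1r lerD2r.
have mf n : measurable_fun setT (fun t => f (Q n t)).
  by apply: measurableT_comp => //; exact: continuous_measurable_fun.
have if_ n : P.-integrable setT (EFin \o (fun t => f (Q n t))).
  apply: (@integrable_bounded _ _ _ P _ 1); first exact: mf.
  by move=> x; have /andP[h1 h2] := f01 (Q n x); rewrite ger0_norm.
have ii (A : set (measurableTypeR R)) : measurable A -> P.-integrable setT (EFin \o (\1_A : measurableTypeR R -> R)).
  move=> mA; apply: (@integrable_bounded _ _ _ P _ 1); first exact: measurable_indic.
  by move=> x; rewrite indicE normr_nat lern1 leq_b1.
have m1 (c d : R) : measurable ([set` `[c, d[] : set (measurableTypeR R)).
  exact: measurable_itv.
have ae01 (g1 g2 : R -> R) : measurable_fun setT g1 -> measurable_fun setT g2 ->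
    P.-integrable setT (EFin \o g1) -> P.-integrable setT (EFin \o g2) ->
    (forall x, 0 <= g1 x) -> (forall x, 0 <= g2 x) ->
    (forall x, 0 <= x < 1 -> g1 x <= g2 x) -> \int[P]_x g1 x <= \int[P]_x g2 x.
  move=> mg1 mg2 i1 i2 g10 g20 g12; rewrite /Rintegral; apply: fine_le.
  - exact: integrable_fin_num.
  - exact: integrable_fin_num.
  apply: ae_ge0_le_integral => //.
  - by move=> x _; rewrite lee_fin.
  - exact/measurable_EFinP.
  - by move=> x _; rewrite lee_fin.
  - exact/measurable_EFinP.
  by apply: (@filterS _ (almost_everywhere P) _ _ _ _ uniform_prob_ae01) => x /g12 + _;
    rewrite /= lee_fin.
have Ilo n : b < Q n t -> 1 - t <= \int[P]_x f (Q n x).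
  move=> hb; have -> : 1 - t = \int[P]_x \1_([set` `[t, 1[]) x.
    have t1 : t <= 1 by rewrite ltW// (lt_trans tt').
    by rewrite Rintegral_indic//; exact: (esym (congr1 fine (uniform_prob_itv t0 t1 (lexx 1)))).
  apply: ae01; [exact: measurable_indic|exact: mf|exact: ii|exact: if_| | |].
    by move=> x; rewrite indicE ler0n.
    by move=> x; case/andP: (f01 (Q n x)).
  move=> x _; rewrite indicE; case: (boolP (x \in _)) => [|_]; last by case/andP: (f01 (Q n x)).
  rewrite inE/= in_itv/= => /andP[tx _].
  by rewrite f1// (le_trans (ltW hb))// Q_nd.
have Ihi n : Q n t' < a -> \int[P]_x f (Q n x) <= 1 - t'.
  move=> hb; have -> : 1 - t' = \int[P]_x \1_([set` `[t', 1[]) x.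
    have t'0 : 0 <= t' by rewrite (le_trans t0)// ltW.
    by rewrite Rintegral_indic//; exact: (esym (congr1 fine (uniform_prob_itv t'0 (ltW t'1) (lexx 1)))).
  apply: ae01; [exact: mf|exact: measurable_indic|exact: if_|exact: ii| | |].
    by move=> x; case/andP: (f01 (Q n x)).
    by move=> x; rewrite indicE ler0n.
  move=> x /andP[_ x1]; rewrite indicE; case: (boolP (x \in _)) => [_|].
    by case/andP: (f01 (Q n x)).
  rewrite notin_setE/= in_itv/= x1 andbT => /negP; rewrite -ltNge => xt.
  by rewrite f0// (le_trans _ (ltW hb))// Q_nd// ltW.
have /cvg_ex[l hl] := Qcvg cf.
have fr1 : l >= 1 - t.
  rewrite leNgt; apply/negP => hlt; have /cvgr_lt/(_ _ hlt) hev := hl.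
  have : up t b.
    split => //; apply: filterS hev => n; rewrite ltNge => /negP hn.
    by rewrite leNgt; apply/negP => /Ilo.
  by move/(ge_inf (upb t)); rewrite leNgt bqs.
have fr2 : l <= 1 - t'.
  rewrite leNgt; apply/negP => hlt; have /cvgr_gt/(_ _ hlt) hev := hl.
  have : lo t' a.
    split => //; apply: filterS hev => n; rewrite ltNge => /negP hn.
    by rewrite leNgt; apply/negP => /Ihi.
  by move/(sup_ubound (lob t')); rewrite leNgt qia.
by have := le_trans fr1 fr2; rewrite lerD2l lerN2 leNgt tt'.
Qed.

Let Qcvg_pt t : qs t <= qi t -> (fun n => Q n t) @ \oo --> qs t.
Proof.
move=> h; apply/cvgrPdist_le => e e0.
have h1 : qs t < qs t + e by rewrite ltrDl.
have h2 : qs t - e < qi t by apply: lt_le_trans h; rewrite ltrBlDr ltrDl.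
near=> n; have ? : Q n t <= qs t + e by near: n; exact: qs_lt.
have ? : qs t - e <= Q n t by near: n; exact: qi_gt.
by rewrite ler_norml; apply/andP; split; lra.
Unshelve. all: by end_near. Qed.

(** The gaps between [qi t] and [qs t] at different points of [[0, 1)] are disjoint, so a rational
    in each shows that only countably many are nonempty. Elsewhere [Q n] converges, and dominated
    convergence applies with [V] the upper limit. *)
Lemma helly_quantile : exists V : R -> R, [/\ measurable_fun setT V,
  forall t, 0 <= V t <= 1 &
  forall f : R -> R, continuous f ->
    (fun n => \int[P]_t f (Q n t)) @ \oo --> \int[P]_t f (V t)].
Proof.
exists qs; split=> // f cf.
have [B _ hB] := continuous_itv01_bounded cf.
have mf : measurable_fun setT f by exact: continuous_measurable_fun.
apply: (@cvg_Rintegral_bounded _ _ _ P _ _ B).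
- by move=> n; exact: (measurableT_comp mf (mQ n)).
- exact: (measurableT_comp mf mqs).
- by move=> n x; exact: hB.
pose D := [set t : R | 0 <= t < 1 /\ qi t < qs t].
have cD : countable D.
  have /choice[q hq] : forall t, exists q : rat, D t -> qi t < ratr q < qs t.
    move=> t; have [[_ h]|nD] := pselect (D t); last by exists 0.
    by have [q] := rat_in_itvoo h; rewrite in_itv/=; exists q.
  apply/countable_injP; exists (fun t => pickle (q t)) => s t.
  rewrite !inE => Ds Dt /(pcan_inj pickleK) qst.
  have lt_ne (x y : R) : D x -> D y -> q x = q y -> ~ x < y.
    move=> Dx Dy e xy; have /andP[_ h1] := hq _ Dx; have /andP[h2 _] := hq _ Dy.
    case: Dx Dy => [/andP[x0 _] _] [/andP[_ y1] _].
    have := qs_le_qi x0 xy y1; rewrite leNgt => /negP; apply.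
    by apply: lt_trans h2 _; rewrite -e.
  have [h|h|//] := ltgtP s t; first by case: (lt_ne s t).
  by case: (lt_ne t s).
have nD : {ae P, forall t, ~ D t}.
  exists D; split; last by move=> t /= /contrapT.
  - exact: countable_measurable.
  - have := @dominates_uniform_prob R 0 1 ltr01.
    move=> /null_content_dominatesP; apply; first exact: countable_measurable.
    exact: countable_lebesgue_measure0.
have [N [mN N0 sN]] := @filterI _ (almost_everywhere P) _ _ _ nD uniform_prob_ae01.
exists N; split=> // t nG; apply: sN => -[nDt t01]; apply: nG.
apply: (@continuous_cvg _ _ _ _ _ _ f); first exact: cf.
apply: Qcvg_pt; rewrite leNgt; apply/negP => lt_q; exact: nDt.
Qed.

End helly.

Section step_quantile.
Variable R : realType.
Let P : probability (measurableTypeR R) R := uniform_prob (@ltr01 R).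

(** The default 1 is the upper bound of the values that occur, which keeps the function
    nondecreasing past [t = 1]. *)
Definition quantile (s : seq R) (t : R) : R :=
  nth 1 (sort <=%O s) (Num.truncn (t * (size s)%:R)).

Lemma quantile01 s t : (forall v, v \in s -> 0 <= v <= 1) -> 0 <= quantile s t <= 1.
Proof.
move=> s01; rewrite /quantile; set k := Num.truncn _.
have [ks|ks] := ltnP k (size (sort <=%O s)); last by rewrite nth_default// ler01 lexx.
by apply: s01; rewrite -(mem_sort <=%O); exact: mem_nth.
Qed.

Lemma quantile_nd s : (forall v, v \in s -> 0 <= v <= 1) ->
  {homo quantile s : t t' / t <= t'}.
Proof.
move=> s01 t t' tt'; have := quantile01 t s01; rewrite /quantile.
set k := Num.truncn _; set k' := Num.truncn _ => /andP[_ k1].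
have kk' : (k <= k')%N by apply: le_truncn; exact: ler_wpM2r.
have [ks|ks] := ltnP k' (size (sort <=%O s)); last by rewrite [leRHS]nth_default.
apply: (sorted_leq_nth le_trans le_refl) => //; first exact: sort_le_sorted.
by rewrite inE (leq_ltn_trans kk').
Qed.

Lemma integral_quantile s (f : R -> R) : (0 < size s)%N ->
  (forall v, v \in s -> 0 <= v <= 1) -> continuous f ->
  \int[P]_t f (quantile s t) = avg s f.
Proof.
move=> s0 s01 cf; have N0 : 0 < (size s)%:R :> R by rewrite ltr0n.
pose N := size s; pose c k := f (nth 1 (sort <=%O s) k).
pose I k := [set` `[k%:R / N%:R, k.+1%:R / N%:R[] : set (measurableTypeR R).
have mI k : measurable (I k) by exact: measurable_itv.
have ic (k : 'I_N) : P.-integrable setT (EFin \o (fun t => c k * \1_(I k) t)).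
  apply: (@integrable_bounded _ _ _ P _ `|c k|).
    by apply: measurable_funM; [exact: measurable_cst|exact: measurable_indic].
  by move=> x; rewrite normrM indicE normr_nat ler_piMr// lern1 leq_b1.
transitivity (\int[P]_t (\sum_(k < N) c k * \1_(I k) t)).
  have mf : measurable_fun setT f by exact: continuous_measurable_fun.
  have mq : measurable_fun setT (quantile s).
    by apply: nondecreasing_measurable => //; exact: quantile_nd.
  rewrite /Rintegral; congr fine; apply: ae_eq_integral => //.
  - by apply/measurable_EFinP; exact: (measurableT_comp mf mq).
  - apply/measurable_EFinP; apply: measurable_sum => k.
    by apply: measurable_funM; [exact: measurable_cst|exact: measurable_indic].
  have [M [mM M0 sM]] := @uniform_prob_ae01 R.
  exists M; split=> // t nt; apply: sM => /andP[t0 t1]; apply: nt => _ /=; congr EFin.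
  have tN0 : 0 <= t * N%:R by rewrite mulr_ge0.
  have kN : (Num.truncn (t * N%:R) < N)%N.
    by rewrite truncn_lt_nat// gtr_pMl.
  rewrite (bigD1 (Ordinal kN))//= big1 ?addr0.
    rewrite indicE mem_set ?mulr1// /I/= in_itv/= ler_pdivrMr// ltr_pdivlMr//.
    exact: truncn_itv.
  move=> j jk; rewrite indicE memNset ?mulr0// /I/= in_itv/= ler_pdivrMr// ltr_pdivlMr//.
  by move=> /truncn_def e; move: jk; rewrite -val_eqE/= e eqxx.
rewrite Rintegral_bigsum//.
have iE (k : 'I_N) : \int[P]_t (c k * \1_(I k) t) = c k / N%:R.
  rewrite RintegralZl//; last first.
    apply: (@integrable_bounded _ _ _ P _ 1); first exact: measurable_indic.
    by move=> x; rewrite indicE normr_nat lern1 leq_b1.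
  rewrite Rintegral_indic//; congr (_ * _).
  have h1 : 0 <= k%:R / N%:R :> R by rewrite divr_ge0.
  have h2 : k%:R / N%:R <= k.+1%:R / N%:R :> R by rewrite ler_pM2r ?invr_gt0// ler_nat.
  have h3 : k.+1%:R / N%:R <= 1 :> R by rewrite ler_pdivrMr// mul1r ler_nat.
  apply: (etrans (congr1 fine (uniform_prob_itv h1 h2 h3))) => /=.
  by rewrite -mulrBl -natr1 addrAC subrr add0r mul1r.
under eq_bigr do rewrite iE.
rewrite -mulr_suml /avg; congr (_ / _).
rewrite -(perm_big _ (permEl (perm_sort <=%O s)))/= (big_nth 1) size_sort big_mkord.
by [].
Qed.

End step_quantile.

Section image_probability.
Variable R : realType.

Lemma image_probability (P : probability (measurableTypeR R) R) (U : R -> R) :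
  measurable_fun [set: R] U ->
  exists mu : probability (measurableTypeR R) R,
    (forall A, mu A = P (U @^-1` A)) /\
    forall (g : R -> R) (C : R), measurable_fun [set: R] g -> (forall x, `|g x| <= C) ->
      \int[mu]_x g x = \int[P]_x g (U x).
Proof.
move=> mU.
pose X : {mfun measurableTypeR R >-> measurableTypeR R} :=
  @mfun_Sub _ _ (measurableTypeR R) (measurableTypeR R) U (mem_set mU).
have XE : X = U :> (R -> R) by rewrite /X mfun_valP.
exists (distribution P X); split.
  by move=> A; rewrite /distribution /pushforward XE.
move=> g C mg gC; rewrite /Rintegral; congr fine.
rewrite /distribution integral_pushforward//.
- exact/measurable_EFinP.
- apply: (@integrable_bounded _ _ _ P (fun x => g (X x)) C) => //.
  by rewrite XE; exact: (measurableT_comp mg mU).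
Qed.

End image_probability.

Section existence.
Variable R : realType.
Let P : probability (measurableTypeR R) R := uniform_prob (@ltr01 R).
Variables (u : nat -> seq R) (w0 : R) (h : R -> R).
Hypothesis w00 : 0 < w0.
Hypothesis u0 : forall n, (0 < n)%N -> all (>= 0) (u n) /\ size (u n) = n.
Hypothesis hu : forall w : R, 0 < w < w0 -> (fun n => hmean (u n) w) @ \oo --> h w.
Hypothesis h1 : forall e : R, 0 < e -> exists2 w, 0 < w < w0 / 2 & 1 - e <= h w.

(** The lists are transported to [[0, 1]] by [cpt w1], a limit is found there through quantile
    functions, and it is carried back. The point at infinity corresponds to [v = 0]; the hypothesis
    [h1] forbids mass there. *)
Lemma exists_limit_measure : exists mu : probability (measurableTypeR R) R,
  nneg_supported mu /\
  forall g : R -> R, continuous g -> (exists M : R, forall x, `|g x| <= M) ->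
    (fun n => avg (u n) g) @ \oo --> \int[mu]_x g x.
Proof.
pose w1 := w0 / 2.
have w10 : 0 < w1 by rewrite divr_gt0.
have w1w0 : w1 < w0 by rewrite ltr_pdivrMr//; have := w00; lra.
have w1ge := ltW w10.
pose s n := [seq cpt w1 x | x <- u n.+1].
have s01 n v : v \in s n -> 0 <= v <= 1 by case/mapP => x _ ->; exact: cpt01.
have us n : size (u n.+1) = n.+1 by case: (u0 (ltn0Sn n)).
have un0 n : all (>= 0) (u n.+1) by case: (u0 (ltn0Sn n)).
have ss n : size (s n) = n.+1 by rewrite size_map.
have avgs n (f : R -> R) : avg (s n) f = avg (u n.+1) (fun x => f (cpt w1 x)).
  by rewrite /avg size_map big_map.
have mE n : mean01 (fun f => avg (u n.+1) (fun x => f (cpt w1 x))).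
  by apply: mean01_avg => [|x _]; [rewrite us|exact: cpt01].
have hst t : 0 < t <= 1 ->
    (fun n => avg (u n.+1) (fun x => stker t (cpt w1 x))) @ \oo --> h (t * w1).
  move=> /andP[t0 t1].
  have := @hu (t * w1); rewrite mulr_gt0//= => /(_ (le_lt_trans (ler_piMl w1ge t1) w1w0)).
  move/(cvg_comp _ _ (cvg_addnr 1)); apply: cvg_trans; apply: near_eq_cvg.
  apply: nearW => n /=; rewrite addn1 -avg_cpt//; congr avg; apply/funext => x.
  by rewrite stker_cpt.
(* The Cauchy property: the lists of indices [n] and [m] are compared along the product filter. *)
have Ecvg f : continuous f -> cvgn (fun n => avg (u n.+1) (fun x => f (cpt w1 x))).
  move=> cf; apply/cauchy_cvgP; apply/cauchy_ballP => e e0.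
  have := @mean01_cvg R (nat * nat)%type (filter_prod \oo \oo) _
    (fun p f => avg (u p.1.+1) (fun x => f (cpt w1 x)))
    (fun p f => avg (u p.2.+1) (fun x => f (cpt w1 x)))
    (fun p => mE p.1) (fun p => mE p.2) 0 ltr01.
  have hyp t : 0 < t <= 1 -> 0 < t ->
    (fun p : nat * nat => avg (u p.1.+1) (fun x => stker t (cpt w1 x)) -
       avg (u p.2.+1) (fun x => stker t (cpt w1 x))) @ filter_prod \oo \oo --> (0 : R).
    move=> t01 _; rewrite -(subrr (h (t * w1))).
    have ht := hst t t01.
    apply: cvgB; [exact: (cvg_comp _ _ cvg_fst ht)|exact: (cvg_comp _ _ cvg_snd ht)].
  move=> /(_ _ hyp f cf) /cvgrPdist_lt/(_ _ e0)[[A B] /= [AF BF] AB].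
  exists ((fun n => avg (u n.+1) (fun x => f (cpt w1 x))) @` A,
          (fun n => avg (u n.+1) (fun x => f (cpt w1 x))) @` B) => /=.
    by split; [apply: filterS AF|apply: filterS BF] => n An; exists n.
  move=> [x y] /= [[n An <-] [m Bm <-]]; rewrite /ball/=.
  by have := AB (n, m) (conj An Bm); rewrite /= sub0r normrN.
have intE n (f : R -> R) : continuous f ->
    \int[P]_t f (quantile (s n) t) = avg (u n.+1) (fun x => f (cpt w1 x)).
  by move=> cf; rewrite integral_quantile ?ss// => v; exact: s01.
have [V [mV V01 Vcvg]] : exists V : R -> R, [/\ measurable_fun setT V,
    forall t, 0 <= V t <= 1 &
    forall f : R -> R, continuous f ->
    (fun n => avg (u n.+1) (fun x => f (cpt w1 x))) @ \oo --> \int[P]_t f (V t)].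
  have [] := @helly_quantile R (fun n => quantile (s n)).
  - by move=> n; apply: quantile_nd; exact: s01.
  - by move=> n t; apply: quantile01; exact: s01.
  - move=> f cf; under eq_fun do rewrite intE//; exact: Ecvg.
  move=> V [mV V01 HV]; exists V; split=> // f cf.
  by have := HV f cf; under eq_fun do rewrite intE//.
have hV t : 0 < t <= 1 -> \int[P]_x stker t (V x) = h (t * w1).
  move=> t01; have := Vcvg _ (continuous_stker t01); have := hst t t01.
  by move=> c1 c2; have := cvg_unique _ c2 c1; apply.
(* Every [stker t] vanishes at 0, so a mass at 0 lowers all values of [h] by that mass, while [h]
   comes arbitrarily close to 1. *)
have V0 : P [set t | V t <= 0] = 0%E.
  have mVle : measurable [set t : measurableTypeR R | V t <= 0].
    by rewrite -[X in measurable X]setTI; apply: measurable_fun_le => //; exact: measurable_cst.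
  apply/eqP; rewrite eq_le measure_ge0 andbT; apply/lee_addgt0Pr => e e0; rewrite add0e.
  have [w /andP[wgt0 ww1] hw] := h1 e0.
  have t01 : 0 < w / w1 <= 1 by rewrite divr_gt0//= ler_pdivrMr// mul1r ltW.
  have := hV _ t01; rewrite divfK ?gt_eqF// => hVw.
  have ie : P.-integrable setT (EFin \o (fun x => stker (w / w1) (V x))).
    apply: (@integrable_bounded _ _ _ P _ 1).
      apply: (@measurableT_comp _ _ _ _ _ _ (stker (w / w1))) => //.
      by apply: continuous_measurable_fun; exact: continuous_stker.
    by move=> x; have /andP[? ?] := stker01 (V x) t01; rewrite ger0_norm.
  have ii : P.-integrable setT (EFin \o (\1_[set t | V t <= 0] : measurableTypeR R -> R)).
    apply: (@integrable_bounded _ _ _ P _ 1); first exact: measurable_indic.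
    by move=> x; rewrite indicE normr_nat lern1 leq_b1.
  have i1 : P.-integrable setT (EFin \o (fun=> 1 : R)).
    apply: (@integrable_bounded _ _ _ P _ 1); first exact: measurable_cst.
    by move=> x; rewrite normr1.
  have hle : \int[P]_x stker (w / w1) (V x) + \int[P]_x \1_[set t | V t <= 0] x <= 1.
    rewrite -RintegralD//.
    have e1 : \int[P]_x (fun=> 1) x = 1 :> R.
      by rewrite Rintegral_cst// mul1r; exact: (congr1 fine (probability_setT P)).
    rewrite -[leRHS]e1.
    apply: le_Rintegral => //.
      apply: (@integrable_bounded _ _ _ P _ (1 + 1)).
        apply: measurable_funD; last exact: measurable_indic.
        apply: (@measurableT_comp _ _ _ _ _ _ (stker (w / w1))) => //.
        by apply: continuous_measurable_fun; exact: continuous_stker.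
      move=> x; apply: (le_trans (ler_normD _ _)); apply: lerD.
        by have /andP[? ?] := stker01 (V x) t01; rewrite ger0_norm.
      by rewrite indicE normr_nat lern1 leq_b1.
    move=> x _; rewrite indicE; have /andP[? ?] := stker01 (V x) t01.
    case: (boolP (x \in _)) => [|_]; last by rewrite addr0.
    rewrite inE/= => Vx; have -> : V x = 0 by apply/le_anti; rewrite Vx; case/andP: (V01 x).
    by rewrite /stker clampE ?lexx ?ler01// mul0r add0r.
  rewrite hVw Rintegral_indic// in hle.
  have fn : P [set t | V t <= 0] \is a fin_num by exact: fin_num_measure.
  rewrite -(fineK fn) lee_fin; move: hle hw; set X := fine _; lra.
(* The inverse of [cpt w1], made nonnegative also on the null set where [V] vanishes. *)
pose U t := pos (((V t)^-1 - 1) / w1).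
have mInv : measurable_fun [set: R] (fun x : R => x^-1).
  rewrite (_ : (fun x => _) = (fun x => if x == 0 then 0 else x^-1)); last first.
    by apply/funext => x; case: eqVneq => // ->; rewrite invr0.
  apply: measurable_fun_if => //.
  - exact: measurable_fun_eqr.
  - rewrite setTI; apply: open_continuous_measurable_fun.
      rewrite (_ : _ @^-1` _ = ~` [set 0]).
        by apply: closed_openC; exact: accessible_closed_set1 (hausdorff_accessible (@Rhausdorff R)) 0.
      by apply/seteqP; split => x /=; [move/eqP | move=> ?; apply/eqP].
    by move=> x /=; rewrite inE /= => /negbT x0; exact: inv_continuous.
have mU : measurable_fun [set: measurableTypeR R] (U : measurableTypeR R -> measurableTypeR R).
  apply: (@measurableT_comp _ _ _ _ _ _ (@pos R)).
    by apply: continuous_measurable_fun; exact: continuous_pos.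
  apply: measurable_funM; last exact: measurable_cst.
  apply: measurable_funB; last exact: measurable_cst.
  exact: (measurableT_comp mInv mV).
have UV t : 0 < V t -> cpt w1 (U t) = V t.
  move=> V0t; rewrite /cpt /U; have /andP[_ V1] := V01 t.
  have h0 : 0 <= ((V t)^-1 - 1) / w1.
    by rewrite divr_ge0// subr_ge0 invf_ge1.
  by rewrite !posE ?pos_ge0// mulrC divfK ?gt_eqF// addrC subrK invrK.
have [mu [muE mug]] := image_probability P mU.
have mu0 : nneg_supported mu.
  apply: (etrans (muE _)); rewrite (_ : _ @^-1` _ = set0) ?measure0//.
  by apply/seteqP; split => x //=; rewrite ltNge pos_ge0.
exists mu; split=> // g cg gM.
apply: (@avg_cvg_measure R u w1) => // w /andP[wgt0 ww1].
have t01 : 0 < w / w1 <= 1 by rewrite divr_gt0//= ler_pdivrMr// mul1r ltW.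
suff -> : \int[mu]_x cpt w x = h w.
  by apply: hu; rewrite wgt0 (lt_trans ww1).
have := hV _ t01; rewrite divfK ?gt_eqF// => <-.
have mc : measurable_fun setT (cpt w : R -> R).
  by apply: continuous_measurable_fun; apply: continuous_cpt; exact: ltW.
have cb x : `|cpt w x| <= 1.
  by have /andP[a b] := cpt01 x (ltW wgt0); rewrite ger0_norm.
rewrite (mug _ 1)// /Rintegral; congr fine.
apply: ae_eq_integral => //.
- by apply/measurable_EFinP; exact: (measurableT_comp mc mU).
- apply/measurable_EFinP; apply: (@measurableT_comp _ _ _ _ _ _ (stker (w / w1))) => //.
  by apply: continuous_measurable_fun; exact: continuous_stker.
exists [set t | V t <= 0]; split=> //.
  by rewrite -[X in measurable X]setTI; apply: measurable_fun_le => //; exact: measurable_cst.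
move=> t nt; rewrite /= leNgt; apply/negP => V0t; apply: nt => _ /=; congr EFin.
by rewrite -(UV _ V0t) stker_cpt ?divr_gt0// divfK// gt_eqF.
Qed.

End existence.

(** * The Appell identity and the Cauchy transform *)

Section appell_identity.
Variable R : realType.
Implicit Types (a : seq R) (u v : seq R) (z w : R[i]) (x b : R).
Notation Re := complex.Re.
Notation Im := complex.Im.

Lemma appell_splits n a p : p \in splits a ->
  appell n a = appell n p.2 - p.1 *: (appell n p.2)^`().
Proof.
elim: a p => //= b a IH p; rewrite inE => /predU1P[->//|].
case/mapP => q qa -> /=; rewrite (IH _ qa) !derivB !derivZ.
by rewrite -!mul_polyC; ring.
Qed.

(* Apply [f(d/dz)] to [z (z^n)' = n z^n] and commute it with multiplication
   by [z]; [f'] is a sum over the factors of [f] with one factor removed. *)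
Lemma appell_euler n a : 'X * (appell n a)^`() =
  n%:R *: appell n a + \sum_(p <- splits a) p.1 *: (appell n p.2)^`().
Proof.
elim: a => [|b a IH] /=.
  rewrite big_nil addr0 derivXn; case: n => [|n]; first by rewrite mulr0n mulr0 scale0r.
  by rewrite /= mulrnAr -exprS scaler_nat.
rewrite big_cons big_map /=.
under eq_bigr do rewrite derivB derivZ scalerBr scalerA mulrC -scalerA.
rewrite sumrB -scaler_sumr.
have IH' : 'X * (appell n a)^`()^`() = n%:R *: (appell n a)^`() +
    \sum_(p <- splits a) p.1 *: (appell n p.2)^`()^`() - (appell n a)^`().
  apply/eqP; rewrite eq_sym subr_eq eq_sym; apply/eqP.
  have := congr1 (fun p => p^`()) IH; rewrite derivM derivX mul1r addrC => ->.
  rewrite derivD derivZ; congr (_ + _); rewrite linear_sum /=.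
  by apply: eq_bigr => p _; rewrite derivZ.
rewrite derivB derivZ mulrBr -scalerAr IH IH'.
by rewrite -!mul_polyC; ring.
Qed.

Notation normc := (@Normc.normc R).

Lemma normc_sqrt w : normc w = Num.sqrt (nsq w). Proof. by case: w. Qed.
Lemma normc_ge0 w : 0 <= normc w. Proof. by rewrite normc_sqrt sqrtr_ge0. Qed.
Lemma sqr_normc_nsq w : normc w ^+ 2 = nsq w.
Proof. by rewrite normc_sqrt sqr_sqrtr// nsq_ge0. Qed.
Lemma normc_le w c : 0 <= c -> (normc w <= c) = (nsq w <= c ^+ 2).
Proof.
move=> c0; rewrite -sqr_normc_nsq; apply/idP/idP => h.
  by rewrite lerXn2r ?nnegrE ?normc_ge0.
by rewrite -(@ler_pXn2r _ 2)// ?nnegrE ?normc_ge0.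
Qed.

Lemma Re_le_normc w : `|Re w| <= normc w.
Proof.
rewrite -(@ler_pXn2r _ 2)// ?nnegrE ?normc_ge0// sqr_normc_nsq.
by rewrite real_normK ?num_real// lerDl sqr_ge0.
Qed.

Lemma Im_le_normc w : `|Im w| <= normc w.
Proof.
rewrite -(@ler_pXn2r _ 2)// ?nnegrE ?normc_ge0// sqr_normc_nsq.
by rewrite real_normK ?num_real// lerDr sqr_ge0.
Qed.

Lemma normc_sum (I : eqType) (r : seq I) (F : I -> R[i]) :
  normc (\sum_(i <- r) F i) <= \sum_(i <- r) normc (F i).
Proof.
elim: r => [|i r IH]; first by rewrite !big_nil Normc.normc0.
by rewrite !big_cons (le_trans (le_normcD _ _))// lerD2l.
Qed.

(** The derivative of [logder v], so that [p''/p] is [logder ^+ 2 + logder2]. *)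
Definition logder2 v z : R[i] := - \sum_(x <- v) (z - x%:C)^-1 ^+ 2.

Lemma pc_deriv2_rooted v z : all (>= 0) v -> slit z ->
  pc (rooted v)^`()^`() z = pc (rooted v) z * (logder v z ^+ 2 + logder2 v z).
Proof.
move=> + sz; elim: v => [|b v IH] /=.
  move=> _; rewrite /rooted /logder /logder2 !big_nil derivC linear0 /pc rmorph0 horner0.
  by rewrite oppr0 addr0 expr0n mulr0.
case/andP=> b0 v0; have {}IH := IH v0.
have dr : (rooted (b :: v))^`()^`() =
    2%:P * (rooted v)^`() + ('X - b%:P) * (rooted v)^`()^`().
  rewrite /rooted big_cons -/(rooted v) derivM derivXsubC mul1r derivD derivM.
  by rewrite derivXsubC mul1r; ring.
rewrite dr pcD !pcM pcXsubC IH pc_deriv_rooted//.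
rewrite /rooted big_cons -/(rooted v) pcM pcXsubC /logder /logder2 !big_cons.
have -> : pc 2%:P z = 2 by rewrite /pc map_polyC hornerC /= rmorph_nat.
move: (\sum_(_ <- _) _) (\sum_(_ <- _) _) (pc _ _) => S1 S2 P.
by have := slit_sub_neq0 sz b0; move: (z - _) => w w0; field.
Qed.

Lemma Im_logder v z : Im (logder v z) = - Im z * \sum_(x <- v) (nsq (z - x%:C))^-1.
Proof.
rewrite /logder Im_sum mulr_sumr; apply: eq_bigr => x _.
by rewrite ImV ImD ImN Im_real subr0 mulNr.
Qed.

(** The triangle inequality bounds it by the sum of the [|z - x|^-2], and this sum is exactly
    [- Im (logder v z) / Im z]. *)
Lemma normc_logder2 v z : 0 < Im z -> normc (logder2 v z) <= - Im (logder v z) / Im z.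
Proof.
move=> z0; rewrite /logder2 normc_sqrt /nsq ReN ImN !sqrrN -/(nsq _) -normc_sqrt.
apply: (le_trans (normc_sum _ _)).
rewrite Im_logder !mulNr opprK mulrAC divff ?gt_eqF// mul1r.
by apply: ler_sum => x _; rewrite expr2 Normc.normcM -expr2 sqr_normc_nsq nsqV.
Qed.

Lemma slit_upper z : 0 < Im z -> slit z.
Proof. by move=> z0; rewrite /slit gt_eqF. Qed.

Lemma Im_logder_lt0 v z : (0 < size v)%N -> 0 < Im z -> Im (logder v z) < 0.
Proof.
case: v => // x v _ z0; rewrite Im_logder mulNr oppr_lt0 mulr_gt0// big_cons.
have nz y : 0 < nsq (z - y%:C).
  rewrite nsq_gt0; apply: contraTneq z0 => /(congr1 (fun w => Im w)).
  by rewrite ImD ImN Im_real subr0 => ->; rewrite ltxx.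
by rewrite ltr_pwDl ?invr_gt0// sumr_ge0// => y _; rewrite invr_ge0 ltW.
Qed.

(** Gives [|w| |1 - b w| >= |Im w|] uniformly in the real [b]. *)
Lemma nsq_one_sub (b : R) w : nsq w * nsq (1 - b%:C * w) =
  Im w ^+ 2 + (Re w - b * nsq w) ^+ 2.
Proof.
by rewrite /nsq ReD ImD ReN ImN ReM ImM Re_real Im_real /=; ring.
Qed.

(** Let [A_j] lack the factor [j], with [s = A_j'/A_j], and let [t] be [A_j''/A_j']. Then
    [A_j'/A' = 1 / (1 - a_j t)], and [t - A'/A] equals [s2 / (s (1 - a_j s))]. Its numerator is at
    most [- Im s / Im z] and its denominator at least [- Im s] in modulus; the resulting bound
    depends neither on [j] nor on [n], so it disappears after division by [n]. *)
Lemma appell_cauchy n a z v : (0 < n)%N -> all (>= 0) a -> 0 < Im z ->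
  size v = n -> all (>= 0) v -> rooted v = appell n a ->
  exists t : R * seq R -> R[i],
    (forall p, p \in splits a -> normc (t p - logder v z) <= (Im z)^-1) /\
    z = n%:R / logder v z + \sum_(p <- splits a) p.1%:C / (1 - p.1%:C * t p).
Proof.
move=> n0 a0 z0 sv v0 ev; have sz := slit_upper z0.
have S0 : Im (logder v z) < 0 by apply: Im_logder_lt0; rewrite ?sv.
have Sn0 : logder v z != 0 by apply: contraTneq S0 => ->; rewrite ltxx.
have q0 : pc (appell n a) z != 0 by rewrite -ev pc_rooted_neq0.
have dq : pc (appell n a)^`() z = pc (appell n a) z * logder v z.
  by rewrite -ev pc_deriv_rooted.
have dq0 : pc (appell n a)^`() z != 0 by rewrite dq mulf_neq0.
have /choice[t ht] : forall p, exists t, p \in splits a ->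
    normc (t - logder v z) <= (Im z)^-1 /\
    pc (appell n p.2)^`() z / pc (appell n a)^`() z = (1 - p.1%:C * t)^-1.
  move=> [b r]; have [brs|] := boolP ((b, r) \in splits a); last by exists 0.
  have [/= b0 r0] := splits_ge0 a0 brs.
  have [w [w0 sw ew]] := nnr_appell n r0.
  set s := logder w z; set s2 := logder2 w z.
  have Is : Im s < 0 by apply: Im_logder_lt0; rewrite ?sw.
  have sn0 : s != 0 by apply: contraTneq Is => ->; rewrite ltxx.
  have P0 : pc (appell n r) z != 0 by rewrite ew pc_rooted_neq0.
  have eqq : pc (appell n a) z = pc (appell n r) z * (1 - b%:C * s).
    by rewrite (appell_splits n brs)/= pcB pcZ ew pc_deriv_rooted// -/s; ring.
  have edq : pc (appell n a)^`() z = pc (appell n r) z * (s - b%:C * (s ^+ 2 + s2)).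
    rewrite (appell_splits n brs)/= derivB derivZ pcB pcZ ew pc_deriv_rooted//.
    by rewrite pc_deriv2_rooted// -/s -/s2; ring.
  have bs0 : 1 - b%:C * s != 0 by move: q0; rewrite eqq mulf_eq0 negb_or => /andP[].
  have d0 : s - b%:C * (s ^+ 2 + s2) != 0 by move: dq0; rewrite edq mulf_eq0 negb_or => /andP[].
  (* The logarithmic derivative of the derivative of [appell n r]. *)
  exists (s + s2 / s) => _; split; last first.
    rewrite edq ew pc_deriv_rooted// -/s -ew.
    have -> : 1 - b%:C * (s + s2 / s) = (s - b%:C * (s ^+ 2 + s2)) / s by field.
    by rewrite invf_div; move: d0; set dd := s - _ => d0; field; rewrite P0 d0.
  have eS : logder v z = (s - b%:C * (s ^+ 2 + s2)) / (1 - b%:C * s).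
    apply: (mulfI q0); rewrite -dq edq eqq; field; exact: bs0.
  have -> : s + s2 / s - logder v z = s2 / (s * (1 - b%:C * s)).
    by rewrite eS; field; rewrite sn0 bs0.
  rewrite Normc.normcM Normc.normcV Normc.normcM.
  have h1 : - Im s <= normc s * normc (1 - b%:C * s).
    rewrite -Normc.normcM -(@ler_pXn2r _ 2)// ?nnegrE ?normc_ge0//; last by rewrite oppr_ge0 ltW.
    by rewrite sqr_normc_nsq nsqM nsq_one_sub sqrrN lerDl sqr_ge0.
  have Is' : 0 < - Im s by rewrite oppr_gt0.
  rewrite ler_pdivrMr ?(lt_le_trans Is')//.
  apply: (le_trans (normc_logder2 w z0)); rewrite mulrC ler_pM2l ?invr_gt0//.
exists t; split; first by move=> p /ht[].
have := congr1 (fun p => pc p z / pc (appell n a)^`() z) (appell_euler n a).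
rewrite /= pcM pcX mulfK// pcD pcZ => e; rewrite [LHS]e {e}.
rewrite mulrDl; congr (_ + _).
  rewrite dq; have -> : (n%:R : R)%:C = n%:R by rewrite rmorph_nat.
  move: (n%:R : R[i]) (pc _ _) (logder v z) q0 Sn0 => N A B A0 B0.
  by field; rewrite A0 B0.
have -> : pc (\sum_(p <- splits a) p.1 *: (appell n p.2)^`()) z =
    \sum_(p <- splits a) p.1%:C * pc (appell n p.2)^`() z.
  elim: (splits a) => [|p r IH]; first by rewrite !big_nil /pc rmorph0 horner0.
  by rewrite !big_cons pcD pcZ IH.
rewrite mulr_suml big_seq [RHS]big_seq; apply: eq_bigr => p ps.
by have [_ <-] := ht p ps; rewrite mulrA.
Qed.

End appell_identity.

(** * The Levy kernel and the functional equation of the Cauchy transform *)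

Section levy_kernel.
Variable R : realType.
Implicit Types (z w : R[i]) (x : R).
Notation Re := complex.Re.
Notation Im := complex.Im.
Notation normc := (@Normc.normc R).

(** The difference is a sum of two squares. The growth in [1 + x ^+ 2] makes the kernels bounded in
    [x] for non-real [w]. *)
Lemma nsq_one_sub_ge x w : Im w ^+ 2 * (1 + x ^+ 2) <= (1 + nsq w) * nsq (1 - x%:C * w).
Proof.
rewrite -subr_ge0.
have -> : (1 + nsq w) * nsq (1 - x%:C * w) - Im w ^+ 2 * (1 + x ^+ 2) =
    (1 - x * Re w) ^+ 2 + (x * nsq w - Re w) ^+ 2.
  by rewrite /nsq ReD ImD ReN ImN ReM ImM Re_real Im_real /=; ring.
by rewrite addr_ge0// sqr_ge0.
Qed.

Lemma one_sub_neq0 x w : Im w != 0 -> 1 - x%:C * w != 0.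
Proof.
move=> w0; rewrite -nsq_gt0 -(@pmulr_rgt0 _ (1 + nsq w)); last by rewrite ltr_pwDl// nsq_ge0.
apply: lt_le_trans (nsq_one_sub_ge x w).
by rewrite mulr_gt0 ?exprn_even_gt0//= ltr_pwDl// sqr_ge0.
Qed.

Definition levy_ker w x : R[i] := (w + x%:C) / (1 - x%:C * w).

(** Separates the centring [x / (1 + x^2)], which feeds the drift, from the weight of [Sigma_] times
    a bounded continuous kernel; these are the two conditions of [levy_data]. *)
Lemma levy_kerE w x : Im w != 0 ->
  x%:C / (1 - x%:C * w) = (x / (1 + x ^+ 2))%:C + (x ^+ 2 / (1 + x ^+ 2))%:C * levy_ker w x.
Proof.
move=> w0; have h := one_sub_neq0 x w0.
have h2 : (1 + x ^+ 2)%:C != 0 :> R[i].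
  by rewrite fmorph_eq0 gt_eqF// ltr_pwDl// sqr_ge0.
rewrite /levy_ker !rmorphM !fmorphV/= in h2 *.
move: h2; rewrite rmorphD rmorph1 rmorphXn/=; move: (x%:C) h => X h h2.
by field; rewrite h h2.
Qed.

Lemma nsq_levy_ker w x : Im w != 0 ->
  nsq (levy_ker w x) <= 2 * (1 + nsq w) ^+ 2 / Im w ^+ 2.
Proof.
move=> w0; have i0 : 0 < Im w ^+ 2 by rewrite exprn_even_gt0.
have d0 : 0 < nsq (1 - x%:C * w) by rewrite nsq_gt0 one_sub_neq0.
rewrite /levy_ker nsqM nsqV ler_pdivrMr// mulrAC ler_pdivlMr//.
have n1 : nsq (w + x%:C) <= 2 * (1 + nsq w) * (1 + x ^+ 2).
  rewrite -subr_ge0 /nsq ReD ImD Re_real Im_real addr0.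
  have -> : 2 * (1 + (Re w ^+ 2 + Im w ^+ 2)) * (1 + x ^+ 2) - ((Re w + x) ^+ 2 + Im w ^+ 2) =
    (Re w - x) ^+ 2 + Im w ^+ 2 + 2 + 2 * (Re w ^+ 2 + Im w ^+ 2) * x ^+ 2 by ring.
  by rewrite !addr_ge0 ?sqr_ge0// mulr_ge0 ?sqr_ge0// mulr_ge0// addr_ge0 ?sqr_ge0.
apply: (le_trans (ler_wpM2r (ltW i0) n1)).
have -> : 2 * (1 + nsq w) * (1 + x ^+ 2) * Im w ^+ 2 =
  2 * (1 + nsq w) * (Im w ^+ 2 * (1 + x ^+ 2)) by ring.
apply: (le_trans (ler_wpM2l _ (nsq_one_sub_ge x w))).
  by rewrite mulr_ge0// addr_ge0// nsq_ge0.
by rewrite expr2 !mulrA.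
Qed.

Lemma abs_le_sqr (a b : R) : a ^+ 2 <= b -> `|a| <= 1 + b.
Proof. by move=> h; have := real_normK (num_real a); nra. Qed.

Lemma continuous_ReIm (f : R -> R[i]) (p q r s : R -> R) :
  continuous p -> continuous q -> continuous r -> continuous s ->
  (forall x, r x ^+ 2 + s x ^+ 2 != 0) ->
  (forall x, f x = (p x +i* q x) / (r x +i* s x)) ->
  continuous (fun x => Re (f x)) /\ continuous (fun x => Im (f x)).
Proof.
move=> cp cq cr cs rs fE.
have cN : continuous (fun x => (r x ^+ 2 + s x ^+ 2)^-1).
  move=> x; apply: cvgV; first exact: rs.
  by apply: cvgD; apply: cvgM; [exact: cr|exact: cr|exact: cs|exact: cs].
have -> : (fun x => Re (f x)) = (fun x => (p x * r x + q x * s x) * (r x ^+ 2 + s x ^+ 2)^-1).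
  by apply/funext => x; rewrite fE ReM ReV ImV /nsq /=; ring.
have -> : (fun x => Im (f x)) = (fun x => (q x * r x - p x * s x) * (r x ^+ 2 + s x ^+ 2)^-1).
  by apply/funext => x; rewrite fE ImM ReV ImV /nsq /=; ring.
split => x; (apply: cvgM; last exact: cN).
- by apply: cvgD; apply: cvgM; [exact: cp|exact: cr|exact: cq|exact: cs].
- by apply: cvgB; apply: cvgM; [exact: cq|exact: cr|exact: cp|exact: cs].
Qed.

Lemma continuous_lin (a b : R) : continuous (fun x => a + b * x).
Proof. by move=> x; apply: cvgD; [exact: cvg_cst|apply: cvgM; [exact: cvg_cst|exact: cvg_id]]. Qed.

Lemma bc_levy_ker w : Im w != 0 ->
  bounded_continuous (fun x => Re (levy_ker w x)) /\
  bounded_continuous (fun x => Im (levy_ker w x)).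
Proof.
move=> w0.
have dE x : 1 - x%:C * w = @Complex R (1 + (- Re w) * x) (0 + (- Im w) * x).
  by apply: complex_eq; rewrite !ReImE; ring.
have nE x : w + x%:C = @Complex R (Re w + 1 * x) (Im w + 0 * x).
  by apply: complex_eq; rewrite !ReImE; ring.
have d0 x : (1 + (- Re w) * x) ^+ 2 + (0 + (- Im w) * x) ^+ 2 != 0.
  by have := one_sub_neq0 x w0; rewrite dE -nsq_eq0.
have fE x : levy_ker w x = (@Complex R (Re w + 1 * x) (Im w + 0 * x)) /
    (@Complex R (1 + (- Re w) * x) (0 + (- Im w) * x)) by rewrite /levy_ker nE dE.
have [c1 c2] := continuous_ReIm (@continuous_lin _ _) (@continuous_lin _ _)
  (@continuous_lin _ _) (@continuous_lin _ _) d0 fE.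
have bd x := nsq_levy_ker x w0.
by split; split => //; exists (1 + 2 * (1 + nsq w) ^+ 2 / Im w ^+ 2) => x;
  apply: abs_le_sqr; apply: le_trans (bd x); rewrite /nsq ?lerDl ?lerDr sqr_ge0.
Qed.

Definition resolvent z x : R[i] := (z - x%:C)^-1.

Lemma nsq_resolvent z x : Im z != 0 -> nsq (resolvent z x) <= (Im z ^+ 2)^-1.
Proof.
move=> z0; have z2 : 0 < Im z ^+ 2 by rewrite exprn_even_gt0.
rewrite /resolvent nsqV lef_pV2 ?posrE//.
  by rewrite /nsq ImD ImN Im_real subr0 lerDr sqr_ge0.
by apply: (lt_le_trans z2); rewrite /nsq ImD ImN Im_real subr0 lerDr sqr_ge0.
Qed.

Lemma bc_resolvent z : Im z != 0 ->
  bounded_continuous (fun x => Re (resolvent z x)) /\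
  bounded_continuous (fun x => Im (resolvent z x)).
Proof.
move=> z0.
have fE x : resolvent z x = (@Complex R (1 + 0 * x) (0 + 0 * x)) /
    (@Complex R (Re z + (- 1) * x) (Im z + 0 * x)).
  rewrite /resolvent -[LHS]mul1r; congr (_ / _).
    by apply: complex_eq; rewrite ?ReImE; ring.
  by apply: complex_eq; rewrite !ReImE; ring.
have d0 x : (Re z + (- 1) * x) ^+ 2 + (Im z + 0 * x) ^+ 2 != 0.
  by rewrite gt_eqF// mul0r addr0 ltr_wpDl ?sqr_ge0// exprn_even_gt0.
have [c1 c2] := continuous_ReIm (@continuous_lin _ _) (@continuous_lin _ _)
  (@continuous_lin _ _) (@continuous_lin _ _) d0 fE.
have bd x := nsq_resolvent x z0.
by split; split => //; exists (1 + (Im z ^+ 2)^-1) => x;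
  apply: abs_le_sqr; apply: le_trans (bd x); rewrite /nsq ?lerDl ?lerDr sqr_ge0.
Qed.

End levy_kernel.

Section positive_integral.
Context d (T : measurableType d) (R : realType) (P : probability T R).

Lemma Rintegral_eq0_ae (f : T -> R) : P.-integrable setT (EFin \o f) ->
  (forall x, 0 <= f x) -> \int[P]_x f x = 0 -> {ae P, forall x, f x = 0}.
Proof.
move=> fi f0 h; have mf := measurable_int _ fi.
have h0 : (\int[P]_x `|(f x)%:E| = 0)%E.
  under eq_integral do rewrite gee0_abs ?lee_fin//.
  by rewrite -(fineK (integrable_fin_num measurableT fi)); rewrite /Rintegral in h; rewrite h.
have := (ae_eq_integral_abs P measurableT mf).1 h0.
by case=> N [mN N0 sN]; exists N; split=> // x fx; apply: sN => /(_ I) [].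
Qed.

Lemma Rintegral_gt0 (f : T -> R) : P.-integrable setT (EFin \o f) ->
  (forall x, 0 < f x) -> 0 < \int[P]_x f x.
Proof.
move=> fi f0; rewrite lt_neqAle Rintegral_ge0 ?andbT; last by move=> x _; exact: ltW.
apply/eqP => /esym h; have [N [mN N0 sN]] := Rintegral_eq0_ae fi (fun x => ltW (f0 x)) h.
have NT : N = setT.
  by apply/seteqP; split=> // x _; apply: sN => fx; have := f0 x; rewrite fx ltxx.
by move: N0; rewrite NT probability_setT => /eqP; rewrite onee_eq0.
Qed.

End positive_integral.

Section cauchy_levy.
Variable R : realType.
Notation Re := complex.Re.
Notation Im := complex.Im.
Notation normc := (@Normc.normc R).

(* [kap = 1/k] serves the [k]-th roots for free convolution. *)
Definition levy_data (s : nat -> seq R) (kap c : R)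
    (Sigma : {finite_measure set (measurableTypeR R) -> \bar R}) : Prop :=
  (fun n => (\sum_(x <- s n) x / (1 + x ^+ 2)) / n%:R) @ \oo --> kap * c /\
  forall phi : R -> R, bounded_continuous phi ->
    (fun n => (\sum_(x <- s n) x ^+ 2 / (1 + x ^+ 2) * phi x) / n%:R) @ \oo -->
      kap * \int[Sigma]_x phi x.

Lemma normc_le_ReIm (w : R[i]) : normc w <= `|Re w| + `|Im w|.
Proof.
rewrite normc_le ?addr_ge0// sqrrD !real_normK ?num_real// /nsq.
by rewrite addrAC lerDl mulrn_wge0// mulr_ge0.
Qed.

Lemma Im_cauchy_lt0 (mu : probability (measurableTypeR R) R) (z : R[i]) :
  0 < Im z -> Im (cauchy_transform mu z) < 0.
Proof.
move=> z0; have zn0 : Im z != 0 by rewrite gt_eqF.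
have [_ [cI [M hM]]] := bc_resolvent zn0.
have iI : mu.-integrable setT (EFin \o (fun x => Im (resolvent z x))).
  by apply: (@integrable_bounded _ _ _ mu _ M) => //; exact: continuous_measurable_fun.
rewrite /cauchy_transform /cintegral /= -[ltLHS]opprK oppr_lt0.
have -> : - (\int[mu]_x Im (resolvent z x)) = \int[mu]_x (-1 * Im (resolvent z x)).
  by rewrite RintegralZl// mulN1r.
apply: Rintegral_gt0.
  apply: (@integrable_bounded _ _ _ mu _ M).
    apply: measurable_funM; first exact: measurable_cst.
    exact: continuous_measurable_fun.
  by move=> x; rewrite mulN1r normrN.
move=> x; rewrite /resolvent ImV ImD ImN Im_real subr0 mulN1r opprK divr_gt0//.
apply: (@lt_le_trans _ _ (Im z ^+ 2)); first by rewrite exprn_gt0.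
by rewrite /nsq ImD ImN Im_real subr0 lerDr sqr_ge0.
Qed.

(** In the exact identity for finite [n], the points [t p / n] all lie within [e n] of [G].
    Replacing them by [G] costs at most [W n * (e n / k0)], and what remains is a sum of the kind
    that [levy_data] controls. *)
Lemma cauchy_levy_eq (s u : nat -> seq R) (kap c : R)
    (Sigma : {finite_measure set (measurableTypeR R) -> \bar R})
    (mu : probability (measurableTypeR R) R) :
  (forall n, (0 < n)%N -> all (>= 0) (s n)) ->
  (forall n, (0 < n)%N -> [/\ all (>= 0) (u n), size (u n) = n &
    rooted (u n) = appell n [seq x / n%:R | x <- s n]]) ->
  levy_data s kap c Sigma ->
  (forall g : R -> R, bounded_continuous g ->
    (fun n => avg (u n) g) @ \oo --> \int[mu]_x g x) ->
  forall z : R[i], 0 < Im z ->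
    (cauchy_transform mu z)^-1 + kap%:C * levy_R c Sigma (cauchy_transform mu z) = z.
Proof.
move=> s0 u0 [hdata1 hdata2] hmu z z0.
have zn0 : Im z != 0 by rewrite gt_eqF.
have zi0 : 0 < (Im z)^-1 by rewrite invr_gt0.
set G := cauchy_transform mu z.
have G0 : Im G < 0 := Im_cauchy_lt0 mu z0.
have Gn0 : Im G != 0 by rewrite lt_eqF.
have [bcR bcI] := bc_resolvent zn0.
have [kR kI] := bc_levy_ker Gn0.
pose Gn n : R[i] := (n%:R^-1)%:C * logder (u n) z.
have GnRe : (fun n => Re (Gn n)) @ \oo --> Re G.
  apply: cvg_trans (hmu _ bcR); apply: near_eq_cvg; near=> n.
  have n0 : (0 < n)%N by near: n; exact: nbhs_infty_gt.
  have [_ su _] := u0 n n0.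
  by rewrite /Gn ReM Im_real mul0r subr0 Re_real /avg su /logder Re_sum mulrC.
have GnIm : (fun n => Im (Gn n)) @ \oo --> Im G.
  apply: cvg_trans (hmu _ bcI); apply: near_eq_cvg; near=> n.
  have n0 : (0 < n)%N by near: n; exact: nbhs_infty_gt.
  have [_ su _] := u0 n n0.
  by rewrite /Gn ImM Im_real mul0r addr0 Re_real /avg su /logder Im_sum mulrC.
pose dn n := `|Re (Gn n) - Re G| + `|Im (Gn n) - Im G|.
have dn0 : dn @ \oo --> (0 : R).
  have -> : (0 : R) = `|Re G - Re G| + `|Im G - Im G| by rewrite !subrr normr0 addr0.
  by apply: cvgD; apply: cvg_norm; apply: cvgB => //; exact: cvg_cst.
pose e n : R := n%:R^-1 / Im z + dn n.
have invn : (fun n => n%:R^-1 : R) @ \oo --> (0 : R).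
  by rewrite -cvg_shiftS; exact: cvg_harmonic.
have e0 : e @ \oo --> (0 : R).
  have h : (fun n => n%:R^-1 * (Im z)^-1 : R) @ \oo --> (0 : R) * (Im z)^-1.
    by apply: cvgM => //; exact: cvg_cst.
  by rewrite -[X in _ --> X]addr0; apply: cvgD => //; move: h; rewrite mul0r.
(* Lower bound of [|1 - x w|^2 / (1 + x^2)] for all [w] close to [G]: there [|Im w|] is at least
   half of [|Im G|] and [|w| <= |G| + 1]. *)
pose k0 := Im G ^+ 2 / 4 / (1 + (normc G + 1) ^+ 2).
have k1 : 0 < 1 + (normc G + 1) ^+ 2 by rewrite ltr_pwDl// sqr_ge0.
have k00 : 0 < k0 by rewrite /k0 !divr_gt0// exprn_even_gt0.
have lower x w : normc (w - G) <= 1 -> normc (w - G) <= - Im G / 2 ->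
    k0 * (1 + x ^+ 2) <= nsq (1 - x%:C * w).
  move=> w1 w2.
  have hI : Im G ^+ 2 / 4 <= Im w ^+ 2.
    have h1 : `|Im w - Im G| <= - Im G / 2.
      by apply: le_trans w2; have := Im_le_normc (w - G); rewrite ImD ImN.
    move: h1; rewrite ler_norml => /andP[_ h1]; move: G0 h1; nra.
  have hn : nsq w <= (normc G + 1) ^+ 2.
    rewrite -normc_le; last by rewrite addr_ge0// normc_ge0.
    rewrite -[w](subrK G) (le_trans (le_normcD _ _))// addrC lerD2l//.
  have hw : 0 < 1 + nsq w by rewrite ltr_pwDl// nsq_ge0.
  have := nsq_one_sub_ge x w.
  have x2 : 0 <= 1 + x ^+ 2 by rewrite addr_ge0// sqr_ge0.
  move=> h; rewrite /k0 mulrAC ler_pdivrMr//.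
  apply: (le_trans (ler_wpM2r x2 hI)); apply: (le_trans h).
  by rewrite mulrC ler_wpM2l ?nsq_ge0// lerD2l.
have GG : normc (G - G) = 0 by rewrite subrr Normc.normc0.
pose L n : R[i] := (n%:R^-1)%:C * \sum_(x <- s n) x%:C / (1 - x%:C * G).
pose W n : R := (\sum_(x <- s n) x ^+ 2 / (1 + x ^+ 2) * 1) / n%:R.
have Wc : W @ \oo --> kap * \int[Sigma]_x (fun=> 1) x.
  by apply: hdata2; split; [move=> x; exact: cvg_cst|exists 1 => x; rewrite normr1].
pose E n : R[i] := (Gn n)^-1 + L n - z.
have bound : \forall n \near \oo, normc (E n) <= W n * (e n / k0).
  have m0 : 0 < Num.min 1 (- Im G / 2) by rewrite lt_min ltr01 divr_gt0// oppr_gt0.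
  have /cvgr_lt/(_ _ m0) hev := e0.
  near=> n.
  have n0 : (0 < n)%N by near: n; exact: nbhs_infty_gt.
  have nR : 0 < n%:R :> R by rewrite ltr0n.
  have nC : (n%:R : R)%:C != 0 :> R[i] by rewrite fmorph_eq0 gt_eqF.
  have en : e n < Num.min 1 (- Im G / 2) by near: n.
  have [un0 su eu] := u0 n n0.
  have a0 : all (>= 0) [seq x / n%:R | x <- s n].
    apply/allP => _ /mapP[x xs ->]; apply: divr_ge0 => //.
    exact: (allP (s0 n n0)).
  have [t [ht hz]] := appell_cauchy n0 a0 z0 su un0 eu.
  set a := [seq x / n%:R | x <- s n] in ht hz a0 *.
  pose g p := (n%:R^-1)%:C * t p.
  have gG p : p \in splits a -> normc (g p - G) <= e n.
    move=> pa; rewrite -(subrKA (Gn n)); apply: (le_trans (le_normcD _ _)).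
    apply: lerD.
      rewrite /g /Gn -mulrBr Normc.normcM ler_pM ?normc_ge0 ?ht//.
      by rewrite normc_sqrt /nsq /= expr0n addr0 sqrtr_sqr ger0_norm// invr_ge0.
    apply: (le_trans (normc_le_ReIm _)).
    by rewrite ReD ImD ReN ImN.
  pose X (p : R * seq R) : R := n%:R * p.1.
  have LE : L n = (n%:R^-1)%:C * \sum_(p <- splits a) (X p)%:C / (1 - (X p)%:C * G).
    congr (_ * _); transitivity (\sum_(b <- a) (n%:R * b)%:C / (1 - (n%:R * b)%:C * G)).
      rewrite /a big_map; apply: eq_bigr => x _.
      by have -> : n%:R * (x / n%:R) = x by rewrite mulrC divfK// gt_eqF.
    by rewrite -[in LHS](map_fst_splits a) big_map.
  have zE : z = (Gn n)^-1 + (n%:R^-1)%:C * \sum_(p <- splits a) (X p)%:C / (1 - (X p)%:C * g p).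
    rewrite {1}hz; congr (_ + _).
      by rewrite /Gn invfM fmorphV/= invrK rmorph_nat.
    rewrite mulr_sumr; apply: eq_bigr => p _.
    have -> : (X p)%:C * g p = p.1%:C * t p.
      rewrite /X /g [(_ * _)%:C]rmorphM [(_^-1)%:C]fmorphV/=.
      by move: (n%:R%:C) nC => N N0; field.
    rewrite /X [(_ * p.1)%:C]rmorphM [(_^-1)%:C]fmorphV/=.
    by move: (n%:R%:C) nC (_ - _) => N N0 D; rewrite -[N * _ / D]mulrA mulKf.
  have EE : E n = (n%:R^-1)%:C * \sum_(p <- splits a)
      ((X p)%:C / (1 - (X p)%:C * G) - (X p)%:C / (1 - (X p)%:C * g p)).
    by rewrite /E {1}zE LE sumrB mulrBr; ring.
  rewrite EE Normc.normcM.
  have -> : normc (n%:R^-1)%:C = n%:R^-1.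
    by rewrite normc_sqrt /nsq /= expr0n addr0 sqrtr_sqr ger0_norm// invr_ge0.
  have -> : W n = n%:R^-1 * \sum_(p <- splits a) (X p) ^+ 2 / (1 + (X p) ^+ 2).
    rewrite /W mulrC; congr (_ * _).
    transitivity (\sum_(b <- a) (n%:R * b) ^+ 2 / (1 + (n%:R * b) ^+ 2)).
      rewrite /a big_map; apply: eq_bigr => x _.
      by rewrite mulr1 [n%:R * _]mulrC divfK// gt_eqF.
    by rewrite -[in LHS](map_fst_splits a) big_map.
  rewrite -mulrA ler_pM2l ?invr_gt0// mulr_suml.
  apply: (le_trans (normc_sum _ _)); rewrite big_seq [leRHS]big_seq.
  apply: ler_sum => p pa; have gp := gG p pa.
  have [e1 e2] : e n <= 1 /\ e n <= - Im G / 2 by move: en; rewrite lt_min => /andP[/ltW ? /ltW].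
  set x := X p.
  have lA : k0 * (1 + x ^+ 2) <= nsq (1 - x%:C * G).
    apply: lower; rewrite GG// divr_ge0// oppr_ge0 ltW//.
  have lB : k0 * (1 + x ^+ 2) <= nsq (1 - x%:C * g p).
    by apply: lower; apply: le_trans gp _.
  have x20 : 0 < 1 + x ^+ 2 by rewrite ltr_pwDl// sqr_ge0.
  have kx0 : 0 < k0 * (1 + x ^+ 2) by rewrite mulr_gt0.
  have A0 : 1 - x%:C * G != 0 by rewrite -nsq_gt0 (lt_le_trans kx0).
  have B0 : 1 - x%:C * g p != 0 by rewrite -nsq_gt0 (lt_le_trans kx0).
  have -> : x%:C / (1 - x%:C * G) - x%:C / (1 - x%:C * g p) =
      x%:C ^+ 2 * (- (g p - G)) / ((1 - x%:C * G) * (1 - x%:C * g p)).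
    by move: (x%:C) (g p) A0 B0 => y h A0 B0; field; rewrite A0 B0.
  rewrite 2!Normc.normcM Normc.normcV normcN.
  have -> : normc (x%:C ^+ 2) = x ^+ 2.
    rewrite normc_sqrt nsqX /nsq /= expr0n addr0.
    by rewrite sqrtr_sqr ger0_norm// sqr_ge0.
  have hAB : k0 * (1 + x ^+ 2) <= normc ((1 - x%:C * G) * (1 - x%:C * g p)).
    rewrite -(@ler_pXn2r _ 2)// ?nnegrE ?normc_ge0 ?(ltW kx0)//.
    by rewrite sqr_normc_nsq nsqM expr2 ler_pM// ltW.
  rewrite ler_pdivrMr ?(lt_le_trans kx0)//.
  have -> : x ^+ 2 / (1 + x ^+ 2) * (e n / k0) * normc ((1 - x%:C * G) * (1 - x%:C * g p)) =
     x ^+ 2 * e n * (normc ((1 - x%:C * G) * (1 - x%:C * g p)) / (k0 * (1 + x ^+ 2))).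
    by field; rewrite !gt_eqF.
  have en0 : 0 <= e n by apply: le_trans gp; exact: normc_ge0.
  apply: (@le_trans _ _ (x ^+ 2 * e n)); first by rewrite ler_wpM2l ?sqr_ge0.
  apply: ler_peMr; first by apply: mulr_ge0 => //; exact: sqr_ge0.
  by rewrite ler_pdivlMr// mul1r.
have Ec : (fun n => normc (E n)) @ \oo --> (0 : R).
  apply: (@squeeze_cvgr _ _ _ _ (fun=> 0) (fun n => W n * (e n / k0))).
  - by apply: filterS bound => n ->; rewrite normc_ge0.
  - exact: cvg_cst.
  - rewrite -(mulr0 (kap * \int[Sigma]_x (fun=> 1) x)) -(mul0r k0^-1).
    by apply: cvgM => //; apply: cvgM => //; exact: cvg_cst.
(* [F] stands for the real or the imaginary part, both additive and homogeneous over the reals. *)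
have LRI (F : R[i] -> R) (FD : forall v w, F (v + w) = F v + F w)
    (FZ : forall (r : R) w, F (r%:C * w) = r * F w) (l : R) :
    (fun n => (\sum_(x <- s n) x ^+ 2 / (1 + x ^+ 2) * F (levy_ker G x)) / n%:R) @ \oo --> kap * l ->
    (fun n => F (L n)) @ \oo --> kap * (F c%:C + l).
  move=> hl.
  have F0 : F 0 = 0 by have := FZ 0 0; rewrite mulr0 mul0r.
  have Fc (r : R) : F r%:C = r * F 1 by rewrite -FZ mulr1.
  have -> : (fun n => F (L n)) = (fun n => F 1 * ((\sum_(x <- s n) x / (1 + x ^+ 2)) / n%:R) +
      (\sum_(x <- s n) x ^+ 2 / (1 + x ^+ 2) * F (levy_ker G x)) / n%:R).
    apply/funext => n; rewrite /L FZ.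
    have -> : F (\sum_(x <- s n) x%:C / (1 - x%:C * G)) =
        \sum_(x <- s n) (x / (1 + x ^+ 2) * F 1 + x ^+ 2 / (1 + x ^+ 2) * F (levy_ker G x)).
      elim: (s n) => [|x r IH]; first by rewrite !big_nil.
      by rewrite !big_cons FD IH levy_kerE// FD FZ Fc.
    by rewrite big_split/= -mulr_suml; ring.
  rewrite mulrDr; apply: cvgD => //.
  by rewrite Fc mulrA mulrC; apply: cvgM => //; exact: cvg_cst.
have ReZ (r : R) w : Re (r%:C * w) = r * Re w by rewrite ReM Im_real mul0r subr0.
have ImZ (r : R) w : Im (r%:C * w) = r * Im w by rewrite ImM Im_real mul0r addr0.
have LRe := LRI (@complex.Re R) (@ReD R) ReZ _ (hdata2 _ kR).
have LIm := LRI (@complex.Im R) (@ImD R) ImZ _ (hdata2 _ kI).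
have nG : nsq G != 0 by rewrite nsq_eq0; apply: contraNneq Gn0 => ->.
have nGn : (fun n => nsq (Gn n)) @ \oo --> nsq G by apply: cvgD; apply: cvgM.
have ERe : (fun n => Re (E n)) @ \oo -->
    Re G / nsq G + kap * (Re c%:C + \int[Sigma]_x Re (levy_ker G x)) - Re z.
  have -> : (fun n => Re (E n)) = (fun n => Re (Gn n) / nsq (Gn n) + Re (L n) - Re z).
    by apply/funext => n; rewrite /E !ReD ReN ReV.
  apply: cvgB; last exact: cvg_cst.
  by apply: cvgD => //; apply: cvgM => //; exact: cvgV.
have EIm : (fun n => Im (E n)) @ \oo -->
    - (Im G / nsq G) + kap * (Im c%:C + \int[Sigma]_x Im (levy_ker G x)) - Im z.
  have -> : (fun n => Im (E n)) = (fun n => - (Im (Gn n) / nsq (Gn n)) + Im (L n) - Im z).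
    by apply/funext => n; rewrite /E !ImD ImN ImV.
  apply: cvgB; last exact: cvg_cst.
  by apply: cvgD => //; apply: cvgN; apply: cvgM => //; exact: cvgV.
have F0 (F : R[i] -> R) (l : R) : (forall w, `|F w| <= normc w) ->
    (fun n => F (E n)) @ \oo --> l -> l = 0.
  move=> Fle Fl; suff F0 : (fun n => F (E n)) @ \oo --> (0 : R).
    exact: (cvg_unique _ Fl F0).
  by apply: norm_cvg0; apply: (@squeeze_cvgr _ _ _ _ (fun=> 0) (fun n => normc (E n))) => //;
    [apply: nearW => n; rewrite normr_ge0 Fle|exact: cvg_cst].
have zRe := F0 (@complex.Re R) _ (@Re_le_normc R) ERe.
have zIm := F0 (@complex.Im R) _ (@Im_le_normc R) EIm.
apply: complex_eq.
- rewrite ReD ReV ReM Im_real mul0r subr0 Re_real /levy_R ReD.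
  by apply/eqP; rewrite -subr_eq0; apply/eqP.
- rewrite ImD ImV ImM Im_real mul0r addr0 Re_real /levy_R ImD.
  by apply/eqP; rewrite -subr_eq0; apply/eqP.
Unshelve. all: by end_near. Qed.

End cauchy_levy.

(** * R-transforms *)

Section levy_inverse.
Variable R : realType.
Implicit Types (u z : R[i]) (x : R).
Notation Re := complex.Re.
Notation Im := complex.Im.
Variables (kap c : R) (Sigma : {finite_measure set (measurableTypeR R) -> \bar R}).
Hypothesis kap0 : 0 <= kap.

(** At [u = 1 / z] this is [(1 + x^2) / |z - x|^2]. Comparing [kap] times its integral with 1
    decides on which side of the real axis [levy_inv u] lies. *)
Definition levy_weight u x : R := (1 + x ^+ 2) * (nsq u / nsq (1 - x%:C * u)).

Lemma Im_levy_ker u x : Im u != 0 -> Im (levy_ker u x) * nsq u = Im u * levy_weight u x.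
Proof.
move=> u0; rewrite /levy_ker /levy_weight ImM ReV ImV.
have d0 : nsq (1 - x%:C * u) != 0 by rewrite nsq_eq0 one_sub_neq0.
by move: d0; rewrite /nsq !ReImE => d0; field; move: d0; rewrite !mul0r !addr0 !subr0 !add0r.
Qed.

Lemma integrable_ReIm_ker u : Im u != 0 ->
  Sigma.-integrable setT (EFin \o (fun x => Re (levy_ker u x))) /\
  Sigma.-integrable setT (EFin \o (fun x => Im (levy_ker u x))).
Proof.
move=> u0; have [[c1 [M1 h1]] [c2 [M2 h2]]] := bc_levy_ker u0.
split; [apply: (@integrable_bounded _ _ _ Sigma _ M1)|apply: (@integrable_bounded _ _ _ Sigma _ M2)] => //;
  exact: continuous_measurable_fun.
Qed.

Lemma levy_weightE u x : Im u != 0 -> levy_weight u x = nsq u / Im u * Im (levy_ker u x).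
Proof.
move=> u0; have := Im_levy_ker x u0 => h.
by apply: (mulfI u0); rewrite -h; field.
Qed.

Lemma integrable_levy_weight u : Im u != 0 ->
  Sigma.-integrable setT (EFin \o levy_weight u).
Proof.
move=> u0; have [_ i2] := integrable_ReIm_ker u0.
have -> : levy_weight u = (fun x => nsq u / Im u * Im (levy_ker u x)).
  by apply/funext => x; exact: levy_weightE.
rewrite (_ : _ \o _ = fun x => ((nsq u / Im u)%:E * (Im (levy_ker u x))%:E)%E)//.
exact: integrableZl.
Qed.

(** The candidate inverse [R(u) + 1/u] of the Cauchy transform, with [R] equal to
    [kap * levy_R c Sigma]. *)
Definition levy_inv u : R[i] := kap%:C * levy_R c Sigma u + u^-1.

Lemma Re_levy_R u : Re (levy_R c Sigma u) = c + \int[Sigma]_x Re (levy_ker u x).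
Proof. by rewrite /levy_R ReD Re_real. Qed.

Lemma Im_levy_R u : Im (levy_R c Sigma u) = \int[Sigma]_x Im (levy_ker u x).
Proof. by rewrite /levy_R ImD Im_real add0r. Qed.

Lemma Im_levy_inv u : Im u != 0 ->
  Im (levy_inv u) = - (Im u / nsq u) * (1 - kap * \int[Sigma]_x levy_weight u x).
Proof.
move=> u0; have nu : nsq u != 0 by rewrite nsq_eq0; apply: contraNneq u0 => ->.
have [_ i2] := integrable_ReIm_ker u0.
rewrite /levy_inv ImD ImM Im_real mul0r addr0 Re_real ImV Im_levy_R.
have -> : \int[Sigma]_x levy_weight u x = nsq u / Im u * \int[Sigma]_x Im (levy_ker u x).
  by rewrite -RintegralZl//; apply: eq_Rintegral => x _; exact: levy_weightE.
by field; rewrite nu u0.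
Qed.

Lemma Im_levy_inv_gt0 u : Im u < 0 ->
  (0 < Im (levy_inv u)) = (kap * \int[Sigma]_x levy_weight u x < 1).
Proof.
move=> u0; have un0 : Im u != 0 by rewrite lt_eqF.
rewrite Im_levy_inv// pmulr_rgt0 ?subr_gt0//.
by rewrite oppr_gt0 pmulr_llt0// invr_gt0 nsq_gt0; apply: contraNneq un0 => ->.
Qed.

Lemma Re_mul_le (a b : R[i]) : Re (a * b) <= (nsq a + nsq b) / 2.
Proof.
rewrite ler_pdivlMr// -subr_ge0 ReM /nsq.
have -> : Re a ^+ 2 + Im a ^+ 2 + (Re b ^+ 2 + Im b ^+ 2) - (Re a * Re b - Im a * Im b) * 2
  = (Re a - Re b) ^+ 2 + (Im a + Im b) ^+ 2 by ring.
by rewrite addr_ge0// sqr_ge0.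
Qed.

(* If [H u = H v] with [u <> v] then dividing by [u - v] gives
   [kap * int (1 + x^2) u v / ((1 - x u)(1 - x v)) = 1], which is excluded
   by the positivity of [Im (H u)] and [Im (H v)] and by AM-GM. *)
Lemma levy_inv_inj u v : Im u < 0 -> Im v < 0 -> 0 < Im (levy_inv u) ->
  levy_inv u = levy_inv v -> u = v.
Proof.
move=> u0 v0 hu huv; have hv : 0 < Im (levy_inv v) by rewrite -huv.
have un0 : Im u != 0 by rewrite lt_eqF.
have vn0 : Im v != 0 by rewrite lt_eqF.
have uz : u != 0 by apply: contraNneq un0 => ->.
have vz : v != 0 by apply: contraNneq vn0 => ->.
move: hu hv; rewrite !Im_levy_inv_gt0// => hu hv.
apply/eqP/negPn/negP => uv.
have uv0 : u - v != 0 by rewrite subr_eq0.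
pose k := u * v / (u - v).
have [iu1 iu2] := integrable_ReIm_ker un0; have [iv1 iv2] := integrable_ReIm_ker vn0.
have e1 : kap%:C * (k * (levy_R c Sigma u - levy_R c Sigma v)) = 1.
  have : kap%:C * (levy_R c Sigma u - levy_R c Sigma v) = v^-1 - u^-1.
    move: huv; rewrite /levy_inv => h.
    rewrite mulrBr; move: h; move: (kap%:C * levy_R c Sigma u) (kap%:C * levy_R c Sigma v).
    move=> A B h; have -> : A = B + v^-1 - u^-1 by rewrite -h addrK.
    ring.
  by rewrite mulrCA => ->; rewrite /k; field; rewrite uz vz uv0.
have iB1 : Sigma.-integrable setT (EFin \o (fun x => Re (levy_ker u x) - Re (levy_ker v x))).
  rewrite (_ : _ \o _ = fun x => ((Re (levy_ker u x))%:E - (Re (levy_ker v x))%:E)%E)//.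
  exact: integrableB.
have iB2 : Sigma.-integrable setT (EFin \o (fun x => Im (levy_ker u x) - Im (levy_ker v x))).
  rewrite (_ : _ \o _ = fun x => ((Im (levy_ker u x))%:E - (Im (levy_ker v x))%:E)%E)//.
  exact: integrableB.
have iZ1 (r : R) : Sigma.-integrable setT (EFin \o (fun x => r * (Re (levy_ker u x) - Re (levy_ker v x)))).
  rewrite (_ : _ \o _ = fun x => (r%:E * (Re (levy_ker u x) - Re (levy_ker v x))%:E)%E)//.
  exact: integrableZl.
have iZ2 (r : R) : Sigma.-integrable setT (EFin \o (fun x => r * (Im (levy_ker u x) - Im (levy_ker v x)))).
  rewrite (_ : _ \o _ = fun x => (r%:E * (Im (levy_ker u x) - Im (levy_ker v x))%:E)%E)//.
  exact: integrableZl.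
have e2 : kap * \int[Sigma]_x Re (k * (levy_ker u x - levy_ker v x)) = 1.
  have := congr1 (fun w => Re w) e1.
  rewrite ReM Im_real mul0r subr0 Re_real Re1 => <-; congr (_ * _).
  rewrite ReM ReD ImD ReN ImN !Re_levy_R !Im_levy_R.
  have -> : c + \int[Sigma]_x Re (levy_ker u x) - (c + \int[Sigma]_x Re (levy_ker v x)) =
    \int[Sigma]_x (Re (levy_ker u x) - Re (levy_ker v x)) by rewrite RintegralB//; ring.
  rewrite -RintegralB// -!RintegralZl// -RintegralB//.
  by apply: eq_Rintegral => x _; rewrite ReM ReD ImD ReN ImN.
have iw := integrable_levy_weight un0; have iw' := integrable_levy_weight vn0.
have iE : Sigma.-integrable setT (EFin \o (fun x => Re (k * (levy_ker u x - levy_ker v x)))).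
  rewrite (_ : _ \o _ = fun x => ((Re k * (Re (levy_ker u x) - Re (levy_ker v x)))%:E
     - (Im k * (Im (levy_ker u x) - Im (levy_ker v x)))%:E)%E); first exact: (integrableB measurableT (iZ1 _) (iZ2 _)).
  by apply/funext => x /=; rewrite ReM ReD ImD ReN ImN.
have iD : Sigma.-integrable setT (EFin \o (fun x => levy_weight u x + levy_weight v x)).
  rewrite (_ : _ \o _ = fun x => ((levy_weight u x)%:E + (levy_weight v x)%:E)%E)//.
  exact: integrableD.
have iH : Sigma.-integrable setT (EFin \o (fun x => 2^-1 * (levy_weight u x + levy_weight v x))).
  rewrite (_ : _ \o _ = fun x => ((2^-1)%:E * (levy_weight u x + levy_weight v x)%:E)%E)//.
  exact: integrableZl.
have le1 : \int[Sigma]_x Re (k * (levy_ker u x - levy_ker v x)) <=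
    2^-1 * (\int[Sigma]_x levy_weight u x + \int[Sigma]_x levy_weight v x).
  rewrite -RintegralD// -RintegralZl//; apply: le_Rintegral => // x _.
  have du := one_sub_neq0 x un0; have dv := one_sub_neq0 x vn0.
  have -> : k * (levy_ker u x - levy_ker v x) =
      (1 + x ^+ 2)%:C * ((u / (1 - x%:C * u)) * (v / (1 - x%:C * v))).
    rewrite /k /levy_ker rmorphD rmorph1 rmorphXn/=.
    by move: (x%:C) du dv => y du dv; field; rewrite uv0 du dv.
  rewrite ReM Im_real mul0r subr0 Re_real /levy_weight -mulrDr [leRHS]mulrCA.
  apply: ler_wpM2l; first by rewrite addr_ge0// sqr_ge0.
  by apply: (le_trans (Re_mul_le _ _)); rewrite !nsqM !nsqV mulrC.
have := ler_wpM2l kap0 le1; rewrite e2; lra.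
Qed.

(** In the cone [(Re z)^2 <= a^2 (Im z)^2] and [b < Im z], while
    [x^2 <= 2 (Re z - x)^2 + 2 (Re z)^2]; together [x^2 + b^2 <= (2 + 2 a^2) |z - x|^2]. *)
Lemma cone_weight_le (a b : R) z x : 0 < b -> Gamma_ a b z ->
  levy_weight z^-1 x <= (2 + 2 * a ^+ 2) * ((1 + x ^+ 2) / (x ^+ 2 + b ^+ 2)).
Proof.
move=> b0 [h1 h2]; have z0 : 0 < Im z by exact: lt_trans h2.
have zn : z != 0 by apply: contraTneq z0 => ->; rewrite ltxx.
have -> : levy_weight z^-1 x = (1 + x ^+ 2) / nsq (z - x%:C).
  rewrite /levy_weight; have -> : 1 - x%:C / z = (z - x%:C) / z by field.
  rewrite nsqM !nsqV invfM invrK; congr (_ * _); rewrite mulrCA mulVf ?mulr1//.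
  by rewrite nsq_eq0.
have x1 : 0 < 1 + x ^+ 2 by rewrite ltr_pwDl// sqr_ge0.
have xb : 0 < x ^+ 2 + b ^+ 2 by rewrite ltr_wpDl ?sqr_ge0// exprn_gt0.
have nz : 0 < nsq (z - x%:C).
  by rewrite /nsq ImD ImN Im_real subr0 ltr_wpDl ?sqr_ge0// exprn_gt0.
rewrite mulrCA ler_pM2l// ler_pdivlMr// mulrC ler_pdivrMr//.
rewrite /nsq !ReImE subr0.
have p2 : Re z ^+ 2 <= a ^+ 2 * Im z ^+ 2.
  rewrite -exprMn -real_normK ?num_real// lerXn2r ?nnegrE ?normr_ge0 ?(ltW h1)//.
  exact: le_trans (normr_ge0 _) (ltW h1).
have b2 : b ^+ 2 <= Im z ^+ 2 by rewrite lerXn2r ?nnegrE ?ltW.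
have x2 : x ^+ 2 <= 2 * (Re z - x) ^+ 2 + 2 * Re z ^+ 2.
  rewrite -subr_ge0; have -> : 2 * (Re z - x) ^+ 2 + 2 * Re z ^+ 2 - x ^+ 2 = (2 * Re z - x) ^+ 2 by ring.
  exact: sqr_ge0.
have s1 := sqr_ge0 (Re z - x); have s2 := sqr_ge0 (Im z); have s3 := sqr_ge0 a.
have : 0 <= a ^+ 2 * (Re z - x) ^+ 2 by rewrite mulr_ge0.
nra.
Qed.

(** Dominated convergence as [b] grows. This is where the height of the truncated cone in the
    definition of the R-transform is chosen. *)
Lemma weight_tail (K : R) : exists2 b : R, 0 < b &
  K * \int[Sigma]_x ((1 + x ^+ 2) / (x ^+ 2 + b ^+ 2)) < 1.
Proof.
have mf (m : nat) : measurable_fun [set: R] (fun x : R => (1 + x ^+ 2) / (x ^+ 2 + m.+1%:R ^+ 2)).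
  apply: continuous_measurable_fun => x; apply: cvgM.
    by apply: cvgD; [exact: cvg_cst|exact: exprn_continuous].
  apply: cvgV; first by rewrite gt_eqF// ltr_wpDl ?sqr_ge0// exprn_gt0.
  by apply: cvgD; [exact: exprn_continuous|exact: cvg_cst].
have : (fun m : nat => K * \int[Sigma]_x ((1 + x ^+ 2) / (x ^+ 2 + m.+1%:R ^+ 2))) @ \oo --> K * 0.
  apply: cvgM; first exact: cvg_cst.
  have -> : (0 : R) = \int[Sigma]_x (fun=> 0) x by rewrite Rintegral_cst// mul0r.
  apply: (@cvg_Rintegral_bounded _ _ _ Sigma _ _ 1).
  - exact: mf.
  - exact: measurable_cst.
  - move=> m x; have d0 : 0 < x ^+ 2 + m.+1%:R ^+ 2 by rewrite ltr_wpDl ?sqr_ge0// exprn_gt0.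
    rewrite ger0_norm; last by rewrite divr_ge0 ?(ltW d0)// addr_ge0// sqr_ge0.
    by rewrite ler_pdivrMr// mul1r addrC lerD2l -{1}(expr1n _ 2) lerXn2r ?nnegrE// ler1n.
  - apply: aeW => x /=.
    apply: (@squeeze_cvgr _ _ _ _ (fun=> 0) (fun m => (1 + x ^+ 2) * m.+1%:R^-1)).
    + apply: nearW => m; have x1 : 0 <= 1 + x ^+ 2 by rewrite addr_ge0// sqr_ge0.
      have d0 : 0 < x ^+ 2 + m.+1%:R ^+ 2 by rewrite ltr_wpDl ?sqr_ge0// exprn_gt0.
      rewrite divr_ge0 ?(ltW d0)//= ler_wpM2l// lef_pV2 ?posrE//.
      apply: ler_wpDl; first exact: sqr_ge0.
      by rewrite expr2 ler_peMl// ler1n.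
    + exact: cvg_cst.
    + by rewrite -(mulr0 (1 + x ^+ 2)); apply: cvgM; [exact: cvg_cst|exact: cvg_harmonic].
rewrite mulr0 => /cvgr_lt/(_ _ ltr01)[m _ /(_ m (leqnn _))/= hm].
by exists m.+1%:R.
Qed.

(** The hypothesis says that [levy_inv] inverts the Cauchy transform [G] on one side. For [u] in the
    cone region [levy_inv u] is in the upper half-plane, so [G (levy_inv u)] and [u] have the same
    image under [levy_inv], and injectivity identifies them. *)
Lemma is_R_transform_levy (mu : probability (measurableTypeR R) R) :
  (forall z, 0 < Im z -> (cauchy_transform mu z)^-1 +
     kap%:C * levy_R c Sigma (cauchy_transform mu z) = z) ->
  is_R_transform mu (fun u => kap%:C * levy_R c Sigma u).
Proof.
move=> H a a0; have [b b0 hb] := weight_tail (kap * (2 + 2 * a ^+ 2)).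
exists b => //; split; last first.
  by move=> z [_ h2]; rewrite addrC H// (lt_trans b0).
move=> u; rewrite /Delta_/= => Du; have [h1 h2] := Du.
have zi : 0 < Im u^-1 by exact: lt_trans h2.
have uz : u != 0 by apply: contraTneq zi => ->; rewrite invr0 ltxx.
have u0 : Im u < 0.
  by move: zi; rewrite ImV oppr_gt0 pmulr_llt0// invr_gt0 nsq_gt0.
have un0 : Im u != 0 by rewrite lt_eqF.
have hI : 0 < Im (levy_inv u).
  rewrite Im_levy_inv_gt0//; apply: le_lt_trans hb.
  rewrite -mulrA ler_wpM2l//.
  have mf : measurable_fun [set: R] (fun x : R => (1 + x ^+ 2) / (x ^+ 2 + b ^+ 2)).
    apply: continuous_measurable_fun => x; apply: cvgM.
      by apply: cvgD; [exact: cvg_cst|exact: exprn_continuous].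
    apply: cvgV; first by rewrite gt_eqF// ltr_wpDl ?sqr_ge0// exprn_gt0.
    by apply: cvgD; [exact: exprn_continuous|exact: cvg_cst].
  have bnd (x : R) : `|(1 + x ^+ 2) / (x ^+ 2 + b ^+ 2)| <= 1 + b ^- 2.
    have b2 : 0 < b ^+ 2 by rewrite exprn_gt0.
    have d0 : 0 < x ^+ 2 + b ^+ 2 by rewrite ltr_wpDl ?sqr_ge0.
    rewrite ger0_norm; last by rewrite divr_ge0 ?(ltW d0)// addr_ge0// sqr_ge0.
    rewrite ler_pdivrMr// mulrDl mul1r mulrDr mulVf ?gt_eqF//.
    have : 0 <= b ^- 2 * x ^+ 2 by rewrite mulr_ge0 ?sqr_ge0// invr_ge0 ltW.
    have := ltW b2; lra.
  have i1 : Sigma.-integrable setT (EFin \o (fun x : R => (1 + x ^+ 2) / (x ^+ 2 + b ^+ 2))).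
    exact: (integrable_bounded Sigma mf bnd).
  rewrite -RintegralZl//; apply: le_Rintegral => //.
  - exact: integrable_levy_weight.
  - rewrite (_ : _ \o _ = fun x : R => ((2 + 2 * a ^+ 2)%:E * ((1 + x ^+ 2) / (x ^+ 2 + b ^+ 2))%:E)%E)//.
    exact: integrableZl.
  - by move=> x _; rewrite -{1}[u]invrK; exact: cone_weight_le.
split => //.
have G0 := Im_cauchy_lt0 mu hI.
apply: levy_inv_inj => //; first by rewrite /levy_inv addrC H.
by rewrite /levy_inv addrC H.
Qed.

End levy_inverse.

(** * An R-transform determines the measure *)

Section r_transform_uniqueness.
Variable R : realType.
Implicit Types mu nu : probability (measurableTypeR R) R.
Implicit Types (y s : R).
Local Notation Re := (@complex.Re R).
Local Notation Im := (@complex.Im R).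

(** Up to sign, the real part of [(i y - s)^-1]; likewise [y * im_ker y s] is its imaginary part up
    to sign. *)
Definition re_ker y s : R := s / (s ^+ 2 + y ^+ 2).
Definition im_ker y s : R := (s ^+ 2 + y ^+ 2)^-1.

Lemma ker_den_gt0 y s : 0 < y -> 0 < s ^+ 2 + y ^+ 2.
Proof. by move=> y0; rewrite ltr_wpDl ?sqr_ge0// exprn_gt0. Qed.

Lemma bc_re_ker y : 0 < y -> bounded_continuous (re_ker y).
Proof.
move=> y0; split.
  move=> s; apply: cvgM; first exact: cvg_id.
  apply: cvgV; first by rewrite gt_eqF// ker_den_gt0.
  by apply: cvgD; [exact: exprn_continuous|exact: cvg_cst].
exists y^-1 => s; have d0 := ker_den_gt0 s y0.
rewrite /re_ker normrM normfV (gtr0_norm d0) ler_pdivrMr// mulrC ler_pdivlMr//.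
have : `|s| ^+ 2 = s ^+ 2 by rewrite real_normK ?num_real.
move: (`|s|) => t <-; have := sqr_ge0 (t - y); have := sqr_ge0 t; have := sqr_ge0 y.
rewrite sqrrB; lra.
Qed.

Lemma bc_im_ker y : 0 < y -> bounded_continuous (im_ker y).
Proof.
move=> y0; split.
  move=> s; apply: cvgV; first by rewrite gt_eqF// ker_den_gt0.
  by apply: cvgD; [exact: exprn_continuous|exact: cvg_cst].
exists (y ^+ 2)^-1 => s; have d0 := ker_den_gt0 s y0.
rewrite ger0_norm ?invr_ge0 ?(ltW d0)// lef_pV2 ?posrE ?exprn_gt0//.
by rewrite lerDr sqr_ge0.
Qed.

Lemma bc_integrable mu (g : R -> R) : bounded_continuous g ->
  mu.-integrable setT (EFin \o g).
Proof.
move=> [cg [M gM]]; apply: (integrable_bounded mu _ gM).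
exact: continuous_measurable_fun.
Qed.

Lemma Re_cauchy_imag mu y : 0 < y ->
  Re (cauchy_transform mu (@Complex R 0 y)) = - \int[mu]_s re_ker y s.
Proof.
move=> y0; rewrite -[LHS]/(\int[mu]_s Re (@Complex R 0 y - s%:C)^-1) -[RHS]mulN1r -RintegralZl//; last first.
  exact/bc_integrable/bc_re_ker.
apply: eq_Rintegral => s _; rewrite ReV /nsq !ReImE /re_ker !sub0r sqrrN subr0.
by rewrite mulN1r mulNr.
Qed.

Lemma Im_cauchy_imag mu y : 0 < y ->
  Im (cauchy_transform mu (@Complex R 0 y)) = - (y * \int[mu]_s im_ker y s).
Proof.
move=> y0; rewrite -[LHS]/(\int[mu]_s Im (@Complex R 0 y - s%:C)^-1) -mulNr -RintegralZl//; last first.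
  exact/bc_integrable/bc_im_ker.
by apply: eq_Rintegral => s _; rewrite ImV /nsq !ReImE /im_ker !sub0r sqrrN subr0 mulNr.
Qed.

(** The integrand increases to 1 with [y]. The level [3/4] exceeds [4/7], which is what the cone
    estimate needs. *)
Lemma im_ker_mass mu : exists2 Y : R, 0 < Y &
  forall y, Y <= y -> 3%:R / 4%:R < \int[mu]_s (y ^+ 2 * im_ker y s).
Proof.
have bcM y : 0 < y -> bounded_continuous (fun s => y ^+ 2 * im_ker y s).
  move=> y0; have [c1 [M hM]] := bc_im_ker y0; split.
    by move=> s; apply: cvgM; [exact: cvg_cst|exact: c1].
  exists (y ^+ 2 * M) => s; rewrite normrM ger0_norm ?sqr_ge0// ler_wpM2l ?sqr_ge0//.
have kle1 y s : 0 < y -> 0 <= y ^+ 2 * im_ker y s <= 1.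
  move=> y0; have d0 := ker_den_gt0 s y0.
  by rewrite divr_ge0 ?sqr_ge0 ?(ltW d0)//= ler_pdivrMr// mul1r lerDr sqr_ge0.
have : (fun m : nat => \int[mu]_s (m.+1%:R ^+ 2 * im_ker m.+1%:R s)) @ \oo --> (1 : R).
  have one : \int[mu]_s (fun=> 1) s = 1 :> R.
    by rewrite Rintegral_cst// mul1r; exact: (congr1 fine (probability_setT mu)).
  rewrite -[X in _ --> X]one.
  apply: (@cvg_Rintegral_bounded _ _ _ mu _ _ 1).
  - by move=> m; apply: continuous_measurable_fun; case: (bcM m.+1%:R).
  - exact: measurable_cst.
  - by move=> m s; have /andP[k0 k1] := kle1 m.+1%:R s (ltr0Sn _ _); rewrite ger0_norm.
  - apply: aeW => s /=.
    have : (fun m : nat => 1 - s ^+ 2 * (m.+1%:R)^-1) @ \oo --> (1 - s ^+ 2 * 0 : R).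
      by apply: cvgB; [exact: cvg_cst|apply: cvgM; [exact: cvg_cst|exact: cvg_harmonic]].
    rewrite mulr0 subr0 => h.
    apply: (squeeze_cvgr _ h (cvg_cst (1:R))).
    apply: nearW => m; have /andP[_ ->] := kle1 m.+1%:R s (ltr0Sn _ _); rewrite andbT.
    have m0 : 0 < m.+1%:R :> R by rewrite ltr0Sn.
    have m1 : 1 <= m.+1%:R :> R by rewrite ler1n.
    have d0 := ker_den_gt0 s m0.
    rewrite /im_ker ler_pdivlMr//.
    move: (m.+1%:R : R) m0 m1 d0 => q q0 q1 d0.
    have s2 := sqr_ge0 s.
    have e : s ^+ 2 * q^-1 * (s ^+ 2 + q ^+ 2) = s ^+ 2 * (s ^+ 2 * q^-1) + s ^+ 2 * q.
      by field; rewrite gt_eqF.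
    rewrite mulrBl mul1r e.
    have : 0 <= s ^+ 2 * (s ^+ 2 * q^-1) by apply: mulr_ge0 => //; apply: mulr_ge0 => //; rewrite invr_ge0 ltW.
    have : 0 <= s ^+ 2 * (q - 1) by rewrite mulr_ge0// subr_ge0.
    rewrite mulrBr; lra.
have q1 : 3%:R / 4%:R < 1 :> R by lra.
move=> /cvgr_gt/(_ _ q1)[m _ /(_ m (leqnn _))/= hm].
exists m.+1%:R => // y hy; apply: (lt_le_trans hm).
have m0 : 0 < m.+1%:R :> R by rewrite ltr0Sn.
have y0 := lt_le_trans m0 hy.
apply: le_Rintegral => //; [exact/bc_integrable/bcM|exact/bc_integrable/bcM|].
move=> s _; have d0 := ker_den_gt0 s m0; have d1 := ker_den_gt0 s y0.
have my : m.+1%:R ^+ 2 <= y ^+ 2 by rewrite lerXn2r ?nnegrE // ltW.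
rewrite /im_ker ler_pdivlMr// mulrAC ler_pdivrMr//; move: (m.+1%:R ^+ 2 : R) my => q my.
rewrite -subr_ge0; have -> : y ^+ 2 * (s ^+ 2 + q) - q * (s ^+ 2 + y ^+ 2) = s ^+ 2 * (y ^+ 2 - q) by ring.
by apply: mulr_ge0; [exact: sqr_ge0|rewrite subr_ge0].
Qed.

(* [y s <= y^2/4 + s^2] bounds the real part of [y G(iy)] by [1 - 3/4 q] where
   [q] is minus its imaginary part, and [q] tends to [1]. *)
Lemma cauchy_imag_cone mu (b : R) : exists2 Y : R, 0 < Y &
  forall y, Y <= y -> Gamma_ 1 b (cauchy_transform mu (@Complex R 0 y))^-1.
Proof.
have [Y Y0 hY] := im_ker_mass mu.
(* The imaginary part of [1 / G(i y)] exceeds [1 / (2 q)], and [y * q <= 4/3]; a height [y] of at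
   least [3 |b| + 1] then makes [2 |b| q < 1]. *)
exists (Order.max Y (3%:R * `|b| + 1)); first by rewrite lt_max Y0.
move=> y; rewrite ge_max => /andP[Yy by_].
have y0 := lt_le_trans Y0 Yy; have hq := hY _ Yy.
have ik := bc_integrable mu (bc_im_ker y0); have rk := bc_integrable mu (bc_re_ker y0).
move: hq; rewrite RintegralZl// => hq.
set A := \int[mu]_s re_ker y s; set B := \int[mu]_s im_ker y s in hq *.
have i1 : mu.-integrable setT (EFin \o (fun s => y * re_ker y s)).
  rewrite (_ : _ \o _ = fun s => (y%:E * (re_ker y s)%:E)%E)//; exact: integrableZl.
have ic : mu.-integrable setT (EFin \o (fun=> 1 : R)).
  by apply: (@integrable_bounded _ _ _ mu _ 1) => // x; rewrite normr1.
have i3 : mu.-integrable setT (EFin \o (fun s => 3%:R / 4%:R * y ^+ 2 * im_ker y s)).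
  rewrite (_ : _ \o _ = fun s => ((3%:R / 4%:R * y ^+ 2)%:E * (im_ker y s)%:E)%E)//.
  exact: integrableZl.
have i2 : mu.-integrable setT (EFin \o (fun s => 1 - 3%:R / 4%:R * y ^+ 2 * im_ker y s)).
  exact: (integrableB measurableT ic i3).
have one : \int[mu]_s (fun=> 1) s = 1 :> R.
  by rewrite Rintegral_cst// mul1r; exact: (congr1 fine (probability_setT mu)).
have I2 : \int[mu]_s (1 - 3%:R / 4%:R * y ^+ 2 * im_ker y s) = 1 - 3%:R / 4%:R * y ^+ 2 * B.
  by rewrite RintegralB// one RintegralZl.
have kb s : `|y * re_ker y s| <= 1 - 3%:R / 4%:R * y ^+ 2 * im_ker y s.
  have d0 := ker_den_gt0 s y0.
  have -> : 1 - 3%:R / 4%:R * y ^+ 2 * im_ker y s = (s ^+ 2 + y ^+ 2 / 4%:R) / (s ^+ 2 + y ^+ 2).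
    by rewrite /im_ker; field; rewrite gt_eqF.
  rewrite /re_ker mulrA normrM normfV (gtr0_norm d0) ler_pM2r ?invr_gt0//.
  rewrite normrM (gtr0_norm y0).
  have : `|s| ^+ 2 = s ^+ 2 by rewrite real_normK ?num_real.
  move: (`|s|) => t <-; have := sqr_ge0 (t - y / 2%:R); rewrite sqrrB; lra.
have hA : `|y * A| <= 1 - 3%:R / 4%:R * y ^+ 2 * B.
  rewrite -I2 -RintegralZl// ler_norml; apply/andP; split.
    rewrite -[X in - X]mul1r -mulNr -RintegralZl//; apply: le_Rintegral => //.
      rewrite (_ : _ \o _ = fun s => ((-1)%:E * (1 - 3%:R / 4%:R * y ^+ 2 * im_ker y s)%:E)%E)//.
      exact: integrableZl.
    by move=> s _; have := kb s; rewrite ler_norml mulN1r => /andP[].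
  by apply: le_Rintegral => // s _; exact: le_trans (ler_norm _) (kb s).
have {}hA : y * `|A| <= 1 - 3%:R / 4%:R * y ^+ 2 * B by rewrite -{1}(gtr0_norm y0) -normrM.
set q := y * B; have eq : y ^+ 2 * B = y * q by rewrite expr2 mulrA.
have {}hA : y * `|A| <= 1 - 3%:R / 4%:R * (y * q) by rewrite -eq mulrA.
rewrite eq in hq.
have lt1 : `|A| < q by rewrite -(ltr_pM2l y0); lra.
have q0 : 0 < q := le_lt_trans (normr_ge0 _) lt1.
have n0 : 0 < nsq (cauchy_transform mu (@Complex R 0 y)).
  by rewrite /nsq Im_cauchy_imag// -/B -/q sqrrN ltr_wpDl ?sqr_ge0// exprn_gt0.
rewrite /Gamma_ /mkset ReV ImV normrM normfV (gtr0_norm n0) mul1r -mulNr ltr_pM2r ?invr_gt0//.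
rewrite ltr_pdivlMr//.
move: n0; rewrite /nsq Re_cauchy_imag// Im_cauchy_imag// -/A -/B -/q opprK normrN => n0.
split=> //.
have A2 : A ^+ 2 < q ^+ 2.
  by rewrite -[ltLHS]real_normK ?num_real// ltrXn2r ?nnegrE ?(ltW q0).
have bq : `|b| * (2%:R * q) < 1.
  have yq : y * q <= 4%:R / 3%:R by have := mulr_ge0 (ltW y0) (normr_ge0 A); lra.
  have : (3%:R * `|b| + 1) * q <= y * q by rewrite ler_pM2r.
  rewrite mulrDl mul1r; lra.
rewrite !sqrrN; apply: (@le_lt_trans _ _ (`|b| * (q ^+ 2 + q ^+ 2))).
  apply: (@le_trans _ _ (`|b| * (A ^+ 2 + q ^+ 2))).
    by rewrite ler_wpM2r ?ler_norm// addr_ge0// sqr_ge0.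
  by rewrite ler_wpM2l// lerD2r ltW.
have -> : `|b| * (q ^+ 2 + q ^+ 2) = `|b| * (2%:R * q) * q by ring.
by rewrite -[ltRHS]mul1r ltr_pM2r.
Qed.

(** For large [y] the point [u], the value of the transform of [mu] at [i y], lies in the region
    where the transform of [nu] inverts [r u + 1/u]; but [r u + 1/u] is [i y] by the identity for
    [mu]. *)
Lemma cauchy_imag_eq mu nu (r : R[i] -> R[i]) :
  is_R_transform mu r -> is_R_transform nu r ->
  exists2 Y : R, 0 < Y & forall y, Y < y ->
    cauchy_transform mu (@Complex R 0 y) = cauchy_transform nu (@Complex R 0 y).
Proof.
move=> /(_ 1 ltr01)[b b0 [_ hm]] /(_ 1 ltr01)[b' b'0 [hn _]].
have [Y Y0 hY] := cauchy_imag_cone mu b'.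
exists (Order.max Y b); first by rewrite lt_max Y0.
move=> y; rewrite gt_max => /andP[Yy by_].
have Gz : Gamma_ 1 b (@Complex R 0 y).
  by rewrite /Gamma_/= normr0 mul1r by_ (lt_trans b0).
have [_] := hn _ (hY _ (ltW Yy)); rewrite (hm _ Gz) => ->.
by [].
Qed.

Lemma R_transform_ker mu nu (r : R[i] -> R[i]) :
  is_R_transform mu r -> is_R_transform nu r ->
  exists2 Y : R, 0 < Y & forall y, Y < y ->
    \int[mu]_s re_ker y s = \int[nu]_s re_ker y s /\
    \int[mu]_s im_ker y s = \int[nu]_s im_ker y s.
Proof.
move=> h1 h2; have [Y Y0 hY] := cauchy_imag_eq h1 h2.
exists Y => // y Yy; have y0 := lt_trans Y0 Yy; have e := hY _ Yy; split.
  by apply: oppr_inj; rewrite -!Re_cauchy_imag// e.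
by apply: (mulfI (lt0r_neq0 y0)); apply: oppr_inj; rewrite -!Im_cauchy_imag// e.
Qed.

End r_transform_uniqueness.

Section limit_transfer.
Variable R : realType.
Implicit Types mu nu : probability (measurableTypeR R) R.

Lemma avg_map (u : seq R) (h g : R -> R) : avg [seq h x | x <- u] g = avg u (g \o h).
Proof. by rewrite /avg big_map size_map. Qed.

Lemma eq_avg (u : seq R) (g h : R -> R) : all (>= 0) u ->
  (forall x, 0 <= x -> g x = h x) -> avg u g = avg u h.
Proof.
move=> /allP u0 gh; rewrite /avg; congr (_ / _); apply: eq_big_seq => x xu.
by apply: gh; have := u0 _ xu.
Qed.

Lemma bc_comp (g h : R -> R) : bounded_continuous g -> continuous h -> bounded_continuous (g \o h).
Proof.
move=> [cg [M gM]] ch; split; last by exists M => x /=.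
by move=> x; apply: continuous_comp; [exact: ch|exact: cg].
Qed.

(* The values [G(iy)] determine the image of a measure by [s |-> s^2], hence
   also the integrals of [h |s|]; comparing those of [s / (s^2 + y^2)] then
   shows that the second measure does not charge the negative reals either. *)
Lemma limit_same_R_transform (u : nat -> seq R) mu nu (r : R[i] -> R[i]) :
  (forall n : nat, (0 < n)%N -> all (>= 0) (u n) /\ size (u n) = n) ->
  (forall g : R -> R, bounded_continuous g -> avg (u n) g @[n --> \oo] --> \int[nu]_x g x) ->
  is_R_transform mu r -> is_R_transform nu r ->
  nneg_supported mu /\
  (forall g : R -> R, bounded_continuous g -> avg (u n) g @[n --> \oo] --> \int[mu]_x g x).
Proof.
move=> u0 hu rm rn; have [Y Y0 hY] := R_transform_ker rm rn.
have csq : continuous (fun s : R => s ^+ 2) by exact: exprn_continuous.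
have cabs : continuous (fun s : R => `|s|) by exact: norm_continuous.
have csqrt : continuous (@Num.sqrt R) by exact: sqrt_continuous.
have [mu2 [mu2E mu2I]] := image_probability mu (continuous_measurable_fun csq).
have mu20 : nneg_supported mu2.
  apply: (etrans (mu2E _)); rewrite (_ : _ @^-1` _ = set0) ?measure0//.
  by apply/seteqP; split=> x //=; rewrite ltNge sqr_ge0.
pose u2 n := [seq x ^+ 2 | x <- u n].
have u20 n : (0 < n)%N -> all (>= 0) (u2 n) /\ size (u2 n) = n.
  move=> n0; have [_ sn] := u0 _ n0; rewrite size_map sn; split=> //.
  by apply/allP => _ /mapP[x _ ->]; rewrite /= sqr_ge0.
have Y2 : 0 < (Y ^+ 2)^-1 by rewrite invr_gt0 exprn_gt0.
have hw (w : R) : 0 < w < (Y ^+ 2)^-1 -> hmean (u2 n) w @[n --> \oo] --> \int[mu2]_x cpt w x.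
  move=> /andP[w0 wY]; pose y := Num.sqrt w^-1.
  have y2 : y ^+ 2 = w^-1 by rewrite sqr_sqrtr// invr_ge0 ltW.
  have y0 : 0 < y by rewrite sqrtr_gt0 invr_gt0.
  have Yy : Y < y.
    have : Y ^+ 2 < y ^+ 2.
      by rewrite y2 -[ltLHS]invrK ltf_pV2 ?posrE.
    by rewrite ltr_pXn2r// ?nnegrE ltW.
  have kE (s : R) : cpt w (s ^+ 2) = y ^+ 2 * im_ker y s.
    rewrite /cpt posE ?sqr_ge0// /im_ker y2 -invfM mulrDr mulfV ?gt_eqF//.
    by rewrite addrC.
  have [_ eI] := hY _ Yy; have [ck bk] := bc_im_ker y0.
  have bcw : bounded_continuous (fun s => y ^+ 2 * im_ker y s).
    split; first by move=> s; apply: cvgM; [exact: cvg_cst|exact: ck].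
    case: bk => M hM; exists (y ^+ 2 * M) => s.
    by rewrite normrM ger0_norm ?sqr_ge0// ler_wpM2l// sqr_ge0.
  have -> : \int[mu2]_x cpt w x = \int[nu]_s (y ^+ 2 * im_ker y s).
    rewrite (mu2I _ 1).
    - transitivity (\int[mu]_s (y ^+ 2 * im_ker y s)).
        by apply: eq_Rintegral => s _; rewrite kE.
      by rewrite !RintegralZl ?eI//; exact: bc_integrable (bc_im_ker y0).
    - by apply: continuous_measurable_fun; apply: continuous_cpt; exact: ltW.
    - by move=> x; have /andP[a b] := cpt01 x (ltW w0); rewrite ger0_norm.
  have := hu _ bcw; apply: cvg_trans; apply: near_eq_cvg; near=> n.
  have n0 : (0 < n)%N by near: n; exists 1%N.
  rewrite -avg_cpt; last by case: (u20 _ n0).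
  by rewrite avg_map; congr (avg _ _); apply/funext => s; rewrite /= kE.
have hA (g : R -> R) : bounded_continuous g -> avg (u n) g @[n --> \oo] --> \int[mu]_x g `|x|.
  move=> bg; have [cg [M gM]] := bc_comp bg csqrt.
  have := avg_cvg_measure Y2 u20 mu20 hw cg (ex_intro _ M gM).
  rewrite (mu2I _ M) => [| |//]; last exact: continuous_measurable_fun.
  under eq_Rintegral do rewrite /= sqrtr_sqr.
  apply: cvg_trans; apply: near_eq_cvg; near=> n.
  have n0 : (0 < n)%N by near: n; exists 1%N.
  have [un _] := u0 _ n0.
  by rewrite avg_map; apply: eq_avg => // x x0 /=; rewrite sqrtr_sqr ger0_norm.
have Y1 : Y < Y + 1 by rewrite ltrDl.
have y0 := lt_trans Y0 Y1; have bk := bc_re_ker y0.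
(* The lists are nonnegative, so the same averages converge to the left side by [hA] and to the
   integral against [nu] by [hu]. *)
have e1 : \int[mu]_s re_ker (Y + 1) `|s| = \int[mu]_s re_ker (Y + 1) s.
  have [-> _] := hY _ Y1.
  exact: (cvg_unique _ (hA _ bk) (hu _ bk)).
have bk' := bc_comp bk cabs.
have pos_ae : \forall s \ae mu, 0 <= s.
  have h : \forall s \ae mu, re_ker (Y + 1) `|s| - re_ker (Y + 1) s = 0.
    apply: Rintegral_eq0_ae.
    - exact: (integrableB measurableT (bc_integrable mu bk') (bc_integrable mu bk)).
    - move=> s; rewrite subr_ge0 /re_ker real_normK ?num_real// ler_wpM2r ?ler_norm//.
      by rewrite invr_ge0 ltW// ker_den_gt0.
    - rewrite RintegralB ?e1 ?subrr//; first exact: (bc_integrable mu bk').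
      exact: (bc_integrable mu bk).
  apply: (@filterS _ (almost_everywhere mu) _ _ _ _ h) => s /eqP.
  rewrite subr_eq0 /re_ker real_normK ?num_real// => /eqP/mulIf.
  by rewrite invr_eq0 gt_eqF ?ker_den_gt0// => /(_ isT) <-.
have hS : nneg_supported mu.
  case: pos_ae => N [mN N0 sN]; apply/eqP; rewrite eq_le measure_ge0 andbT -N0.
  apply: le_measure; rewrite ?inE//.
    by rewrite (_ : [set _ | _] = `]-oo, 0[%classic)//; apply/seteqP; split=> x /=; rewrite in_itv.
  by move=> x /= x0; apply: sN => /=; rewrite leNgt x0.
split=> // g bg; have := hA _ bg; congr (_ --> _).
rewrite (Rintegral_pos hS (g := fun x => g `|x|)); last first.
  apply: continuous_measurable_fun; exact: (bc_comp bg cabs).1.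
rewrite (Rintegral_pos hS (g := g)); last exact: continuous_measurable_fun bg.1.
by apply: eq_Rintegral => x _; rewrite ger0_norm// pos_ge0.
Unshelve. all: by end_near. Qed.

End limit_transfer.

(** * The Marchenko-Pastur distribution *)

Section density.
Local Open Scope ereal_scope.
Context d (T : measurableType d) (R : realType).
Variables (mu nu : {measure set T -> \bar R}) (p : T -> R).
Hypotheses (mp : measurable_fun setT p) (p0 : forall x, (0 <= p x)%R).
Hypothesis nuE : forall A, measurable A -> nu A = \int[mu]_(x in A) (p x)%:E.
Import HBNNSimple.

Lemma ge0_integral_density (f : T -> \bar R) : measurable_fun setT f ->
  (forall x, 0 <= f x) -> \int[nu]_x f x = \int[mu]_x (f x * (p x)%:E).
Proof.
move=> mf f0; pose f_ := nnsfun_approx measurableT mf.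
have mpE : measurable_fun setT (EFin \o p) by exact/measurable_EFinP.
transitivity (limn (fun n => \int[nu]_x (f_ n x)%:E)).
  rewrite -monotone_convergence//.
  - apply: eq_integral => y _; apply/esym/cvg_lim => //.
    by apply: cvg_nnsfun_approx=> // *; apply: f0.
  - by move=> n; exact/measurable_EFinP/measurable_funP.
  - by move=> n y _; rewrite lee_fin.
  - by move=> y _ m n mn; rewrite lee_fin; exact/lefP/nd_nnsfun_approx.
rewrite [X in limn X](_ : _ = (fun n => \int[mu]_x ((f_ n x)%:E * (p x)%:E))).
  rewrite -monotone_convergence//; last 3 first.
    - by move=> n /=; apply: emeasurable_funM => //; exact/measurable_EFinP/measurable_funP.
    - by move=> n x _ /=; rewrite mule_ge0// lee_fin.
    - move=> x _ m n mn; rewrite lee_pmul ?lee_fin//.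
      by exact/lefP/nd_nnsfun_approx.
  apply: eq_integral => x _ /=; apply/cvg_lim => //.
  apply: cvgeZr => //.
  by apply: cvg_nnsfun_approx=> // y Dy; apply: f0.
apply/funext => n.
under eq_integral do rewrite fimfunE -fsumEFin//.
rewrite ge0_integral_fsum//; last 2 first.
- by move=> y; exact/measurable_EFinP/measurable_funM.
- by move=> y x _; rewrite nnfun_muleindic_ge0.
transitivity (\sum_(k \in range (f_ n)) \int[mu]_x ((k * \1_(f_ n @^-1` [set k]) x)%:E * (p x)%:E)); last first.
  rewrite -ge0_integral_fsum//.
  - apply: eq_integral => x _; rewrite -ge0_mule_fsuml ?fsumEFin -?fimfunE//.
    by move=> r; rewrite nnfun_muleindic_ge0.
  - by move=> r; apply: emeasurable_funM => //; exact/measurable_EFinP/measurable_funM.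
  - by move=> r x _; rewrite mule_ge0 ?nnfun_muleindic_ge0 ?lee_fin.
apply: eq_fsbigr => r _.
rewrite integralZl_indic_nnsfun// integral_indic//= setIT nuE//.
have [r0|r0] := ltP r 0%R.
  rewrite preimage_nnfun0// integral_set0 mule0 integral0_eq// => x _.
  by rewrite indic0 mulr0 mul0e.
under [RHS]eq_integral do rewrite EFinM -muleA.
rewrite ge0_integralZl//; last 2 first.
- by apply: emeasurable_funM => //; exact/measurable_EFinP.
- by move=> x _; rewrite mule_ge0 ?lee_fin.
congr (_ * _); rewrite integral_mkcond; apply: eq_integral => x _.
rewrite patchE indicE; case: ifP => xA; first by rewrite mul1e.
by rewrite mul0e.
Qed.
End density.

(** * A semicircle integral by an explicit primitive *)

Section semicircle_integral.
Variable R : realType.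

Lemma asin1 : asin 1 = pi / 2 :> R.
Proof. by rewrite -[in LHS]sin_pihalf sinK// in_itv/= lexx andbT; have := @pi_gt0 R; lra. Qed.

Lemma asinN1 : asin (- 1) = - (pi / 2) :> R.
Proof.
by rewrite -[in LHS]sin_pihalf -sinN sinK// in_itv/= lexx/=; have := @pi_gt0 R; lra.
Qed.

(** The end points are included: the primitive is evaluated where [asin] takes the arguments [-1]
    and [1] and is not differentiable. *)
Lemma within_continuous_asin : {within `[(-1 : R), 1], continuous (@asin R)}.
Proof.
have h : - (pi / 2) <= pi / 2 :> R by have := @pi_gt0 R; lra.
have := @segment_can_le_continuous R _ _ (@sin R) (@asin R) h _ (@sinK R).
rewrite sinN sin_pihalf; apply; apply: continuous_subspaceT; exact: continuous_sin.
Qed.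

Lemma cvg_asin (F : set_system R) (FF : Filter F) (h : R -> R) (l : R) :
  -1 <= l <= 1 -> h @ F --> l -> (\forall x \near F, -1 <= h x <= 1) ->
  (asin (h x)) @[x --> F] --> asin l.
Proof.
move=> l1 hl near1.
have l1' : `[(-1 : R), 1]%classic l by rewrite /= in_itv.
have := (subspace_continuousP _ _).1 within_continuous_asin l l1'.
apply: cvg_trans; apply: (@cvg_comp _ _ _ h (@asin R) F (within `[(-1:R), 1] (nbhs l))) => //.
move=> A; rewrite /within/= => hA.
have h2 := hl _ hA.
apply: (@filterS2 _ F FF _ _ _ _ h2 near1) => x /= + h1; apply; by rewrite in_itv.
Qed.

Section pointwise_derivatives.
Implicit Types (f g : R -> R) (x a b : R).

Lemma is_derive_sub f g x a b : is_derive x 1 f a -> is_derive x 1 g b ->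
  is_derive x 1 (fun y => f y - g y) (a - b).
Proof. by move=> hf hg; exact: (is_deriveB hf hg). Qed.

Lemma is_derive_add f g x a b : is_derive x 1 f a -> is_derive x 1 g b ->
  is_derive x 1 (fun y => f y + g y) (a + b).
Proof. by move=> hf hg; exact: (is_deriveD hf hg). Qed.

Lemma is_derive_mul f g x a b : is_derive x 1 f a -> is_derive x 1 g b ->
  is_derive x 1 (fun y => f y * g y) (f x * b + g x * a).
Proof. by move=> hf hg; exact: (is_deriveM hf hg). Qed.

Lemma is_derive_cmul f x c a : is_derive x 1 f a ->
  is_derive x 1 (fun y => c * f y) (c * a).
Proof.
move=> hf; have := is_derive_mul (is_derive_cst c x 1) hf.
by rewrite mulr0 addr0.
Qed.

Lemma is_derive_inv f x a : f x != 0 -> is_derive x 1 f a ->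
  is_derive x 1 (fun y => (f y)^-1) (- a / f x ^+ 2).
Proof.
move=> f0 hf; have := is_deriveV f0 hf; congr (is_derive _ _ _ _).
by rewrite /GRing.scale/= !mulNr [X in - X = _]mulrC.
Qed.

Lemma is_derive_compose f g x a b : is_derive (g x) 1 f a -> is_derive x 1 g b ->
  is_derive x 1 (fun y => f (g y)) (a * b).
Proof. by move=> hf hg; exact: (is_derive1_comp hf hg). Qed.

Lemma is_derive_subc x c : is_derive x 1 (fun y : R => y - c) 1.
Proof. by have := is_derive_sub (is_derive_id x 1) (is_derive_cst c x 1); rewrite subr0. Qed.

End pointwise_derivatives.

Section primitive.
Variables m d s : R.
Hypotheses (d0 : 0 < d) (dm : d <= m) (s0 : 0 < s).

Definition sc_root : R := Num.sqrt ((m + s) ^+ 2 - d ^+ 2).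
(** An increasing homography that maps [[m - d, m + d]] onto [[-1, 1]]; [d <= m] and [0 < s] keep
    its pole outside the interval. *)
Definition sc_arg (x : R) : R := ((m + s) * (x + s) - sc_root ^+ 2) / (d * (x + s)).
(** A primitive of [sqrt (d^2 - (x - m)^2) / (s + x)]: the square root and the first arcsine come
    from division by [s + x], the second arcsine from the pole, where the numerator squared is
    [- sc_root ^+ 2]. *)
Definition sc_prim (x : R) : R := Num.sqrt (d ^+ 2 - (x - m) ^+ 2) +
  (m + s) * asin ((x - m) / d) - sc_root * asin (sc_arg x).

Let ms0 : 0 < (m + s) ^+ 2 - d ^+ 2.
Proof.
have := mulr_gt0 (_ : 0 < m + s - d) (_ : 0 < m + s + d) => h.
rewrite subr_sqr; apply: h; have := d0; have := dm; have := s0; lra.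
Qed.

Lemma sc_root_gt0 : 0 < sc_root. Proof. by rewrite sqrtr_gt0. Qed.
Lemma sqr_sc_root : sc_root ^+ 2 = (m + s) ^+ 2 - d ^+ 2.
Proof. by rewrite sqr_sqrtr// ltW. Qed.

Lemma sc_xs x : m - d <= x -> 0 < x + s.
Proof. have := dm; have := s0; lra. Qed.

Lemma one_sub_sqr_sc_arg x : m - d <= x ->
  1 - sc_arg x ^+ 2 = (sc_root ^+ 2 * (d ^+ 2 - (x - m) ^+ 2)) / (d * (x + s)) ^+ 2.
Proof.
move=> /sc_xs xs; rewrite /sc_arg sqr_sc_root; field.
by rewrite !gt_eqF.
Qed.

Lemma sc_dist_ge0 x : m - d <= x <= m + d -> 0 <= d ^+ 2 - (x - m) ^+ 2.
Proof.
move=> /andP[x1 x2]; have -> : d ^+ 2 - (x - m) ^+ 2 = (x - (m - d)) * (m + d - x) by ring.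
by apply: mulr_ge0; rewrite subr_ge0.
Qed.

Lemma sc_dist_gt0 x : m - d < x < m + d -> 0 < d ^+ 2 - (x - m) ^+ 2.
Proof.
move=> /andP[x1 x2]; have -> : d ^+ 2 - (x - m) ^+ 2 = (x - (m - d)) * (m + d - x) by ring.
by apply: mulr_gt0; rewrite subr_gt0.
Qed.

Lemma sqr_le1 (y : R) : 0 <= 1 - y ^+ 2 -> -1 <= y <= 1.
Proof. by rewrite subr_ge0 -ler_norml -[y ^+ 2]real_normK ?num_real// expr_le1. Qed.

Lemma sqr_lt1 (y : R) : 0 < 1 - y ^+ 2 -> -1 < y < 1.
Proof. by rewrite subr_gt0 -ltr_norml -[y ^+ 2]real_normK ?num_real// expr_lt1. Qed.

Lemma sc_arg_itv x : m - d <= x <= m + d -> -1 <= sc_arg x <= 1.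
Proof.
move=> x1; apply: sqr_le1; rewrite one_sub_sqr_sc_arg; last by case/andP: x1.
apply: divr_ge0; last exact: sqr_ge0.
by apply: mulr_ge0; [exact: sqr_ge0|exact: sc_dist_ge0].
Qed.

Lemma sc_arg_oo x : m - d < x < m + d -> -1 < sc_arg x < 1.
Proof.
move=> x1; have x2 : m - d <= x by case/andP: x1 => /ltW.
apply: sqr_lt1; rewrite one_sub_sqr_sc_arg//.
apply: divr_gt0; last by rewrite exprn_gt0// mulr_gt0// sc_xs.
by apply: mulr_gt0; [rewrite exprn_gt0// sc_root_gt0|exact: sc_dist_gt0].
Qed.

Lemma sc_lin_itv x : m - d <= x <= m + d -> -1 <= (x - m) / d <= 1.
Proof. by move=> /andP[x1 x2]; rewrite ler_pdivlMr// ler_pdivrMr//; apply/andP; split; lra. Qed.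

Lemma sc_lin_oo x : m - d < x < m + d -> -1 < (x - m) / d < 1.
Proof. by move=> /andP[x1 x2]; rewrite ltr_pdivlMr// ltr_pdivrMr//; apply/andP; split; lra. Qed.

Lemma sc_prim_right : sc_prim (m + d) = pi / 2 * (m + s - sc_root).
Proof.
have x0 : 0 < m + d + s by apply: sc_xs; have := d0; lra.
rewrite /sc_prim; have -> : d ^+ 2 - (m + d - m) ^+ 2 = 0 by ring.
have -> : (m + d - m) / d = 1 by field; rewrite gt_eqF.
have -> : sc_arg (m + d) = 1.
  rewrite /sc_arg sqr_sc_root; field.
  by rewrite !gt_eqF.
rewrite sqrtr0 asin1; ring.
Qed.

Lemma sc_prim_left : sc_prim (m - d) = - (pi / 2 * (m + s - sc_root)).
Proof.
have x0 : 0 < m - d + s by apply: sc_xs.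
rewrite /sc_prim; have -> : d ^+ 2 - (m - d - m) ^+ 2 = 0 by ring.
have -> : (m - d - m) / d = -1 by field; rewrite gt_eqF.
have -> : sc_arg (m - d) = -1.
  rewrite /sc_arg sqr_sc_root; field.
  by rewrite !gt_eqF.
rewrite sqrtr0 asinN1; ring.
Qed.

Lemma continuous_sc_arg x : m - d <= x -> {for x, continuous sc_arg}.
Proof.
move=> /sc_xs xs; apply: cvgM.
  apply: cvgB; last exact: cvg_cst.
  by apply: cvgM; [exact: cvg_cst|apply: cvgD; [exact: cvg_id|exact: cvg_cst]].
apply: cvgV; first by rewrite mulf_neq0// gt_eqF.
by apply: cvgM; [exact: cvg_cst|apply: cvgD; [exact: cvg_id|exact: cvg_cst]].
Qed.

Lemma continuous_sc_sqrt : continuous (fun x : R => Num.sqrt (d ^+ 2 - (x - m) ^+ 2)).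
Proof.
move=> x; apply: continuous_comp; last exact: sqrt_continuous.
apply: cvgB; first exact: cvg_cst.
apply: (@continuous_comp _ _ _ (fun x => x - m) (fun x => x ^+ 2)); last exact: exprn_continuous.
by apply: cvgB; [exact: cvg_id|exact: cvg_cst].
Qed.

Lemma sc_prim_cvg (F : set_system R) (FF : Filter F) (x : R) : m - d <= x <= m + d ->
  F --> x -> (\forall y \near F, m - d <= y <= m + d) -> sc_prim y @[y --> F] --> sc_prim x.
Proof.
move=> xi Fx Fi.
have h1 : (y - m) / d @[y --> F] --> (x - m) / d.
  by apply: cvgM; [apply: cvgB; [exact: Fx|exact: cvg_cst]|exact: cvg_cst].
have h2 : sc_arg y @[y --> F] --> sc_arg x.
  have x1 : m - d <= x by case/andP: xi.
  have := continuous_sc_arg x1; apply: cvg_trans; exact: cvg_app.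
apply: cvgB; [apply: cvgD|].
- have := @continuous_sc_sqrt x; apply: cvg_trans; exact: cvg_app.
- apply: cvgM; first exact: cvg_cst.
  by apply: cvg_asin => //; [exact: sc_lin_itv|apply: filterS Fi => y; exact: sc_lin_itv].
- apply: cvgM; first exact: cvg_cst.
  by apply: cvg_asin => //; [exact: sc_arg_itv|apply: filterS Fi => y; exact: sc_arg_itv].
Qed.

Lemma is_derive_sc_prim x : m - d < x < m + d ->
  is_derive x (1 : R) sc_prim (Num.sqrt (d ^+ 2 - (x - m) ^+ 2) / (s + x)).
Proof.
move=> xi; have x0 := sc_dist_gt0 xi; have l1 := sc_lin_oo xi; have a1 := sc_arg_oo xi.
have x1 : m - d <= x by case/andP: xi => /ltW.
have xs := sc_xs x1.
set J := Num.sqrt (d ^+ 2 - (x - m) ^+ 2).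
have J0 : 0 < J by rewrite sqrtr_gt0.
have J2 : J ^+ 2 = d ^+ 2 - (x - m) ^+ 2 by rewrite sqr_sqrtr// ltW.
have dJ : is_derive x (1 : R) (fun x : R => Num.sqrt (d ^+ 2 - (x - m) ^+ 2)) (- (x - m) / J).
  have dq := is_derive_sub (is_derive_cst (d ^+ 2) x 1)
    (is_derive_mul (is_derive_subc x m) (is_derive_subc x m)).
  have := is_derive_compose (g := fun y : R => d ^+ 2 - (y - m) ^+ 2) (is_derive1_sqrt x0) dq; congr (is_derive _ _ _ _).
  by rewrite -/J; field; rewrite gt_eqF.
have dA1 : is_derive x (1 : R) (fun x : R => asin ((x - m) / d)) J^-1.
  have dq := is_derive_mul (is_derive_subc x m) (is_derive_cst d^-1 x 1).
  have := is_derive_compose (g := fun y : R => (y - m) / d) (is_derive1_asin l1) dq; congr (is_derive _ _ _ _).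
  have -> : 1 - ((x - m) / d) ^+ 2 = (J / d) ^+ 2.
    by rewrite [RHS]expr_div_n J2; field; rewrite gt_eqF.
  rewrite sqrtr_sqr ger0_norm ?divr_ge0 ?ltW//.
  by rewrite mulr0 add0r mulr1 /cst; field; rewrite !gt_eqF.
have dA2 : is_derive x (1 : R) (fun x : R => asin (sc_arg x)) (sc_root / (J * (x + s))).
  have xs0 : d * (x - - s) != 0 by rewrite opprK mulf_neq0// gt_eqF.
  have dq : is_derive x (1 : R) sc_arg (sc_root ^+ 2 / (d * (x + s) ^+ 2)).
    have := is_derive_mul (is_derive_sub (is_derive_cmul (m + s) (is_derive_subc x (- s)))
      (is_derive_cst (sc_root ^+ 2) x 1))
      (is_derive_inv (f := fun y => d * (y - - s)) xs0 (is_derive_cmul d (is_derive_subc x (- s)))).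
    rewrite (_ : (fun y => _) = sc_arg); last by apply/funext => y; rewrite /sc_arg opprK.
    congr (is_derive _ _ _ _); rewrite opprK /cst; field.
    by rewrite !gt_eqF.
  have := is_derive_compose (is_derive1_asin a1) dq; congr (is_derive _ _ _ _).
  rewrite one_sub_sqr_sc_arg// -J2 -exprMn -expr_div_n sqrtr_sqr ger0_norm; last first.
    by apply: divr_ge0; apply: mulr_ge0; rewrite ?ltW// sc_root_gt0.
  by field; rewrite !gt_eqF ?sc_root_gt0.
have := is_derive_sub (is_derive_add dJ (is_derive_cmul (m + s) dA1)) (is_derive_cmul sc_root dA2).
congr (is_derive _ _ _ _).
have e : J = (d ^+ 2 - (x - m) ^+ 2) / J by rewrite -J2 expr2 mulfK ?gt_eqF.
rewrite [in RHS]e mulrA -expr2 sqr_sc_root; field.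
by rewrite [s + x]addrC !gt_eqF.
Qed.

Lemma sc_integral :
  (\int[lebesgue_measure]_(x in `[(m - d)%R, (m + d)%R]) (Num.sqrt (d ^+ 2 - (x - m) ^+ 2) / (s + x))%R%:E
   = (pi * (m + s - sc_root))%R%:E)%E.
Proof.
have ab : m - d < m + d by have := d0; lra.
rewrite (continuous_FTC2 (F := sc_prim)) //.
- rewrite sc_prim_right sc_prim_left -EFinB; congr (_%:E); rewrite opprK; lra.
- apply/subspace_continuousP => x /=; rewrite in_itv/= => /andP[x1 _].
  apply: cvg_within_filter; apply: cvgM; first exact: continuous_sc_sqrt.
  apply: cvgV; first by rewrite gt_eqF// addrC sc_xs.
  by apply: cvgD; [exact: cvg_cst|exact: cvg_id].
- split.
  + move=> x; rewrite in_itv/= => xi; by case: (is_derive_sc_prim xi).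
  + apply: sc_prim_cvg; first by rewrite lexx ltW.
    * exact: cvg_at_right_filter cvg_id.
    * near=> y; apply/andP; split; near: y; [exact: nbhs_right_ge|exact: nbhs_right_le].
  + apply: sc_prim_cvg; first by rewrite lexx ltW.
    * exact: cvg_at_left_filter cvg_id.
    * near=> y; apply/andP; split; near: y; [exact: nbhs_left_ge|exact: nbhs_left_le].
- move=> x; rewrite in_itv/= => xi; rewrite derive1E.
  by case: (is_derive_sc_prim xi).
Unshelve. all: by end_near. Qed.

End primitive.
End semicircle_integral.

Section marchenko_pastur_transform.
Variable R : realType.
Variable lam : R.
Hypothesis lam01 : 0 < lam <= 1.

Let lam0 : 0 < lam. Proof. by case/andP: lam01. Qed.
Let lam1 : lam <= 1. Proof. by case/andP: lam01. Qed.

Lemma MP_left : (1 - Num.sqrt lam) ^+ 2 = (1 + lam) - 2 * Num.sqrt lam.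
Proof. by rewrite sqrrB expr1n sqr_sqrtr ?ltW//; ring. Qed.

Lemma MP_right : (1 + Num.sqrt lam) ^+ 2 = (1 + lam) + 2 * Num.sqrt lam.
Proof. by rewrite sqrrD expr1n sqr_sqrtr ?ltW//; ring. Qed.

Lemma MP_pdfE x : (1 + lam) - 2 * Num.sqrt lam <= x <= (1 + lam) + 2 * Num.sqrt lam ->
  MP_pdf lam x = (2 * pi * lam * x)^-1 * Num.sqrt ((2 * Num.sqrt lam) ^+ 2 - (x - (1 + lam)) ^+ 2).
Proof. by rewrite /MP_pdf MP_left MP_right => ->; congr (_ * Num.sqrt _); ring. Qed.

Lemma MP_pdf_out x : ~~ ((1 + lam) - 2 * Num.sqrt lam <= x <= (1 + lam) + 2 * Num.sqrt lam) ->
  MP_pdf lam x = 0.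
Proof. by rewrite /MP_pdf MP_left MP_right => /negbTE ->. Qed.

Lemma MP_left_ge0 : 0 <= (1 + lam) - 2 * Num.sqrt lam.
Proof. by rewrite -MP_left sqr_ge0. Qed.

Lemma MP_nneg : nneg_supported (MP lam).
Proof.
apply: integral0_eq => x /= x0.
rewrite MP_pdf_out// negb_and -ltNge; apply/orP; left.
exact: lt_le_trans x0 MP_left_ge0.
Qed.

Lemma MP_atom0 : MP lam [set 0] = 0%E.
Proof. by apply: integral_set1; exact/measurable_EFinP/measurable_MP_pdf. Qed.

Lemma MP_not_dirac0 : ~ is_dirac0 (MP lam).
Proof.
move=> h; have := etrans (esym MP_atom0) (h [set 0] (measurable_set1 _)).
by rewrite diracE mem_set// => /eqP; rewrite eqe eq_sym oner_eq0.
Qed.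

Definition MP_root (s : R) : R := Num.sqrt ((1 + lam + s) ^+ 2 - (2 * Num.sqrt lam) ^+ 2).

(** At [z = - 1 / s] the integrand is [- u / (s + u)], whose factor [u] cancels the [1 / u] of the
    density. What is left is the semicircle integral with centre [1 + lam] and radius
    [2 sqrt lam]. *)
Lemma MP_psi s : 0 < s ->
  psi_transform (MP lam) (- s^-1) = - ((1 + lam + s - MP_root s) / (2 * lam)).
Proof.
move=> s0; have l0 := lam0.
pose h (x : R) := pos x / (s + pos x).
have sp x : 0 < s + pos x by rewrite ltr_wpDr// pos_ge0.
have h0 x : 0 <= h x by apply: divr_ge0; [exact: pos_ge0|exact: ltW].
have mh : measurable_fun [set: R] h.
  apply: continuous_measurable_fun => x; apply: cvgM; first exact: continuous_pos.
  apply: cvgV; first by rewrite gt_eqF.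
  by apply: cvgD; [exact: cvg_cst|exact: continuous_pos].
rewrite /psi_transform /Rintegral.
have -> : (\int[MP lam]_(x in `[0%R, +oo[) (x * - s^-1 / (1 - x * - s^-1))%:E =
   \int[MP lam]_(x in `[0%R, +oo[) (- (h x)%:E))%E.
  apply: eq_integral => x; rewrite inE/= in_itv/= andbT => x0; rewrite -[RHS]/((- h x)%:E); congr (_%:E).
  rewrite /h posE//; have sx : s + x != 0 by rewrite gt_eqF// ltr_wpDr.
  have sn : s != 0 by rewrite gt_eqF.
  by field; rewrite ?sn ?sx.
rewrite integral_ge0N; last by move=> x _; rewrite lee_fin.
rewrite fineN; congr (- _).
pose D : set R := `[0, +oo[%classic.
pose d := 2 * Num.sqrt lam.
have d0 : 0 < d by rewrite mulr_gt0// sqrtr_gt0.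
have dm : d <= 1 + lam by rewrite -subr_ge0 MP_left_ge0.
pose J x := Num.sqrt (d ^+ 2 - (x - (1 + lam)) ^+ 2) / (s + x).
pose I : set R := `[(1 + lam - d), (1 + lam + d)]%classic.
have mE : measurable_fun setT ((EFin \o h) \_ D).
  have mD : measurable (D : set (measurableTypeR R)) by exact: measurable_itv.
  apply/(measurable_restrictT _ mD); apply: measurable_funTS.
  exact/measurable_EFinP.
have hD x : (0 <= ((EFin \o h) \_ D) x)%E.
  by rewrite patchE; case: ifP => // _; rewrite lee_fin.
rewrite integral_mkcond.
rewrite (@ge0_integral_density _ _ _ lebesgue_measure (MP lam) (MP_pdf lam))//; last 2 first.
- exact: measurable_MP_pdf.
- by move=> x; exact: MP_pdf_ge0.
have cJ : {within I, continuous J}.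
  apply/subspace_continuousP => x; rewrite /I /= in_itv/= => /andP[x1 _].
  apply: cvg_within_filter; apply: cvgM; first exact: continuous_sc_sqrt.
  have xs : 0 < s + x by rewrite ltr_wpDr// (le_trans MP_left_ge0).
  by apply: cvgV; [rewrite gt_eqF|apply: cvgD; [exact: cvg_cst|exact: cvg_id]].
have J0 x : I x -> 0 <= J x.
  rewrite /I /= in_itv/= => /andP[x1 _]; apply: divr_ge0; first exact: sqrtr_ge0.
  by rewrite addr_ge0 ?(ltW s0)// (le_trans MP_left_ge0).
have e x : (((EFin \o h) \_ D) x * (MP_pdf lam x)%:E =
    ((EFin \o (fun x => (2 * pi * lam)^-1 * J x)%R) \_ I) x)%E.
  rewrite !patchE; case: (boolP (x \in I)) => xI; last first.
    have pdf0 : MP_pdf lam x = 0.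
      by apply: MP_pdf_out; move: xI; rewrite notin_setE /I /= in_itv/= => /negP.
    by rewrite pdf0 mule0.
  have xI' : 1 + lam - d <= x <= 1 + lam + d by move: xI; rewrite inE /I /= in_itv.
  have x0 : 0 <= x by apply: le_trans MP_left_ge0 _; case/andP: xI'.
  rewrite mem_set; last by rewrite /D /= in_itv/= x0.
  rewrite /= -EFinM MP_pdfE// /h posE// /J; congr (_%:E).
  have sx : s + x != 0 by rewrite gt_eqF// ltr_wpDr.
  (* The origin is in the support only when [lam = 1]; there [pos x] kills the left side and the
     square root vanishes on the right. *)
  have [x00|xn0] := eqVneq x 0.
    rewrite x00 mul0r mul0r; have -> : d ^+ 2 - (0 - (1 + lam)) ^+ 2 = - (1 - lam) ^+ 2 - (2 * (2 * lam) - d ^+ 2) by ring.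
    rewrite /d exprMn sqr_sqrtr ?ltW// (_ : 2 * (2 * lam) - 2 ^+ 2 * lam = 0); last by ring.
    by rewrite subr0 ler0_sqrtr ?oppr_le0 ?sqr_ge0// mul0r mulr0.
  have pi0 : pi != 0 :> R by rewrite gt_eqF// pi_gt0.
  rewrite -/d; move: (Num.sqrt _) (pi : R) pi0 => q w pi0; field.
  have ln : lam != 0 by rewrite gt_eqF.
  by rewrite ?pi0 ?ln ?xn0 ?sx.
under eq_integral do rewrite e.
rewrite -integral_mkcond.
have mJ : measurable_fun I (EFin \o J).
  apply/measurable_EFinP; apply: subspace_continuous_measurable_fun => //.
  exact: measurable_itv.
under eq_integral do rewrite /= EFinM.
rewrite ge0_integralZl//; last by rewrite lee_fin invr_ge0 !mulr_ge0 ?pi_ge0// ltW.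
rewrite sc_integral// -EFinM /=.
have pi0 : pi != 0 :> R by rewrite gt_eqF// pi_gt0.
rewrite /MP_root /sc_root -/d; move: (Num.sqrt _) (pi : R) pi0 => q w pi0; field.
have ln : lam != 0 by rewrite gt_eqF.
by rewrite ?pi0 ?ln.
exact: measurable_itv.
Qed.

(** Both sides say that [MP_root s = 1 + lam + s - 2 lam t]; squared, this becomes
    [s t = (1 - t)(1 - lam t)]. The way back from the squares uses that the right side is
    nonnegative. *)
Lemma MP_psi_eq s t : 0 < s -> 0 < t < 1 ->
  psi_transform (MP lam) (- s^-1) = - t <-> s = (1 - t) * (1 - lam * t) / t.
Proof.
move=> s0 /andP[t0 t1]; have l0 := lam0; have l1 := lam1.
rewrite MP_psi//; have tn : t != 0 by rewrite gt_eqF.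
have d2 : (2 * Num.sqrt lam) ^+ 2 = 4%:R * lam.
  by rewrite exprMn sqr_sqrtr ?ltW//; ring.
have r2 : 0 <= (1 + lam + s) ^+ 2 - (2 * Num.sqrt lam) ^+ 2.
  rewrite d2; have -> : (1 + lam + s) ^+ 2 - 4%:R * lam = (1 - lam) ^+ 2 + s * (2 * (1 + lam) + s) by ring.
  apply: addr_ge0; first exact: sqr_ge0.
  by apply: mulr_ge0; [exact: ltW|lra].
have lt1 : lam * t < 1.
  by apply: (@le_lt_trans _ _ t) => //; rewrite ler_piMl// ltW.
have q0 : 0 <= MP_root s by exact: sqrtr_ge0.
have q2 : MP_root s ^+ 2 = (1 + lam + s) ^+ 2 - 4%:R * lam by rewrite /MP_root sqr_sqrtr// d2.
have key : (1 + lam + s - 2 * lam * t) ^+ 2 - MP_root s ^+ 2 =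
    4%:R * lam * ((1 - t) * (1 - lam * t) - s * t) by rewrite q2; ring.
split => [/oppr_inj h|h].
  have e : MP_root s = 1 + lam + s - 2 * lam * t.
    by rewrite -h; field; rewrite gt_eqF.
  move: key; rewrite -e subrr => /esym/eqP.
  rewrite mulf_eq0 (gt_eqF (mulr_gt0 _ l0))//= subr_eq0 => /eqP ->.
  by rewrite mulfK.
have hs : s * t = (1 - t) * (1 - lam * t) by rewrite h mulfVK.
have p0 : 0 <= 1 + lam + s - 2 * lam * t.
  have : lam * t <= lam by rewrite ler_piMr// ltW.
  lra.
have e : MP_root s = 1 + lam + s - 2 * lam * t.
  apply/eqP; rewrite -(eqrXn2 (n := 2))//; apply/eqP.
  by apply/eqP; rewrite eq_sym -subr_eq0 key -hs subrr mulr0.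
by rewrite e; congr (- _); field; rewrite gt_eqF.
Qed.

Lemma MP_psi_inv t : 0 < t < 1 ->
  psi_inv (MP lam) (- t) = - (t / ((1 - t) * (1 - lam * t))).
Proof.
move=> t01; have /andP[t0 t1] := t01.
have lt1 : lam * t < 1.
  by apply: (@le_lt_trans _ _ t) => //; rewrite ler_piMl ?lam1// ltW.
pose s := (1 - t) * (1 - lam * t) / t.
have s0 : 0 < s by apply: divr_gt0 => //; apply: mulr_gt0; rewrite subr_gt0.
have -> : t / ((1 - t) * (1 - lam * t)) = s^-1 by rewrite /s invf_div.
rewrite /psi_inv; case: xgetP => [w _ [w0 hw]|/(_ (- s^-1)) []]; last first.
  by split; [rewrite oppr_lt0 invr_gt0|apply/MP_psi_eq].
have nw : 0 < - w^-1 by rewrite oppr_gt0 invr_lt0.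
have ww : w = - (- w^-1)^-1 by rewrite invrN opprK invrK.
by move: hw; rewrite ww (MP_psi_eq nw t01) => hs; rewrite hs.
Qed.

Lemma MP_S_transform t : 0 < t < 1 -> S_transform (MP lam) (- t) = (1 - lam * t)^-1.
Proof.
move=> t01; have /andP[t0 t1] := t01.
have lt1 : lam * t < 1.
  by apply: (@le_lt_trans _ _ t) => //; rewrite ler_piMl ?lam1// ltW.
rewrite /S_transform MP_psi_inv//; field.
by rewrite !subr_eq0 !gt_eqF// oppr_eq0 gt_eqF.
Qed.

End marchenko_pastur_transform.

(** * S-transforms *)

Section profiles.
Variable R : realType.

(** Properties of the limit of [bmean (s n) y / n] as a function of [y]. They suffice for continuity
    and for solving equations in [y] by intermediate values. *)
Record profile (M : R -> R) : Prop := Profile {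
  profile_ge0 : forall y, 0 < y -> 0 <= M y ;
  profile_le : forall y z, 0 < y -> y <= z -> M y <= M z ;
  profile_ratio : forall y z, 0 < y -> y <= z -> M z <= z / y * M y ;
  profile_small : forall e, 0 < e -> exists2 y, 0 < y & M y < e }.

(* For [lam = 0] the point [w] at which the limit [mu] of the Appell roots has
   [psi_mu (- w) = - M y], for [0 < lam] the one for [MP lam] times [mu]. *)
Definition width (lam : R) (M : R -> R) (y : R) : R := y / ((1 - M y) * (1 - lam * M y)).

Variables (M : R -> R) (hM : profile M) (lam : R).
Hypothesis lam01 : 0 <= lam <= 1.

Let lam0 : 0 <= lam. Proof. by case/andP: lam01. Qed.
Let lam1 : lam <= 1. Proof. by case/andP: lam01. Qed.

(** Monotonicity of [M] and of [M y / y] in opposite directions gives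
    [|M x - M y| <= |x - y| * M y / y]. *)
Lemma profile_continuous y : 0 < y -> {for y, continuous M}.
Proof.
move=> y0; have My := profile_ge0 hM y0.
have l (k : R) : M y + k * (`|x - y| * (M y / y)) @[x --> y] --> M y.
  have e : M y + k * (0 * (M y / y)) = M y by rewrite mul0r mulr0 addr0.
  rewrite -[X in _ --> X]e.
  apply: cvgD; first exact: cvg_cst.
  apply: cvgM; first exact: cvg_cst.
  apply: cvgM; last exact: cvg_cst.
  have h1 : x - y @[x --> y] --> y - y by apply: cvgB; [exact: cvg_id|exact: cvg_cst].
  have e1 : `|y - y| = 0 by rewrite subrr normr0.
  by rewrite -[X in _ --> X]e1; exact: cvg_norm h1.
apply: (@squeeze_cvgr _ _ _ _ (fun x => M y + (-1) * (`|x - y| * (M y / y)))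
   (fun x => M y + 1 * (`|x - y| * (M y / y)))); [|exact: l|exact: l].
near=> x; have x0 : 0 < x by near: x; exact: lt_nbhsr.
rewrite mulN1r mul1r.
have yn : y != 0 by rewrite gt_eqF.
have [xy|yx] := leP x y.
  have h1 := profile_le hM x0 xy; have h2 := profile_ratio hM x0 xy.
  have h3 : x / y * M y <= M x.
    have := ler_wpM2l (divr_ge0 (ltW x0) (ltW y0)) h2.
    have -> // : x / y * (y / x * M x) = M x.
    by field; rewrite !gt_eqF.
  rewrite ler0_norm ?subr_le0//; apply/andP; split.
    apply: (le_trans _ h3); rewrite le_eqVlt; apply/orP; left; apply/eqP; field.
    by rewrite gt_eqF.
  apply: (le_trans h1); rewrite lerDl mulr_ge0 ?divr_ge0 ?(ltW y0)//.
  by rewrite oppr_ge0 subr_le0.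
have h1 := profile_le hM y0 (ltW yx); have h2 := profile_ratio hM y0 (ltW yx).
rewrite gtr0_norm ?subr_gt0//; apply/andP; split.
  apply: (le_trans _ h1); rewrite gerBl mulr_ge0 ?divr_ge0 ?(ltW y0)//.
  by rewrite subr_ge0 ltW.
apply: (le_trans h2); rewrite le_eqVlt; apply/orP; left; apply/eqP; field.
by rewrite gt_eqF.
Unshelve. all: by end_near. Qed.

Lemma profile_lt e : 0 < e -> exists2 y, 0 < y & forall z, 0 < z -> z <= y -> M z < e.
Proof.
move=> e0; have [y y0 My] := profile_small hM e0; exists y => // z z0 zy.
exact: le_lt_trans (profile_le hM z0 zy) My.
Qed.

Section half.
Variable y0 : R.
Hypotheses (y00 : 0 < y0) (My0 : M y0 < 2^-1).

Lemma profile_half y : 0 < y -> y <= y0 -> 0 <= M y < 2^-1.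
Proof.
move=> yp yy; rewrite (profile_ge0 hM yp)/=.
exact: le_lt_trans (profile_le hM yp yy) My0.
Qed.

(** Both factors lie between [1/2] and 1 because [lam * M y <= M y < 1/2]. *)
Lemma width_den_bounds y : 0 < y -> y <= y0 ->
  4%:R^-1 <= (1 - M y) * (1 - lam * M y) <= 1.
Proof.
move=> yp yy; have /andP[m0 m1] := profile_half yp yy.
have q0 : 0 <= lam * M y by exact: mulr_ge0.
have q1 : lam * M y <= M y by rewrite ler_piMl.
move: (lam * M y) q0 q1 => q q0 q1; apply/andP; split.
  have : 0 <= (1 - M y - 2^-1) * (1 - q - 2^-1) by apply: mulr_ge0; lra.
  by lra.
have : 0 <= M y * (1 - q) by apply: mulr_ge0 => //; lra.
lra.
Qed.

Lemma width_bounds y : 0 < y -> y <= y0 -> y <= width lam M y <= 4%:R * y.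
Proof.
move=> yp yy; have /andP[d0 d1] := width_den_bounds yp yy; rewrite /width.
have dp : 0 < (1 - M y) * (1 - lam * M y) by apply: lt_le_trans d0; lra.
rewrite ler_pdivlMr// ler_pdivrMr//; apply/andP; split; first by rewrite ler_piMr// ltW.
move: ((1 - M y) * _) d0 d1 dp => D d0 d1 dp.
have : 0 <= y * (D - 4%:R^-1) by apply: mulr_ge0; [exact: ltW|rewrite subr_ge0].
rewrite mulrBr; lra.
Qed.

(** Since [y <= width y <= 4 y], the value [w] lies between the widths at [w / 4] and at [y0]. *)
Lemma width_surj w : 0 < w -> w < y0 -> exists y, [/\ 0 < y, y <= y0 & width lam M y = w].
Proof.
move=> w0 wy.
have w4 : 0 < w / 4%:R by rewrite divr_gt0.
have w4y : w / 4%:R <= y0 by lra.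
have /andP[a1 a2] := width_bounds w4 w4y.
have /andP[b1 b2] := width_bounds y00 (lexx _).
have cont : {within `[w / 4%:R, y0], continuous (width lam M)}.
  apply/subspace_continuousP => x /=; rewrite in_itv/= => /andP[x1 x2].
  have xp : 0 < x by exact: lt_le_trans x1.
  have cM := profile_continuous xp.
  apply: cvg_within_filter; apply: cvgM; first exact: cvg_id.
  apply: cvgV; first by have /andP[h _] := width_den_bounds xp x2; rewrite gt_eqF// (lt_le_trans _ h).
  apply: cvgM; first by apply: cvgB; [exact: cvg_cst|exact: cM].
  by apply: cvgB; [exact: cvg_cst|apply: cvgM; [exact: cvg_cst|exact: cM]].
have [] := @IVT R (width lam M) _ _ w w4y cont.
  have fw : width lam M (w / 4%:R) <= w by lra.
  by rewrite ge_min fw/= le_max; apply/orP; right; lra.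
move=> y; rewrite in_itv/= => /andP[y1 y2] e; exists y; split=> //.
exact: lt_le_trans y1.
Qed.

Lemma profile_surj t : 0 < t -> t < M y0 -> exists y, [/\ 0 < y, y <= y0 & M y = t].
Proof.
move=> t0 tM; have [y1 y10 My1] := profile_small hM t0.
have y1y : y1 <= y0.
  by rewrite leNgt; apply/negP => /ltW /(profile_le hM y00); lra.
have cont : {within `[y1, y0], continuous M}.
  apply/subspace_continuousP => x /=; rewrite in_itv/= => /andP[x1 x2].
  apply: cvg_within_filter; apply: profile_continuous; exact: lt_le_trans x1.
have [] := @IVT R M _ _ t y1y cont.
  by rewrite ge_min (ltW My1)/= le_max (ltW tM) orbT.
move=> y; rewrite in_itv/= => /andP[h1 h2] e; exists y; split=> //.
exact: lt_le_trans h1.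
Qed.

Section limits.
Variable u : nat -> seq R.
Hypothesis u0 : forall n : nat, (0 < n)%N -> all (>= 0) (u n) /\ size (u n) = n.
Hypothesis hu : forall y, 0 < y -> y <= y0 ->
  hmean (u n) (width lam M y) @[n --> \oo] --> 1 - M y.

Lemma profile_limit_measure : exists mu : probability (measurableTypeR R) R,
  nneg_supported mu /\
  forall g : R -> R, bounded_continuous g -> avg (u n) g @[n --> \oo] --> \int[mu]_x g x.
Proof.
have hw (w : R) : 0 < w < y0 -> hmean (u n) w @[n --> \oo] --> limn (fun n => hmean (u n) w).
  move=> /andP[w0 wy]; have [y [yp yy <-]] := width_surj w0 wy.
  by apply/cvg_ex; exists (1 - M y); exact: hu.
have [|mu [mu0 hmu]] := exists_limit_measure y00 u0 hw.
  move=> e e0; have [y1 y10 h1] := profile_lt e0.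
  (* With [y <= y0 / 9] the width is at most [4 y0 / 9], strictly below the required [y0 / 2]. *)
  pose y := Order.min (Order.min y1 y0) (y0 / 9%:R).
  have yp : 0 < y by rewrite !lt_min y10 y00 divr_gt0.
  have yy1 : y <= y1 by rewrite !ge_min lexx.
  have yy0 : y <= y0 by rewrite !ge_min lexx !orbT.
  have y9 : y <= y0 / 9%:R by rewrite !ge_min lexx !orbT.
  have /andP[b1 b2] := width_bounds yp yy0.
  exists (width lam M y); first by apply/andP; split; lra.
  have -> : limn (fun n => hmean (u n) (width lam M y)) = 1 - M y.
    by apply/cvg_lim => //; exact: hu.
  by have := h1 _ yp yy1; lra.
by exists mu; split=> // g [cg bg]; exact: hmu.
Qed.

Lemma profile_measure (mu : probability (measurableTypeR R) R) :
  (forall g : R -> R, bounded_continuous g -> avg (u n) g @[n --> \oo] --> \int[mu]_x g x) ->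
  forall y, 0 < y -> y <= y0 -> \int[mu]_x cpt (width lam M y) x = 1 - M y.
Proof.
move=> hmu y yp yy; have /andP[b1 _] := width_bounds yp yy.
have w0 : 0 <= width lam M y by apply: le_trans b1; exact: ltW.
have bc : bounded_continuous (cpt (width lam M y)).
  split; first exact: continuous_cpt.
  by exists 1 => x; have /andP[a b] := cpt01 x w0; rewrite ger0_norm.
apply: (cvg_unique _ (hmu _ bc)) => //.
have := hu yp yy; apply: cvg_trans; apply: near_eq_cvg; near=> n.
have n0 : (0 < n)%N by near: n; exists 1%N.
by rewrite avg_cpt//; case: (u0 n0).
Unshelve. all: by end_near. Qed.

Lemma profile_limit (mu : probability (measurableTypeR R) R) : nneg_supported mu ->
  (forall y, 0 < y -> y <= y0 -> \int[mu]_x cpt (width lam M y) x = 1 - M y) ->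
  forall g : R -> R, bounded_continuous g -> avg (u n) g @[n --> \oo] --> \int[mu]_x g x.
Proof.
move=> mu0 hmu g [cg bg]; apply: (avg_cvg_measure y00 u0 mu0) => // w /andP[w0 wy].
by have [y [yp yy <-]] := width_surj w0 wy; rewrite hmu//; exact: hu.
Qed.

End limits.
End half.
End profiles.

Section s_transform.
Variable R : realType.
Implicit Types mu nu : probability (measurableTypeR R) R.

Lemma Rintegral_nneg_itv mu (g : R -> R) : nneg_supported mu -> measurable_fun setT g ->
  \int[mu]_(x in `[0, +oo[) g x = \int[mu]_x g x.
Proof.
move=> mu0 mg; rewrite /Rintegral; congr fine.
rewrite integral_mkcond; apply: ae_eq_integral => //.
- have mD : measurable (`[0, +oo[%classic : set (measurableTypeR R)) by exact: measurable_itv.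
  apply/(measurable_restrictT _ mD); apply: measurable_funTS.
  exact/measurable_EFinP.
- exact/measurable_EFinP.
- apply: (@filterS _ (almost_everywhere mu) _ _ _ _ (nneg_supported_ae mu0)) => x x0 _ /=.
  by rewrite patchE mem_set//= in_itv/= x0.
Qed.

Lemma bc_cpt (w : R) : 0 <= w -> bounded_continuous (cpt w).
Proof.
move=> w0; split; first exact: continuous_cpt.
by exists 1 => x; have /andP[a b] := cpt01 x w0; rewrite ger0_norm.
Qed.

Lemma integrable_cpt mu (w : R) : 0 <= w -> mu.-integrable setT (EFin \o cpt w).
Proof.
move=> w0; have [c [M hM]] := bc_cpt w0.
by apply: (@integrable_bounded _ _ _ mu _ M) => //; exact: continuous_measurable_fun.
Qed.

Lemma integrable_one mu : mu.-integrable setT (EFin \o (fun=> 1 : R)).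
Proof. by apply: (@integrable_bounded _ _ _ mu _ 1) => // x; rewrite normr1. Qed.

Lemma Rintegral_one mu : \int[mu]_x (fun=> 1) x = 1 :> R.
Proof. by rewrite Rintegral_cst// mul1r; exact: (congr1 fine (probability_setT mu)). Qed.

Lemma psi_cpt mu (w : R) : nneg_supported mu -> 0 <= w ->
  psi_transform mu (- w) = - (1 - \int[mu]_x cpt w x).
Proof.
move=> mu0 w0; rewrite opprB -(Rintegral_one mu) -RintegralB//; last 2 first.
- exact: integrable_cpt.
- exact: integrable_one.
rewrite /psi_transform -(Rintegral_nneg_itv mu0 (g := fun x => cpt w x - 1)).
  apply: eq_Rintegral => x; rewrite inE/= in_itv/= andbT => x0.
  rewrite /cpt posE//; have xw : 0 < 1 + w * x by rewrite ltr_pwDl// mulr_ge0.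
  have -> : 1 - x * - w = 1 + w * x by ring.
  by field; rewrite gt_eqF.
apply: measurable_funB => //; apply: continuous_measurable_fun; exact: continuous_cpt.
Qed.

Lemma ae0_dirac0 mu : (\forall x \ae mu, x = 0) -> is_dirac0 mu.
Proof.
move=> [N [mN N0 sN]].
have h (A : set (measurableTypeR R)) : measurable A -> ~ A (0 : R) -> mu A = 0%E.
  move=> mA A0; apply/eqP; rewrite eq_le measure_ge0 andbT -N0.
  apply: le_measure; rewrite ?inE// => x Ax; apply: sN => /= x0.
  by apply: A0; rewrite -x0.
move=> A mA; rewrite diracE; have [A0|A0] := pselect (A (0 : R)).
  rewrite mem_set// -[A]setCK; apply: (etrans (probability_setC mu (measurableC mA))).
  apply: (etrans (congr1 (fun t => (1 - t)%E) (h _ (measurableC mA) _))) => [|]; last by rewrite sube0.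
  by move=> /(_ A0).
by apply: (etrans (h _ mA A0)); rewrite memNset.
Qed.

(** [cpt v - cpt w] is nonnegative and vanishes on the half-line only at 0, so equal integrals put
    all the mass there. *)
Lemma cpt_inj mu (v w : R) : nneg_supported mu -> 0 <= v -> v < w ->
  \int[mu]_x cpt v x = \int[mu]_x cpt w x -> is_dirac0 mu.
Proof.
move=> mu0 v0 vw e; have w0 := le_lt_trans v0 vw; apply: ae0_dirac0.
have h : \forall x \ae mu, cpt v x - cpt w x = 0.
  apply: Rintegral_eq0_ae.
  - exact: (integrableB measurableT (integrable_cpt mu v0) (integrable_cpt mu (ltW w0))).
  - move=> x; rewrite subr_ge0 lef_pV2 ?posrE ?cpt_den ?(ltW w0)//.
    by rewrite lerD2l ler_wpM2r ?pos_ge0// ltW.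
  - by rewrite RintegralB ?e ?subrr//; apply: integrable_cpt => //; exact: ltW.
apply: (@filterS2 _ (almost_everywhere mu) _ _ _ _ _ h (nneg_supported_ae mu0)).
move=> x /eqP + x0; rewrite subr_eq0 => /eqP/invr_inj/addrI.
rewrite posE// => /eqP; rewrite -subr_eq0 -mulrBl mulf_eq0 subr_eq0 lt_eqF//=.
by move/eqP.
Qed.

Lemma cpt0 mu : \int[mu]_x cpt 0 x = 1.
Proof. by rewrite -[RHS](Rintegral_one mu); apply: eq_Rintegral => x _; rewrite /cpt mul0r addr0 invr1. Qed.

Lemma dirac0_cpt mu (w : R) : 0 <= w -> is_dirac0 mu -> \int[mu]_x cpt w x = 1.
Proof.
move=> w0 md; rewrite -[RHS](Rintegral_one mu) /Rintegral; congr fine.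
apply: ae_eq_integral => //.
- by apply/measurable_EFinP; apply: continuous_measurable_fun; exact: continuous_cpt.
- exists (~` [set 0]); split.
  + by apply: measurableC; exact: measurable_set1.
  + apply: (etrans (md _ _)); first by apply: measurableC; exact: measurable_set1.
    by rewrite diracE memNset// => /(_ erefl).
  + move=> x /= h x0; apply: h => _; rewrite x0 /cpt posE// mulr0 addr0 invr1//.
Qed.

Lemma cpt_lt1 mu (w : R) : nneg_supported mu -> 0 < w -> ~ is_dirac0 mu -> \int[mu]_x cpt w x < 1.
Proof.
move=> mu0 w0 nd; rewrite lt_neqAle; apply/andP; split.
  by apply/eqP => e; apply: nd; apply: (cpt_inj mu0 (lexx 0) w0); rewrite cpt0 e.
rewrite -(Rintegral_one mu); apply: le_Rintegral => //.
- exact: integrable_cpt (ltW w0).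
- exact: integrable_one.
- by move=> x _; have /andP[] := cpt01 x (ltW w0).
Qed.

Lemma atom0_lt1 mu : nneg_supported mu -> ~ is_dirac0 mu -> 0 < 1 - fine (mu [set 0]).
Proof.
move=> mu0 nd; rewrite subr_gt0 lt_neqAle.
have mz : measurable ([set 0] : set (measurableTypeR R)) by exact: measurable_set1.
have fz : mu [set 0] \is a fin_num by exact: fin_num_measure.
apply/andP; split; last first.
  by rewrite -lee_fin fineK//; exact: probability_le1.
apply/eqP => e; apply: nd; apply: ae0_dirac0; exists (~` [set 0]); split=> //.
- by apply: measurableC; exact: measurable_set1.
- apply: (etrans (probability_setC mu (measurable_set1 _))).
  have m1 : mu [set 0] = 1%E by rewrite -[LHS]fineK ?e.
  by apply: (etrans (congr1 (fun t => (1 - t)%E) m1)); rewrite subee.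
Qed.

(** Off the Dirac mass at 0 the preimage on the negative half-line is unique, so the choice made in
    [psi_inv] is determined. *)
Lemma psi_inv_cpt mu (w t : R) : nneg_supported mu -> ~ is_dirac0 mu -> 0 < w ->
  \int[mu]_x cpt w x = 1 - t -> psi_inv mu (- t) = - w.
Proof.
move=> mu0 nd w0 e; have pw : psi_transform mu (- w) = - t.
  by rewrite psi_cpt ?(ltW w0)// e; congr (- _); ring.
rewrite /psi_inv; case: xgetP => [v _ [v0 hv]|/(_ (- w)) []]; last first.
  by split=> //; rewrite oppr_lt0.
have nv : 0 <= - v by rewrite oppr_ge0 ltW.
have ev : \int[mu]_x cpt (- v) x = 1 - t.
  move: hv; rewrite -[v]opprK psi_cpt// => /oppr_inj; rewrite opprK; lra.
have [lt|lt|//] := ltgtP (- v) w.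
- by case: nd; apply: (cpt_inj mu0 nv lt); rewrite ev e.
- by case: nd; apply: (cpt_inj mu0 (ltW w0) lt); rewrite ev e.
- by move=> <-; rewrite opprK.
Qed.

(** The default value in [psi_inv] is 0; a strictly negative value therefore is a genuine
    preimage. *)
Lemma psi_inv_neq0 mu (w t : R) : nneg_supported mu -> 0 < w ->
  psi_inv mu (- t) = - w -> \int[mu]_x cpt w x = 1 - t.
Proof.
move=> mu0 w0; rewrite /psi_inv; case: xgetP => [v _ [v0 hv] e|_ /eqP].
  by move: hv; rewrite e psi_cpt ?(ltW w0)//; lra.
by rewrite eq_sym oppr_eq0 gt_eqF.
Qed.

Section parametrized.
Variables (lam : R) (M : R -> R) (y0 : R) (mu nu : probability (measurableTypeR R) R).
Hypotheses (lam01 : 0 < lam <= 1) (hM : profile M) (y00 : 0 < y0) (My0 : M y0 < 2^-1).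
Hypotheses (mu0 : nneg_supported mu) (nu0 : nneg_supported nu).
Hypothesis hmu : forall y, 0 < y -> y <= y0 -> \int[mu]_x cpt (width 0 M y) x = 1 - M y.

Let lam0 : 0 < lam. Proof. by case/andP: lam01. Qed.
Let lamW : 0 <= lam <= 1. Proof. by case/andP: lam01 => /ltW -> ->. Qed.

Lemma width0 y : width 0 M y = y / (1 - M y).
Proof. by rewrite /width mul0r subr0 mulr1. Qed.

Lemma S_transform_mu y : ~ is_dirac0 mu -> 0 < y -> y <= y0 -> 0 < M y ->
  S_transform mu (- M y) = y / M y.
Proof.
move=> nd yp yy Mp; have /andP[m0 m1] := profile_half hM My0 yp yy.
have w0 : 0 < y / (1 - M y) by rewrite divr_gt0// subr_gt0; lra.
rewrite /S_transform (psi_inv_cpt mu0 nd w0); last by rewrite -width0 hmu.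
have h1 : 1 - M y != 0 by rewrite subr_eq0 gt_eqF//; lra.
have h2 : M y != 0 by rewrite gt_eqF.
by field; rewrite ?h1 ?h2.
Qed.

Lemma S_transform_nu_MP y : 0 < y -> y <= y0 -> 0 < M y ->
  y / M y * S_transform (MP lam) (- M y) = (1 - M y) / M y * width lam M y.
Proof.
move=> yp yy Mp; have /andP[m0 m1] := profile_half hM My0 yp yy.
rewrite MP_S_transform//; last by rewrite Mp/=; lra.
have h1 : 1 - M y != 0 by rewrite subr_eq0 gt_eqF//; lra.
have h2 : M y != 0 by rewrite gt_eqF.
have h3 : 1 - lam * M y != 0.
  rewrite subr_eq0 gt_eqF//; apply: (@le_lt_trans _ _ (M y)); last by lra.
  by rewrite ler_piMl//; case/andP: lamW.
by rewrite /width; field; rewrite ?h1 ?h2 ?h3.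
Qed.

Lemma profile_gt0 y : ~ is_dirac0 mu -> 0 < y -> y <= y0 -> 0 < M y.
Proof.
move=> nd yp yy; have /andP[m0 m1] := profile_half hM My0 yp yy.
have w0 : 0 < width 0 M y by rewrite width0 divr_gt0// subr_gt0; lra.
by have := cpt_lt1 mu0 w0 nd; rewrite hmu//; lra.
Qed.

(** All S-transforms are read off at [z = - M y], and these points fill an interval ending at 0. If
    [mu] is the Dirac mass at 0 then [M y0 = 0], which forces [nu] to be it too. *)
Lemma is_free_mult_conv_profile :
  (forall y, 0 < y -> y <= y0 -> \int[nu]_x cpt (width lam M y) x = 1 - M y) ->
  is_free_mult_conv (MP lam) mu nu.
Proof.
move=> hnu; split=> //; first exact: MP_nneg.
have /andP[b1 _] := width_bounds hM lamW My0 y00 (lexx _).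
have w0 : 0 < width lam M y0 by exact: lt_le_trans b1.
have wm0 : 0 < width 0 M y0.
  rewrite width0 divr_gt0// subr_gt0; have := My0; lra.
split=> [[/MP_not_dirac0//|dm]|_ nd].
  apply: (cpt_inj nu0 (lexx 0) w0); rewrite cpt0 hnu//.
  by rewrite -hmu// dirac0_cpt// ltW.
have Mp := profile_gt0 nd y00 (lexx _).
have nnu : ~ is_dirac0 nu.
  by move=> dn; have := hnu _ y00 (lexx _); rewrite dirac0_cpt ?(ltW w0)//; lra.
split=> //.
(* [M y0] keeps [z] in the range covered by the parametrization; the other two terms are the
   constraints on [e] from the masses of [mu] and [nu] off 0. *)
exists (Order.min (M y0) (Order.min (1 - fine (mu [set 0])) (1 - fine (nu [set 0])))).
  by rewrite !lt_min Mp !atom0_lt1.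
split.
- have -> : fine (MP lam [set 0]) = 0 by rewrite (MP_atom0 lam).
  by rewrite ge_min; apply/orP; left; rewrite subr0; have := My0; lra.
- by rewrite !ge_min lexx !orbT.
- by rewrite !ge_min lexx !orbT.
move=> z; rewrite ltrNl !lt_min => /andP[/andP[zM _] z0].
have nz : 0 < - z by rewrite oppr_gt0.
have [y [yp yy My]] := profile_surj hM y00 nz zM.
rewrite -[z]opprK -My; have Myp : 0 < M y by rewrite My.
rewrite S_transform_mu// mulrC S_transform_nu_MP// /S_transform.
have /andP[c1 _] := width_bounds hM lamW My0 yp yy.
rewrite (psi_inv_cpt nu0 nnu (w := width lam M y)); last 2 first.
- exact: lt_le_trans c1.
- by rewrite hnu.
by rewrite mulrN -mulNr -mulrN invrN opprK.
Qed.

(** The product formula fixes [psi_inv nu] at [- M y], hence the integral of [cpt] at the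
    corresponding width. It is available only near 0, so [y0] shrinks to a [y1] with [M y < e] below
    it; the Dirac case bypasses S-transforms. *)
Lemma free_mult_conv_cpt : is_free_mult_conv (MP lam) mu nu ->
  exists2 y1, 0 < y1 <= y0 &
    forall y, 0 < y -> y <= y1 -> \int[nu]_x cpt (width lam M y) x = 1 - M y.
Proof.
move=> [_ _ _ [dd nd]]; have [dm|dm] := pselect (is_dirac0 mu).
  exists y0; first by rewrite y00/=.
  move=> y yp yy; have /andP[c1 _] := width_bounds hM lamW My0 yp yy.
  have z01 : 0 <= (0 : R) <= 1 by lra.
  have /andP[c2 _] := width_bounds hM z01 My0 yp yy.
  rewrite (dirac0_cpt _ (dd (or_intror dm))); last by apply: le_trans c1; exact: ltW.
  rewrite -hmu// dirac0_cpt//; exact: le_trans (ltW yp) c2.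
have [nn [e e0 [_ _ _ he]]] := nd (@MP_not_dirac0 _ _) dm.
have [y1 y10 h1] := profile_lt hM e0.
exists (Order.min y1 y0); first by rewrite lt_min y10 y00 ge_min lexx orbT.
move=> y yp; rewrite le_min => /andP[yy1 yy0].
have Mp := profile_gt0 dm yp yy0; have Me := h1 _ yp yy1.
have /andP[c1 _] := width_bounds hM lamW My0 yp yy0.
have w0 := lt_le_trans yp c1.
have := he (- M y); rewrite ltrN2 Me oppr_lt0 Mp => /(_ isT).
rewrite S_transform_mu// mulrC S_transform_nu_MP// /S_transform => hS.
apply: psi_inv_neq0 => //.
have /andP[m0 m1] := profile_half hM My0 yp yy0.
have h1' : 1 - M y != 0 by rewrite subr_eq0 gt_eqF//; lra.
have h2 : M y != 0 by rewrite gt_eqF.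
have h3 : (1 - M y) / M y != 0 by rewrite mulf_neq0// invr_eq0.
apply: (mulfI h3); by rewrite [RHS]mulrN -hS invrN mulrN mulNr opprK.
Qed.

End parametrized.
End s_transform.

(** * The limit profile *)

Section levy_profile.
Variable R : realType.
Variables (s : nat -> seq R) (kap c : R).
Variable Sigma : {finite_measure set (measurableTypeR R) -> \bar R}.
Hypothesis s0 : forall n : nat, (0 < n)%N -> all (>= 0) (s n).
Hypothesis hs : levy_data s kap c Sigma.

(** The Levy kernel at [u = - y], real for real [x]; [pos] removes its pole at [x = - 1 / y] and
    makes it continuous and bounded on the line. *)
Definition blue_ker (y x : R) : R := (pos x - y) / (1 + y * pos x).
(* [y R(-y)] with [R] equal to [kap * levy_R c Sigma]. *)
Definition levy_profile (y : R) : R := kap * (y * c + \int[Sigma]_x (y * blue_ker y x)).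

Lemma blue_den (y x : R) : 0 < y -> 0 < 1 + y * pos x.
Proof. by move=> y0; rewrite ltr_pwDl// mulr_ge0 ?pos_ge0// ltW. Qed.

Lemma continuous_blue_ker (y : R) : 0 < y -> continuous (blue_ker y).
Proof.
move=> y0 x; apply: cvgM; first by apply: cvgB; [exact: continuous_pos|exact: cvg_cst].
apply: cvgV; first by rewrite gt_eqF// blue_den.
apply: cvgD; first exact: cvg_cst.
by apply: cvgM; [exact: cvg_cst|exact: continuous_pos].
Qed.

Lemma blue_ker_le (y x : R) : 0 < y -> `|y * blue_ker y x| <= 1 + y ^+ 2.
Proof.
move=> y0; have d0 := blue_den x y0; have p0 := pos_ge0 x; rewrite /blue_ker mulrA normrM.
rewrite normfV (gtr0_norm d0) ler_pdivrMr// ler_norml mulrBr -expr2.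
have yx : 0 <= y * pos x by rewrite mulr_ge0// ltW.
have y2 := sqr_ge0 y; have : 0 <= y ^+ 2 * (y * pos x) by rewrite mulr_ge0.
by move: (y * pos x) (y ^+ 2) yx y2 => a b a0 b0 ab; apply/andP; split; lra.
Qed.

Lemma bc_blue_ker (y : R) : 0 < y -> bounded_continuous (blue_ker y).
Proof.
move=> y0; split; first exact: continuous_blue_ker.
exists ((1 + y ^+ 2) / y) => x; rewrite ler_pdivlMr// mulrC -{1}(gtr0_norm y0) -normrM.
exact: blue_ker_le.
Qed.

(** For [x >= 0], [x / (1 + y x)] equals [x / (1 + x^2)] plus [x^2 / (1 + x^2)] times
    [blue_ker y x]: the centring and the bounded kernel that [levy_data] controls. *)
Lemma cvg_bmean (y : R) : 0 < y -> bmean (s n) y / n%:R @[n --> \oo] --> levy_profile y.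
Proof.
move=> y0; have [h1 h2] := hs; have [cb [B hB]] := bc_blue_ker y0.
have -> : levy_profile y = y * (kap * c + kap * \int[Sigma]_x blue_ker y x).
  rewrite /levy_profile RintegralZl//; first ring.
  by apply: (integrable_bounded Sigma _ hB); exact: continuous_measurable_fun.
have : y * ((\sum_(x <- s n) x / (1 + x ^+ 2)) / n%:R +
   (\sum_(x <- s n) x ^+ 2 / (1 + x ^+ 2) * blue_ker y x) / n%:R) @[n --> \oo]
   --> y * (kap * c + kap * \int[Sigma]_x blue_ker y x).
  apply: cvgM; first exact: cvg_cst.
  by apply: cvgD => //; apply: h2; exact: bc_blue_ker.
apply: cvg_trans; apply: near_eq_cvg; near=> n.
have n0 : (0 < n)%N by near: n; exists 1%N.
rewrite -mulrDl mulrA -big_split/= mulr_sumr; congr (_ / _); apply: eq_big_seq => x xs.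
have x0 : 0 <= x by have /allP := s0 n0; apply.
rewrite /blue_ker posE//.
have d1 : 1 + x ^+ 2 != 0 by rewrite gt_eqF// ltr_pwDl// sqr_ge0.
have d2 : 1 + y * x != 0 by rewrite gt_eqF// ltr_pwDl// mulr_ge0// ltW.
rewrite [x * y]mulrC; field.
by rewrite ?d1 ?d2.
Unshelve. all: by end_near. Qed.

(** The first three clauses hold for the finite averages and pass to the limit in [n]. Smallness
    near 0 does not follow that way and is proved on the integral formula by dominated
    convergence. *)
Lemma profile_levy : profile levy_profile.
Proof.
have bm (y z : R) (l : seq R) : all (>= 0) l -> 0 < y -> y <= z ->
    bmean l y <= bmean l z <= z / y * bmean l y.
  move=> /allP l0 y0 yz; have z0 := lt_le_trans y0 yz.
  rewrite /bmean mulr_sumr; apply/andP; split; rewrite !big_seq; apply: ler_sum => a al;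
    have a0 : 0 <= a by [exact: l0 _ al];
    have dy : 0 < 1 + a * y by [rewrite ltr_pwDl// mulr_ge0// ltW];
    have dz : 0 < 1 + a * z by [rewrite ltr_pwDl// mulr_ge0// ltW].
    have ayz : a * y <= a * z by rewrite ler_wpM2l.
    rewrite ler_pdivrMr// mulrAC ler_pdivlMr//; move: (a * y) (a * z) ayz => p q; lra.
  have -> : z / y * (a * y / (1 + a * y)) = a * z / (1 + a * y).
    by field; rewrite !gt_eqF.
  apply: ler_wpM2l; first by rewrite mulr_ge0// ltW.
  by rewrite lef_pV2 ?posrE// lerD2l ler_wpM2l.
have big_n : \forall n \near \oo, (0 < n)%N by exists 1%N.
split.
- move=> y y0; apply: (cvgr_to_ge (cvg_bmean y0)); apply: filterS big_n => n n0.
  by rewrite divr_ge0// bmean_ge0 ?s0// ltW.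
- move=> y z y0 yz; apply: (ler_cvg_to (cvg_bmean y0) (cvg_bmean (lt_le_trans y0 yz))).
  apply: filterS big_n => n n0; rewrite ler_wpM2r ?invr_ge0//.
  by have /andP[] := bm _ _ _ (s0 n0) y0 yz.
- move=> y z y0 yz.
  apply: (ler_cvg_to (cvg_bmean (lt_le_trans y0 yz)) (cvgM (cvg_cst (z / y)) (cvg_bmean y0))).
  apply: filterS big_n => n n0; rewrite -[leRHS]/(z / y * (bmean (s n) y / n%:R)) mulrA ler_wpM2r ?invr_ge0//.
  by have /andP[] := bm _ _ _ (s0 n0) y0 yz.
move=> e e0.
have : levy_profile m.+1%:R^-1 @[m --> \oo] --> kap * (0 * c + 0).
  apply: cvgM; first exact: cvg_cst.
  apply: cvgD; first by apply: cvgM; [exact: cvg_harmonic|exact: cvg_cst].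
  have z : \int[Sigma]_x (fun=> 0) x = 0 :> R by rewrite Rintegral_cst// mul0r.
  rewrite -[X in _ --> X]z.
  apply: (@cvg_Rintegral_bounded _ _ _ Sigma _ _ 2).
  - move=> m; apply: continuous_measurable_fun => x; apply: cvgM; first exact: cvg_cst.
    by apply: continuous_blue_ker; rewrite invr_gt0.
  - exact: measurable_cst.
  - move=> m x; have y0 : 0 < m.+1%:R^-1 :> R by rewrite invr_gt0.
    apply: (le_trans (blue_ker_le x y0)); rewrite -[leRHS]/(1 + 1) lerD2l.
    by rewrite expr_le1 ?(ltW y0)// invf_le1// ler1n.
  - apply: aeW => x /=.
    have hh := @cvg_harmonic R.
    have e0' : 0 * ((pos x - 0) / (1 + 0 * pos x)) = 0 :> R by rewrite mul0r.
    rewrite -[X in _ --> X]e0'; apply: cvgM; first exact: hh.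
    apply: cvgM; first by apply: cvgB; [exact: cvg_cst|exact: hh].
    apply: cvgV; first by rewrite mul0r addr0 oner_neq0.
    by apply: cvgD; [exact: cvg_cst|apply: cvgM; [exact: hh|exact: cvg_cst]].
rewrite mul0r addr0 mulr0 => /cvgr_lt/(_ _ e0)[m _ /(_ m (leqnn _))/= hm].
by exists m.+1%:R^-1; rewrite ?invr_gt0.
Qed.

End levy_profile.

(** * Approximation by polynomials *)

Section coefficient_limits.
Variable R : realType.

(** Pointwise convergence to 0 on a real interval, with tails bounded uniformly in [N], gives
    convergence of the coefficients one at a time: the part of index at least [k + 1], divided by
    [x ^+ k], is at most [K * x]. *)
Lemma coef_cvg0 (d : nat -> nat -> R) (D : nat -> R -> R) (A C x0 : R) :
  0 < x0 -> 0 <= A -> 0 <= C ->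
  (forall x, 0 < x -> x <= x0 -> D N x @[N --> \oo] --> 0) ->
  (forall x N m, 0 < x -> x <= x0 -> `|D N x - \sum_(j < m) d N j * x ^+ j| <= A * (C * x) ^+ m) ->
  forall k, d N k @[N --> \oo] --> 0.
Proof.
move=> x00 A0 C0 hD hT; elim/ltn_ind => k IH.
apply/cvgrPdist_le => e e0.
pose K := A * C ^+ k.+1.
have K0 : 0 <= K by rewrite mulr_ge0// exprn_ge0.
(* Chosen so that the tail contributes at most [e / 2]; adding 1 to [K] allows [K = 0]. *)
pose x := Order.min x0 (e / (2 * (K + 1))).
have K1 : 0 < 2 * (K + 1) by rewrite mulr_gt0// ltr_wpDl.
have xp : 0 < x by rewrite lt_min x00 divr_gt0.
have xx0 : x <= x0 by rewrite ge_min lexx.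
have xe : K * x <= e / 2.
  apply: (@le_trans _ _ (K * (e / (2 * (K + 1))))).
    by rewrite ler_wpM2l// ge_min lexx orbT.
  have -> : K * (e / (2 * (K + 1))) = (e / 2) * (K / (K + 1)).
    by field; rewrite gt_eqF// ltr_wpDl.
  have K2 : 0 < K + 1 by rewrite ltr_wpDl.
  by apply: ler_piMr; [rewrite divr_ge0// ltW|rewrite ler_pdivrMr// mul1r lerDl].
have h : `|D N x| + \sum_(j < k) `|d N j| * x ^+ j @[N --> \oo] --> 0 + \sum_(j < k) 0 * x ^+ j.
  apply: cvgD; first by rewrite -[X in _ --> X](@normr0 _ R); apply: cvg_norm; exact: hD.
  apply: cvg_bigsum => j.
  apply: cvgM; last exact: cvg_cst.
  by rewrite -[X in _ --> X](@normr0 _ R); apply: cvg_norm; exact: IH.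
have ex : 0 < e / 2 * x ^+ k by rewrite mulr_gt0 ?divr_gt0// exprn_gt0.
move: h; rewrite big1 ?addr0 => [|j _]; last by rewrite mul0r.
move=> /cvgr_lt/(_ _ ex); apply: filterS => N hN.
rewrite sub0r normrN -(ler_pM2r (_ : 0 < x ^+ k)) ?exprn_gt0//.
have hx := hT x N k.+1 xp xx0; move: hx; rewrite big_ord_recr/= => hx.
have hs : `|\sum_(j < k) d N j * x ^+ j| <= \sum_(j < k) `|d N j| * x ^+ j.
  apply: (le_trans (ler_norm_sum _ _ _)); apply: ler_sum => j _.
  by rewrite normrM [`|x ^+ j|]ger0_norm// exprn_ge0// ltW.
have -> : `|d N k| * x ^+ k = `|d N k * x ^+ k|.
  by rewrite normrM [`|x ^+ k|]ger0_norm// exprn_ge0// ltW.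
set S := \sum_(j < k) _ in hx hs; set T := \sum_(j < k) _ in hN hs.
have h3 : A * (C * x) ^+ k.+1 <= e / 2 * x ^+ k.
  rewrite exprMn mulrA -/K exprSr [x ^+ k * x]mulrC mulrA.
  by rewrite ler_pM2r ?exprn_gt0.
have : `|d N k * x ^+ k| <= `|D N x - (S + d N k * x ^+ k)| + (`|D N x| + `|S|).
  have -> : d N k * x ^+ k = - (D N x - (S + d N k * x ^+ k)) + (D N x - S) by ring.
  apply: (le_trans (ler_normD _ _)); rewrite normrN.
  have -> : D N x - (S + (- (D N x - (S + d N k * x ^+ k)) + (D N x - S))) = D N x - (S + d N k * x ^+ k) by ring.
  by rewrite lerD2l; exact: ler_normB.
lra.
Qed.

Lemma one_sub_pow_ge (x : R) (m : nat) : 0 <= x <= 1 -> 1 - m%:R * x <= (1 - x) ^+ m.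
Proof.
move=> /andP[x0 x1]; elim: m => [|m IH]; first by rewrite mul0r subr0 expr0.
have y0 : 0 <= 1 - x by rewrite subr_ge0.
rewrite exprS; apply: (le_trans _ (ler_wpM2l y0 IH)).
have : 0 <= m%:R * x ^+ 2 by rewrite mulr_ge0// sqr_ge0.
rewrite -natr1; move: (m%:R : R) => M h; rewrite -subr_ge0.
by have -> : (1 - x) * (1 - M * x) - (1 - (M + 1) * x) = M * x ^+ 2 by ring.
Qed.

(** With [q = t / m], the product [(1 + q) exp (- q)] is at least [1 - q^2], and Bernoulli's
    inequality gives [(1 - q^2)^m >= 1 - t^2 / m]. *)
Lemma expR_sub_pow (t : R) (m : nat) : 0 <= t -> (0 < m)%N -> t <= m%:R ->
  0 <= expR t - (1 + t / m%:R) ^+ m <= expR t * (t ^+ 2 / m%:R).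
Proof.
move=> t0 m0 tm; have mp : 0 < m%:R :> R by rewrite ltr0n.
have mn : m%:R != 0 :> R by rewrite gt_eqF.
pose q := t / m%:R; have q0 : 0 <= q by rewrite divr_ge0.
have q1 : q <= 1 by rewrite ler_pdivrMr// mul1r.
have et : expR t = expR q ^+ m by rewrite -expRM_natr /q mulfVK.
have h1 : 1 + q <= expR q by exact: expR_ge1Dx.
rewrite -/q; apply/andP; split.
  by rewrite subr_ge0 et lerXn2r ?nnegrE ?addr_ge0 ?expR_ge0.
have h2 : 1 - q ^+ 2 <= (1 + q) * expR (- q).
  have -> : 1 - q ^+ 2 = (1 + q) * (1 + - q) by ring.
  by rewrite ler_wpM2l ?addr_ge0//; exact: expR_ge1Dx.
have q2 : 0 <= q ^+ 2 <= 1 by rewrite sqr_ge0 expr_le1.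
have q2' : 0 <= 1 - q ^+ 2 by rewrite subr_ge0; case/andP: q2.
have h3 := one_sub_pow_ge m q2.
have h4 : (1 - q ^+ 2) ^+ m <= (1 + q) ^+ m * expR (- t).
  have -> : expR (- t) = expR (- q) ^+ m by rewrite -expRM_natr mulNr /q mulfVK.
  by rewrite -exprMn lerXn2r ?nnegrE// mulr_ge0 ?addr_ge0// expR_ge0.
have -> : t ^+ 2 / m%:R = m%:R * q ^+ 2 by rewrite /q; field.
have h5 := ler_wpM2l (expR_ge0 t) (le_trans h3 h4).
rewrite [leRHS]mulrCA -expRD subrr expR0 mulr1 in h5.
by move: h5; rewrite mulrBr mulr1; lra.
Qed.

End coefficient_limits.

Section hadamard_lists.
Variable R : realType.
Variables (f : real_entire R) (c : R) (alpha : nat -> R).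
Hypothesis hf : LPI_form f 1 0 c alpha.

Let alpha0 j : 0 <= alpha j. Proof. by case: hf. Qed.

Definition defect (N : nat) : R := c - \sum_(j < N) alpha j.

(* The defect [c - sum_(j < N) alpha j], that is the exponential factor that
   remains after [N] factors, is spread over [N + 1] equal roots. *)
Definition hadamard_list (N : nat) : seq R :=
  [seq alpha j | j <- index_iota 0 N] ++ nseq N.+1 (defect N / N.+1%:R).

Lemma big_hadamard (g : R -> R) N : \sum_(a <- hadamard_list N) g a =
  \sum_(j < N) g (alpha j) + N.+1%:R * g (defect N / N.+1%:R).
Proof.
rewrite big_cat big_map big_mkord; congr (_ + _).
by rewrite big_nseq iter_addr_0 mulr_natl.
Qed.

Lemma prod_hadamard (g : R -> R) N : \prod_(a <- hadamard_list N) g a =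
  (\prod_(j < N) g (alpha j)) * g (defect N / N.+1%:R) ^+ N.+1.
Proof.
rewrite big_cat big_map big_mkord; congr (_ * _).
by rewrite big_nseq iter_mulr_1.
Qed.

Lemma sum_alpha_le N : \sum_(j < N) alpha j <= c.
Proof.
case: hf => _ ca lc _; apply: le_trans lc.
rewrite -(big_mkord xpredT alpha); apply: nondecreasing_cvgn_le => //.
exact: nondecreasing_series.
Qed.

Lemma defect_ge0 N : 0 <= defect N.
Proof. by rewrite subr_ge0 sum_alpha_le. Qed.

Lemma defect_le N : defect N <= c.
Proof. by rewrite gerBl sumr_ge0. Qed.

Lemma c_ge0 : 0 <= c. Proof. exact: le_trans (defect_ge0 0) (defect_le 0). Qed.

Lemma hadamard_ge0 N : all (>= 0) (hadamard_list N).
Proof.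
rewrite all_cat; apply/andP; split; first by apply/allP => _ /mapP[j _ ->] /=.
by apply/allP => _ /nseqP[-> _] /=; rewrite divr_ge0 ?defect_ge0.
Qed.

Lemma sum_hadamard N : \sum_(a <- hadamard_list N) a = c.
Proof. by rewrite big_hadamard /defect mulrCA mulfV ?mulr1 ?pnatr_eq0// addrC subrK. Qed.

(** Taylor coefficients of [x |-> f (- x)], which turn out to be the limits of the elementary
    symmetric functions of the approximating lists. *)
Definition signed_coef k : R := (-1) ^+ k * (f k / k`!%:R).

Lemma cexp_real (x : R) : cexp x%:C = (expR x)%:C.
Proof. by rewrite /cexp Re_real Im_real cos0 sin0 mulr1 mulr0. Qed.

Lemma cvg_Re (u : nat -> R[i]) (l : R[i]) : u n @[n --> \oo] --> l ->
  complex.Re (u n) @[n --> \oo] --> complex.Re l.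
Proof.
move=> /cvgrPdist_le h; apply/cvgrPdist_le => e e0.
have /h : 0 < e%:C by rewrite ltcR.
apply: filterS => n; rewrite /Num.norm/= lecR; apply: le_trans.
by have := Re_le_normc (l - u n); rewrite ReD ReN.
Qed.

Lemma signed_series (x : R) : series (fun k => signed_coef k * x ^+ k) @ \oo -->
  complex.Re (eval_entire f (- x)%:C).
Proof.
have h : series (fun k => (f k / k`!%:R)%:C * (- x)%:C ^+ k) @ \oo --> eval_entire f (- x)%:C.
  exact: (@entire_cvg R f (- x)%:C).
have := cvg_Re h; apply: cvg_trans; apply: near_eq_cvg; apply: nearW => n.
rewrite /series/= Re_sum; apply: eq_bigr => k _.
rewrite -rmorphXn -rmorphM Re_real /signed_coef [(- x) ^+ k]exprNn; ring.
Qed.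

(** The convergence factors [exp (- alpha_j x)] are collected with [exp (c x)] into a single
    exponential of the remaining defect. *)
Lemma prod_cvg (x : R) :
  expR (defect N * x) * \prod_(j < N) (1 + alpha j * x) @[N --> \oo] -->
  complex.Re (eval_entire f (- x)%:C).
Proof.
case: hf => _ _ _ /(_ (- x)%:C)/cvg_Re; apply: cvg_trans; apply: near_eq_cvg.
apply: nearW => N; rewrite expr0 mulr1 mul1r -rmorphN -rmorphM cexp_real.
rewrite (eq_bigr (fun j : 'I_N => ((1 + alpha j * x) * expR (- (alpha j * x)))%:C)); last first.
  move=> j _; rewrite -!rmorphM cexp_real -(rmorph1 (real_complex R)) -rmorphB -rmorphM.
  by rewrite mulrN opprK.
rewrite -rmorph_prod -rmorphM Re_real big_split/= -expR_sum.
have -> : defect N * x = - c * - x + \sum_(j < N) - (alpha j * x).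
  by rewrite sumrN -mulr_suml /defect; ring.
by rewrite expRD -mulrA [expR (\sum_(_ < _) _) * _]mulrC.
Qed.

(** The terms of the series at [x = 1] are bounded because the series converges. *)
Lemma signed_coef_bounded : exists2 B : R, 0 <= B & forall k, `|signed_coef k| <= B.
Proof.
have h : cvgn (series (fun k => signed_coef k * 1 ^+ k)).
  by apply/cvg_ex; eexists; exact: signed_series.
have [M [_ hM]] := cvg_series_bounded h.
exists (`|M| + 1) => // k.
have M1 : M < `|M| + 1 by apply: (le_lt_trans (ler_norm _)); rewrite ltrDl.
by have /= := hM _ M1 k I; rewrite expr1n mulr1.
Qed.

Lemma esp_hadamard_le N k : 0 <= esp (hadamard_list N) k <= c ^+ k.
Proof.
rewrite esp_ge0 ?hadamard_ge0//=; apply: esp_le; first exact: hadamard_ge0.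
by rewrite sum_hadamard.
Qed.

(** The remaining exponential is replaced by the power [(1 + defect x / (N + 1))^(N + 1)]; the error
    tends to 0 because the defect and the partial products stay bounded in terms of [c]. *)
Lemma prod_hadamard_cvg (x : R) : 0 < x ->
  \prod_(a <- hadamard_list N) (1 + a * x) @[N --> \oo] -->
  complex.Re (eval_entire f (- x)%:C).
Proof.
move=> x0; have c0 := c_ge0.
pose r (N : nat) := \prod_(j < N) (1 + alpha j * x) *
  (expR (defect N * x) - (1 + defect N * x / N.+1%:R) ^+ N.+1).
have hr : r N @[N --> \oo] --> 0.
  pose K := expR (c * x) * (expR (c * x) * (c * x) ^+ 2).
  apply: (@squeeze_cvgr _ _ _ _ (fun=> 0) (fun N => K * N.+1%:R^-1)); last 2 first.
  - exact: cvg_cst.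
  - by rewrite -[X in _ --> X](mulr0 K); apply: cvgM; [exact: cvg_cst|exact: cvg_harmonic].
  near=> N.
  have cN : c * x <= N.+1%:R.
    apply: (@le_trans _ _ N%:R); last by rewrite ler_nat.
    by near: N; exact: nbhs_infty_ger.
  have d0 : 0 <= defect N * x by rewrite mulr_ge0 ?defect_ge0// ltW.
  have dc : defect N * x <= c * x by rewrite ler_wpM2r ?defect_le// ltW.
  have /andP[e0 e1] := expR_sub_pow d0 (ltn0Sn N) (le_trans dc cN).
  have p0 : 0 <= \prod_(j < N) (1 + alpha j * x).
    by apply: prodr_ge0 => j _; rewrite addr_ge0// mulr_ge0// ltW.
  have p1 : \prod_(j < N) (1 + alpha j * x) <= expR (c * x).
    apply: (@le_trans _ _ (expR (\sum_(j < N) alpha j * x))).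
      rewrite expR_sum; apply: ler_prod => j _.
      by rewrite expR_ge1Dx addr_ge0// mulr_ge0// ltW.
    by rewrite ler_expR -mulr_suml ler_wpM2r ?sum_alpha_le// ltW.
  apply/andP; split; first exact: mulr_ge0.
  apply: (le_trans (ler_pM p0 e0 p1 e1)).
  have -> : K * N.+1%:R^-1 = expR (c * x) * (expR (c * x) * ((c * x) ^+ 2 / N.+1%:R)).
    by rewrite /K !mulrA.
  apply: ler_wpM2l; first exact: expR_ge0.
  apply: ler_pM; rewrite ?expR_ge0 ?ler_expR//.
    by rewrite divr_ge0// sqr_ge0.
  by rewrite ler_wpM2r ?invr_ge0// lerXn2r ?nnegrE// (le_trans d0).
have e N : \prod_(a <- hadamard_list N) (1 + a * x) =
    expR (defect N * x) * \prod_(j < N) (1 + alpha j * x) - r N.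
  by rewrite prod_hadamard /r [defect N / _ * x]mulrAC mulrBr [expR _ * _]mulrC subKr.
rewrite -[X in _ --> X]subr0; under eq_fun do rewrite e.
exact: (cvgB (@prod_cvg x) hr).
Unshelve. all: by end_near. Qed.

Lemma geometric_tail (q : R) m i : 0 <= q -> q <= 2^-1 ->
  \sum_(m <= j < m + i) q ^+ j <= 2 * q ^+ m.
Proof.
move=> q0 q1; suff : \sum_(m <= j < m + i) q ^+ j + 2 * q ^+ (m + i) <= 2 * q ^+ m.
  by apply: le_trans; rewrite lerDl mulr_ge0// exprn_ge0.
elim: i => [|i IH]; first by rewrite addn0 big_geq// add0r.
apply: le_trans IH; rewrite addnS big_nat_recr ?leq_addr//= -addrA lerD2l exprS.
have : 0 <= q ^+ (m + i) * (2^-1 - q) by rewrite mulr_ge0 ?exprn_ge0// subr_ge0.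
rewrite mulrBr [q * _]mulrC; move: (q ^+ (m + i)) => p; lra.
Qed.

Lemma esp_hadamard_cvg k : esp (hadamard_list N) k @[N --> \oo] --> signed_coef k.
Proof.
have c0 := c_ge0; have [B B0 hB] := signed_coef_bounded.
pose d N k := esp (hadamard_list N) k - signed_coef k.
pose F x := complex.Re (eval_entire f (- x)%:C).
pose D N x := \prod_(a <- hadamard_list N) (1 + a * x) - F x.
pose C := c + 1; have C0 : 0 < C by rewrite ltr_wpDl.
suff h : d N k @[N --> \oo] --> 0.
  have e N : esp (hadamard_list N) k = d N k + signed_coef k by rewrite /d subrK.
  rewrite -[X in _ --> X]add0r; under eq_fun do rewrite e.
  exact: (cvgD h (cvg_cst (signed_coef k))).
(* [C = c + 1] dominates both [c] and 1, hence both kinds of coefficients; on the chosen interval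
   [C * x <= 1/2], and the factor 2 sums the geometric tail. *)
apply: (@coef_cvg0 _ d D (2 * (1 + B)) C (2 * C)^-1).
- by rewrite invr_gt0 mulr_gt0.
- by rewrite mulr_ge0// addr_ge0.
- exact: ltW.
- move=> x x0 _; rewrite -[X in _ --> X](subrr (F x)).
  by apply: cvgB; [exact: prod_hadamard_cvg|exact: cvg_cst].
move=> x N m x0 xC; pose q := C * x.
have q0 : 0 <= q by rewrite mulr_ge0// ltW.
have q1 : q <= 2^-1.
  apply: (le_trans (ler_wpM2l (ltW C0) xC)); rewrite le_eqVlt; apply/orP; left.
  by apply/eqP; field; rewrite gt_eqF.
have dle j : `|d N j * x ^+ j| <= (1 + B) * q ^+ j.
  rewrite normrM [`|x ^+ j|]ger0_norm ?exprn_ge0 ?(ltW x0)// /q exprMn mulrA.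
  rewrite ler_wpM2r ?exprn_ge0 ?(ltW x0)//; apply: (le_trans (ler_normB _ _)).
  have /andP[e0 e1] := esp_hadamard_le N j; rewrite ger0_norm//.
  have C1 : 1 <= C ^+ j by rewrite exprn_ege1// lerDr.
  have cC : c ^+ j <= C ^+ j by rewrite lerXn2r ?nnegrE ?(ltW C0)// lerDl.
  have := hB j; have : B <= B * C ^+ j by rewrite ler_peMr.
  rewrite mulrDl mul1r; lra.
have lim : \sum_(0 <= j < K) d N j * x ^+ j @[K --> \oo] --> D N x.
  have h1 : \sum_(0 <= j < K) esp (hadamard_list N) j * x ^+ j @[K --> \oo] -->
      \prod_(a <- hadamard_list N) (1 + a * x).
    apply: cvg_near_cst; exists (size (hadamard_list N)).+1 => //= K hK.
    by case: K hK => // K hK; rewrite big_mkord (prod_esp x (N := K)).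
  have e K : \sum_(0 <= j < K) d N j * x ^+ j =
      \sum_(0 <= j < K) esp (hadamard_list N) j * x ^+ j - series (fun k => signed_coef k * x ^+ k) K.
    by rewrite /series/= -sumrB; apply: eq_bigr => j _; rewrite -mulrBl.
  under eq_fun do rewrite e.
  exact: (cvgB h1 (@signed_series x)).
have lim2 : `|\sum_(0 <= j < K) d N j * x ^+ j - \sum_(j < m) d N j * x ^+ j| @[K --> \oo] -->
    `|D N x - \sum_(j < m) d N j * x ^+ j|.
  by apply: cvg_norm; apply: cvgB => //; exact: cvg_cst.
apply: (cvgr_to_le lim2); exists m => //= K mK.
rewrite -(big_mkord xpredT (fun j => d N j * x ^+ j)) (big_cat_nat (n := m))//=.
rewrite addrAC subrr add0r.
apply: (le_trans (ler_norm_sum _ _ _)).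
apply: (@le_trans _ _ (\sum_(m <= j < K) (1 + B) * q ^+ j)).
  by apply: ler_sum => j _; exact: dle.
rewrite -mulr_sumr -(subnKC mK) -mulrA mulrCA ler_wpM2l ?addr_ge0//.
exact: geometric_tail.
Qed.

End hadamard_lists.

(** * From the measures [Sigma_] to Levy data of finite lists *)

Section integral_Sigma.
Variable R : realType.
Variables (alpha : nat -> R) (n : nat).

Definition sw (x : R) : R := x ^+ 2 / (x ^+ 2 + 1).

Lemma ge0_integral_Sigma (h : R -> R) : measurable_fun setT h -> (forall x, 0 <= h x) ->
  (\int[Sigma_ alpha n]_x (h x)%:E =
   \sum_(0 <= j <oo) (n%:R^-1 * (sw (n%:R * alpha j) * h (n%:R * alpha j)))%:E)%E.
Proof.
move=> mh h0; have mE : measurable_fun setT (EFin \o h) by exact/measurable_EFinP.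
rewrite /Sigma_ ge0_integral_mscale//=; last by move=> x _; rewrite lee_fin.
rewrite ge0_integral_measure_series//=; last by move=> x _; rewrite lee_fin.
rewrite -nneseriesZl; last by move=> j _; apply: integral_ge0 => x _; rewrite lee_fin.
apply: eq_eseriesr => j _.
rewrite ge0_integral_mscale//=; last by move=> x _; rewrite lee_fin.
by rewrite integral_dirac//= diracT mul1e.
Qed.

Lemma ge0_integral_Sigma_lim (h : R -> R) : measurable_fun setT h -> (forall x, 0 <= h x) ->
  cvgn (series (fun j => n%:R^-1 * (sw (n%:R * alpha j) * h (n%:R * alpha j)))) ->
  (\int[Sigma_ alpha n]_x (h x)%:E =
   (limn (series (fun j => n%:R^-1 * (sw (n%:R * alpha j) * h (n%:R * alpha j))))%R)%:E)%E.
Proof.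
move=> mh h0 hc; rewrite ge0_integral_Sigma// -EFin_lim//; congr (limn _).
by apply/funext => m; rewrite /= /series/= sumEFin.
Qed.

(** Positive and negative parts are treated separately; absolute convergence makes both integrals
    finite, so their difference is the limit of the signed series. *)
Lemma cvg_integral_Sigma (g : R -> R) : measurable_fun setT g ->
  cvgn (series (fun j => n%:R^-1 * (sw (n%:R * alpha j) * `|g (n%:R * alpha j)|))) ->
  series (fun j => n%:R^-1 * (sw (n%:R * alpha j) * g (n%:R * alpha j))) @ \oo -->
    \int[Sigma_ alpha n]_x g x.
Proof.
move=> mg gc.
pose gp x := Order.max (g x) 0; pose gn x := Order.max (- g x) 0.
have mp : measurable_fun setT gp by exact: measurable_maxr.
have mn : measurable_fun setT gn by apply: measurable_maxr => //; exact: measurableT_comp.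
have p0 x : 0 <= gp x by rewrite le_max lexx orbT.
have n0 x : 0 <= gn x by rewrite le_max lexx orbT.
have pn x : g x = gp x - gn x.
  by rewrite /gp /gn; have [h|h] := leP (g x) 0; have [h'|h'] := leP (- g x) 0; lra.
have sw0 x : 0 <= sw x by rewrite divr_ge0 ?addr_ge0 ?sqr_ge0.
have dom (h : R -> R) : (forall x, 0 <= h x) -> (forall x, h x <= `|g x|) ->
    cvgn (series (fun j => n%:R^-1 * (sw (n%:R * alpha j) * h (n%:R * alpha j)))).
  move=> h0 hg; apply: series_le_cvg gc => j.
  - by rewrite mulr_ge0 ?invr_ge0// mulr_ge0.
  - by rewrite mulr_ge0 ?invr_ge0// mulr_ge0.
  - by rewrite ler_wpM2l ?invr_ge0// ler_wpM2l.
have cp : cvgn (series (fun j => n%:R^-1 * (sw (n%:R * alpha j) * gp (n%:R * alpha j)))).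
  by apply: dom => // x; rewrite ge_max ler_norm normr_ge0.
have cn : cvgn (series (fun j => n%:R^-1 * (sw (n%:R * alpha j) * gn (n%:R * alpha j)))).
  by apply: dom => // x; rewrite ge_max -normrN ler_norm normr_ge0.
have -> : \int[Sigma_ alpha n]_x g x =
    limn (series (fun j => n%:R^-1 * (sw (n%:R * alpha j) * gp (n%:R * alpha j)))) -
    limn (series (fun j => n%:R^-1 * (sw (n%:R * alpha j) * gn (n%:R * alpha j)))).
  rewrite /Rintegral integralE.
  have -> : ((fun x => (g x)%:E)^\+)%E = (fun x => (gp x)%:E).
    by apply/funext => x; rewrite funeposE -EFin_max.
  have -> : ((fun x => (g x)%:E)^\-)%E = (fun x => (gn x)%:E).
    by apply/funext => x; rewrite funenegE -EFinN -EFin_max.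
  by rewrite !ge0_integral_Sigma_lim.
have e m : series (fun j => n%:R^-1 * (sw (n%:R * alpha j) * g (n%:R * alpha j))) m =
    series (fun j => n%:R^-1 * (sw (n%:R * alpha j) * gp (n%:R * alpha j))) m -
    series (fun j => n%:R^-1 * (sw (n%:R * alpha j) * gn (n%:R * alpha j))) m.
  by rewrite /series/= -sumrB; apply: eq_bigr => j _; rewrite {1}pn; ring.
rewrite (funext e); exact: cvgB.
Qed.

End integral_Sigma.

Section scaled_lists.
Variable R : realType.

Lemma sw_ge0 (x : R) : 0 <= sw x.
Proof. by rewrite divr_ge0 ?addr_ge0 ?sqr_ge0. Qed.

Lemma sw_le1 (x : R) : sw x <= 1.
Proof. by rewrite ler_pdivrMr ?ltr_wpDl ?sqr_ge0// mul1r lerDl. Qed.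

Lemma sw_le (x : R) : 0 <= x -> sw x <= x.
Proof.
move=> x0; rewrite ler_pdivrMr ?ltr_wpDl ?sqr_ge0//.
have : 0 <= x * ((x - 2^-1) ^+ 2 + (1 - 4%:R^-1)).
  by apply: mulr_ge0 => //; apply: addr_ge0; [exact: sqr_ge0|lra].
have -> : x * ((x - 2^-1) ^+ 2 + (1 - 4%:R^-1)) = x * (x ^+ 2 + 1) - x ^+ 2 by field.
by rewrite subr_ge0.
Qed.

Lemma sw_le_sqr (x : R) : sw x <= x ^+ 2.
Proof.
have h : 0 < x ^+ 2 + 1 by rewrite ltr_wpDl ?sqr_ge0.
by rewrite ler_pdivrMr// ler_peMr ?sqr_ge0// lerDr sqr_ge0.
Qed.

Section fixed_n.
Variables (f : real_entire R) (c : R) (alpha : nat -> R) (n : nat).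
Hypothesis hf : LPI_form f 1 0 c alpha.
Hypothesis n0 : (0 < n)%N.

Let alpha0 j : 0 <= alpha j. Proof. by case: hf. Qed.
Let np : 0 < n%:R :> R. Proof. by rewrite ltr0n. Qed.
Let nn : n%:R != 0 :> R. Proof. by rewrite gt_eqF. Qed.

Definition scaled_list (N : nat) : seq R := [seq n%:R * a | a <- hadamard_list c alpha N].
Definition spread (N : nat) : R := n%:R * (defect c alpha N / N.+1%:R).

Lemma scaled_ge0 N : all (>= 0) (scaled_list N).
Proof.
apply/allP => _ /mapP[a /(allP (hadamard_ge0 hf N)) a0 ->] /=.
by rewrite mulr_ge0.
Qed.

Lemma big_scaled (g : R -> R) N : \sum_(x <- scaled_list N) g x =
  \sum_(j < N) g (n%:R * alpha j) + N.+1%:R * g (spread N).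
Proof. by rewrite big_map (big_hadamard c alpha (fun a => g (n%:R * a))). Qed.

Lemma spread_ge0 N : 0 <= spread N.
Proof. by rewrite mulr_ge0// divr_ge0// (defect_ge0 hf). Qed.

Lemma spread_le N : spread N <= n%:R * c * N.+1%:R^-1.
Proof. by rewrite /spread mulrA ler_wpM2r ?invr_ge0// ler_wpM2l// (defect_le hf). Qed.

Lemma mass_term_le j : n%:R^-1 * sw (n%:R * alpha j) <= alpha j.
Proof. by rewrite ler_pdivrMl// sw_le// mulr_ge0. Qed.

Lemma cvg_alpha : cvgn (series alpha). Proof. by case: hf. Qed.

Lemma cvg_mass (phi : R -> R) (B : R) : measurable_fun setT phi -> (forall x, `|phi x| <= B) ->
  series (fun j => n%:R^-1 * (sw (n%:R * alpha j) * phi (n%:R * alpha j))) @ \oo -->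
    \int[Sigma_ alpha n]_x phi x.
Proof.
move=> mphi hB; have B0 : 0 <= B by exact: le_trans (hB 0).
apply: cvg_integral_Sigma => //.
apply: (@series_le_cvg _ _ (fun j => B * alpha j)).
- by move=> j; rewrite mulr_ge0 ?invr_ge0// mulr_ge0// sw_ge0.
- by move=> j; rewrite mulr_ge0.
- move=> j; rewrite mulrA mulrC; apply: ler_pM => //.
    by rewrite mulr_ge0 ?invr_ge0// sw_ge0.
  exact: mass_term_le.
have -> : series (fun j => B * alpha j) = (fun m => B * series alpha m).
  by apply/funext => m; rewrite /series/= mulr_sumr.
by apply: is_cvgM; [exact: is_cvg_cst|exact: cvg_alpha].
Qed.

(** Mass of [Sigma_] carried by the atoms of index at least [N], plus the mass of the [N + 1] equal
    entries. It involves no test function, so one choice of [N] serves all of them. *)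
Definition mass_gap (N : nat) : R :=
  (\int[Sigma_ alpha n]_x (fun=> 1) x - \sum_(0 <= j < N) n%:R^-1 * (sw (n%:R * alpha j) * 1)) +
  n%:R^-1 * (N.+1%:R * sw (spread N)).

(** The equal entries are of order [1 / (N + 1)] and [sw] is quadratic at 0, so [N + 1] of them
    carry a mass of order [1 / (N + 1)]. *)
Lemma cvg_spread_mass : n%:R^-1 * (N.+1%:R * sw (spread N)) @[N --> \oo] --> (0 : R).
Proof.
apply: (@squeeze_cvgr _ _ _ _ (fun=> 0) (fun N => n%:R * c ^+ 2 * N.+1%:R^-1)); last 2 first.
- exact: cvg_cst.
- by rewrite -[X in _ --> X](mulr0 (n%:R * c ^+ 2)); apply: cvgM; [exact: cvg_cst|exact: cvg_harmonic].
apply: nearW => N; apply/andP; split.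
  by apply: mulr_ge0; rewrite ?invr_ge0//; apply: mulr_ge0 => //; exact: sw_ge0.
have N0 : N.+1%:R != 0 :> R by rewrite pnatr_eq0.
have h : sw (spread N) <= (n%:R * c * N.+1%:R^-1) ^+ 2.
  apply: (le_trans (sw_le_sqr _)); rewrite lerXn2r ?nnegrE ?spread_ge0 ?spread_le//.
  exact: le_trans (spread_ge0 N) (spread_le N).
rewrite ler_pdivrMl//; apply: (le_trans (ler_wpM2l _ h)) => //.
rewrite le_eqVlt; apply/orP; left; apply/eqP; field.
by rewrite addrC natr1.
Qed.

Lemma cvg_mass_gap : mass_gap N @[N --> \oo] --> (0 : R).
Proof.
rewrite -[X in _ --> X](addr0 (0 : R)); apply: cvgD; last exact: cvg_spread_mass.
rewrite -[X in _ --> X](subrr (\int[Sigma_ alpha n]_x (fun=> 1) x)).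
apply: cvgB; first exact: cvg_cst.
by apply: (@cvg_mass (fun=> 1) 1) => // x; rewrite normr1.
Qed.

Lemma mass_gap_le (phi : R -> R) (B : R) N : measurable_fun setT phi -> (forall x, `|phi x| <= B) ->
  `|(\sum_(x <- scaled_list N) x ^+ 2 / (1 + x ^+ 2) * phi x) / n%:R - \int[Sigma_ alpha n]_x phi x|
    <= B * mass_gap N.
Proof.
move=> mphi hB; have B0 : 0 <= B by exact: le_trans (hB 0).
under eq_bigr do rewrite [1 + _]addrC.
rewrite (big_scaled (fun x => sw x * phi x)) mulrDl.
have -> : (\sum_(j < N) sw (n%:R * alpha j) * phi (n%:R * alpha j)) / n%:R =
    \sum_(0 <= j < N) n%:R^-1 * (sw (n%:R * alpha j) * phi (n%:R * alpha j)).
  by rewrite big_mkord mulr_suml; apply: eq_bigr => j _; rewrite mulrC.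
rewrite addrAC; apply: (le_trans (ler_normD _ _)); rewrite /mass_gap mulrDr lerD//; last first.
  have -> : N.+1%:R * (sw (spread N) * phi (spread N)) / n%:R =
      phi (spread N) * (n%:R^-1 * (N.+1%:R * sw (spread N))) by ring.
  have k0 : 0 <= n%:R^-1 * (N.+1%:R * sw (spread N)).
    by apply: mulr_ge0; rewrite ?invr_ge0//; apply: mulr_ge0 => //; exact: sw_ge0.
  by rewrite normrM [X in _ * X]ger0_norm// ler_wpM2r.
rewrite distrC.
pose u psi K : R := series (fun j => n%:R^-1 * (sw (n%:R * alpha j) * psi (n%:R * alpha j))) K.
have l1 : `|u phi K - u phi N| @[K --> \oo] --> `|\int[Sigma_ alpha n]_x phi x - u phi N|.
  by apply: cvg_norm; apply: cvgB; [exact: (cvg_mass mphi hB)|exact: cvg_cst].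
have l2 : B * (u (fun=> 1) K - u (fun=> 1) N) @[K --> \oo] -->
    B * (\int[Sigma_ alpha n]_x (fun=> 1) x - u (fun=> 1) N).
  apply: cvgM; [exact: cvg_cst|apply: cvgB; [|exact: cvg_cst]].
  by apply: (@cvg_mass (fun=> 1) 1) => // x; rewrite normr1.
apply: (ler_cvg_to l1 l2).
exists N => //= K NK.
rewrite /u /series/=.
rewrite !(@big_cat_nat _ _ _ N 0 K)//= addrAC subrr add0r addrAC subrr add0r.
apply: (le_trans (ler_norm_sum _ _ _)); rewrite mulr_sumr; apply: ler_sum => j _.
rewrite normrM ger0_norm ?invr_ge0// mulrCA ler_wpM2l ?invr_ge0//.
by rewrite normrM ger0_norm ?sw_ge0// mulr1 mulrC ler_wpM2r ?sw_ge0.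
Qed.

(** [x / (1 + x^2) = x - x * sw x], and the entries before scaling add up to exactly [c] for every
    [N]. *)
Lemma cvg_center : (\sum_(x <- scaled_list N) x / (1 + x ^+ 2)) / n%:R @[N --> \oo] -->
  c - \int[Sigma_ alpha n]_x x.
Proof.
have c0 := c_ge0 hf.
have h1 : series (fun j => n%:R^-1 * (sw (n%:R * alpha j) * (n%:R * alpha j))) @ \oo -->
    \int[Sigma_ alpha n]_x x.
  apply: (@cvg_integral_Sigma R alpha n (fun x => x)) => //.
  apply: (@series_le_cvg _ _ alpha) => //.
  - by move=> j; rewrite mulr_ge0 ?invr_ge0// mulr_ge0// sw_ge0.
  - move=> j; rewrite ler_pdivrMl// ger0_norm ?mulr_ge0// ler_piMl ?sw_le1//.
    by rewrite mulr_ge0.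
  - exact: cvg_alpha.
have h2 : defect c alpha N * sw (spread N) @[N --> \oo] --> (0 : R).
  apply: (@squeeze_cvgr _ _ _ _ (fun=> 0) (fun N => c * (n%:R * c) * N.+1%:R^-1)); last 2 first.
  - exact: cvg_cst.
  - by rewrite -[X in _ --> X](mulr0 (c * (n%:R * c))); apply: cvgM; [exact: cvg_cst|exact: cvg_harmonic].
  apply: nearW => N; apply/andP; split.
    by rewrite mulr_ge0 ?sw_ge0// (defect_ge0 hf).
  rewrite -mulrA; apply: ler_pM; rewrite ?sw_ge0 ?(defect_ge0 hf) ?(defect_le hf)//.
  exact: le_trans (sw_le (spread_ge0 N)) (spread_le N).
have e N : (\sum_(x <- scaled_list N) x / (1 + x ^+ 2)) / n%:R =
   c - series (fun j => n%:R^-1 * (sw (n%:R * alpha j) * (n%:R * alpha j))) N -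
   defect c alpha N * sw (spread N).
  rewrite (big_scaled (fun x => x / (1 + x ^+ 2))) mulrDl mulr_suml.
  have dE (x : R) : 1 + x ^+ 2 != 0 by rewrite gt_eqF// ltr_pwDl// sqr_ge0.
  have -> : \sum_(j < N) n%:R * alpha j / (1 + (n%:R * alpha j) ^+ 2) / n%:R =
     \sum_(j < N) alpha j - series (fun j => n%:R^-1 * (sw (n%:R * alpha j) * (n%:R * alpha j))) N.
    rewrite /series/= big_mkord -sumrB; apply: eq_bigr => j _.
    rewrite /sw [_ ^+ 2 + 1]addrC; have := dE (n%:R * alpha j).
    move: (alpha j) => a d; field.
    by rewrite nn d.
  have -> : N.+1%:R * (spread N / (1 + spread N ^+ 2)) / n%:R =
     defect c alpha N - defect c alpha N * sw (spread N).
    have N0 : N.+1%:R != 0 :> R by rewrite pnatr_eq0.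
    have -> : N.+1%:R * (spread N / (1 + spread N ^+ 2)) / n%:R =
        (N.+1%:R * spread N / n%:R) / (1 + spread N ^+ 2).
      by move: (N.+1%:R : R) N0 (spread N) (dE (spread N)) => M M0 y y0; field; rewrite nn y0.
    have -> : N.+1%:R * spread N / n%:R = defect c alpha N.
      by rewrite /spread; move: (N.+1%:R : R) N0 => M M0; field; rewrite M0 nn.
    rewrite /sw [_ ^+ 2 + 1]addrC; move: (dE (spread N)); move: (spread N) => y y0; field.
    by rewrite y0.
  by rewrite /defect; ring.
rewrite (funext e) -[X in _ --> X]subr0; apply: cvgB => //.
by apply: cvgB => //; exact: cvg_cst.
Qed.

End fixed_n.
End scaled_lists.

Section diagonal.
Variable R : realType.
Variables (f : nat -> real_entire R) (c_ : nat -> R) (alpha : nat -> nat -> R) (c : R).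
Variable Sigma : {finite_measure set (measurableTypeR R) -> \bar R}.
Hypothesis hf : forall n, (0 < n)%N -> LPI_form (f n) 1 0 (c_ n) (alpha n).
Hypothesis hS : weak_cvg (fun n => Sigma_ (alpha n) n) Sigma.
Hypothesis hc : (fun n => c_ n - \int[Sigma_ (alpha n) n]_x x) @ \oo --> c.

Lemma cvg_of_dist (u v : nat -> R) (l B : R) : v n @[n --> \oo] --> l ->
  (forall n, (0 < n)%N -> `|u n - v n| <= B * n%:R^-1) -> u n @[n --> \oo] --> l.
Proof.
move=> vl huv; rewrite -[X in _ --> X](add0r l).
have e n : u n = (u n - v n) + v n by rewrite subrK.
rewrite (funext e); apply: cvgD => //.
have hB : B * n%:R^-1 @[n --> \oo] --> (0 : R).
  rewrite -[X in _ --> X](mulr0 B); apply: cvgM; first exact: cvg_cst.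
  by rewrite -cvg_shiftS; exact: cvg_harmonic.
apply/cvgrPdist_le => d d0; have /cvgr_lt/(_ _ d0) := hB.
move=> [m _ hm]; exists m.+1 => // n /= mn; rewrite sub0r normrN.
have n0 : (0 < n)%N by exact: leq_trans mn.
by apply: (le_trans (huv _ n0)); apply/ltW; apply: hm => /=; exact: ltnW.
Qed.

(** For each [n] a single [N] brings the centring and the mass gap within [1 / n]. The extra
    property [Q] can be required of the same [N], which ties the chosen lists to the polynomial they
    approximate. *)
Lemma levy_data_diagonal (Q : nat -> nat -> Prop) :
  (forall n, (0 < n)%N -> \forall N \near \oo, Q n N) ->
  exists Nn : nat -> nat,
    levy_data (fun n => scaled_list (c_ n) (alpha n) n (Nn n)) 1 c Sigma /\
    forall n, (0 < n)%N -> Q n (Nn n).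
Proof.
move=> hQ.
pose ctr n N := (\sum_(x <- scaled_list (c_ n) (alpha n) n N) x / (1 + x ^+ 2)) / n%:R.
have : forall n, exists N, (0 < n)%N ->
    [/\ `|ctr n N - (c_ n - \int[Sigma_ (alpha n) n]_x x)| <= n%:R^-1,
        mass_gap (c_ n) (alpha n) n N <= n%:R^-1 & Q n N].
  case=> [|n]; first by exists 0%N.
  have ni : 0 < n.+1%:R^-1 :> R by rewrite invr_gt0.
  have h1 : \forall N \near \oo, `|ctr n.+1 N - (c_ n.+1 - \int[Sigma_ (alpha n.+1) n.+1]_x x)| <= n.+1%:R^-1.
    have /cvgrPdist_le/(_ _ ni) := cvg_center (hf (ltn0Sn n)) (ltn0Sn n).
    by apply: filterS => N; rewrite distrC.
  have h2 : \forall N \near \oo, mass_gap (c_ n.+1) (alpha n.+1) n.+1 N <= n.+1%:R^-1.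
    have /cvgr_lt/(_ _ ni) := cvg_mass_gap (hf (ltn0Sn n)) (ltn0Sn n).
    by apply: filterS => N /ltW.
  have [N hN] : exists N, [/\ `|ctr n.+1 N - (c_ n.+1 - \int[Sigma_ (alpha n.+1) n.+1]_x x)| <= n.+1%:R^-1,
        mass_gap (c_ n.+1) (alpha n.+1) n.+1 N <= n.+1%:R^-1 & Q n.+1 N].
    by apply: (@filter_ex _ \oo); apply: filterS3 h1 h2 (hQ _ (ltn0Sn n)) => N; split.
  by exists N => _.
move=> /choice[Nn hN]; exists Nn; split; last by move=> n n0; case: (hN n n0).
split.
- rewrite mul1r; apply: (cvg_of_dist (B := 1) hc) => n n0.
  by rewrite mul1r; case: (hN n n0).
- move=> phi bphi; have [cphi [B hB]] := bphi; rewrite mul1r.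
  have B0 : 0 <= B by exact: le_trans (hB 0).
  apply: (cvg_of_dist (B := B) (hS bphi)) => n n0.
  have mphi := continuous_measurable_fun cphi.
  apply: (le_trans (mass_gap_le (hf n0) n0 (Nn n) mphi hB)).
  by rewrite ler_wpM2l//; case: (hN n n0).
Qed.

End diagonal.

(** * Root distributions of the two families *)

Section coefficients_of_means.
Variable R : realType.
Implicit Types (s u : seq R) (w : R).

Lemma prod_splits s (p : R * seq R) (F : R -> R) : p \in splits s ->
  \prod_(a <- s) F a = F p.1 * \prod_(b <- p.2) F b.
Proof.
elim: s p => //= a s IH p; rewrite inE => /predU1P[->/=|]; first by rewrite big_cons.
by case/mapP => q qs ->/=; rewrite big_cons (IH _ qs) big_cons mulrCA.
Qed.

(** With [P] the product of the [1 + a w], [bmean] is the logarithmic derivative [w P' / P]; it is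
    thus a rational function of the coefficients. *)
Lemma bmean_coef u w n : all (>= 0) u -> 0 <= w -> (size u <= n)%N ->
  bmean u w * (\sum_(k < n.+1) esp u k * w ^+ k) = \sum_(k < n.+1) k%:R * (esp u k * w ^+ k).
Proof.
move=> /allP u0 w0 sn; rewrite -(prod_esp w sn).
rewrite /bmean -(sum_splits (fun a => a * w / (1 + a * w))) mulr_suml.
have h (p : R * seq R) : p \in splits u ->
    p.1 * w / (1 + p.1 * w) * \prod_(a <- u) (1 + a * w) =
    \sum_(k < n.+1) (p.1 * esp p.2 k) * w ^+ k.+1.
  move=> pu; have p0 : 0 <= p.1.
    by apply: u0; rewrite -(map_fst_splits u); apply: map_f.
  rewrite (prod_splits (fun a => 1 + a * w) pu) mulrA mulfVK; last first.
    by rewrite gt_eqF// ltr_pwDl// mulr_ge0.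
  have sp : (size p.2 <= n)%N by apply: leq_trans sn; rewrite (size_splits pu).
  rewrite (prod_esp w sp) mulr_sumr; apply: eq_bigr => k _; rewrite exprS; ring.
rewrite (eq_big_seq _ h) exchange_big/=.
rewrite [RHS]big_ord_recl mul0r add0r.
rewrite (eq_bigr (fun k : 'I_n.+1 => k.+1%:R * (esp u k.+1 * w ^+ k.+1))); last first.
  by move=> k _; rewrite -mulr_suml -esp_sum_splits mulrA.
by rewrite big_ord_recr/= esp_gt_size// mul0r mulr0 addr0.
Qed.

Lemma prod_ge1 u w : all (>= 0) u -> 0 <= w -> 1 <= \prod_(a <- u) (1 + a * w).
Proof.
move=> /allP u0 w0; rewrite big_seq; elim/big_ind: _ => [//|x y x1 y1|a au].
  by rewrite mulr_ege1.
by rewrite lerDl mulr_ge0// u0.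
Qed.

Lemma bmeanE u w n : all (>= 0) u -> 0 <= w -> (size u <= n)%N ->
  bmean u w = (\sum_(k < n.+1) k%:R * (esp u k * w ^+ k)) / (\sum_(k < n.+1) esp u k * w ^+ k).
Proof.
move=> u0 w0 sn; rewrite -(bmean_coef u0 w0 sn) mulfK// -(prod_esp w sn).
by rewrite gt_eqF// (lt_le_trans ltr01)// prod_ge1.
Qed.

(** [hmean] depends rationally on the coefficients, so their convergence suffices and no continuity
    of roots is invoked. *)
Lemma hmean_coef_cvg (U : nat -> seq R) u w n : (0 < n)%N -> 0 < w ->
  all (>= 0) u -> size u = n ->
  (forall N, all (>= 0) (U N) /\ size (U N) = n) ->
  (forall k, (k <= n)%N -> esp (U N) k @[N --> \oo] --> esp u k) ->
  hmean (U N) w @[N --> \oo] --> hmean u w.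
Proof.
move=> n0 w0 u0 su hU hesp.
have e N : hmean (U N) w = 1 - ((\sum_(k < n.+1) k%:R * (esp (U N) k * w ^+ k)) /
    (\sum_(k < n.+1) esp (U N) k * w ^+ k)) / n%:R.
  by have [U0 sU] := hU N; rewrite hmean_bmean ?sU// (bmeanE U0 (ltW w0) (n := n)) ?sU.
rewrite (funext e) hmean_bmean ?su// (bmeanE u0 (ltW w0) (n := n)) ?su//.
have hk (k : 'I_n.+1) : esp (U N) k * w ^+ k @[N --> \oo] --> esp u k * w ^+ k.
  by apply: cvgM; [apply: hesp; rewrite -ltnS|exact: cvg_cst].
apply: cvgB; first exact: cvg_cst.
apply: cvgM; last exact: cvg_cst.
apply: cvgM.
  by apply: cvg_bigsum => k; apply: cvgM; [exact: cvg_cst|exact: hk].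
apply: cvgV; last exact: cvg_bigsum.
have sn : (size u <= n)%N by rewrite su.
by rewrite -(prod_esp w sn) gt_eqF// (lt_le_trans ltr01)// prod_ge1// ltW.
Qed.

Lemma esp_scale (t : R) s k : esp [seq t * a | a <- s] k = t ^+ k * esp s k.
Proof.
elim: s k => [|a s IH] [|k] /=; rewrite ?esp0 ?mulr1 ?expr0 ?mul1r ?mulr0//.
by rewrite !IH exprS; ring.
Qed.

End coefficients_of_means.

Section operators.
Variable R : realType.

Lemma apply_entire_monomial (f : real_entire R) (L : {poly R} -> {poly R}) n (a : nat -> R) :
  (forall k, (k <= n)%N -> iter k L 'X^n = a k *: 'X^(n - k)) ->
  apply_entire f L 'X^n = altpoly n (fun k => signed_coef f k * a k).
Proof.
move=> hL; rewrite /apply_entire size_polyXn; apply/polyP => i.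
rewrite coef_sum coef_poly ltnS.
under eq_bigr => k _ do rewrite coefZ hL ?leq_ord// coefZ coefXn.
case: leqP => ni; last first.
  rewrite big1// => k _; rewrite (_ : (i == n - k)%N = false) ?mulr0//.
  by apply/negbTE; rewrite neq_ltn (leq_ltn_trans (leq_subr _ _) ni) orbT.
have kn : (n - i < n.+1)%N by rewrite ltnS leq_subr.
rewrite (bigD1 (Ordinal kn))//= subKn// eqxx mulr1 big1 ?addr0; last first.
  move=> k; rewrite -val_eqE/= => kne; rewrite (_ : (i == n - k)%N = false) ?mulr0//.
  apply/negbTE/eqP => ik; move/eqP: kne; apply; rewrite ik subKn// leq_ord//.
by rewrite /signed_coef mulrA mulrA -exprMn mulrNN mulr1 expr1n mul1r.
Qed.

Lemma iter_derivXn n k : (k <= n)%N ->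
  iter k (fun p : {poly R} => p^`()) 'X^n = (n ^_ k)%:R *: 'X^(n - k).
Proof.
move=> kn; elim: k kn => [|k IH] kn; first by rewrite ffactn0 scale1r subn0.
rewrite iterS IH ?(ltnW kn)//= derivZ derivXn -[_ *+ (n - k)]scaler_nat scalerA.
by rewrite ffactnSr natrM -subnS.
Qed.

Lemma Lbeta_Xn (beta : R) m :
  Lbeta beta ('X^(m.+1) : {poly R}) = (m.+1%:R * (m.+1%:R + beta) : R) *: ('X^m : {poly R}).
Proof.
rewrite /Lbeta derivnS derivn1 derivXn /= derivMn derivXn.
have -> : 'X * ('X^(m.-1) *+ m *+ m.+1) = (m%:R * m.+1%:R : R) *: ('X^m : {poly R}).
  rewrite -natrM scaler_nat mulrnA !mulrnAr -exprS; case: m => [|m] //=.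
rewrite -['X^m *+ m.+1]scaler_nat scalerA -scalerDl; congr (_ *: _).
by rewrite -natr1; ring.
Qed.

Lemma iter_Lbeta (beta rho : R) n k : (k <= n)%N ->
  iter k (fun p => rho *: Lbeta beta p) 'X^n =
  ((n ^_ k)%:R * \prod_(i < k) (rho * (n%:R + beta - i%:R))) *: 'X^(n - k).
Proof.
move=> kn; elim: k kn => [|k IH] kn; first by rewrite ffactn0 big_ord0 mulr1 scale1r subn0.
rewrite iterS IH ?(ltnW kn)//=.
have lin (a : R) (p : {poly R}) : Lbeta beta (a *: p) = a *: Lbeta beta p.
  by rewrite /Lbeta derivnZ derivZ -scalerAr scalerDr !scalerA [_ * a]mulrC.
rewrite lin; have -> : (n - k)%N = (n - k.+1).+1 by lia.
rewrite Lbeta_Xn !scalerA; congr (_ *: _).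
have -> : (n - k.+1).+1%:R = n%:R - k%:R :> R.
  by rewrite -natrB ?(ltnW kn)//; congr (_%:R); lia.
rewrite big_ord_recr/= ffactnSr natrM (natrB _ (ltnW kn)).
by move: (n%:R : R) (k%:R : R) ((n ^_ k)%:R : R) (\prod_(i < k) _) => a b d e; ring.
Qed.

End operators.

Section root_lists.
Variable R : realType.

Definition real_roots (p : {poly R}) : seq R := [seq complex.Re z | z <- croots p].

Lemma nnr_real_roots n (p : {poly R}) : nnr n p ->
  [/\ all (>= 0) (real_roots p), size (real_roots p) = n,
      croots p = [seq (x%:C)%C | x <- real_roots p] & p = rooted (real_roots p)].
Proof.
move=> /nnr_slit[pm sp hp]; have [h1 h2 h3 h4] := croots_nonneg pm sp hp.
by split=> //; rewrite /real_roots ?size_map// -map_comp; exact: h3.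
Qed.

Variables (f : real_entire R) (c : R) (alpha : nat -> R).
Hypothesis hf : LPI_form f 1 0 c alpha.

Lemma signed_coef0 : signed_coef f 0 = 1.
Proof.
apply: (cvg_unique _ (esp_hadamard_cvg hf (k := 0))) => //.
have e N : esp (hadamard_list c alpha N) 0 = 1 by rewrite esp0.
by rewrite (funext e); exact: cvg_cst.
Qed.

Lemma nnr_signed_coef n (a : nat -> R) : a 0%N = 1 ->
  (forall N, nnr n (altpoly n (fun k => esp (hadamard_list c alpha N) k * a k))) ->
  nnr n (altpoly n (fun k => signed_coef f k * a k)).
Proof.
move=> a0 h; apply: (nnr_limit h); first by rewrite signed_coef0 a0 mulr1.
by move=> k _; apply: cvgM; [exact: esp_hadamard_cvg|exact: cvg_cst].
Qed.

End root_lists.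

Section root_means.
Variable R : realType.
Variables (f : nat -> real_entire R) (c_ : nat -> R) (alpha : nat -> nat -> R) (c : R).
Variable Sigma : {finite_measure set (measurableTypeR R) -> \bar R}.
Hypothesis hf : forall n, (0 < n)%N -> LPI_form (f n) 1 0 (c_ n) (alpha n).
Hypothesis hS : weak_cvg (fun n => Sigma_ (alpha n) n) Sigma.
Hypothesis hc : (fun n => c_ n - \int[Sigma_ (alpha n) n]_x x) @ \oo --> c.

Local Notation M := (levy_profile 1 c Sigma).

Lemma levy_profile_admissible : profile M.
Proof.
have [Nn [hs _]] := levy_data_diagonal hf hS hc (Q := fun _ _ => True) (fun n _ => filterT).
apply: (profile_levy _ hs) => n n0; exact: (scaled_ge0 n (hf n0) _).
Qed.

Variables (lam : R) (rho : nat -> R) (p : nat -> {poly R}).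
Hypothesis lam01 : 0 <= lam <= 1.
Hypothesis hrho : rho n @[n --> \oo] --> (1 : R).
Hypothesis hpos : forall n, (0 < n)%N -> forall i, (i < n)%N -> 0 < rho n - lam * i%:R / n%:R.

(* [lam = 0] and [rho = 1] give the Appell polynomials; [rho n] equal to
   [lam (n + beta n) / n] gives the Laguerre ones. *)
Definition weight (n i : nat) : R := (1 - i%:R / n%:R) * (rho n - lam * i%:R / n%:R).

(** The power of [n] accounts for the passage from the roots [a] of the approximating lists to
    [n * a]. *)
Definition moment (n k : nat) : R := n%:R ^+ k * \prod_(i < k) weight n i.

Hypothesis hp : forall n, (0 < n)%N ->
  p n = altpoly n (fun k => signed_coef (f n) k * moment n k).
Hypothesis hnnr : forall n N, (0 < n)%N ->
  nnr n (altpoly n (fun k => esp (hadamard_list (c_ n) (alpha n) N) k * moment n k)).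

Lemma nnr_p n : (0 < n)%N -> nnr n (p n).
Proof.
move=> n0; rewrite hp//; apply: (nnr_signed_coef (hf n0)) => [|N]; last exact: hnnr.
by rewrite /moment big_ord0 mulr1 expr0.
Qed.

(** The coefficient ratios are exploited for the finite products, whose root lists are [U n N]. [N]
    is taken so large that [hmean] of [U n N] is within [1 / n] of that of the roots of [p n], and
    the diagonal inherits the limit. *)
Lemma hmean_real_roots_cvg (y : R) : 0 < y -> M y < 1 ->
  hmean (real_roots (p n)) (width lam M y) @[n --> \oo] --> 1 - M y.
Proof.
move=> y0 My1; have My0 := profile_ge0 levy_profile_admissible y0.
have lM : lam * M y < 1.
  by apply: le_lt_trans My1; rewrite ler_piMl//; case/andP: lam01.
set w := width lam M y.
have w0 : 0 < w by apply: divr_gt0 => //; apply: mulr_gt0; rewrite subr_gt0.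
have : forall n, exists U : nat -> seq R, (0 < n)%N -> forall N,
    [/\ all (>= 0) (U N), size (U N) = n & rooted (U N) =
      altpoly n (fun k => esp (hadamard_list (c_ n) (alpha n) N) k * moment n k)].
  case=> [|n]; first by exists (fun=> [::]).
  have : forall N, exists u, [/\ all (>= 0) u, size u = n.+1 & rooted u =
      altpoly n.+1 (fun k => esp (hadamard_list (c_ n.+1) (alpha n.+1) N) k * moment n.+1 k)].
    by move=> N; have [u [u0 su eu]] := hnnr N (ltn0Sn n); exists u.
  by move=> /choice[U hU]; exists U.
move=> /choice[U hU].
pose Q n N := `|hmean (real_roots (p n)) w - hmean (U n N) w| <= n%:R^-1.
have hQ n : (0 < n)%N -> \forall N \near \oo, Q n N.
  move=> n0; have [r0 sr _ er] := nnr_real_roots (nnr_p n0).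
  have hesp k : (k <= n)%N -> esp (U n N) k @[N --> \oo] --> esp (real_roots (p n)) k.
    move=> kn; have eU N : esp (U n N) k = esp (hadamard_list (c_ n) (alpha n) N) k * moment n k.
      have [U0 sU eqU] := hU n n0 N.
      move: eqU; rewrite rooted_altpoly sU => /altpoly_inj; exact.
    have -> : esp (real_roots (p n)) k = signed_coef (f n) k * moment n k.
      move: er; rewrite rooted_altpoly sr hp// => /esym/altpoly_inj; exact.
    rewrite (funext eU); apply: cvgM; last exact: cvg_cst.
    exact: (esp_hadamard_cvg (hf n0)).
  have hU' N : all (>= 0) (U n N) /\ size (U n N) = n by case: (hU n n0 N).
  have := hmean_coef_cvg n0 w0 r0 sr hU' hesp => /cvgrPdist_le.
  by apply; rewrite invr_gt0 ltr0n.
have [Nn [hs hQN]] := levy_data_diagonal hf hS hc hQ.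
have s0 n : (0 < n)%N -> all (>= 0) (scaled_list (c_ n) (alpha n) n (Nn n)).
  by move=> n0; exact: (scaled_ge0 n (hf n0) _).
apply: (cvg_of_dist (B := 1) (v := fun n => hmean (U n (Nn n)) w)); last first.
  by move=> n n0; rewrite mul1r; exact: hQN.
apply: (@hmean_cvg _ (fun n => scaled_list (c_ n) (alpha n) n (Nn n)) _ rho) => //.
- by rewrite My0.
- move=> n n0; have [U0 sU eU] := hU n n0 (Nn n).
  split=> //; [exact: s0|exact: hpos|].
  rewrite eU; apply: eq_altpoly => k _.
  by rewrite /weighted /scaled_list esp_scale /moment mulrCA mulrA.
- exact: (cvg_bmean s0 hs).
Qed.

End root_means.

Section existence.
Variable R : realType.
Variables (s : nat -> seq R) (kap c : R).
Variable Sigma : {finite_measure set (measurableTypeR R) -> \bar R}.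
Hypothesis s0 : forall n : nat, (0 < n)%N -> all (>= 0) (s n).
Hypothesis hs : levy_data s kap c Sigma.
Hypothesis kap0 : 0 <= kap.

Local Notation M := (levy_profile kap c Sigma).

Lemma ffact_prod n k : (0 < n)%N -> (k <= n)%N ->
  (n ^_ k)%:R = n%:R ^+ k * \prod_(i < k) (1 - i%:R / n%:R) :> R.
Proof.
move=> n0; have nn : n%:R != 0 :> R by rewrite pnatr_eq0 -lt0n.
elim: k => [|k IH] kn; first by rewrite ffactn0 big_ord0 mulr1 expr0.
rewrite ffactnSr natrM (natrB _ (ltnW kn)) IH ?(ltnW kn)// big_ord_recr/= exprSr.
have -> : 1 - k%:R / n%:R = (n%:R - k%:R) / n%:R :> R by rewrite mulrBl mulfV.
move: (n%:R : R) nn => N nn; field.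
by rewrite nn.
Qed.

(* [u n] lists the roots of the Appell polynomial of [s n / n]. *)
Lemma exists_levy_measure : exists (u : nat -> seq R) (mu : probability (measurableTypeR R) R),
  [/\ forall n : nat, (0 < n)%N -> all (>= 0) (u n) /\ size (u n) = n,
      forall g : R -> R, bounded_continuous g -> avg (u n) g @[n --> \oo] --> \int[mu]_x g x,
      nneg_supported mu,
      forall y, 0 < y -> M y < 1 -> hmean (u n) (width 0 M y) @[n --> \oo] --> 1 - M y &
      is_R_transform mu (fun w => kap%:C%C * levy_R c Sigma w)].
Proof.
have hM := profile_levy s0 hs.
have : forall n, exists u : seq R, (0 < n)%N ->
    [/\ all (>= 0) u, size u = n & rooted u = appell n [seq x / n%:R | x <- s n]].
  case=> [|n]; first by exists [::].
  have [|u [u0 su eu]] := @nnr_appell R n.+1 [seq x / n.+1%:R | x <- s n.+1].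
    by apply/allP => _ /mapP[x /(allP (s0 (ltn0Sn n))) x0 ->] /=; rewrite divr_ge0.
  by exists u.
move=> /choice[u hu].
have u0 n : (0 < n)%N -> all (>= 0) (u n) /\ size (u n) = n by move=> n0; case: (hu n n0).
have z01 : 0 <= (0 : R) <= 1 by rewrite lexx ler01.
have hh y : 0 < y -> M y < 1 -> hmean (u n) (width 0 M y) @[n --> \oo] --> 1 - M y.
  move=> y0 My; apply: (@hmean_cvg _ s u (fun=> 1)) => //.
  - by rewrite (profile_ge0 hM y0).
  - exact: cvg_cst.
  - move=> n n0; have [un0 sn en] := hu n n0; split; [exact: s0|by []|by []| |].
      by move=> i _; rewrite !mul0r subr0 ltr01.
    rewrite en appell_altpoly; apply: eq_altpoly => k kn; rewrite /weighted.
    have -> : [seq x / n%:R | x <- s n] = [seq n%:R^-1 * x | x <- s n].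
      by apply: eq_map => x; rewrite mulrC.
    rewrite esp_scale ffact_prod//.
    have nk : n%:R ^+ k != 0 :> R by rewrite expf_neq0// pnatr_eq0 -lt0n.
    rewrite exprVn mulrACA mulVf// mul1r; congr (_ * _).
    by apply: eq_bigr => i _; rewrite !mul0r subr0 mulr1.
  - exact: cvg_bmean.
have half0 : 0 < 2^-1 :> R by rewrite invr_gt0.
have [y0 y00 My0] := profile_small hM half0.
have h1 y : 0 < y -> y <= y0 -> hmean (u n) (width 0 M y) @[n --> \oo] --> 1 - M y.
  by move=> yp yy; apply: hh => //; have /andP[_] := profile_half hM My0 yp yy; lra.
have [mu [mu0 hmu]] := profile_limit_measure hM z01 y00 My0 u0 h1.
exists u, mu; split=> //.
apply: is_R_transform_levy => // z z0.
apply: (cauchy_levy_eq s0 _ hs hmu z0) => n n0.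
by case: (hu n n0).
Qed.

End existence.

Section root_distribution.
Variable R : realType.

Lemma continuous_measurable_borelC (phi : R[i] -> R) : continuous phi ->
  measurable_fun [set: borelC R] (phi : borelC R -> R).
Proof.
move=> cphi; apply: (measurability (@RGenOInfty.G R)); first exact: RGenOInfty.measurableE.
move=> _ [_ [x ->] <-]; rewrite setTI; apply: sub_sigma_algebra.
by apply: open_comp; [move=> z _; exact: cphi|exact: interval_open].
Qed.

Lemma continuous_real_complex : continuous (fun x : R => x%:C : R[i]).
Proof.
move=> x; apply/cvgrPdist_le => e e0.
have [er er0] : complex.Im e = 0 /\ 0 < complex.Re e.
  by move: e0; rewrite ltcE/= => /andP[/eqP ->].
have /cvgrPdist_le/(_ _ er0) : y @[y --> x] --> x by exact: cvg_id.
apply: filterS => y hy; rewrite -rmorphB lecE/= /Num.norm/= er eqxx/=.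
by rewrite expr0n addr0 sqrtr_sqr.
Qed.

Lemma ge0_integral_root_distr n (p : {poly R}) (h : R[i] -> R) :
  measurable_fun [set: borelC R] (h : borelC R -> R) -> (forall z, 0 <= h z) ->
  (\int[root_distr n p]_z (h z)%:E = ((\sum_(z <- croots p) h z) / n%:R)%:E)%E.
Proof.
move=> mh h0; have mE : measurable_fun [set: borelC R] (EFin \o h) by exact/measurable_EFinP.
rewrite /root_distr ge0_integral_mscale//=; last by move=> x _; rewrite lee_fin.
rewrite ge0_integral_measure_sum//=; last by move=> x _; rewrite lee_fin.
under eq_bigr => k _ do rewrite integral_dirac//= diracT mul1e.
rewrite sumEFin -EFinM mulrC; congr ((_ / _)%:E).
by rewrite [RHS](big_nth 0) big_mkord.
Qed.

Lemma integral_root_distr n (p : {poly R}) (phi : R[i] -> R) : continuous phi ->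
  \int[root_distr n p]_z phi z = (\sum_(z <- croots p) phi z) / n%:R.
Proof.
move=> cphi; have mphi := continuous_measurable_borelC cphi.
pose gp z := Order.max (phi z) 0; pose gn z := Order.max (- phi z) 0.
have mp : measurable_fun [set: borelC R] (gp : borelC R -> R) by exact: measurable_maxr.
have mn : measurable_fun [set: borelC R] (gn : borelC R -> R).
  by apply: measurable_maxr => //; exact: measurableT_comp.
have p0 x : 0 <= gp x by rewrite le_max lexx orbT.
have n0 x : 0 <= gn x by rewrite le_max lexx orbT.
rewrite /Rintegral integralE.
have -> : ((fun x => (phi x)%:E)^\+)%E = (fun x => (gp x)%:E).
  by apply/funext => x; rewrite funeposE -EFin_max.
have -> : ((fun x => (phi x)%:E)^\-)%E = (fun x => (gn x)%:E).
  by apply/funext => x; rewrite funenegE -EFinN -EFin_max.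
rewrite !ge0_integral_root_distr//= -mulrBl -sumrB; congr (_ / _); apply: eq_bigr => z _.
by rewrite /gp /gn; have [h|h] := leP (phi z) 0; have [h'|h'] := leP (- phi z) 0; lra.
Qed.

Lemma weak_cvgC_avg (p : nat -> {poly R}) (mu : probability (measurableTypeR R) R) :
  (forall n, (0 < n)%N -> nnr n (p n)) ->
  (forall g : R -> R, bounded_continuous g ->
    avg (real_roots (p n)) g @[n --> \oo] --> \int[mu]_x g x) ->
  weak_cvgC (fun n => root_distr n (p n)) mu.
Proof.
move=> hp hmu phi [cphi [B hB]].
have bc : bounded_continuous (fun x : R => phi x%:C).
  split; last by exists B.
  by move=> x; apply: continuous_comp; [exact: continuous_real_complex|exact: cphi].
apply: (cvg_of_dist (B := 0) (hmu _ bc)) => n n0.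
have [_ sr er _] := nnr_real_roots (hp n n0).
rewrite integral_root_distr// {1}er /avg sr big_map subrr normr0 mul0r//.
Qed.

End root_distribution.

Section operator_families.
Variable R : realType.

Lemma moment_falling n k : (0 < n)%N -> (k <= n)%N ->
  moment (0 : R) (fun=> 1) n k = (n ^_ k)%:R.
Proof.
move=> n0 kn; rewrite ffact_prod// /moment; congr (_ * _).
by apply: eq_bigr => i _; rewrite /weight !mul0r subr0 mulr1.
Qed.

Lemma moment_laguerre (lam beta : R) (rho : nat -> R) n k : (0 < n)%N -> (k <= n)%N ->
  rho n = lam / n%:R * (n%:R + beta) ->
  moment lam rho n k = (n ^_ k)%:R * \prod_(i < k) (lam / n%:R * (n%:R + beta - i%:R)).
Proof.
move=> n0 kn hr; rewrite ffact_prod// /moment -mulrA -big_split/=; congr (_ * _).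
apply: eq_bigr => i _; rewrite /weight hr; congr (_ * _).
by ring.
Qed.

Lemma nnr_appell_list n (a : nat -> R) (L : seq R) : all (>= 0) L ->
  (forall k, (k <= n)%N -> a k = (n ^_ k)%:R) -> nnr n (altpoly n (fun k => esp L k * a k)).
Proof.
move=> L0 ha; rewrite (eq_altpoly (b' := fun k => esp L k * (n ^_ k)%:R)).
  by rewrite -appell_altpoly; exact: nnr_appell.
by move=> k kn; rewrite ha.
Qed.

Lemma appell_family (f : real_entire R) n : (0 < n)%N ->
  apply_entire f (fun p => p^`()) 'X^n =
  altpoly n (fun k => signed_coef f k * moment 0 (fun=> 1) n k).
Proof.
move=> n0; apply: apply_entire_monomial => k kn.
by rewrite moment_falling// iter_derivXn.
Qed.

Lemma laguerre_family (f : real_entire R) (lam beta : R) (rho : nat -> R) n : (0 < n)%N ->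
  rho n = lam / n%:R * (n%:R + beta) ->
  apply_entire f (fun p => (lam / n%:R) *: Lbeta beta p) 'X^n =
  altpoly n (fun k => signed_coef f k * moment lam rho n k).
Proof.
move=> n0 hr; apply: apply_entire_monomial => k kn.
by rewrite (moment_laguerre n0 kn hr) iter_Lbeta.
Qed.

Lemma nnr_laguerre_list (lam beta : R) (rho : nat -> R) n (L : seq R) : (0 < n)%N ->
  -1 < beta -> 0 < lam -> rho n = lam / n%:R * (n%:R + beta) -> all (>= 0) L ->
  nnr n (altpoly n (fun k => esp L k * moment lam rho n k)).
Proof.
move=> n0 hb l0 hr L0.
have l1 : 0 < lam / n%:R by rewrite divr_gt0// ltr0n.
have := nnr_laguerre hb l1 (nnr_appell_list L0 (fun k (_ : (k <= n)%N) => erefl (n ^_ k)%:R)).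
congr (nnr _ _); apply: eq_altpoly => k kn.
by rewrite (moment_laguerre n0 kn hr) mulrA.
Qed.

End operator_families.

(** * Infinite divisibility and the theorem *)

Section infinite_divisibility.
Variable R : realType.

Lemma cvg_div_ratio k : (0 < k)%N -> (n %/ k).+1%:R / n%:R @[n --> \oo] --> (k%:R^-1 : R).
Proof.
move=> k0; have kp : 0 < k%:R :> R by rewrite ltr0n.
apply: (cvg_of_dist (B := 1) (cvg_cst (k%:R^-1 : R))) => n n0.
have np : 0 < n%:R :> R by rewrite ltr0n.
have e : n%:R = (n %/ k)%:R * k%:R + (n %% k)%:R :> R by rewrite -natrM -natrD -divn_eq.
have r0 : 0 <= (n %% k)%:R :> R by [].
have r1 : (n %% k)%:R <= k%:R :> R by rewrite ler_nat ltnW// ltn_pmod.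
have -> : (n %/ k).+1%:R / n%:R - k%:R^-1 = ((n %/ k).+1%:R * k%:R - n%:R) / k%:R / n%:R :> R.
  by move: (n%:R : R) (k%:R : R) np kp (_.+1%:R : R) => N K N0 K0 q; field; rewrite !gt_eqF.
have -> : (n %/ k).+1%:R * k%:R - n%:R = k%:R - (n %% k)%:R :> R.
  by rewrite -natr1 mulrDl mul1r [X in _ - X]e; ring.
rewrite normrM [`|n%:R^-1|]ger0_norm ?invr_ge0 ?(ltW np)// ler_wpM2r ?invr_ge0 ?(ltW np)//.
rewrite ger0_norm; last by rewrite divr_ge0 ?(ltW kp)// subr_ge0.
by rewrite ler_pdivrMr// mul1r gerBl.
Qed.

(** The list of index [n %/ k + 1] is normalised by [n] instead of about [n / k], which divides its
    data by [k]. The shift by one keeps the index positive. *)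
Lemma levy_data_div (s : nat -> seq R) (c : R)
    (Sigma : {finite_measure set (measurableTypeR R) -> \bar R}) k : (0 < k)%N ->
  levy_data s 1 c Sigma -> levy_data (fun n => s (n %/ k).+1) k%:R^-1 c Sigma.
Proof.
move=> k0 [h1 h2].
have hk : (n %/ k).+1 @[n --> \oo] --> \oo.
  apply/cvgnyPge => N; exists (N * k)%N => // n /= nk.
  by apply: leqW; rewrite leq_divRL.
have key (F : nat -> R) (l : R) : F n / n%:R @[n --> \oo] --> 1 * l ->
    F (n %/ k).+1 / n%:R @[n --> \oo] --> k%:R^-1 * l.
  rewrite mul1r => hF; rewrite mulrC.
  have e n : F (n %/ k).+1 / n%:R = F (n %/ k).+1 / (n %/ k).+1%:R * ((n %/ k).+1%:R / n%:R).
    by rewrite mulrA mulfVK// pnatr_eq0.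
  rewrite (funext e); apply: cvgM; last exact: cvg_div_ratio.
  exact: (cvg_comp _ _ hk hF).
split; first exact: (key (fun n => \sum_(x <- s n) x / (1 + x ^+ 2))).
by move=> phi bphi; exact: (key (fun n => \sum_(x <- s n) x ^+ 2 / (1 + x ^+ 2) * phi x) _ (h2 _ bphi)).
Qed.

End infinite_divisibility.

(** The curves [width 0 M] and [width lambda M] carry the same values [1 - M y]. They produce the
    two measures in the first claim and identify given ones in the second. *)
Theorem theorem2p12 (R : realType) (f : nat -> real_entire R) (c : R)
    (Sigma : {finite_measure set (measurableTypeR R) -> \bar R})
    (hf : admissible f c Sigma)
    (beta : nat -> R) (hbeta : forall n, (0 < n)%N -> -1 < beta n)
    (lambda : R) (hlambda : 0 < lambda <= 1)
    (hlim : (fun n => n%:R / (n%:R + beta n)) @ \oo --> lambda) :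
  (exists mu nu : probability (measurableTypeR R) R,
     free_levy_pair mu c Sigma /\ is_free_mult_conv (MP lambda) mu nu) /\
  (forall mu nu : probability (measurableTypeR R) R,
     free_levy_pair mu c Sigma -> is_free_mult_conv (MP lambda) mu nu ->
     weak_cvgC
       (fun n => root_distr n (apply_entire (f n) (fun p => p^`()) 'X^n)) mu /\
     weak_cvgC
       (fun n => root_distr n
          (apply_entire (f n)
             (fun p => (lambda / n%:R) *: Lbeta (beta n) p) 'X^n)) nu).
Proof.
have [c_ [alpha [hL hS hc]]] := hf.
have {}hL n : (0 < n)%N -> LPI_form (f n) 1 0 (c_ n) (alpha n) by move=> /hL[].
have l0 : 0 < lambda by case/andP: hlambda.
have lW : 0 <= lambda <= 1 by case/andP: hlambda => /ltW -> ->.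
have z01 : 0 <= (0 : R) <= 1 by rewrite lexx ler01.
pose M := levy_profile 1 c Sigma.
have hM : profile M by exact: (levy_profile_admissible hL hS hc).
pose rho n := lambda / n%:R * (n%:R + beta n).
have hrho : rho n @[n --> \oo] --> (1 : R).
  have ln : lambda != 0 by rewrite gt_eqF.
  rewrite -[X in _ --> X](mulfV ln).
  have e n : rho n = lambda * (n%:R / (n%:R + beta n))^-1 by rewrite /rho invf_div mulrAC mulrA.
  rewrite (funext e); apply: cvgM; first exact: cvg_cst.
  exact: cvgV.
(* The quantity is [lambda / n] times [n + beta n - i], positive because [i + 1 <= n] and
   [beta n > -1]. *)
have hpos n : (0 < n)%N -> forall i, (i < n)%N -> 0 < rho n - lambda * i%:R / n%:R.
  move=> n0 i ni; have -> : rho n - lambda * i%:R / n%:R = lambda / n%:R * (n%:R + beta n - i%:R).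
    by rewrite /rho; ring.
  apply: mulr_gt0; first by rewrite divr_gt0// ltr0n.
  have : i.+1%:R <= n%:R :> R by rewrite ler_nat.
  by rewrite -natr1; have := hbeta n n0; lra.
pose pA n := apply_entire (f n) (fun p => p^`()) 'X^n.
pose pL n := apply_entire (f n) (fun p => (lambda / n%:R) *: Lbeta (beta n) p) 'X^n.
have nA n N : (0 < n)%N -> nnr n (altpoly n (fun k => esp (hadamard_list (c_ n) (alpha n) N) k * moment (0:R) (fun=> 1) n k)).
  move=> n0; apply: nnr_appell_list; first exact: (hadamard_ge0 (hL n n0)).
  by move=> k kn; exact: moment_falling.
have nL n N : (0 < n)%N -> nnr n (altpoly n (fun k => esp (hadamard_list (c_ n) (alpha n) N) k * moment lambda rho n k)).
  move=> n0; apply: (nnr_laguerre_list n0 (hbeta n n0) l0 erefl).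
  exact: (hadamard_ge0 (hL n n0)).
have eA n : (0 < n)%N -> pA n = altpoly n (fun k => signed_coef (f n) k * moment (0:R) (fun=> 1) n k).
  exact: appell_family.
have eL n : (0 < n)%N -> pL n = altpoly n (fun k => signed_coef (f n) k * moment lambda rho n k).
  by move=> n0; exact: (laguerre_family (f n) n0 erefl).
have hposA n : (0 < n)%N -> forall i, (i < n)%N -> 0 < (1 : R) - 0 * i%:R / n%:R.
  by move=> _ i _; rewrite !mul0r subr0.
have nnrA n : (0 < n)%N -> nnr n (pA n) by exact: (nnr_p hL eA nA).
have nnrL n : (0 < n)%N -> nnr n (pL n) by exact: (nnr_p hL eL nL).
have half0 : 0 < 2^-1 :> R by rewrite invr_gt0.
have [y0 y00 My0] := profile_small hM half0.
have Mlt y : 0 < y -> y <= y0 -> M y < 1.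
  by move=> yp yy; have /andP[_] := profile_half hM My0 yp yy; lra.
have hA y : 0 < y -> y <= y0 -> hmean (real_roots (pA n)) (width 0 M y) @[n --> \oo] --> 1 - M y.
  move=> yp yy.
  exact: (hmean_real_roots_cvg hL hS hc z01 (cvg_cst (1:R)) hposA eA nA yp (Mlt y yp yy)).
have hLg y : 0 < y -> y <= y0 -> hmean (real_roots (pL n)) (width lambda M y) @[n --> \oo] --> 1 - M y.
  move=> yp yy.
  exact: (hmean_real_roots_cvg hL hS hc lW hrho hpos eL nL yp (Mlt y yp yy)).
have rA n : (0 < n)%N -> all (>= 0) (real_roots (pA n)) /\ size (real_roots (pA n)) = n.
  by move=> n0; case: (nnr_real_roots (nnrA n n0)).
have rL n : (0 < n)%N -> all (>= 0) (real_roots (pL n)) /\ size (real_roots (pL n)) = n.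
  by move=> n0; case: (nnr_real_roots (nnrL n n0)).
(* No side condition is imposed here: only some lists with the right Levy data are needed to
   construct [mu0]. *)
have [Nn [hs _]] := levy_data_diagonal hL hS hc (Q := fun _ _ => True) (fun n _ => filterT).
set s := (fun n => scaled_list _ _ _ _) in hs.
have s0 n : (0 < n)%N -> all (>= 0) (s n) by move=> n0; exact: (scaled_ge0 n (hL n n0) _).
have [u [mu0 [u0 hu mu00 hum rmu0]]] := exists_levy_measure s0 hs ler01.
have {}rmu0 : is_R_transform mu0 (levy_R c Sigma).
  by move: rmu0; congr (is_R_transform _ _); apply/funext => w; rewrite mul1r.
have hu' y : 0 < y -> y <= y0 -> hmean (u n) (width 0 M y) @[n --> \oo] --> 1 - M y.
  by move=> yp yy; apply: hum => //; exact: Mlt.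
split.
  have [nu [nu0 hnu]] := profile_limit_measure hM lW y00 My0 rL hLg.
  exists mu0, nu; split; last first.
    apply: (is_free_mult_conv_profile hlambda hM y00 My0 mu00 nu0).
      exact: (profile_measure hM z01 My0 u0 hu' hu).
    exact: (profile_measure hM lW My0 rL hLg hnu).
  split=> // k k0.
  have s'0 n : (0 < n)%N -> all (>= 0) (s (n %/ k).+1) by move=> _; exact: s0.
  have hs' := levy_data_div k0 hs.
  have ki : 0 <= k%:R^-1 :> R by rewrite invr_ge0.
  (* The [k]-th free convolution root, built from the data divided by [k]. *)
  have [_ [rk [_ _ _ _ hrk]]] := exists_levy_measure s'0 hs' ki.
  exists rk, (fun w => (k%:R^-1)%:C * levy_R c Sigma w); split=> //.
  move: rmu0; congr (is_R_transform _ _); apply/funext => w.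
  have -> : (k%:R : R[i]) = (k%:R : R)%:C by rewrite rmorph_nat.
  by rewrite mulrA -rmorphM mulfV ?mul1r// pnatr_eq0 -lt0n.
move=> mu nu [_ rmu] hconv.
(* The given [mu] shares its R-transform with [mu0]; this gives its support and makes it the limit
   of the lists [u n]. *)
have [mun hmu] := limit_same_R_transform u0 hu rmu rmu0.
have cmu := profile_measure hM z01 My0 u0 hu' hmu.
have nun : nneg_supported nu by case: hconv.
split.
  apply: weak_cvgC_avg; first exact: nnrA.
  exact: (profile_limit hM z01 y00 My0 rA hA mun cmu).
(* The S-transform of [nu] is known only near 0, so the values of [nu] are known up to [y1] only; a
   shorter interval of parameters is still enough. *)
have [y1 /andP[y10 y1y] cnu] := free_mult_conv_cpt hlambda hM y00 My0 mun nun cmu hconv.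
apply: weak_cvgC_avg; first exact: nnrL.
have My1 : M y1 < 2^-1 by exact: le_lt_trans (profile_le hM y10 y1y) My0.
apply: (profile_limit hM lW y10 My1 rL _ nun cnu) => y yp yy.
by apply: hLg => //; exact: le_trans y1y.
Qed.
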